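(* Let $1\le p<\infty$, and let $T$ be a map defined on $H^p$ with values in $\mathrm{Hol}(\mathbb{D})$. The following are equivalent: (i) $T$ maps $H^p$ into $H^p$, and $T:H^p\to H^p$ is a continuous linear map sending inner functions to inner functions. (ii) There exist inner functions $\psi,\phi$, with $\phi$ non-constant, such that $$Tf=\psi\cdot(f\circ\phi)\quad\text{for all } f\in H^p.$$ If, further, $T(H^p)=H^p$, then (in (ii)) $\psi$ is a unimodular constant and $\phi$ is an automorphism of $\mathbb{D}$, and consequently $T$ is invertible.
   Context: $\mathbb{D}$ is the open unit disk in $\mathbb{C}$, $\mathbb{T}$ is the unit circle, and $\mathrm{Hol}(\mathbb{D})$ is the space of holomorphic functions on $\mathbb{D}$. For $1\le p<\infty$, the Hardy space $H^p$ is the set of $f\in\mathrm{Hol}(\mathbb{D})$ such that $\|f\|_p:=\sup_{r<1}\Bigl(\frac{1}{2\pi}\int_{0}^{2\pi}|f(re^{it})|^p\,dt\Bigr)^{1/p}<\infty$, with norm $\|\cdot\|_p$. A function $h\in\mathrm{Hol}(\mathbb{D})$ is called inner if it is bounded and its radial limits $h^*(e^{it}):=\lim_{r\to1^-}h(re^{it})$ satisfy $|h^*(e^{it})|=1$ for a.e. $e^{it}\in\mathbb{T}$. In particular unimodular constants are inner, and a non-constant inner function maps $\mathbb{D}$ into $\mathbb{D}$. An automorphism of $\mathbb{D}$ is a biholomorphic map of $\mathbb{D}$ onto itself. *)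

(* Defs.v *)
From HB Require Import structures.
From mathcomp Require Import all_boot all_order all_algebra.
From mathcomp Require Import complex.
From mathcomp Require Import all_classical all_reals all_analysis.

Set Implicit Arguments.
Unset Strict Implicit.
Unset Printing Implicit Defensive.

Import Order.TTheory GRing.Theory Num.Theory.
Import numFieldNormedType.Exports.

Local Open Scope classical_set_scope.
Local Open Scope ring_scope.
Local Open Scope complex_scope.

Section HardySpaces.
Variable R : realType.

(* A function on the disc has type [disc -> R[i]^o]: Leibniz equality is then
   equality on the disc, and [R[i]^o] is R[i] seen as a normed module over
   itself, so that [derivable] below is complex differentiability. *)
Definition disc : Type := {z : R[i] | `|z| < 1}.

(* Extension by 0; only ever evaluated at, or near, points of the disc. *)
Definition ext (f : disc -> R[i]^o) (z : R[i]^o) : R[i]^o :=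
  oapp f 0 (insub z : option disc).

Definition Hol : set (disc -> R[i]^o) :=
  [set f | forall z : disc, derivable (ext f) (val z) 1].

Definition polar (r t : R) : R[i]^o := (r * cos t) +i* (r * sin t).

(* [normc] is the modulus with values in R rather than in R[i]. *)
Definition hardy_mean (p : R) (f : disc -> R[i]^o) (r : R) : \bar R :=
  ((((2 * pi)^-1)%R%:E * \int[lebesgue_measure]_(t in `[0%R, (2 * pi)%R])
     (ComplexField.Normc.normc (ext f (polar r t)) `^ p)%:E) `^ p^-1)%E.

Definition hardy_norm (p : R) (f : disc -> R[i]^o) : \bar R :=
  ereal_sup [set hardy_mean p f r | r in `[0, 1[].

Definition hardy (p : R) : set (disc -> R[i]^o) :=
  [set f | Hol f /\ (hardy_norm p f < +oo)%E].

Definition inner : set (disc -> R[i]^o) :=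
  [set h | [/\ Hol h,
    exists M : R, forall z, ComplexField.Normc.normc (h z) <= M &
    {ae lebesgue_measure, forall t : R, t \in `[0, 2 * pi] ->
      exists l : R[i]^o, ext h (polar r t) @[r --> 1^'-] --> l /\ `|l| = 1}]].

Definition automorphism (phi : disc -> disc) : Prop :=
  exists phi' : disc -> disc,
    [/\ cancel phi phi', cancel phi' phi, Hol (val \o phi) & Hol (val \o phi')].

(* Maps are total on [disc -> R[i]^o], but only their values on H^p matter. *)
Definition hardy_operator (p : R)
    (T : (disc -> R[i]^o) -> (disc -> R[i]^o)) : Prop :=
  [/\ forall f, hardy p f -> hardy p (T f),
      forall (c : R[i]) f g, hardy p f -> hardy p g ->
        T (c *: f + g) = c *: T f + T g &
      forall f, hardy p f -> forall e : R, 0 < e ->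
        exists2 d : R, 0 < d & forall g, hardy p g ->
          (hardy_norm p (g - f)%R < d%:E)%E ->
          (hardy_norm p (T g - T f)%R < e%:E)%E].

Definition hardy_invertible (p : R)
    (T : (disc -> R[i]^o) -> (disc -> R[i]^o)) : Prop :=
  exists S, [/\ hardy_operator p S,
    forall f, hardy p f -> S (T f) = f &
    forall f, hardy p f -> T (S f) = f].

(* The symbol [phi] of f \o phi is typed as a self-map of the disc, which a
   non-constant inner function is by the maximum principle. *)
Definition weighted_composition (p : R)
    (T : (disc -> R[i]^o) -> (disc -> R[i]^o))
    (psi : disc -> R[i]^o) (phi : disc -> disc) : Prop :=
  [/\ inner psi, inner (val \o phi), forall c, phi <> cst c &
      forall f, hardy p f -> T f = psi \* (f \o phi)].

End HardySpaces.

(* Main.v *)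
Require Import Defs.
From mathcomp Require Import all_boot all_order all_algebra.
From mathcomp Require Import complex.
From mathcomp Require Import all_classical all_reals all_analysis measurable_realfun.
From mathcomp Require Import ring lra.

(* Littlewood subordination makes f |-> psi * (f \o phi) bounded on H^p. It preserves inner
   functions: if phi is inner and phi 0 = b, the powers of phi are orthogonal on the circle for the
   weight |phi - b|^2, so the weighted mean of |f \o phi|^2 is that of 1 when f is inner.

   Conversely, let g n be the image of z^n. The image of z^k (z + a) / (1 + conj a z) is inner and
   equals g (k+1) + a g k - conj a g (k+2) up to O(|a|^2), uniformly. On the circle all of these
   have modulus 1, and letting a tend to 0 along the real and the imaginary axis gives
   g (k+1)^2 = g k * g (k+2), first a.e. on the circle and then on the disc. Hence
   g n = phi^n * g 0, where phi = g 1 / g 0 is inner. It is not constant, since otherwise evaluation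
   at a boundary point would be continuous on H^p, and density of polynomials gives
   T f = g 0 * (f \o phi).

   If T is onto, 1 = psi * (f \o phi) with f in H^p forces |psi 0| = 1, so psi is constant. Then
   z^n = g_n \o phi with g_n in H^p, and g_n = g_1^n. Through the weight above the Taylor
   coefficients of g_n are bounded independently of n, so |g_1| <= 1 and g_1 inverts phi. *)

Set Implicit Arguments.
Unset Strict Implicit.
Unset Printing Implicit Defensive.

Import Order.TTheory GRing.Theory Num.Theory.
Import numFieldNormedType.Exports.
Local Open Scope classical_set_scope.
Local Open Scope ring_scope.

(** Only bounded functions are given radial limits; functions of H^p are handled through means over
    circles of radius below 1. Fatou's theorem is used for f \o phi and for g 1 / g 0, because the
    definition of an inner function demands that the radial limit exist. The main obstacle is
    density of polynomials for every p >= 1. Dilates are Cauchy in quadratic mean by Bessel's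
    inequality, which says nothing about other exponents. The way round is a factorization f = B k^2
    with |B| <= 1 and k of bounded quadratic means: k = 1 + h, where Re h is a harmonic majorant of
    |f|^(p/2). Such a majorant comes from the subharmonicity of |f|^q, needed down to q = 1/2
    because p may be 1. The case q = 1/2 is reduced to polynomials, where each factor w - a is
    replaced by a zero-free one of nearly the same modulus on the circle, so that a holomorphic
    square root exists. Subharmonicity also yields Littlewood's subordination, on which both
    directions rely. *)

(** * Complex numbers *)

Section ComplexParts.
Variable R : realType.
(** Wrappers typed on [R[i]^o] and blocked from simplification, so that rewriting with [cpartE]
    leaves stable atoms for [ring] and [lra]. *)
Definition cre (z : R[i]^o) : R := complex.Re z.
Definition cim (z : R[i]^o) : R := complex.Im z.
Definition cnorm (z : R[i]^o) : R := ComplexField.Normc.normc z.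
Definition cconj (z : R[i]^o) : R[i]^o := conjc z.
Definition creal (r : R) : R[i]^o := Complex r 0.
Definition ci : R[i]^o := Complex 0 1.
End ComplexParts.
Arguments cre {R} z : simpl never.
Arguments cim {R} z : simpl never.
Arguments cnorm {R} z : simpl never.
Arguments cconj {R} z : simpl never.
Arguments creal {R} r : simpl never.
Arguments ci {R} : simpl never.

Local Notation "z ^*" := (cconj z) : ring_scope.
Local Notation "r %:C" := (creal r) : ring_scope.

Section ComplexModulus.
Variable R : realType.
Local Notation C := (R[i]^o).
Implicit Types (x y z w : C) (r s t : R).

Lemma complex_eqP z w : cre z = cre w -> cim z = cim w -> z = w.
Proof. by case: z; case: w => a b c d; rewrite /cre /cim /= => -> ->. Qed.

Lemma creD z w : cre (z + w) = cre z + cre w. Proof. by case: z; case: w. Qed.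
Lemma cimD z w : cim (z + w) = cim z + cim w. Proof. by case: z; case: w. Qed.
Lemma creN z : cre (- z) = - cre z. Proof. by case: z. Qed.
Lemma cimN z : cim (- z) = - cim z. Proof. by case: z. Qed.
Lemma creM z w : cre (z * w) = cre z * cre w - cim z * cim w.
Proof. by case: z; case: w. Qed.
Lemma cimM z w : cim (z * w) = cre z * cim w + cim z * cre w.
Proof. by case: z; case: w. Qed.
Lemma cre_conj z : cre (z^*) = cre z. Proof. by case: z. Qed.
Lemma cim_conj z : cim (z^*) = - cim z. Proof. by case: z. Qed.
Lemma cre_real r : cre (r%:C) = r. Proof. by []. Qed.
Lemma cim_real r : cim (r%:C) = 0. Proof. by []. Qed.
Lemma cre0 : cre (0 : C) = 0. Proof. by []. Qed.
Lemma cim0 : cim (0 : C) = 0. Proof. by []. Qed.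
Lemma cre1 : cre (1 : C) = 1. Proof. by []. Qed.
Lemma cim1 : cim (1 : C) = 0. Proof. by []. Qed.
Lemma cre_i : cre (ci : C) = 0. Proof. by []. Qed.
Lemma cim_i : cim (ci : C) = 1. Proof. by []. Qed.

Definition cpartE := (creD, cimD, creN, cimN, creM, cimM, cre_conj, cim_conj,
  cre_real, cim_real, cre0, cim0, cre1, cim1, cre_i, cim_i).

Lemma normcE' z : `|z| = (cnorm z)%:C.
Proof. by case: z. Qed.

Lemma normc_ge0 z : 0 <= cnorm z.
Proof. by case: z => a b; rewrite sqrtr_ge0. Qed.

Lemma sqr_normcE z : cnorm z ^+ 2 = cre z ^+ 2 + cim z ^+ 2.
Proof. by case: z => a b; rewrite /cnorm /= sqr_sqrtr// addr_ge0 ?sqr_ge0. Qed.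

Lemma mulc_conj z : z * z^* = (cnorm z ^+ 2)%:C.
Proof. by apply: complex_eqP; rewrite !cpartE ?sqr_normcE; ring. Qed.

Lemma normc_real r : cnorm (r%:C) = `|r|.
Proof. by rewrite /cnorm /= expr0n addr0 sqrtr_sqr. Qed.

Lemma normcMr z w : cnorm (z * w) = cnorm z * cnorm w.
Proof. exact: ComplexField.Normc.normcM. Qed.

Lemma normcXn z n : cnorm (z ^+ n) = cnorm z ^+ n.
Proof.
elim: n => [|n IH]; first by rewrite !expr0 (normc_real 1) normr1.
by rewrite !exprS normcMr IH.
Qed.

Lemma normc_inv z : cnorm (z^-1) = (cnorm z)^-1.
Proof. exact: ComplexField.Normc.normcV. Qed.

Lemma normcDle z w : cnorm (z + w) <= cnorm z + cnorm w.
Proof. exact: le_normcD. Qed.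

Lemma normcNE z : cnorm (- z) = cnorm z.
Proof. exact: normcN. Qed.

Lemma normc_distC z w : cnorm (z - w) = cnorm (w - z).
Proof. by rewrite -normcNE opprB. Qed.

Lemma normcBle z w : cnorm (z - w) <= cnorm z + cnorm w.
Proof. by rewrite -(normcNE w) normcDle. Qed.

Lemma normc_conj z : cnorm (z^* : C) = cnorm z.
Proof. by case: z => a b; rewrite /cnorm /= sqrrN. Qed.

Lemma normc_eq0P z : cnorm z = 0 <-> z = 0.
Proof.
split; first exact: ComplexField.Normc.eq0_normc.
by move=> ->; rewrite (normc_real 0) normr0.
Qed.

Lemma normc_0 : cnorm (0 : C) = 0.
Proof. exact/normc_eq0P. Qed.

Lemma normc_1 : cnorm (1 : C) = 1.
Proof. by rewrite (normc_real 1) normr1. Qed.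

Lemma normc_gt0 z : z != 0 -> 0 < cnorm z.
Proof.
by move=> z0; rewrite lt_def normc_ge0 andbT; apply: contra_neq z0 => /normc_eq0P.
Qed.

Lemma normc_neq0 z : 0 < cnorm z -> z != 0.
Proof. by apply: contraTneq => ->; rewrite normc_0 ltxx. Qed.

Lemma ler_normc_sub z w : `|cnorm z - cnorm w| <= cnorm (z - w).
Proof.
rewrite ler_norml; apply/andP; split.
  have := normcDle (w - z) z; rewrite subrK (normc_distC w z); lra.
by have := normcDle (z - w) w; rewrite subrK; lra.
Qed.

Lemma normc_sub_ge z w : cnorm z - cnorm w <= cnorm (z - w).
Proof. exact: le_trans (ler_norm _) (ler_normc_sub _ _). Qed.

Lemma normr_Re_le z : `|cre z| <= cnorm z.
Proof.
rewrite -[leLHS]ger0_norm// -ler_sqr ?nnegrE ?normc_ge0//.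
by rewrite !real_normK ?num_real// sqr_normcE lerDl sqr_ge0.
Qed.

Lemma normr_Im_le z : `|cim z| <= cnorm z.
Proof.
rewrite -[leLHS]ger0_norm// -ler_sqr ?nnegrE ?normc_ge0//.
by rewrite !real_normK ?num_real// sqr_normcE lerDr sqr_ge0.
Qed.

Lemma Re_le_normc z : cre z <= cnorm z.
Proof. exact: le_trans (ler_norm _) (normr_Re_le _). Qed.

Lemma normc_leReIm z : cnorm z <= `|cre z| + `|cim z|.
Proof.
rewrite -ler_sqr ?nnegrE ?normc_ge0 ?addr_ge0// sqr_normcE sqrrD.
rewrite !real_normK ?num_real//.
have : 0 <= `|cre z| * `|cim z| by rewrite mulr_ge0.
by rewrite mulr2n; lra.
Qed.

Lemma conjcM z w : (z * w)^* = z^* * w^*. Proof. by apply: complex_eqP; rewrite !cpartE; ring. Qed.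
Lemma conjcD z w : (z + w)^* = z^* + w^*. Proof. by apply: complex_eqP; rewrite !cpartE; ring. Qed.
Lemma conjcN z : (- z)^* = - z^*. Proof. by apply: complex_eqP; rewrite !cpartE; ring. Qed.
Lemma conjcB z w : (z - w)^* = z^* - w^*. Proof. by rewrite conjcD conjcN. Qed.
Lemma conjc_creal r : (r%:C)^* = r%:C. Proof. by apply: complex_eqP; rewrite !cpartE ?oppr0. Qed.
Lemma conjc0 : (0 : C)^* = 0. Proof. exact: (conjc_creal 0). Qed.
Lemma conjc1 : (1 : C)^* = 1. Proof. exact: (conjc_creal 1). Qed.
Lemma conjcK z : (z^*)^* = z. Proof. by apply: complex_eqP; rewrite !cpartE ?opprK. Qed.
Lemma conjcX z n : (z ^+ n)^* = (z^*) ^+ n.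
Proof. by elim: n => [|n IH]; rewrite ?conjc1// !exprS conjcM IH. Qed.
Lemma conjc_sum I (s : seq I) (P : pred I) (F : I -> C) :
  (\sum_(i <- s | P i) F i)^* = \sum_(i <- s | P i) (F i)^*.
Proof. by apply: (big_morph (@cconj R) conjcD conjc0). Qed.

Lemma normc_sum I (s : seq I) (P : pred I) (F : I -> C) :
  cnorm (\sum_(i <- s | P i) F i) <= \sum_(i <- s | P i) cnorm (F i).
Proof.
elim/big_rec2: _ => [|i x y _ H]; first by rewrite normc_0.
by rewrite (le_trans (normcDle _ _))// lerD2l.
Qed.

(** The norm of [R[i]^o] is itself complex-valued, so library epsilons are complex; a positive
    element of [R[i]] is real, hence real epsilons suffice. *)
Lemma cvgCP (T : Type) (F : set_system T) {FF : Filter F} (f : T -> C) (l : C) :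
  f @ F --> l <-> forall e : R, 0 < e -> \forall x \near F, cnorm (l - f x) < e.
Proof.
split => [/cvgrPdist_lt H e e0|H].
  have e0' : 0 < (e%:C : C) by rewrite ltcR.
  by apply: filterS (H _ e0') => x; rewrite normcE' ltcR.
apply/cvgrPdist_lt => eps eps0.
have [e e0 ->] : exists2 e : R, 0 < e & eps = e%:C.
  exists (cre eps); last by move: eps0; case: eps => a b; rewrite ltcE /= => /andP[/eqP -> _].
  by move: eps0; rewrite ltcE => /andP[_].
by apply: filterS (H e e0) => x; rewrite normcE' ltcR.
Qed.

Lemma near_normc_lt (z : C) (e : R) : 0 < e ->
  \forall w \near nbhs z, cnorm (z - w) < e.
Proof.
have H : (fun w : C => w) w @[w --> z] --> z by exact: cvg_id.
by move=> e0; exact: (proj1 (@cvgCP C (nbhs z) _ (fun w => w) z) H e e0).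
Qed.

Lemma continuous_lipR (f : C -> R) :
  (forall z w, `|f z - f w| <= cnorm (z - w)) -> continuous f.
Proof.
move=> lipf z; apply: (proj2 (@cvgrPdist_lt _ _ _ (nbhs z) _ f (f z))) => e e0.
by apply: filterS (near_normc_lt z e0) => w; apply: le_lt_trans.
Qed.

Lemma continuous_normc : continuous (fun z : C => cnorm z).
Proof. by apply: continuous_lipR => z w; exact: ler_normc_sub. Qed.

Lemma continuous_Re : continuous (fun z : C => cre z).
Proof. by apply: continuous_lipR => z w; rewrite -creN -creD; exact: normr_Re_le. Qed.

Lemma continuous_Im : continuous (fun z : C => cim z).
Proof. by apply: continuous_lipR => z w; rewrite -cimN -cimD; exact: normr_Im_le. Qed.

Lemma continuous_conjc : continuous (fun z : C => z^* : C).
Proof.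
move=> z; apply: (proj2 (@cvgCP _ (nbhs z) _ _ _)) => e e0.
by apply: filterS (near_normc_lt z e0) => w; rewrite -conjcB normc_conj.
Qed.

Lemma continuous_complex (T : topologicalType) (f g : T -> R) (x : T) :
  {for x, continuous f} -> {for x, continuous g} ->
  {for x, continuous (fun y : T => Complex (f y) (g y) : C)}.
Proof.
move=> cf cg; apply: (proj2 (@cvgCP _ (nbhs x) _ _ _)) => e e0.
have e20 : 0 < e / 2 by rewrite divr_gt0.
move/cvgrPdist_lt/(_ _ e20) : cf; move/cvgrPdist_lt/(_ _ e20) : cg.
apply: filterS2 => y gy fy.
rewrite (le_lt_trans (normc_leReIm _))//= [ltRHS](splitr e).
by rewrite ltrD.
Qed.

Lemma continuous_real_complex : continuous (fun r => r%:C : C).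
Proof.
move=> x; apply: continuous_complex; first exact: cvg_id.
exact: cvg_cst.
Qed.

Definition cis t : C := Complex (cos t) (sin t).
Lemma cre_cis t : cre (cis t) = cos t. Proof. by []. Qed.
Lemma cim_cis t : cim (cis t) = sin t. Proof. by []. Qed.

Lemma polarE r t : polar r t = r%:C * cis t.
Proof. by apply: complex_eqP; rewrite !cpartE ?cre_cis ?cim_cis /polar /cre /cim /=; ring. Qed.

Lemma normc_cis t : cnorm (cis t) = 1.
Proof. by rewrite /cnorm /= cos2Dsin2 sqrtr1. Qed.

Lemma cisD s t : cis (s + t) = cis s * cis t.
Proof. by apply: complex_eqP; rewrite !cpartE !(cre_cis, cim_cis) ?cosD ?sinD; ring. Qed.

Lemma cis0 : cis 0 = 1.
Proof. by rewrite /cis cos0 sin0. Qed.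

Lemma cis_conj t : (cis t)^* = cis (- t).
Proof. by rewrite /cis cosN sinN. Qed.

Lemma mulcis_conj t : cis t * (cis t)^* = 1.
Proof. by rewrite mulc_conj normc_cis expr1n. Qed.

Lemma cis2pi : cis (2 * pi) = 1.
Proof. by rewrite /cis [2 * pi]mulr_natl cos2pi sin2pi. Qed.

Lemma continuous_cis : continuous cis.
Proof.
move=> t; apply: continuous_complex; [exact: continuous_cos|exact: continuous_sin].
Qed.

Lemma normc_lt1 z : (`|z| < 1) = (cnorm z < 1).
Proof. by rewrite normcE' (ltcR (cnorm z) 1). Qed.

Lemma normc_eq1 z : (`|z| = 1) <-> cnorm z = 1.
Proof. by rewrite normcE'; split => [/complexI|->]. Qed.

Lemma real_complexM r s : (r * s)%:C = r%:C * s%:C.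
Proof. by apply: complex_eqP; rewrite !cpartE; ring. Qed.
Lemma real_complexD r s : (r + s)%:C = r%:C + s%:C.
Proof. by apply: complex_eqP; rewrite !cpartE; ring. Qed.
Lemma real_complexX r n : (r ^+ n)%:C = r%:C ^+ n.
Proof. by elim: n => // n IH; rewrite !exprS real_complexM IH. Qed.
Lemma real_complexN r : (- r)%:C = - r%:C.
Proof. by apply: complex_eqP; rewrite !cpartE ?oppr0. Qed.
Lemma real_complexV r : (r^-1)%:C = (r%:C)^-1.
Proof.
have [->|r0] := eqVneq r 0; first by rewrite invr0 -[0%:C]/(0 : C) invr0.
have rc0 : r%:C != 0 by apply: normc_neq0; rewrite normc_real normr_gt0.
by apply: (mulfI rc0); rewrite mulfV// -real_complexM mulfV.
Qed.

End ComplexModulus.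

(** * Integrals of continuous functions *)

Section Integrals.
Variable R : realType.
Local Notation C := (R[i]^o).
Local Notation mu := (@lebesgue_measure R).
Implicit Types (a b c t x : R) (u v : R -> R) (f g : R -> C).

(* A record, so that failed comparisons of two instances stop at the head. *)
Record con (V : topologicalType) a b (u : R -> V) : Prop := Con
  { conP : forall x, a <= x <= b -> {for x, continuous u} }.

Definition rint a b u : R := \int[mu]_(t in `[a, b]) u t.

Lemma con_cst (V : topologicalType) a b (k : V) : con a b (fun=> k).
Proof. by split => x _; exact: cvg_cst. Qed.

Lemma con_sub (V : topologicalType) a b c d (u : R -> V) :
  a <= c -> d <= b -> con a b u -> con c d u.
Proof.
move=> ac db cu; split => x /andP[cx xd]; apply: (conP cu).
by rewrite (le_trans ac cx) (le_trans xd db).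
Qed.

Lemma conD a b u v : con a b u -> con a b v -> con a b (fun t => u t + v t).
Proof. by move=> cu cv; split => x xab; apply: cvgD; [exact: (conP cu)|exact: (conP cv)]. Qed.

Lemma conM a b u v : con a b u -> con a b v -> con a b (fun t => u t * v t).
Proof. by move=> cu cv; split => x xab; apply: cvgM; [exact: (conP cu)|exact: (conP cv)]. Qed.

Lemma conMc a b f g : con a b f -> con a b g -> con a b (fun t => f t * g t : C).
Proof. by move=> cu cv; split => x xab; apply: cvgM; [exact: (conP cu)|exact: (conP cv)]. Qed.

Lemma conZc a b (k : C) f : con a b f -> con a b (fun t => k * f t : C).
Proof. by move=> cf; exact: (conMc (@con_cst C a b k) cf). Qed.

Lemma con_comp (V W : topologicalType) a b (u : R -> V) (h : V -> W) :
  con a b u -> continuous h -> con a b (fun t => h (u t)).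
Proof.
by move=> cu ch; split => x xab; exact: (continuous_comp (conP cu xab) (ch _)).
Qed.

Lemma con_Re a b f : con a b f -> con a b (fun t => cre (f t)).
Proof. by move=> cf; apply: (con_comp (h := fun z : C => cre z) cf); exact: continuous_Re. Qed.

Lemma con_Im a b f : con a b f -> con a b (fun t => cim (f t)).
Proof. by move=> cf; apply: (con_comp (h := fun z : C => cim z) cf); exact: continuous_Im. Qed.

Lemma con_normc a b f : con a b f -> con a b (fun t => cnorm (f t)).
Proof. by move=> cf; apply: (con_comp (h := fun z : C => cnorm z) cf); exact: continuous_normc. Qed.

Lemma con_within (V : topologicalType) a b (u : R -> V) :
  con a b u -> {within `[a, b], continuous u}.
Proof.
move=> cu; apply: continuous_in_subspaceT => x; rewrite inE /= in_itv /=.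
exact: (conP cu).
Qed.

Lemma con_integrable a b u : con a b u -> mu.-integrable `[a, b] (EFin \o u).
Proof.
move=> cu; apply: continuous_compact_integrable; first exact: segment_compact.
exact: con_within.
Qed.

Lemma eq_rint a b u v : (forall t, a <= t <= b -> u t = v t) ->
  rint a b u = rint a b v.
Proof. by move=> uv; apply: eq_Rintegral => t; rewrite inE /= in_itv /=; exact: uv. Qed.

Lemma rintD a b u v : con a b u -> con a b v ->
  rint a b (fun t => u t + v t) = rint a b u + rint a b v.
Proof. by move=> cu cv; rewrite /rint RintegralD//; exact: con_integrable. Qed.

Lemma rintZ a b k u : con a b u ->
  rint a b (fun t => k * u t) = k * rint a b u.
Proof. by move=> cu; rewrite /rint RintegralZl//; exact: con_integrable. Qed.

Lemma rintB a b u v : con a b u -> con a b v ->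
  rint a b (fun t => u t - v t) = rint a b u - rint a b v.
Proof. by move=> cu cv; rewrite /rint RintegralB//; exact: con_integrable. Qed.

Lemma rint_cst a b k : a <= b -> rint a b (fun=> k) = k * (b - a).
Proof.
move=> ab; rewrite /rint Rintegral_cst//= lebesgue_measure_itv /= lte_fin.
by case: ltP => // ba; rewrite (@le_anti _ _ a b) ?ab// subrr.
Qed.

Lemma rint_le a b u v : con a b u -> con a b v ->
  (forall t, a <= t <= b -> u t <= v t) -> rint a b u <= rint a b v.
Proof.
move=> cu cv uv; apply: le_Rintegral => //; first exact: con_integrable.
exact: con_integrable.
Qed.

Lemma rint_ge0 a b u : (forall t, a <= t <= b -> 0 <= u t) -> 0 <= rint a b u.
Proof.
by move=> u0; apply: Rintegral_ge0 => x /=; rewrite in_itv /=; exact: u0.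
Qed.

Lemma normr_rint_le a b u : con a b u -> `|rint a b u| <= rint a b (fun t => `|u t|).
Proof. by move=> cu; apply: le_normr_Rintegral => //; exact: con_integrable. Qed.

Lemma rint_split a b c u : a <= b -> b <= c -> con a c u ->
  rint a c u = rint a b u + rint b c u.
Proof.
move=> ab bc cu; have iu := con_integrable cu.
have := @Rintegral_itvB R u (BLeft a) (BRight c) b iu.
rewrite !bnd_simp => /(_ ab bc) H.
rewrite -[rint a c u](subrK (rint a b u)) /rint H addrC.
congr (_ + _); rewrite Rintegral_itv_obnd_cbnd//.
apply: integrableS iu => //; apply: subset_itvr.
by rewrite bnd_simp.
Qed.

Lemma rint_FTC a b u (U : R -> R) : a <= b -> con a b u ->
  (forall x, a <= x <= b -> is_derive x 1 U (u x)) ->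
  rint a b u = U b - U a.
Proof.
rewrite le_eqVlt => /predU1P[<- _ _|ab cu dU].
  by rewrite subrr /rint set_itv1 Rintegral_set1.
have cU : con a b U.
  split => x xab; apply: differentiable_continuous; apply/derivable1_diffP.
  by have [] := dU x xab.
rewrite /rint /Rintegral (@continuous_FTC2 R u U a b ab) //.
- exact: con_within.
- split.
  + by move=> x; rewrite in_itv /= => /andP[ax xb]; have [] := dU x; rewrite ?ltW.
  + by apply: cvg_at_right_filter; apply: (conP cU); rewrite lexx ltW.
  + by apply: cvg_at_left_filter; apply: (conP cU); rewrite lexx ltW.
- move=> x; rewrite in_itv /= => /andP[ax xb]; rewrite derive1E.
  by apply: (derive_val (is_derive := dU x _)); rewrite !ltW.
Qed.

Definition cint a b f : C :=
  Complex (rint a b (fun t => cre (f t))) (rint a b (fun t => cim (f t))).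

Lemma cre_cint a b f : cre (cint a b f) = rint a b (fun t => cre (f t)).
Proof. by []. Qed.

Lemma cim_cint a b f : cim (cint a b f) = rint a b (fun t => cim (f t)).
Proof. by []. Qed.

Lemma eq_cint a b f g : (forall t, a <= t <= b -> f t = g t) ->
  cint a b f = cint a b g.
Proof. by move=> fg; congr Complex; apply: eq_rint => t /fg ->. Qed.

Lemma cintD a b f g : con a b f -> con a b g ->
  cint a b (fun t => f t + g t) = cint a b f + cint a b g.
Proof.
move=> cf cg; apply: complex_eqP; rewrite ?creD ?cimD !(cre_cint, cim_cint).
  by rewrite -rintD; [apply: eq_rint => t _; exact: creD|exact: con_Re..].
by rewrite -rintD; [apply: eq_rint => t _; exact: cimD|exact: con_Im..].
Qed.

Lemma cintZ a b (k : C) f : con a b f ->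
  cint a b (fun t => k * f t) = k * cint a b f.
Proof.
move=> cf; have cr := con_Re cf; have ci := con_Im cf.
have cZ (h : R -> R) (d : R) : con a b h -> con a b (fun t => d * h t).
  by move=> ch; apply: conM => //; exact: con_cst.
apply: complex_eqP; rewrite ?creM ?cimM !(cre_cint, cim_cint).
  rewrite -!rintZ// -rintB; [|exact: cZ..].
  by apply: eq_rint => t _; exact: creM.
rewrite -!rintZ// -rintD; [|exact: cZ..].
by apply: eq_rint => t _; exact: cimM.
Qed.

Lemma cint_split a b c f : a <= b -> b <= c -> con a c f ->
  cint a c f = cint a b f + cint b c f.
Proof.
move=> ab bc cf; rewrite /cint (rint_split ab bc) ?(rint_split (u := fun t => cim (f t)) ab bc)//.
  exact: con_Im.
exact: con_Re.
Qed.

(* Rotating the integral onto the positive axis reduces to the real part. *)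
Lemma normc_cint_le a b f : con a b f ->
  cnorm (cint a b f) <= rint a b (fun t => cnorm (f t)).
Proof.
move=> cf; set I := cint a b f.
have [I0|I0] := eqVneq I 0.
  by rewrite I0 normc_0; apply: rint_ge0 => t _; exact: normc_ge0.
have nI : cnorm I != 0 by rewrite gt_eqF// normc_gt0.
have [k nk kI] : exists2 k : C, cnorm k = 1 & cre (k * I) = cnorm I.
  exists (I^* * ((cnorm I)^-1)%:C).
    by rewrite normcMr normc_conj normc_real ger0_norm ?invr_ge0 ?normc_ge0// mulfV.
  rewrite mulrC mulrA mulc_conj -real_complexM cre_real.
  by rewrite expr2 -mulrA mulfV ?mulr1.
rewrite -kI -cintZ// cre_cint; have ck := @conZc a b k f cf.
apply: rint_le; [exact: con_Re|exact: con_normc|].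
move=> t _; apply: le_trans (Re_le_normc _) _.
by rewrite normcMr nk mul1r.
Qed.

Lemma normc_cint_bound a b f M : a <= b -> con a b f ->
  (forall t, a <= t <= b -> cnorm (f t) <= M) ->
  cnorm (cint a b f) <= M * (b - a).
Proof.
move=> ab cf fM; apply: le_trans (normc_cint_le cf) _.
rewrite -(rint_cst M ab); apply: rint_le => //; first exact: con_normc.
exact: con_cst.
Qed.

(** Derivative along a real parameter. It is taken by components because [R[i]^o] is a normed module
    over [R[i]], not over [R]. *)
Definition cderive (U : R -> C) (x : R) (d : C) :=
  is_derive x 1 (fun t => cre (U t)) (cre d) /\
  is_derive x 1 (fun t => cim (U t)) (cim d).

Lemma cint_FTC a b f (U : R -> C) : a <= b -> con a b f ->
  (forall x, a <= x <= b -> cderive U x (f x)) ->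
  cint a b f = U b - U a.
Proof.
move=> ab cf dU; apply: complex_eqP; rewrite ?creD ?cimD ?creN ?cimN.
  apply: (rint_FTC (U := fun t => cre (U t)) ab); first exact: con_Re.
  by move=> x /dU[].
apply: (rint_FTC (U := fun t => cim (U t)) ab); first exact: con_Im.
by move=> x /dU[].
Qed.

Lemma cderiveM (U V : R -> C) (x : R) (d e : C) : cderive U x d -> cderive V x e ->
  cderive (fun t => U t * V t) x (d * V x + U x * e).
Proof.
move=> [dU1 dU2] [dV1 dV2]; split.
  have -> : (fun t => cre (U t * V t)) =
     (fun t => cre (U t) * cre (V t) - cim (U t) * cim (V t)).
    by apply/funext => t; exact: creM.
  apply: is_derive_eq; rewrite !cpartE /GRing.scale /=; ring.
have -> : (fun t => cim (U t * V t)) =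
     (fun t => cre (U t) * cim (V t) + cim (U t) * cre (V t)).
  by apply/funext => t; exact: cimM.
apply: is_derive_eq; rewrite !cpartE /GRing.scale /=; ring.
Qed.

Lemma cderiveD (U V : R -> C) (x : R) (d e : C) : cderive U x d -> cderive V x e ->
  cderive (fun t => U t + V t) x (d + e).
Proof.
move=> [dU1 dU2] [dV1 dV2]; split.
  have -> : (fun t => cre (U t + V t)) = (fun t => cre (U t) + cre (V t)).
    by apply/funext => t; exact: creD.
  by apply: is_derive_eq; rewrite creD.
have -> : (fun t => cim (U t + V t)) = (fun t => cim (U t) + cim (V t)).
  by apply/funext => t; exact: cimD.
by apply: is_derive_eq; rewrite cimD.
Qed.

Lemma cderive_cst (k : C) (x : R) : cderive (fun=> k) x 0.
Proof. by split; exact: is_derive_cst. Qed.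

Lemma cderive_real (x : R) : cderive (fun t => t%:C) x 1.
Proof. by split; [exact: is_derive_id|exact: is_derive_cst]. Qed.

Lemma cderive_cis (x : R) : cderive (@cis R) x (ci * cis x).
Proof.
split; rewrite !cpartE cre_cis cim_cis; apply: is_derive_eq; ring.
Qed.

Lemma cderive_eq (U : R -> C) (x : R) (d e : C) :
  cderive U x d -> d = e -> cderive U x e.
Proof. by move=> H <-. Qed.

End Integrals.

(** * The Cauchy integral formula *)

Section Derivable.
Variable R : realType.
Local Notation C := (R[i]^o).
Implicit Types (z w d : C) (f g : C -> C) (e : R).

Lemma nbhs_normcP z (P : set C) :
  nbhs z P <-> exists2 e : R, 0 < e & forall w, cnorm (w - z) < e -> P w.
Proof.
split => [/nbhs_normP[eps /= eps0 H]|[e e0 H]]; last first.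
  by apply: filterS (near_normc_lt z e0) => w; rewrite normc_distC; exact: H.
have [e e0 ee] : exists2 e : R, 0 < e & eps = e%:C.
  exists (cre eps); last by move: eps0; case: eps H => a b _; rewrite ltcE /= => /andP[/eqP -> _].
  by move: eps0; rewrite ltcE => /andP[_].
exists e => // w we; apply: H; rewrite /= normcE' ee ltcR.
by rewrite normc_distC.
Qed.

(** First-order expansion with real epsilons; being trivially true at [w = z], it avoids punctured
    neighbourhoods in everything that follows. *)
Lemma derivableCP f z : derivable f z 1 <->
  exists d, forall e, 0 < e ->
    \forall w \near z, cnorm (f w - f z - d * (w - z)) <= e * cnorm (w - z).
Proof.
split => [df|[d H]].
  exists (lim (h^-1 *: ((f \o shift z) (h *: (1 : C)) - f z) @[h --> (0:C)^'])) => e e0.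
  have /cvgCP/(_ e e0) := df.
  move=> /(@nbhs_normcP 0 _)[r r0 H].
  apply/nbhs_normcP; exists r => // w wr.
  have [->|wz] := eqVneq w z; first by rewrite !subrr mulr0 subr0 normc_0 mulr0.
  have wz0 : w - z != 0 by rewrite subr_eq0.
  move: (H (w - z)); rewrite subr0 => /(_ wr wz0) /ltW.
  move: (lim _) => d.
  rewrite /= /GRing.scale /= mulr1 subrK => Hd.
  have -> : f w - f z - d * (w - z) = - ((d - (w - z)^-1 * (f w - f z)) * (w - z)).
    by field.
  by rewrite normcNE normcMr ler_wpM2r ?normc_ge0.
apply/cvg_ex; exists d; apply/cvgCP => e e0.
have e20 : 0 < e / 2 by rewrite divr_gt0.
have /nbhs_normcP[r r0 Hr] := H _ e20.
apply/(@nbhs_normcP 0); exists r => // h; rewrite subr0 => hr h0.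
have := Hr (h + z); rewrite addrK => /(_ hr).
rewrite /= /GRing.scale /= mulr1 => Hh.
have nh0 : 0 < cnorm h by apply: normc_gt0.
have -> : d - h^-1 * (f (h + z) - f z) = - ((f (h + z) - f z - d * h) * h^-1).
  by field.
rewrite normcNE normcMr normc_inv ltr_pdivrMr// (le_lt_trans Hh)//.
by rewrite ltr_pM2r// gtr_pMr// invf_lt1// ltr1n.
Qed.

Lemma derivable_continuous f z : derivable f z 1 -> {for z, continuous f}.
Proof. by move=> /derivable1_diffP /differentiable_continuous. Qed.

Lemma derivable_bound f z : derivable f z 1 ->
  exists2 M, 0 < M & \forall w \near z, cnorm (f w - f z) <= M * cnorm (w - z).
Proof.
move=> /derivableCP[d /(_ 1 ltr01) H]; exists (1 + cnorm d).
  by rewrite ltr_wpDr ?normc_ge0.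
apply: filterS H => w Hw.
rewrite -[f w - f z](subrK (d * (w - z))) (le_trans (normcDle _ _))//.
by rewrite mulrDl lerD// normcMr.
Qed.

Lemma continuousB_at f g z : {for z, continuous f} -> {for z, continuous g} ->
  {for z, continuous (fun w => f w - g w : C)}.
Proof. exact: continuousB. Qed.

Lemma continuous_affine (A B w0 : C) : continuous (fun w : C => A + B * (w - w0) : C).
Proof.
move=> z; have H : (A + B * (w - w0) : C) @[w --> z] --> (A + B * (z - w0) : C).
  apply: (@cvgD _ _ _ (nbhs z) _ (fun=> A) (fun w => B * (w - w0))).
    exact: cvg_cst.
  apply: (@cvgM _ _ (nbhs z) _ (fun=> B) (fun w => w - w0)).
    exact: cvg_cst.
  apply: (@cvgB _ _ _ (nbhs z) _ (fun w => w) (fun=> w0)).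
    exact: cvg_id.
  exact: cvg_cst.
exact: H.
Qed.

End Derivable.

(** * Goursat's theorem by bisection of rectangles *)

Section Rectangles.
Variable R : realType.
Local Notation C := (R[i]^o).

Section Bisection.
Variables (I : R -> R -> R -> R -> C) (a b c d : R).
Hypotheses (ab : a <= b) (cd : c <= d).
Hypothesis addx : forall x1 x2 x3 y1 y2, a <= x1 -> x1 <= x2 -> x2 <= x3 ->
  x3 <= b -> c <= y1 -> y1 <= y2 -> y2 <= d ->
  I x1 x3 y1 y2 = I x1 x2 y1 y2 + I x2 x3 y1 y2.
Hypothesis addy : forall x1 x2 y1 y2 y3, a <= x1 -> x1 <= x2 -> x2 <= b ->
  c <= y1 -> y1 <= y2 -> y2 <= y3 -> y3 <= d ->
  I x1 x2 y1 y3 = I x1 x2 y1 y2 + I x1 x2 y2 y3.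
Hypothesis loc : forall x y, a <= x <= b -> c <= y <= d -> forall e : R, 0 < e ->
  exists2 r : R, 0 < r & forall x1 x2 y1 y2,
    a <= x1 -> x1 <= x <= x2 -> x2 <= b -> c <= y1 -> y1 <= y <= y2 -> y2 <= d ->
    x2 - x1 < r -> y2 - y1 < r ->
    cnorm (I x1 x2 y1 y2) <= e * ((x2 - x1) + (y2 - y1)) ^+ 2.

Let mid (x y : R) := (x + y) / 2.
Let nI (q : R * R * R * R) := cnorm (I q.1.1.1 q.1.1.2 q.1.2 q.2).
(** Keeps a quarter that carries at least a quarter of the modulus. The last one is a default,
    justified in [big]. *)
Let step (q : R * R * R * R) :=
  let: (x1, x2, y1, y2) := q in
  let q1 := (x1, mid x1 x2, y1, mid y1 y2) in
  let q2 := (mid x1 x2, x2, y1, mid y1 y2) in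
  let q3 := (x1, mid x1 x2, mid y1 y2, y2) in
  let q4 := (mid x1 x2, x2, mid y1 y2, y2) in
  if nI q / 4 <= nI q1 then q1 else if nI q / 4 <= nI q2 then q2 else
  if nI q / 4 <= nI q3 then q3 else q4.
Let Q n := iter n step (a, b, c, d).
Let x1 n := (Q n).1.1.1.
Let x2 n := (Q n).1.1.2.
Let y1 n := (Q n).1.2.
Let y2 n := (Q n).2.

Let invariant n : [/\ a <= x1 n, x1 n <= x2 n, x2 n <= b &
  [/\ c <= y1 n, y1 n <= y2 n, y2 n <= d,
  x2 n - x1 n = (b - a) / 2 ^+ n & y2 n - y1 n = (d - c) / 2 ^+ n]].
Proof.
elim: n => [|n]; first by split => //; split => //; rewrite expr0 divr1.
rewrite /x1 /x2 /y1 /y2 /Q iterS -/(Q n); move: (Q n) => [[[p q] r] s] /=.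
rewrite /mid => -[ap pq qb [cr rs sd E1 E2]].
have e1 : (b - a) / 2 ^+ n.+1 = (q - p) / 2 by rewrite E1 exprSr invfM mulrA.
have e2 : (d - c) / 2 ^+ n.+1 = (s - r) / 2 by rewrite E2 exprSr invfM mulrA.
rewrite e1 e2 /step.
by do 3?[case: ifP => _ /=]; split; try lra; split; lra.
Qed.

Let nested n : [/\ x1 n <= x1 n.+1, x2 n.+1 <= x2 n, y1 n <= y1 n.+1 & y2 n.+1 <= y2 n].
Proof.
have := invariant n.
rewrite /x1 /x2 /y1 /y2 /Q iterS -/(Q n); move: (Q n) => [[[p q] r] s] /=.
rewrite /mid => -[ap pq qb [cr rs sd E1 E2]]; rewrite /step.
by do 3?[case: ifP => _ /=]; split; lra.
Qed.

(** If the first three quarters all fall short, additivity and the triangle inequality leave at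
    least a quarter of the modulus to the fourth. *)
Let big n : cnorm (I a b c d) / 4 ^+ n <= nI (Q n).
Proof.
elim: n => [|n IH]; first by rewrite expr0 divr1.
rewrite exprSr invfM mulrA (le_trans (y := nI (Q n) / 4))//.
  by rewrite ler_pM2r.
have := invariant n; rewrite /x1 /x2 /y1 /y2.
have -> : Q n.+1 = step (Q n) by [].
move: (Q n) => [[[p q] r] s] /=.
rewrite /mid => -[ap pq qb [cr rs sd E1 E2]].
case: ifP => // /negbT; rewrite -ltNge => h1.
case: ifP => // /negbT; rewrite -ltNge => h2.
case: ifP => // /negbT; rewrite -ltNge => h3.
rewrite leNgt; apply/negP => h4; move: h1 h2 h3 h4.
rewrite /nI /= /mid => h1 h2 h3 h4.
have E : I p q r s = I p ((p + q) / 2) r ((r + s) / 2) +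
  I ((p + q) / 2) q r ((r + s) / 2) + (I p ((p + q) / 2) ((r + s) / 2) s +
  I ((p + q) / 2) q ((r + s) / 2) s).
  rewrite (@addy p q r ((r + s) / 2) s); [|lra..].
  by congr (_ + _); apply: addx; lra.
have : cnorm (I p q r s) < cnorm (I p q r s); last by rewrite ltxx.
rewrite [X in cnorm X < _]E; apply: le_lt_trans (normcDle _ _) _.
apply: (@le_lt_trans _ _ (cnorm (I p ((p + q) / 2) r ((r + s) / 2)) +
  cnorm (I ((p + q) / 2) q r ((r + s) / 2)) +
  (cnorm (I p ((p + q) / 2) ((r + s) / 2) s) +
  cnorm (I ((p + q) / 2) q ((r + s) / 2) s)))).
  by apply: lerD; exact: normcDle.
lra.
Qed.

Let nested_sup (l h : nat -> R) : (forall n, l n <= h n) ->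
  (forall n, l n <= l n.+1) -> (forall n, h n.+1 <= h n) ->
  exists x, forall n, l n <= x <= h n.
Proof.
move=> lh ln hn.
have nl : {homo l : m n / (m <= n)%N >-> m <= n} by apply: homo_leq => // ? ? ?; exact: le_trans.
have nh : {homo h : m n / (m <= n)%N >-> n <= m}.
  by apply: (homo_leq (r := fun x y => y <= x)) => // y x z yx zy; exact: le_trans zy yx.
have lhmn m n : l m <= h n.
  by apply: (le_trans (nl _ _ (leq_maxl m n))); apply: le_trans (nh _ _ (leq_maxr m n)).
exists (sup (range l)) => n; apply/andP; split.
  apply: ub_le_sup; last by exists n.
  by exists (h 0%N) => _ [m _ <-].
by apply: ge_sup; [exists (l 0%N), 0%N|move=> _ [m _ <-]].
Qed.

(** An additive rectangle function that is small compared with the squared size near every point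
    vanishes: bisection would otherwise produce a point where the local bound fails. *)
Lemma rectangle_zero : I a b c d = 0.
Proof.
have [x Hx] : exists x, forall n, x1 n <= x <= x2 n.
  by apply: nested_sup => n; [case: (invariant n)|case: (nested n)|case: (nested n)].
have [y Hy] : exists y, forall n, y1 n <= y <= y2 n.
  by apply: nested_sup => n; [case: (invariant n) => _ _ _ []|case: (nested n)|case: (nested n)].
apply/normc_eq0P; apply/eqP; rewrite eq_le normc_ge0 andbT; apply/ler_addgt0Pr => e e0.
rewrite add0r.
pose S := (b - a) + (d - c).
have S0 : 0 <= S by rewrite addr_ge0 // subr_ge0.
have eS : 0 < e / (S ^+ 2 + 1) by rewrite divr_gt0// ltr_wpDl// sqr_ge0.
have [r r0 Hr] := loc (Hx 0%N) (Hy 0%N) eS.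
have [n Hn] : exists n, S / 2 ^+ n < r.
  have := @cvg_geometric R S (2^-1).
  rewrite ger0_norm// invf_lt1// ltr1n => /(_ isT) /cvgrPdist_lt /(_ r r0) [n _ /(_ n (leqnn n))].
  rewrite /geometric /= sub0r normrN ger0_norm ?mulr_ge0 ?exprn_ge0// exprVn => ?; by exists n.
have [p1 p2 p3 [p4 p5 p6 E1 E2]] := invariant n.
have P2 : 0 < 2 ^+ n :> R by rewrite exprn_gt0.
have := Hr _ _ _ _ p1 (Hx n) p3 p4 (Hy n) p6.
have B1 : x2 n - x1 n < r.
  rewrite E1; apply: le_lt_trans Hn; rewrite ler_pM2r ?invr_gt0//.
  by rewrite /S lerDl subr_ge0.
have B2 : y2 n - y1 n < r.
  rewrite E2; apply: le_lt_trans Hn; rewrite ler_pM2r ?invr_gt0//.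
  by rewrite /S lerDr subr_ge0.
move=> /(_ B1 B2); rewrite E1 E2 -mulrDl -/S.
(* The loss 4^n in [big] is exactly the gain from the squared half-perimeter (S / 2^n)^2. *)
move=> /(le_trans (big n)).
rewrite expr_div_n -exprM [(n * 2)%N]mulnC exprM (_ : (2 : R) ^+ 2 = 4); last by ring.
rewrite mulrA ler_pM2r ?invr_gt0 ?exprn_gt0//.
move=> /le_trans; apply; rewrite mulrAC ler_pdivrMr ?ltr_wpDl ?sqr_ge0//.
by rewrite ler_pM2l// lerDl.
Qed.

End Bisection.

Lemma cderive_continuous (U : R -> C) x (d : C) : cderive U x d -> {for x, continuous U}.
Proof.
move=> [[d1 _] [d2 _]].
have -> : U = (fun t => Complex (cre (U t)) (cim (U t))) by apply/funext => t; case: (U t).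
apply: continuous_complex; apply: differentiable_continuous; exact/derivable1_diffP.
Qed.

Section Goursat.
Variables (gam gu gv : R -> R -> C) (a b c d L : R) (g : C -> C).
Hypotheses (ab : a <= b) (cd : c <= d).
Hypothesis du : forall u v, a <= u <= b -> c <= v <= d -> cderive (gam^~ v) u (gu u v).
Hypothesis dv : forall u v, a <= u <= b -> c <= v <= d -> cderive (gam u) v (gv u v).
Hypothesis cu : forall v, c <= v <= d -> con a b (gu^~ v).
Hypothesis cv : forall u, a <= u <= b -> con c d (gv u).
Hypothesis Lu : forall u v, a <= u <= b -> c <= v <= d -> cnorm (gu u v) <= L.
Hypothesis Lv : forall u v, a <= u <= b -> c <= v <= d -> cnorm (gv u v) <= L.
Hypothesis dg : forall u v, a <= u <= b -> c <= v <= d -> derivable g (gam u v) 1.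

Let H (f : C -> C) v p q := cint p q (fun u => f (gam u v) * gu u v).
Let V (f : C -> C) u p q := cint p q (fun v => f (gam u v) * gv u v).
Let I (f : C -> C) x1 x2 y1 y2 := H f y1 x1 x2 + V f x2 y1 y2 - H f y2 x1 x2 - V f x1 y1 y2.

Let cgam1 v : c <= v <= d -> con a b (gam^~ v).
Proof. by move=> vcd; split => u uab; apply: cderive_continuous; exact: du. Qed.

Let cgam2 u : a <= u <= b -> con c d (gam u).
Proof. by move=> uab; split => v vcd; apply: cderive_continuous; exact: dv. Qed.

Let conH (f : C -> C) v : (forall u v, a <= u <= b -> c <= v <= d -> {for gam u v, continuous f}) ->
  c <= v <= d -> con a b (fun u => f (gam u v) * gu u v).
Proof.
move=> cf vcd; apply: (conMc (f := fun u => f (gam u v))); last exact: cu.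
split => u uab; apply: (continuous_comp (f := gam^~ v)); first exact: (conP (cgam1 vcd)).
exact: cf.
Qed.

Let conV (f : C -> C) u : (forall u v, a <= u <= b -> c <= v <= d -> {for gam u v, continuous f}) ->
  a <= u <= b -> con c d (fun v => f (gam u v) * gv u v).
Proof.
move=> cf uab; apply: (conMc (f := fun v => f (gam u v))); last exact: cv.
split => v vcd; apply: (continuous_comp (f := gam u)); first exact: (conP (cgam2 uab)).
exact: cf.
Qed.

Let cg u v : a <= u <= b -> c <= v <= d -> {for gam u v, continuous g}.
Proof. by move=> uab vcd; apply: derivable_continuous; exact: dg. Qed.

Let L0 : 0 <= L.
Proof. by apply: le_trans (normc_ge0 (gu a c)) (Lu _ _); rewrite lexx. Qed.

Let gam_lip u v x y : a <= u <= b -> c <= v <= d -> a <= x <= b -> c <= y <= d ->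
  cnorm (gam u v - gam x y) <= L * (`|u - x| + `|v - y|).
Proof.
move=> uab vcd xab ycd.
have lipu p q : a <= p -> p <= q -> q <= b -> cnorm (gam q v - gam p v) <= L * (q - p).
  move=> ap pq qb.
  rewrite -(@cint_FTC _ p q (gu^~ v) (gam^~ v) pq).
  - apply: normc_cint_bound => //; first by apply: con_sub (cu vcd).
    by move=> t /andP[pt tq]; apply: Lu => //; rewrite (le_trans ap pt) (le_trans tq qb).
  - by apply: con_sub (cu vcd).
  - by move=> t /andP[pt tq]; apply: du => //; rewrite (le_trans ap pt) (le_trans tq qb).
have lipv p q : c <= p -> p <= q -> q <= d -> cnorm (gam x q - gam x p) <= L * (q - p).
  move=> ap pq qb.
  rewrite -(@cint_FTC _ p q (gv x) (gam x) pq).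
  - apply: normc_cint_bound => //; first by apply: con_sub (cv xab).
    by move=> t /andP[pt tq]; apply: Lv => //; rewrite (le_trans ap pt) (le_trans tq qb).
  - by apply: con_sub (cv xab).
  - by move=> t /andP[pt tq]; apply: dv => //; rewrite (le_trans ap pt) (le_trans tq qb).
have -> : gam u v - gam x y = (gam u v - gam x v) + (gam x v - gam x y) by ring.
apply: le_trans (normcDle _ _) _; rewrite mulrDr lerD//.
  case/andP: uab => ? ?; case/andP: xab => ? ?.
  case: (lerP x u) => xu; first exact: lipu.
  by rewrite normc_distC; apply: lipu => //; exact: ltW.
case/andP: vcd => ? ?; case/andP: ycd => ? ?.
case: (lerP y v) => xu; first exact: lipv.
by rewrite normc_distC; apply: lipv => //; exact: ltW.
Qed.

(** [P] is a primitive of the affine integrand, so the four sides telescope around the corners. *)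
Let I_lin (A B w0 : C) x1 x2 y1 y2 : a <= x1 -> x1 <= x2 -> x2 <= b ->
  c <= y1 -> y1 <= y2 -> y2 <= d -> I (fun w => A + B * (w - w0)) x1 x2 y1 y2 = 0.
Proof.
move=> ax x12 xb cy y12 yd.
pose P w : C := A * w + B * ((w - w0) * (w - w0)) * 2^-1.
have cf u v : a <= u <= b -> c <= v <= d -> {for gam u v, continuous (fun w : C => A + B * (w - w0))}.
  by move=> _ _; exact: continuous_affine.
have dP (U : R -> C) x e : cderive U x e -> cderive (fun t => P (U t)) x ((A + B * (U x - w0)) * e).
  move=> dU; have dU0 : cderive (fun t => U t - w0) x e.
    by apply: cderive_eq (cderiveD dU (cderive_cst (- w0) x)) _; rewrite addr0.
  apply: cderive_eq (cderiveD (cderiveM (cderive_cst A x) dU)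
    (cderiveM (cderiveM (cderive_cst B x) (cderiveM dU0 dU0)) (cderive_cst (2^-1) x))) _.
  have : 2 * 2^-1 = 1 :> C by rewrite mulfV// (eqr_nat C 2 0).
  move: (2^-1 : C) => h Hh; rewrite !mul0r !mulr0 !add0r !addr0.
  transitivity (A * e + B * (e * (U x - w0)) * (2 * h)); first by ring.
  by rewrite Hh; ring.
have EH v : c <= v <= d -> H (fun w => A + B * (w - w0)) v x1 x2 = P (gam x2 v) - P (gam x1 v).
  move=> vcd; apply: (cint_FTC (U := fun u => P (gam u v))) => //.
    exact: (con_sub ax xb (@conH (fun w => A + B * (w - w0)) v cf vcd)).
  by move=> x /andP[xx1 xx2]; apply: dP; apply: du => //; rewrite (le_trans ax xx1) (le_trans xx2 xb).
have EV u : a <= u <= b -> V (fun w => A + B * (w - w0)) u y1 y2 = P (gam u y2) - P (gam u y1).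
  move=> uab; apply: (cint_FTC (U := fun v => P (gam u v))) => //.
    exact: (con_sub cy yd (@conV (fun w => A + B * (w - w0)) u cf uab)).
  by move=> x /andP[xx1 xx2]; apply: dP; apply: dv => //; rewrite (le_trans cy xx1) (le_trans xx2 yd).
rewrite /I EH ?EH ?EV ?EV; last 4 first.
- by rewrite ax (le_trans x12).
- by rewrite xb (le_trans ax).
- by rewrite yd (le_trans cy).
- by rewrite cy (le_trans y12).
by ring.
Qed.

(** The contour is the image under [gam] of the boundary of a parameter rectangle. Near a point, [g]
    differs from its first-order part by o(size), and that part contributes nothing by [I_lin], so
    the contour integral is o(size^2). *)
Lemma goursat : H g c a b + V g b c d = H g d a b + V g a c d.
Proof.
suff: I g a b c d = 0 by rewrite /I => E; apply/eqP; rewrite -subr_eq0 -E; apply/eqP; ring.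
apply: (@rectangle_zero (I g)) => //.
- move=> x1 x2 x3 y1 y2 ax x12 x23 xb cy y12 yd; rewrite /I.
  have S v : c <= v <= d -> H g v x1 x3 = H g v x1 x2 + H g v x2 x3.
    by move=> vcd; apply: cint_split => //; apply: con_sub (conH cg vcd).
  rewrite (S y1) ?(S y2); first by ring.
    by rewrite yd (le_trans cy).
  by rewrite cy (le_trans y12).
- move=> x1 x2 y1 y2 y3 ax x12 xb cy y12 y23 yd; rewrite /I.
  have S u : a <= u <= b -> V g u y1 y3 = V g u y1 y2 + V g u y2 y3.
    by move=> uab; apply: cint_split => //; apply: con_sub (conV cg uab).
  rewrite (S x1) ?(S x2); first by ring.
    by rewrite xb (le_trans ax).
  by rewrite ax (le_trans x12).
move=> x y xab ycd e e0.
have /derivableCP[B HB] := dg xab ycd.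
set w0 := gam x y in HB *; set A := g w0 in HB *.
(* The four sides together cost eta * 2 L^2 s^2, with [s] the half-perimeter; the radius r / (2 L +
   1) below makes L s < r. *)
pose eta := e / (2 * L ^+ 2 + 1).
have D0 : 0 < 2 * L ^+ 2 + 1 by rewrite ltr_wpDl// mulr_ge0// sqr_ge0.
have eta0 : 0 < eta by rewrite divr_gt0.
have /nbhs_normcP[r r0 Hr] := HB _ eta0.
exists (r / (2 * L + 1)); first by rewrite divr_gt0// ltr_wpDl// mulr_ge0.
move=> x1 x2 y1 y2 ax /andP[x1x xx2] xb cy /andP[y1y yy2] yd sx sy.
have x12 := le_trans x1x xx2; have y12 := le_trans y1y yy2.
rewrite -[I g _ _ _ _]subr0 -(@I_lin A B w0 x1 x2 y1 y2)//.
set lin := fun w => A + B * (w - w0).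
pose s := (x2 - x1) + (y2 - y1).
have s0 : 0 <= s by rewrite addr_ge0// subr_ge0.
have sL : L * s < r.
  have L1 : 0 < 2 * L + 1 by rewrite ltr_wpDl// mulr_ge0.
  move: sx sy; rewrite ltr_pdivlMr// ltr_pdivlMr// => sx sy.
  have := mulr_ge0 L0 s0; rewrite /s in s0 *.
  have hx : 0 <= x2 - x1 by rewrite subr_ge0.
  have hy : 0 <= y2 - y1 by rewrite subr_ge0.
  nra.
have near u v : x1 <= u <= x2 -> y1 <= v <= y2 ->
    cnorm (g (gam u v) - lin (gam u v)) <= eta * (L * s).
  move=> /andP[xu ux] /andP[yv vy].
  have E : cnorm (gam u v - w0) <= L * s.
    apply: (le_trans (gam_lip _ _ _ _)) => //.
    - by rewrite (le_trans ax xu) (le_trans ux xb).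
    - by rewrite (le_trans cy yv) (le_trans vy yd).
    - rewrite ler_wpM2l// /s lerD// ler_norml; lra.
  have /Hr := le_lt_trans E sL.
  have -> : g (gam u v) - A - B * (gam u v - w0) = g (gam u v) - lin (gam u v).
    by rewrite /lin; ring.
  by move/le_trans; apply; rewrite ler_wpM2l// ltW.
have clin u v : a <= u <= b -> c <= v <= d -> {for gam u v, continuous lin}.
  by move=> _ _; exact: continuous_affine.
have cNlin u v : a <= u <= b -> c <= v <= d -> {for gam u v, continuous (fun w : C => g w - lin w)}.
  by move=> uab vcd; apply: continuousB_at; [exact: cg|exact: clin].
have sub_x u : x1 <= u <= x2 -> a <= u <= b.
  by case/andP => p q; rewrite (le_trans ax p) (le_trans q xb).
have sub_y v : y1 <= v <= y2 -> c <= v <= d.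
  by case/andP => p q; rewrite (le_trans cy p) (le_trans q yd).
have BH v : y1 <= v <= y2 -> cnorm (H g v x1 x2 - H lin v x1 x2) <= eta * (L * s) * L * (x2 - x1).
  move=> vy.
  have -> : H g v x1 x2 - H lin v x1 x2 = H (fun w => g w - lin w) v x1 x2.
    apply/eqP; rewrite subr_eq /H -cintD//.
    - by apply/eqP; apply: eq_cint => t _; ring.
    - by apply: con_sub (conH cNlin (sub_y _ vy)).
    - by apply: con_sub (conH clin (sub_y _ vy)).
  apply: normc_cint_bound => //.
    by apply: con_sub (conH cNlin (sub_y _ vy)).
  move=> t tx; rewrite normcMr; apply: ler_pM; rewrite ?normc_ge0 //.
    exact: near.
  by apply: Lu; [exact: sub_x|exact: sub_y].
have BV u : x1 <= u <= x2 -> cnorm (V g u y1 y2 - V lin u y1 y2) <= eta * (L * s) * L * (y2 - y1).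
  move=> ux.
  have -> : V g u y1 y2 - V lin u y1 y2 = V (fun w => g w - lin w) u y1 y2.
    apply/eqP; rewrite subr_eq /V -cintD//.
    - by apply/eqP; apply: eq_cint => t _; ring.
    - by apply: con_sub (conV cNlin (sub_x _ ux)).
    - by apply: con_sub (conV clin (sub_x _ ux)).
  apply: normc_cint_bound => //.
    by apply: con_sub (conV cNlin (sub_x _ ux)).
  move=> t ty; rewrite normcMr; apply: ler_pM; rewrite ?normc_ge0 //.
    exact: near.
  by apply: Lv; [exact: sub_x|exact: sub_y].
have y1i : y1 <= y1 <= y2 by rewrite lexx.
have y2i : y1 <= y2 <= y2 by rewrite lexx y12.
have x1i : x1 <= x1 <= x2 by rewrite lexx.
have x2i : x1 <= x2 <= x2 by rewrite lexx x12.
have -> : I g x1 x2 y1 y2 - I lin x1 x2 y1 y2 =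
   ((H g y1 x1 x2 - H lin y1 x1 x2) + (V g x2 y1 y2 - V lin x2 y1 y2)) -
   ((H g y2 x1 x2 - H lin y2 x1 x2) + (V g x1 y1 y2 - V lin x1 y1 y2)).
  by rewrite /I; ring.
apply: le_trans (normcBle _ _) _.
apply: (le_trans (lerD (normcDle _ _) (normcDle _ _))).
apply: (le_trans (lerD (lerD (BH _ y1i) (BV _ x2i)) (lerD (BH _ y2i) (BV _ x1i)))).
have -> : eta * (L * s) * L * (x2 - x1) + eta * (L * s) * L * (y2 - y1) +
  (eta * (L * s) * L * (x2 - x1) + eta * (L * s) * L * (y2 - y1)) = eta * (2 * L ^+ 2) * s ^+ 2.
  by rewrite /s; ring.
rewrite -/s ler_wpM2r ?sqr_ge0// /eta mulrAC ler_pdivrMr// ler_pM2l//.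
by rewrite lerDl.
Qed.

End Goursat.
End Rectangles.

(** * Averages over the circle *)

Section CircleMean.
Variable R : realType.
Local Notation C := (R[i]^o).
Local Notation mu := (@lebesgue_measure R).
Implicit Types (u v : R -> R) (f g : R -> C) (t : R).

Record cont (V : topologicalType) (u : R -> V) : Prop := Cont
  { contP : continuous u }.

Lemma conT (V : topologicalType) a b (u : R -> V) : cont u -> con a b u.
Proof. by move=> [cu]; split => x _; exact: cu. Qed.

Lemma cont_comp (V W : topologicalType) (u : R -> V) (h : V -> W) :
  cont u -> continuous h -> cont (fun t => h (u t)).
Proof. by move=> [cu] ch; split => x; exact: (continuous_comp (cu x) (ch _)). Qed.

Lemma cont_cis : cont (@cis R : R -> C).
Proof. by split; exact: continuous_cis. Qed.

Lemma cont_cst (V : topologicalType) (k : V) : cont (fun _ : R => k).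
Proof. by split => t; exact: cvg_cst. Qed.

Lemma ccontD f g : cont f -> cont g -> cont (fun t => f t + g t : C).
Proof. by move=> [cf] [cg]; split => t; apply: cvgD; [exact: cf|exact: cg]. Qed.

Lemma ccontB f g : cont f -> cont g -> cont (fun t => f t - g t : C).
Proof. by move=> [cf] [cg]; split => t; apply: cvgB; [exact: cf|exact: cg]. Qed.

Lemma ccontN f : cont f -> cont (fun t => - f t : C).
Proof. by move=> [cf]; split => t; apply: cvgN; exact: cf. Qed.

Lemma ccontM f g : cont f -> cont g -> cont (fun t => f t * g t : C).
Proof. by move=> [cf] [cg]; split => t; apply: cvgM; [exact: cf|exact: cg]. Qed.

Lemma ccontX n f : cont f -> cont (fun t => f t ^+ n : C).
Proof.
move=> cf; elim: n => [|n IH]; first exact: cont_cst.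
by under eq_fun do rewrite exprS; exact: ccontM.
Qed.

Lemma ccont_sum I (s : seq I) (F : I -> R -> C) : (forall i, cont (F i)) ->
  cont (fun t => \sum_(i <- s) F i t).
Proof.
move=> cF; elim: s => [|i s IH].
  by under eq_fun do rewrite big_nil; exact: cont_cst.
by under eq_fun do rewrite big_cons; exact: ccontD.
Qed.

Lemma ccont_conj f : cont f -> cont (fun t => (f t)^* : C).
Proof. by move=> cf; apply: (cont_comp (h := fun z : C => z^* : C) cf); exact: continuous_conjc. Qed.

Lemma cont_Re f : cont f -> cont (fun t => cre (f t)).
Proof. by move=> cf; apply: (cont_comp (h := fun z : C => cre z) cf); exact: continuous_Re. Qed.

Lemma cont_Im f : cont f -> cont (fun t => cim (f t)).
Proof. by move=> cf; apply: (cont_comp (h := fun z : C => cim z) cf); exact: continuous_Im. Qed.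

Lemma cont_normc f : cont f -> cont (fun t => cnorm (f t)).
Proof. by move=> cf; apply: (cont_comp (h := fun z : C => cnorm z) cf); exact: continuous_normc. Qed.

Lemma ccont_real u : cont u -> cont (fun t => (u t)%:C : C).
Proof. by move=> cu; apply: (cont_comp (h := fun r => r%:C : C) cu); exact: continuous_real_complex. Qed.

Lemma contD u v : cont u -> cont v -> cont (fun t => u t + v t).
Proof. by move=> [cf] [cg]; split => t; apply: cvgD; [exact: cf|exact: cg]. Qed.

Lemma contN u : cont u -> cont (fun t => - u t).
Proof. by move=> [cf]; split => t; apply: cvgN; exact: cf. Qed.

Lemma contB u v : cont u -> cont v -> cont (fun t => u t - v t).
Proof. by move=> [cf] [cg]; split => t; apply: cvgB; [exact: cf|exact: cg]. Qed.

Lemma contM u v : cont u -> cont v -> cont (fun t => u t * v t).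
Proof. by move=> [cf] [cg]; split => t; apply: cvgM; [exact: cf|exact: cg]. Qed.

Lemma contX n u : cont u -> cont (fun t => u t ^+ n).
Proof.
move=> cf; elim: n => [|n IH]; first exact: cont_cst.
by under eq_fun do rewrite exprS; exact: contM.
Qed.

Lemma cont_normr u : cont u -> cont (fun t => `|u t|).
Proof. by move=> cu; apply: (cont_comp (h := fun x : R => `|x|) cu); exact: norm_continuous. Qed.

Hint Resolve cont_cis cont_cst ccontD ccontB ccontN ccontM ccontX ccont_sum
  ccont_conj cont_Re cont_Im cont_normc ccont_real contD contN contB contM contX
  cont_normr : cont.
Ltac contt := solve [auto 30 with cont].

Definition mean u : R := (2 * pi)^-1 * rint 0 (2 * pi) u.
Definition cmean f : C := (2 * pi)^-1%:C * cint 0 (2 * pi) f.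

Lemma pi2_gt0 : 0 < 2 * pi :> R.
Proof. by rewrite mulr_gt0// pi_gt0. Qed.

Lemma pi2V_ge0 : 0 <= (2 * pi)^-1 :> R.
Proof. by rewrite invr_ge0 ltW// pi2_gt0. Qed.

Lemma eq_mean u v : u =1 v -> mean u = mean v.
Proof. by move=> uv; congr (_ * _); apply: eq_rint => t _. Qed.

Lemma mean_cst (k : R) : mean (fun=> k) = k.
Proof.
rewrite /mean rint_cst ?(ltW pi2_gt0)// subr0 mulrCA mulVf ?mulr1//.
by rewrite gt_eqF// pi2_gt0.
Qed.

Lemma meanD u v : cont u -> cont v ->
  mean (fun t => u t + v t) = mean u + mean v.
Proof. by move=> cu cv; rewrite /mean rintD ?mulrDr//; exact: conT. Qed.

Lemma meanZ (k : R) u : cont u -> mean (fun t => k * u t) = k * mean u.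
Proof. by move=> cu; rewrite /mean rintZ 1?mulrCA//; exact: conT. Qed.

Lemma meanB u v : cont u -> cont v ->
  mean (fun t => u t - v t) = mean u - mean v.
Proof. by move=> cu cv; rewrite /mean rintB ?mulrBr//; exact: conT. Qed.

Lemma mean_le u v : cont u -> cont v -> (forall t, u t <= v t) ->
  mean u <= mean v.
Proof.
move=> cu cv uv; rewrite /mean ler_wpM2l ?pi2V_ge0//.
by apply: rint_le => //; exact: conT.
Qed.

Lemma mean_ge0 u : (forall t, 0 <= u t) -> 0 <= mean u.
Proof. by move=> u0; rewrite /mean mulr_ge0 ?pi2V_ge0//; apply: rint_ge0. Qed.

Lemma mean_bound u (k : R) : cont u -> (forall t, u t <= k) -> mean u <= k.
Proof.
move=> cu uk; rewrite -[leRHS]mean_cst; apply: mean_le => //.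
exact: cont_cst.
Qed.

(** Dominated convergence with a constant majorant. *)
Lemma mean_cvg0 (u_ : nat -> R -> R) (M : R) :
  (forall n, cont (u_ n)) -> (forall n t, `|u_ n t| <= M) ->
  {ae mu, forall t, t \in `[0, 2 * pi] -> u_ n t @[n --> \oo] --> 0} ->
  mean (u_ n) @[n --> \oo] --> 0.
Proof.
move=> cu uM u0.
suff: rint 0 (2 * pi) (u_ n) @[n --> \oo] --> 0.
  by move=> /(cvgMl_tmp (a := (2 * pi)^-1)); rewrite mulr0.
have mI : measurable (`[0, 2 * pi]%classic : set R) by [].
have mu_ n := measurable_int _ (con_integrable (conT 0 (2 * pi) (cu n))).
have iM : mu.-integrable `[0, 2 * pi]%classic (EFin \o cst M).
  by apply: con_integrable; exact: con_cst.
have uM' : \forall t \ae mu, forall n, `[0, 2 * pi]%classic t ->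
    (`|(EFin \o u_ n) t| <= (EFin \o cst M) t)%E.
  by apply: aeW => t n _ /=; rewrite lee_fin.
have u0' : \forall t \ae mu, `[0, 2 * pi]%classic t ->
    (fun n => (EFin \o u_ n) t) @ \oo --> (EFin \o (fun _ : R => 0 : R)) t.
  apply: filterS u0; first exact: (ae_filter_ringOfSetsType mu).
  by move=> t H tI; apply: (cvg_comp (fun n => u_ n t) (fun x => x%:E) (H tI)); exact: cvg_refl.
have m0 := measurable_int mu (con_integrable (@con_cst _ R 0 (2 * pi) 0)).
have [_ _ +] := @dominated_convergence _ _ R mu _ mI _ _ _ mu_ m0 u0' iM uM'.
rewrite [X in _ --> X -> _](_ : _ = 0%:E); last exact: integral0.
by move=> /fine_cvg; apply: cvg_trans; exact: cvg_refl.
Qed.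

Lemma Re_cmean f : cre (cmean f) = mean (fun t => cre (f t)).
Proof. by rewrite /cmean creM !cpartE mul0r subr0. Qed.

Lemma Im_cmean f : cim (cmean f) = mean (fun t => cim (f t)).
Proof. by rewrite /cmean cimM !cpartE mul0r addr0. Qed.

Lemma eq_cmean f g : f =1 g -> cmean f = cmean g.
Proof. by move=> fg; congr (_ * _); apply: eq_cint => t _. Qed.

Lemma cmean_cst (k : C) : cmean (fun=> k) = k.
Proof. by apply: complex_eqP; rewrite ?Re_cmean ?Im_cmean mean_cst. Qed.

Lemma cmeanD f g : cont f -> cont g ->
  cmean (fun t => f t + g t) = cmean f + cmean g.
Proof. by move=> cf cg; rewrite /cmean cintD ?mulrDr//; exact: conT. Qed.

Lemma cmeanZ (k : C) f : cont f -> cmean (fun t => k * f t) = k * cmean f.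
Proof. by move=> cf; rewrite /cmean cintZ 1?mulrCA//; exact: conT. Qed.

Lemma cmeanN f : cont f -> cmean (fun t => - f t) = - cmean f.
Proof.
by move=> cf; rewrite -mulN1r -cmeanZ//; apply: eq_cmean => t; rewrite mulN1r.
Qed.

Lemma cmeanB f g : cont f -> cont g ->
  cmean (fun t => f t - g t) = cmean f - cmean g.
Proof. by move=> cf cg; rewrite cmeanD ?cmeanN//; exact: ccontN. Qed.

Lemma cmean_sum I (s : seq I) (F : I -> R -> C) : (forall i, cont (F i)) ->
  cmean (fun t => \sum_(i <- s) F i t) = \sum_(i <- s) cmean (F i).
Proof.
move=> cF; elim: s => [|i s IH].
  by rewrite big_nil -[RHS](cmean_cst 0); apply: eq_cmean => t; rewrite big_nil.
rewrite big_cons -IH -cmeanD//; last exact: ccont_sum.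
by apply: eq_cmean => t; rewrite big_cons.
Qed.

Lemma normc_cmean_le f : cont f -> cnorm (cmean f) <= mean (fun t => cnorm (f t)).
Proof.
move=> cf; rewrite /cmean normcMr normc_real ger0_norm ?pi2V_ge0// /mean.
by rewrite ler_wpM2l ?pi2V_ge0//; apply: normc_cint_le; exact: conT.
Qed.

Lemma cmean_conj f : cont f -> cmean (fun t => (f t)^*) = (cmean f)^*.
Proof.
move=> cf; apply: complex_eqP.
  by rewrite cre_conj !Re_cmean; apply: eq_mean => t; rewrite cre_conj.
rewrite cim_conj !Im_cmean -mulN1r -meanZ; last by contt.
by apply: eq_mean => t; rewrite cim_conj mulN1r.
Qed.

Lemma cmean_real u : cmean (fun t => (u t)%:C) = (mean u)%:C.
Proof. by apply: complex_eqP; rewrite ?Re_cmean ?Im_cmean !cpartE ?mean_cst. Qed.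

Lemma cis_exp n t : cis t ^+ n = cis (n%:R * t) :> C.
Proof.
elim: n => [|n IH]; first by rewrite mul0r cis0.
by rewrite exprS IH -cisD -natr1 mulrDl mul1r addrC.
Qed.

Lemma cderive_cis_exp n (t : R) :
  cderive (fun t => cis t ^+ n) t (n%:R * ci * cis t ^+ n).
Proof.
elim: n => [|n IH].
  by rewrite mulr0n !mul0r; exact: cderive_cst.
have -> : (fun t : R => cis t ^+ n.+1 : C) = (fun t => cis t * cis t ^+ n).
  by apply/funext => s; rewrite exprS.
apply: cderive_eq (cderiveM (cderive_cis t) IH) _.
by rewrite exprS -natr1; ring.
Qed.

Lemma cmean_cis_exp n : (0 < n)%N -> cmean (fun t => cis t ^+ n) = 0.
Proof.
move=> n0; rewrite /cmean.
have ni0 : n%:R * ci != 0 :> C.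
  by rewrite mulf_neq0 ?pnatr_eq0 -?lt0n// eq_complex /= oner_eq0 andbF.
have cn : con 0 (2 * pi) (fun t => cis t ^+ n : C).
  by apply: conT; contt.
suff H : n%:R * ci * cint 0 (2 * pi) (fun t => cis t ^+ n) = 0 :> C.
  have /eqP := H; rewrite mulf_eq0 (negbTE ni0) => /eqP ->.
  by rewrite mulr0.
rewrite -(cintZ _ cn) (cint_FTC (U := fun t => cis t ^+ n) (ltW pi2_gt0) (conZc _ cn)).
  by rewrite cis2pi cis0 subrr.
by move=> x _; exact: cderive_cis_exp.
Qed.

Lemma cmean_conj_cis_exp n : (0 < n)%N -> cmean (fun t => (cis t)^* ^+ n) = 0.
Proof.
move=> n0; transitivity (cmean (fun t => (cis t ^+ n)^*)).
  by apply: eq_cmean => t; rewrite conjcX.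
rewrite cmean_conj ?cmean_cis_exp ?conjc0//.
by contt.
Qed.

End CircleMean.
#[export] Hint Resolve cont_cis cont_cst ccontD ccontB ccontN ccontM ccontX ccont_sum
  ccont_conj cont_Re cont_Im cont_normc ccont_real contD contN contB contM contX
  cont_normr : cont.
Ltac contt := solve [auto 30 with cont].

(** * Holomorphic functions on the disc and Cauchy's formula *)

Section Holomorphic.
Variable R : realType.
Local Notation C := (R[i]^o).
Implicit Types (r s t : R) (z w : C) (f g : C -> C) (n m N : nat).

Lemma con_comp_at (V W : topologicalType) a b (u : R -> V) (h : V -> W) :
  con a b u -> (forall x, a <= x <= b -> {for u x, continuous h}) ->
  con a b (fun t => h (u t)).
Proof.
by move=> cu ch; split => x xab; exact: (continuous_comp (conP cu xab) (ch _ xab)).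
Qed.

Record holo f : Prop := Holo { holoP : forall z, cnorm z < 1 -> derivable f z 1 }.

Lemma holo_cst (k : C) : holo (fun=> k).
Proof. by split => z _; exact: derivable_cst. Qed.

Lemma holo_id : holo (fun z => z).
Proof. by split => z _; exact: derivable_id. Qed.

Lemma holoD f g : holo f -> holo g -> holo (fun z => f z + g z).
Proof. by move=> [hf] [hg]; split => z z1; apply: derivableD; [exact: hf|exact: hg]. Qed.

Lemma holoB f g : holo f -> holo g -> holo (fun z => f z - g z).
Proof. by move=> [hf] [hg]; split => z z1; apply: derivableB; [exact: hf|exact: hg]. Qed.

Lemma holoM f g : holo f -> holo g -> holo (fun z => f z * g z).
Proof. by move=> [hf] [hg]; split => z z1; apply: derivableM; [exact: hf|exact: hg]. Qed.

Lemma holoX f n : holo f -> holo (fun z => f z ^+ n).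
Proof.
move=> hf; elim: n => [|n IH]; first exact: holo_cst.
by under eq_fun do rewrite exprS; exact: holoM.
Qed.

Lemma holoV f : holo f -> (forall z, cnorm z < 1 -> f z != 0) -> holo (fun z => (f z)^-1).
Proof. by move=> [hf] f0; split => z z1; apply: derivableV; [exact: f0|exact: hf]. Qed.

Lemma holo_sum I (q : seq I) (F : I -> C -> C) : (forall i, holo (F i)) ->
  holo (fun z => \sum_(i <- q) F i z).
Proof.
move=> hF; elim: q => [|i q IH].
  by under eq_fun do rewrite big_nil; exact: holo_cst.
by under eq_fun do rewrite big_cons; exact: holoD.
Qed.

Lemma derivable_comp f g z : derivable f z 1 -> derivable g (f z) 1 ->
  derivable (fun w => g (f w)) z 1.
Proof.
move=> df dg; have cf := derivable_continuous df.
have [M M0 HM] := derivable_bound df.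
have [a Ha] := (derivableCP _ _).1 df; have [b Hb] := (derivableCP _ _).1 dg.
apply/derivableCP; exists (b * a) => e e0.
have e1 : 0 < e / 2 / M by rewrite !divr_gt0.
have b1 : 0 < cnorm b + 1 by rewrite ltr_wpDl// normc_ge0.
have e2 : 0 < e / 2 / (cnorm b + 1) by rewrite !divr_gt0.
have Hg := cf _ (Hb _ e1); have Hf := Ha _ e2.
near=> w.
have Hw : cnorm (g (f w) - g (f z) - b * (f w - f z)) <= e / 2 / M * cnorm (f w - f z).
  by near: w; exact: Hg.
have Hw2 : cnorm (f w - f z - a * (w - z)) <= e / 2 / (cnorm b + 1) * cnorm (w - z).
  by near: w; exact: Hf.
have Hw3 : cnorm (f w - f z) <= M * cnorm (w - z) by near: w; exact: HM.
have -> : g (f w) - g (f z) - b * a * (w - z) =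
  (g (f w) - g (f z) - b * (f w - f z)) + b * (f w - f z - a * (w - z)) by ring.
apply: le_trans (normcDle _ _) _; rewrite [e in leRHS]splitr mulrDl lerD//.
  apply: le_trans Hw _; rewrite -mulrA ler_wpM2l ?divr_ge0 ?(ltW e0)//.
  by rewrite ler_pdivrMl.
rewrite normcMr; apply: le_trans (ler_wpM2l (normc_ge0 b) Hw2) _.
rewrite mulrA ler_wpM2r ?normc_ge0// mulrCA ger_pMr ?divr_gt0//.
by rewrite ler_pdivrMr// mul1r lerDl.
Unshelve. all: by end_near. Qed.

Lemma holo_comp f g : holo f -> holo g -> (forall z, cnorm z < 1 -> cnorm (f z) < 1) ->
  holo (fun z => g (f z)).
Proof. by move=> [hf] [hg] f1; split => z z1; apply: derivable_comp; [exact: hf|apply: hg; exact: f1]. Qed.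

Definition pt r t : C := r%:C * cis t.

Lemma normc_pt r t : 0 <= r -> cnorm (pt r t) = r.
Proof. by move=> r0; rewrite normcMr normc_cis normc_real mulr1 ger0_norm. Qed.

Lemma cont_pt r : cont (pt r).
Proof. by rewrite /pt; contt. Qed.

Lemma cont_holo f r : holo f -> 0 <= r < 1 -> cont (fun t => f (pt r t)).
Proof.
move=> hf /andP[r0 r1]; split => t.
apply: (@continuous_comp _ _ _ (pt r) f t); first exact: (contP (cont_pt r)).
by apply: derivable_continuous; apply: (holoP hf); rewrite normc_pt.
Qed.

(** The Cauchy kernel: on the unit circle w = cis t one has dw / (w - z) = i [kern z t] dt. A circle
    of radius [r] uses [kern] at z / r. *)
Definition kern z t : C := (1 - z * (cis t)^*)^-1.

Lemma normc_zcis z t : cnorm (z * (cis t)^*) = cnorm z.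
Proof. by rewrite normcMr normc_conj normc_cis mulr1. Qed.

Lemma normc_kern_ge z t : 1 - cnorm z <= cnorm (1 - z * (cis t)^*).
Proof. by have := normc_sub_ge 1 (z * (cis t)^*); rewrite normc_1 normc_zcis. Qed.

Lemma kern_neq0 z t : cnorm z < 1 -> 1 - z * (cis t)^* != 0.
Proof.
by move=> z1; apply: normc_neq0; apply: lt_le_trans (normc_kern_ge z t); rewrite subr_gt0.
Qed.

Lemma normc_kern_le z t : cnorm z < 1 -> cnorm (kern z t) <= (1 - cnorm z)^-1.
Proof.
move=> z1; rewrite normc_inv lef_pV2 ?posrE ?subr_gt0 ?normc_kern_ge//.
by apply: normc_gt0; exact: kern_neq0.
Qed.

Lemma cont_inv (u : R -> C) : cont u -> (forall t, u t != 0) -> cont (fun t => (u t)^-1 : C).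
Proof. by move=> [cu] u0; split => t; apply: cvgV; [exact: u0|exact: cu]. Qed.

Lemma cont_kern z : cnorm z < 1 -> cont (kern z).
Proof. by move=> z1; apply: cont_inv; [contt|move=> t; exact: kern_neq0]. Qed.

(** The finite geometric sum has the exact remainder (z conj(cis t))^N [kern z t]. Taylor estimates
    then need no exchange of a limit with an integral. *)
Lemma cmean_kern_expand (u : R -> C) (M : R) z N : cont u ->
  (forall t, cnorm (u t) <= M) -> cnorm z < 1 ->
  cnorm (cmean (fun t => u t * kern z t) -
         \sum_(n < N) z ^+ n * cmean (fun t => u t * (cis t)^* ^+ n))
  <= M * cnorm z ^+ N / (1 - cnorm z).
Proof.
move=> cu uM z1; have ck := cont_kern z1.
have z10 : 0 < 1 - cnorm z by rewrite subr_gt0.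
have -> : \sum_(n < N) z ^+ n * cmean (fun t => u t * (cis t)^* ^+ n) =
    cmean (fun t => \sum_(n < N) z ^+ n * (u t * (cis t)^* ^+ n)).
  rewrite cmean_sum; last by move=> i; contt.
  by apply: eq_bigr => i _; rewrite cmeanZ//; contt.
rewrite -cmeanB; [|contt|by apply: ccont_sum => i; contt].
have -> : (fun t => u t * kern z t - \sum_(n < N) z ^+ n * (u t * (cis t)^* ^+ n)) =
          (fun t => (z * (cis t)^*) ^+ N * (u t * kern z t)).
  apply/funext => t; have k0 := kern_neq0 t z1.
  have -> : \sum_(n < N) z ^+ n * (u t * (cis t)^* ^+ n) =
     u t * \sum_(n < N) (z * (cis t)^*) ^+ n.
    by rewrite mulr_sumr; apply: eq_bigr => i _; rewrite exprMn; ring.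
  have E : (1 - z * (cis t)^*) * (\sum_(n < N) (z * (cis t)^*) ^+ n) = 1 - (z * (cis t)^*) ^+ N.
    by rewrite -opprB mulNr -subrX1 opprB.
  have -> : \sum_(n < N) (z * (cis t)^*) ^+ n = (1 - (z * (cis t)^*) ^+ N) * kern z t.
    by rewrite -E /kern mulrAC mulfV// mul1r.
  by ring.
apply: le_trans (normc_cmean_le _) _; first by contt.
apply: mean_bound; first by contt.
move=> t; rewrite !normcMr normcXn normc_zcis [leRHS]mulrAC mulrC.
apply: ler_wpM2r; first by rewrite exprn_ge0// normc_ge0.
apply: ler_pM; rewrite ?normc_ge0//; exact: normc_kern_le.
Qed.

Lemma geometric_small (x e : R) : 0 <= x < 1 -> 0 < e -> exists N, x ^+ N < e.
Proof.
move=> /andP[x0 x1] e0; have := @cvg_geometric R 1 x.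
rewrite ger0_norm// x1 => /(_ isT) /cvgrPdist_lt /(_ e e0) [N _ /(_ N (leqnn N))].
by rewrite /geometric /= mul1r sub0r normrN ger0_norm ?exprn_ge0//; exists N.
Qed.

Lemma eq_small (x y : C) (M q : R) : 0 <= q < 1 -> 
  (forall N, cnorm (x - y) <= M * q ^+ N.+1) -> x = y.
Proof.
move=> q1 H; apply/eqP; rewrite -subr_eq0; apply/eqP/normc_eq0P/eqP.
rewrite eq_le normc_ge0 andbT; apply/ler_addgt0Pr => e e0; rewrite add0r.
have M1 : 0 < `|M| + 1 by rewrite ltr_wpDl.
have [N HN] := geometric_small q1 (divr_gt0 e0 M1).
move: HN; rewrite ltr_pdivlMr// => HN.
apply: le_trans (H N) _; apply: le_trans (ltW HN).
have qN : 0 <= q ^+ N by rewrite exprn_ge0//; case/andP: q1.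
have [q0 q1'] := andP q1.
have Mq : M * q <= `|M| + 1 by have := ler_norm M; have := normr_ge0 M; nra.
by rewrite exprS mulrA [leRHS]mulrC ler_wpM2r.
Qed.

Lemma cmean_kern z : cnorm z < 1 -> cmean (kern z) = 1.
Proof.
move=> z1; have ck := cont_kern z1.
apply: (@eq_small _ _ ((1 - cnorm z)^-1) (cnorm z)); first by rewrite normc_ge0.
move=> N; have := @cmean_kern_expand (fun=> 1) 1 z N.+1 (cont_cst _ _) _ z1.
rewrite normc_1 mul1r mulrC => /(_ (fun=> lexx _)).
have -> : cmean (fun t => 1 * kern z t) = cmean (kern z) by apply: eq_cmean => t; rewrite mul1r.
rewrite big_ord_recl expr0 mul1r big1 ?addr0.
  by have -> : cmean (fun t : R => 1 * (cis t)^* ^+ 0) = 1 :> C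
    by rewrite -[RHS](cmean_cst 1); apply: eq_cmean => t; rewrite expr0 mulr1.
move=> i _; have -> : cmean (fun t : R => 1 * (cis t)^* ^+ lift ord0 i) =
   cmean (fun t : R => (cis t)^* ^+ lift ord0 i).
  by apply: eq_cmean => t; rewrite mul1r.
by rewrite cmean_conj_cis_exp ?mulr0.
Qed.

Section Cauchy.
Variables (f : C -> C) (r : R) (z : C).
Hypotheses (hf : holo f) (r0 : 0 < r) (r1 : r < 1) (zr : cnorm z < r).

(** The circle of radius [r] is shrunk linearly to [z], with [u] the shrinking factor. The integral
    of the difference quotient [g] does not depend on [u] > 0, and it tends to 0 with [u] because
    [g] is bounded near [z] while the curve has length O(u). *)
Let g w := (f w - f z) * (w - z)^-1.
Let gam (u v : R) : C := z + u%:C * (pt r v - z).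
Let gu (u v : R) : C := pt r v - z.
Let gv (u v : R) : C := u%:C * (r%:C * (ci * cis v)).

Let ptz v : pt r v - z != 0.
Proof.
apply: normc_neq0; apply: lt_le_trans (normc_sub_ge _ _).
by rewrite normc_pt ?ltW// subr_gt0.
Qed.

Let ptz2 v : cnorm (pt r v - z) <= 2.
Proof. by apply: le_trans (normcBle _ _) _; rewrite (normc_pt v (ltW r0)); have := r1; have := zr; lra. Qed.

Let gamz u v : gam u v - z = u%:C * (pt r v - z).
Proof. by rewrite /gam addrC addKr. Qed.

Let gam_lt1 u v : 0 <= u <= 1 -> cnorm (gam u v) < 1.
Proof.
move=> /andP[u0 u1].
have -> : gam u v = (1 - u)%:C * z + u%:C * pt r v.
  by rewrite /gam real_complexD real_complexN -[1%:C]/(1 : C); ring.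
apply: le_lt_trans (normcDle _ _) _.
rewrite normcMr [cnorm (u%:C * _)]normcMr !normc_real (normc_pt v (ltW r0)).
rewrite (ger0_norm u0) ger0_norm ?subr_ge0//.
have := normc_ge0 z; have := r0; have := r1; have := zr; nra.
Qed.

Let dg u v : 0 < u <= 1 -> derivable g (gam u v) 1.
Proof.
move=> /andP[u0 u1]; apply: derivableM.
  apply: derivableB; last exact: derivable_cst.
  by apply: (holoP hf); apply: gam_lt1; rewrite u1 ltW.
apply: derivableV; last by apply: derivableB; [exact: derivable_id|exact: derivable_cst].
rewrite gamz mulf_neq0//; apply: normc_neq0; rewrite normc_real gtr0_norm//.
Qed.

Let V u := cint 0 (2 * pi) (fun v => g (gam u v) * gv u v).

(** Goursat's theorem on [e, 1] x [0, 2 pi]: the sides at angles 0 and 2 pi are the same segment and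
    cancel. *)
Let V_eq e : 0 < e <= 1 -> V e = V 1.
Proof.
move=> /andP[e0 e1].
have [L L0 HL] : exists2 L, 0 <= L & forall u v, 0 <= u <= 1 -> cnorm (gu u v) <= L /\ cnorm (gv u v) <= L.
  exists 2 => // u v /andP[u0 u1]; rewrite /gu /gv; split; first exact: ptz2.
  rewrite !normcMr normc_cis !normc_real (ger0_norm u0) (gtr0_norm r0).
  have -> : cnorm (ci : C) = 1 by rewrite /cnorm /= expr0n expr1n add0r sqrtr1.
  rewrite !mulr1; have := r0; have := r1; nra.
have i01 u : e <= u <= 1 -> 0 <= u <= 1.
  by case/andP => eu u1; rewrite u1 andbT (le_trans (ltW e0)).
have := @goursat R gam gu gv e 1 0 (2 * pi) L g e1 (ltW (pi2_gt0 R)).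
move=> /(_ _ _ _ _ _ _ _)/wrap[].
- move=> u v _ _; rewrite /gam /gu.
  apply: cderive_eq (cderiveD (cderive_cst z u) (cderiveM (cderive_real u) (cderive_cst (pt r v - z) u))) _.
  by rewrite mulr0 addr0 mul1r add0r.
- move=> u v _ _; rewrite /gam /gv /pt.
  apply: cderive_eq (cderiveD (cderive_cst z v) (cderiveM (cderive_cst u%:C v)
    (cderiveD (cderiveM (cderive_cst r%:C v) (cderive_cis v)) (cderive_cst (- z) v)))) _.
  by rewrite !mul0r !add0r addr0.
- by move=> v _; exact: con_cst.
- by move=> u _; apply: conT; rewrite /gv; contt.
- by move=> u v /i01 u01 _; case: (HL u v u01).
- by move=> u v /i01 u01 _; case: (HL u v u01).
- by move=> u v /andP[eu u1] _; apply: dg; rewrite u1 (lt_le_trans e0).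
have -> : cint e 1 (fun u => g (gam u (2 * pi)) * gu u (2 * pi)) =
          cint e 1 (fun u => g (gam u 0) * gu u 0).
  by apply: eq_cint => u _; rewrite /gam /gu /pt cis2pi cis0.
by move/addrI.
Qed.

Let con_V u : 0 < u <= 1 -> con 0 (2 * pi) (fun v => g (gam u v) * gv u v).
Proof.
move=> u01; apply: (conMc (f := fun v => g (gam u v))); last by apply: conT; rewrite /gv; contt.
have cg : cont (gam u) by rewrite /gam; have := cont_pt r; contt.
apply: (@con_comp_at C C _ _ (gam u) g); first exact: conT.
by move=> v _; apply: derivable_continuous; exact: dg.
Qed.

Let V1 : V 1 = 0.
Proof.
have z1 := lt_trans zr r1.
have [M M0 /nbhs_normcP[d d0 HM]] := derivable_bound (holoP hf z1).
apply/normc_eq0P/eqP; rewrite eq_le normc_ge0 andbT; apply/ler_addgt0Pr => e e0.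
rewrite add0r.
have D0 : 0 < 2 * M * (2 * pi) by rewrite !mulr_gt0// pi_gt0.
(* Since |pt r v - z| <= 2, the bound d / 4 keeps the curve where the quotient is at most [M]; the
   last bound makes 2 M u * 2 pi at most [e]. *)
pose u := Num.min 1 (Num.min (d / 4) (e / (2 * M * (2 * pi)))).
have u0 : 0 < u by rewrite /u !lt_min ltr01 !divr_gt0.
have u1 : u <= 1 by rewrite /u ge_min lexx.
have ud : u <= d / 4 by rewrite /u !ge_min lexx orbT.
have ue : u <= e / (2 * M * (2 * pi)) by rewrite /u !ge_min lexx !orbT.
rewrite -(@V_eq u) ?u0//.
have D : 0 <= 2 * pi :> R by rewrite ltW// pi2_gt0.
apply: (le_trans (normc_cint_bound (M := 2 * M * u) D (con_V _) _)) => //; first by rewrite u0.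
  move=> v _.
  have B : cnorm (pt r v - z) <= 2.
    exact: ptz2.
  have P0 : 0 < cnorm (pt r v - z) by apply: normc_gt0.
  have gn : cnorm (gam u v - z) = u * cnorm (pt r v - z).
    by rewrite gamz normcMr normc_real gtr0_norm.
  have gz : 0 < cnorm (gam u v - z) by rewrite gn mulr_gt0.
  have := HM (gam u v).
  rewrite {1}gn => /(_ _)/wrap[].
    nra.
  rewrite /g normcMr normcMr normc_inv => H.
  have -> : cnorm (gv u v) = u * r.
    rewrite /gv !normcMr normc_cis !normc_real !gtr0_norm//.
    have -> : cnorm (ci : C) = 1 by rewrite /cnorm /= expr0n expr1n add0r sqrtr1.
    by rewrite !mulr1.
  have H2 : cnorm (f (gam u v) - f z) * (cnorm (gam u v - z))^-1 <= M.
    by rewrite ler_pdivrMr.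
  have H3 : 0 <= cnorm (f (gam u v) - f z) * (cnorm (gam u v - z))^-1.
    by rewrite divr_ge0 ?normc_ge0.
  move: H2 H3; set X := (_ * _^-1) => H2 H3.
  have : X * (u * r) <= M * (u * r) by rewrite ler_wpM2r// mulr_ge0 ?ltW.
  have : M * u * r <= M * u * 2 by rewrite ler_wpM2l ?mulr_ge0 ?ltW//; have := r1; lra.
  lra.
rewrite subr0; move: ue; rewrite ler_pdivlMr//; lra.
Qed.

Lemma cauchy_formula : cmean (fun t => f (pt r t) * kern (z * (r^-1)%:C) t) = f z.
Proof.
have zr1 : cnorm (z * (r^-1)%:C) < 1.
  by rewrite normcMr normc_real gtr0_norm ?invr_gt0// ltr_pdivrMr// mul1r.
have ck := cont_kern zr1.
have cf : cont (fun t => f (pt r t)) by apply: cont_holo => //; rewrite r1 ltW.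
have rc0 : r%:C != 0 :> C by apply: normc_neq0; rewrite normc_real gtr0_norm.
(* On the full circle dw / (w - z) is i times the kernel; subtracting f z then costs only the mean
   of the kernel, which is 1. *)
have E t : g (gam 1 t) * gv 1 t = ci * ((f (pt r t) - f z) * kern (z * (r^-1)%:C) t).
  have -> : gam 1 t = pt r t by rewrite /gam -[1%:C]/(1 : C); ring.
  have K : kern (z * (r^-1)%:C) t * (pt r t - z) = pt r t.
    rewrite /kern; have k0 := kern_neq0 t zr1.
    apply: (mulfI k0); rewrite mulrA mulfV// mul1r mulrBl mul1r.
    rewrite /pt real_complexV.
    have -> : z * (r%:C)^-1 * (cis t)^* * (r%:C * cis t) = z * ((r%:C)^-1 * r%:C) * (cis t * (cis t)^*).
      by ring.
    by rewrite mulVf// mulcis_conj !mulr1.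
  rewrite /g /gv -[1%:C]/(1 : C) mul1r.
  have -> : r%:C * (ci * cis t) = ci * (kern (z * (r^-1)%:C) t * (pt r t - z)).
    by rewrite K /pt; ring.
  have := ptz t; move: (pt r t - z) (kern _ _) (f (pt r t) - f z) => d k F d0.
  by rewrite mulrCA -mulrA [_^-1 * _]mulrC -!mulrA mulfV// mulr1.
have : cmean (fun t => (f (pt r t) - f z) * kern (z * (r^-1)%:C) t) = 0.
  have ci0 : ci != 0 :> C by rewrite eq_complex /= oner_eq0 andbF.
  apply: (mulfI ci0); rewrite mulr0 -cmeanZ; last by contt.
  by rewrite /cmean -(eq_cint (fun t _ => E t)) -/(V 1) V1 mulr0.
have -> : (fun t => (f (pt r t) - f z) * kern (z * (r^-1)%:C) t) =
   (fun t => f (pt r t) * kern (z * (r^-1)%:C) t - f z * kern (z * (r^-1)%:C) t).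
  by apply/funext => t; rewrite mulrBl.
rewrite cmeanB; [|contt..].
by rewrite cmeanZ// cmean_kern// mulr1 => /eqP; rewrite subr_eq0 => /eqP.
Qed.

End Cauchy.

End Holomorphic.

(** * Taylor coefficients and the Poisson formula *)

Section Taylor.
Variable R : realType.
Local Notation C := (R[i]^o).
Implicit Types (r s t : R) (z w : C) (f g : C -> C) (n m N : nat).

Lemma creal_nat n : (n%:R)%:C = n%:R :> C.
Proof. by elim: n => // n IH; rewrite -!natr1 real_complexD IH. Qed.

Lemma cis_natmul n : cis (n%:R * (2 * pi)) = 1 :> C.
Proof. by rewrite -cis_exp cis2pi expr1n. Qed.

Lemma cis_representative t : exists2 t', 0 <= t' <= 2 * pi & cis t' = cis t :> C.
Proof.
have p0 := pi2_gt0 R.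
pose k := Num.floor (t / (2 * pi)).
have /andP[k1 k2] := floor_itv (t / (2 * pi)); rewrite -/k in k1 k2.
exists (t - k%:~R * (2 * pi)).
  rewrite subr_ge0 -ler_pdivlMr// k1 lerBlDr -[X in X + _]mul1r -mulrDl.
  by rewrite -ler_pdivrMr// addrC -intrD1 ltW.
have E : cis (- (k%:~R * (2 * pi))) = 1 :> C.
  case: k {k1 k2} => n; first by rewrite -cis_conj cis_natmul conjc1.
  by rewrite NegzE mulrNz mulNr opprK cis_natmul.
by rewrite cisD E mulr1.
Qed.

Lemma holo_circle_bound f r : holo f -> 0 <= r < 1 ->
  exists2 M, 0 <= M & forall t, cnorm (f (pt r t)) <= M.
Proof.
move=> hf r01; have cf := cont_normc (cont_holo hf r01).
have [c _ Hc] := @EVT_max R (fun t => cnorm (f (pt r t))) 0 (2 * pi) (ltW (pi2_gt0 R))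
   (continuous_subspaceT (contP cf)).
exists (cnorm (f (pt r c))); first exact: normc_ge0.
move=> t; have [t' t'i E] := cis_representative t.
by rewrite /pt -E; apply: (Hc t'); rewrite in_itv.
Qed.

Lemma cauchy_bound f r M z : holo f -> 0 < r < 1 -> cnorm z < r ->
  (forall t, cnorm (f (pt r t)) <= M) -> cnorm (f z) <= M / (1 - cnorm z / r).
Proof.
move=> hf /andP[r0 r1] zr fM.
have nr x : cnorm (x * (r^-1)%:C) = cnorm x / r.
  by rewrite normcMr normc_real gtr0_norm ?invr_gt0.
have z1 : cnorm (z * (r^-1)%:C) < 1 by rewrite nr ltr_pdivrMr ?mul1r.
have ckz := cont_kern z1.
have cf : cont (fun t => f (pt r t)) by apply: cont_holo => //; rewrite r1 ltW.
rewrite -(cauchy_formula hf r0 r1 zr).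
apply: le_trans (normc_cmean_le _) _; first by contt.
apply: mean_bound; first by contt.
move=> t; rewrite normcMr -nr; apply: ler_pM; rewrite ?normc_ge0//.
exact: normc_kern_le.
Qed.

Lemma cauchy_mean_bound f r z : holo f -> 0 < r < 1 -> cnorm z < r ->
  cnorm (f z) <= mean (fun t => cnorm (f (pt r t))) / (1 - cnorm z / r).
Proof.
move=> hf /andP[r0 r1] zr.
have nr x : cnorm (x * (r^-1)%:C) = cnorm x / r.
  by rewrite normcMr normc_real gtr0_norm ?invr_gt0.
have z1 : cnorm (z * (r^-1)%:C) < 1 by rewrite nr ltr_pdivrMr ?mul1r.
have ckz := cont_kern z1.
have cf : cont (fun t => f (pt r t)) by apply: cont_holo => //; rewrite r1 ltW.
rewrite -{1}(cauchy_formula hf r0 r1 zr).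
apply: le_trans (normc_cmean_le _) _; first by contt.
rewrite [leRHS]mulrC -meanZ; last by contt.
apply: mean_le; [by contt..|].
move=> t; rewrite normcMr mulrC ler_wpM2r ?normc_ge0// -nr.
exact: normc_kern_le.
Qed.

Lemma small_eq (x y : C) (M q : R) n0 : 0 <= q < 1 ->
  (forall N, (n0 <= N)%N -> cnorm (x - y) <= M * q ^+ N) -> x = y.
Proof.
move=> q1 H; apply: (@eq_small _ x y (M * q ^+ n0) q q1) => N.
by rewrite -mulrA -exprD; apply: H; rewrite leq_addr.
Qed.

Lemma cmean_ortho n m : cmean (fun t => cis t ^+ n * (cis t)^* ^+ m) = (n == m)%:R :> C.
Proof.
have [nm|mn|->] := ltngtP n m.
- transitivity (cmean (fun t => (cis t)^* ^+ (m - n) : C)); last first.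
    by rewrite cmean_conj_cis_exp ?subn_gt0.
  apply: eq_cmean => t.
  rewrite -{1}(subnKC (ltnW nm)) exprD mulrA -exprMn mulcis_conj expr1n mul1r//.
- transitivity (cmean (fun t => cis t ^+ (n - m) : C)); last first.
    by rewrite cmean_cis_exp ?subn_gt0.
  apply: eq_cmean => t.
  by rewrite -{1}(subnK (ltnW mn)) exprD -mulrA -exprMn mulcis_conj expr1n mulr1.
- rewrite -[RHS](cmean_cst 1); apply: eq_cmean => t.
  by rewrite -exprMn mulcis_conj expr1n.
Qed.

Definition fcoef (u : R -> C) n : C := cmean (fun t => u t * (cis t)^* ^+ n).

Lemma fcoef_poly (c : nat -> C) N m :
  fcoef (fun t => \sum_(n < N) c n * cis t ^+ n) m = if (m < N)%N then c m else 0.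
Proof.
rewrite /fcoef.
transitivity (cmean (fun t => \sum_(n < N) c n * (cis t ^+ n * (cis t)^* ^+ m))).
  by apply: eq_cmean => t; rewrite mulr_suml; apply: eq_bigr => i _; rewrite mulrA.
rewrite cmean_sum; last by move=> i; contt.
rewrite (eq_bigr (fun i : 'I_N => c i * (val i == m)%:R)); last first.
  by move=> i _; rewrite cmeanZ; [rewrite cmean_ortho|contt].
case: ifP => [mN|mN].
  rewrite (bigD1 (Ordinal mN))//= eqxx mulr1 big1 ?addr0// => i.
  by rewrite -val_eqE /= => /negbTE ->; rewrite mulr0.
rewrite big1// => i _; case: eqP => [im|_]; last by rewrite mulr0.
by move: mN; rewrite -im ltn_ord.
Qed.

Lemma fcoef_le (u : R -> C) n : cont u -> cnorm (fcoef u n) <= mean (fun t => cnorm (u t)).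
Proof.
move=> cu; apply: le_trans (normc_cmean_le _) _; first by contt.
by rewrite le_eqVlt; apply/orP; left; apply/eqP/eq_mean => t;
  rewrite normcMr normcXn normc_conj normc_cis expr1n mulr1.
Qed.

(** The Taylor coefficient at 0, read off the circle of radius 1/2; by [tcE] any other radius gives
    the same number. *)
Definition tc f n : C := fcoef (fun t => f (pt 2^-1 t)) n * 2 ^+ n.

(** Cauchy's formula on the larger circle expands [f] on the smaller one in powers of cis t, with
    error O((s / r)^N). By orthogonality the n-th coefficient is the predicted one up to that error,
    for every N > n. *)
Lemma taylor_step f r s n : holo f -> 0 < r < 1 -> 0 < s < r ->
  fcoef (fun t => f (pt s t)) n = fcoef (fun t => f (pt r t)) n / r%:C ^+ n * s%:C ^+ n.
Proof.
move=> hf r01 /andP[s0 sr]; have /andP[r0 r1] := r01.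
have r01' : 0 <= r < 1 by rewrite r1 ltW.
have s01 : 0 <= s < 1 by rewrite (lt_trans sr r1) ltW.
have [M M0 fM] := holo_circle_bound hf r01'.
have cf := cont_holo hf r01'; have cs := cont_holo hf s01.
pose c k := fcoef (fun t => f (pt r t)) k / r%:C ^+ k * s%:C ^+ k.
have q1 : 0 <= s / r < 1 by rewrite divr_ge0 ?(ltW r0) ?(ltW s0)//= ltr_pdivrMr ?mul1r.
apply: (@small_eq _ _ (M / (1 - s / r)) (s / r) n.+1 q1) => N nN.
rewrite -/(c n) -[c n](_ : (if (n < N)%N then c n else 0) = _); last by rewrite nN.
rewrite -fcoef_poly /fcoef -cmeanB; [|contt|]; last first.
  by apply: ccontM; [apply: ccont_sum => i; contt|contt].
apply: le_trans (normc_cmean_le _) _.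
  by apply: ccontB; [contt|apply: ccontM; [apply: ccont_sum => i; contt|contt]].
apply: mean_bound.
  by apply: cont_normc; apply: ccontB; [contt|apply: ccontM; [apply: ccont_sum => i; contt|contt]].
move=> t; rewrite -mulrBl normcMr normcXn normc_conj normc_cis expr1n mulr1.
have ps : cnorm (pt s t) < r by rewrite normc_pt ?(ltW s0).
rewrite -(cauchy_formula hf r0 r1 ps).
have nz : cnorm (pt s t * (r^-1)%:C) = s / r.
  by rewrite normcMr normc_real normc_pt ?(ltW s0)// gtr0_norm ?invr_gt0.
have z1 : cnorm (pt s t * (r^-1)%:C) < 1 by rewrite nz; case/andP: q1.
have := cmean_kern_expand N cf fM z1; rewrite nz.
rewrite [_ / (1 - _)]mulrAC; apply: le_trans.
rewrite le_eqVlt; apply/orP; left; apply/eqP; congr (cnorm (_ - _)).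
apply: eq_bigr => i _; rewrite /c /pt -/(fcoef _ _) !exprMn real_complexV exprVn; ring.
Qed.

Lemma tcE f r n : holo f -> 0 < r < 1 ->
  fcoef (fun t => f (pt r t)) n = tc f n * r%:C ^+ n.
Proof.
move=> hf /andP[r0 r1].
have h0 : 0 < 2^-1 :> R by rewrite invr_gt0.
have h1 : 2^-1 < 1 :> R by rewrite invf_lt1// ltr1n.
have rn x : 0 < x -> x%:C ^+ n != 0 :> C.
  by move=> x0; rewrite expf_neq0//; apply: normc_neq0; rewrite normc_real gtr0_norm.
have two : (2^-1)%:C ^+ n * 2 ^+ n = 1 :> C.
  rewrite -exprMn; have -> : (2^-1)%:C * 2 = 1 :> C; last by rewrite expr1n.
  by rewrite -(creal_nat 2) -real_complexM mulVf.
rewrite /tc; have [hr|hr|hr] := ltrgtP r 2^-1.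
- rewrite (@taylor_step f 2^-1 r)// ?h0 ?r0//.
  suff -> : (2 : C) ^+ n = ((2^-1)%:C ^+ n)^-1 by [].
  by apply: (mulfI (rn _ h0)); rewrite two mulfV ?rn.
- rewrite [in RHS](@taylor_step f r 2^-1)// ?r0 ?h0//.
  by rewrite -!mulrA [_ * (_ * r%:C ^+ n)]mulrA two mul1r mulVf ?rn ?mulr1.
- by rewrite hr -mulrA [_ * _%:C ^+ n]mulrC two mulr1.
Qed.

Lemma taylor_bound f r M z N : holo f -> 0 < r < 1 -> cnorm z < r ->
  (forall t, cnorm (f (pt r t)) <= M) ->
  cnorm (f z - \sum_(n < N) tc f n * z ^+ n) <= M * (cnorm z / r) ^+ N / (1 - cnorm z / r).
Proof.
move=> hf r01 zr fM; have /andP[r0 r1] := r01.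
have nz : cnorm (z * (r^-1)%:C) = cnorm z / r.
  by rewrite normcMr normc_real gtr0_norm ?invr_gt0.
have z1 : cnorm (z * (r^-1)%:C) < 1 by rewrite nz ltr_pdivrMr ?mul1r.
have cf : cont (fun t => f (pt r t)) by apply: cont_holo => //; rewrite r1 ltW.
have := cmean_kern_expand N cf fM z1; rewrite nz cauchy_formula//.
apply: le_trans; rewrite le_eqVlt; apply/orP; left; apply/eqP; congr (cnorm (_ - _)).
apply: eq_bigr => i _; rewrite -/(fcoef _ _) tcE// exprMn real_complexV exprVn.
have rc : r%:C ^+ i != 0 :> C.
  by rewrite expf_neq0//; apply: normc_neq0; rewrite normc_real gtr0_norm.
transitivity (tc f i * z ^+ i * (r%:C ^+ i / r%:C ^+ i)); last by ring.
by rewrite mulfV ?mulr1.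
Qed.

Lemma taylor_approx f r e : holo f -> 0 <= r < 1 -> 0 < e ->
  exists N0, forall N z, (N0 <= N)%N -> cnorm z <= r ->
  cnorm (f z - \sum_(n < N) tc f n * z ^+ n) <= e.
Proof.
move=> hf /andP[r0 r1] e0; pose s := (1 + r) / 2.
have rs : r < s by rewrite /s; lra.
have s1 : s < 1 by rewrite /s; lra.
have s0 : 0 < s by rewrite (le_lt_trans r0).
have [M M0 fM] : exists2 M, 0 <= M & forall t, cnorm (f (pt s t)) <= M.
  by apply: holo_circle_bound => //; rewrite s1 ltW.
have q1 : 0 <= r / s < 1 by rewrite divr_ge0 ?(ltW s0)//= ltr_pdivrMr ?mul1r.
have /andP[q0 q2] := q1.
have d0 : 0 < e * (1 - r / s) / (M + 1).
  by rewrite divr_gt0 ?mulr_gt0 ?subr_gt0// ltr_wpDl.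
have [N0 HN0] := geometric_small q1 d0.
exists N0 => N z NN zr; have zs := le_lt_trans zr rs.
apply: le_trans (taylor_bound N hf _ zs fM) _; first by rewrite s0.
have zq : cnorm z / s <= r / s by rewrite ler_pM2r ?invr_gt0.
have B1 : (cnorm z / s) ^+ N <= (r / s) ^+ N0.
  apply: (@le_trans _ _ ((r / s) ^+ N)).
    by rewrite lerXn2r ?nnegrE// divr_ge0 ?normc_ge0 ?(ltW s0).
  by rewrite ler_wiXn2l// ltW.
have D1 : 0 < 1 - cnorm z / s by rewrite subr_gt0 (le_lt_trans zq).
rewrite ler_pdivrMr//.
apply: (@le_trans _ _ (M * (e * (1 - r / s) / (M + 1)))).
  by rewrite ler_wpM2l// (le_trans B1)// ltW.
have X0 : 0 < e * (1 - r / s) by rewrite mulr_gt0 ?subr_gt0.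
apply: (@le_trans _ _ (e * (1 - r / s))).
  rewrite mulrCA ger_pMr// ler_pdivrMr ?mul1r ?lerDl// ltr_wpDl//.
by rewrite ler_wpM2l ?(ltW e0)//; lra.
Qed.

Lemma holo_mean f r : holo f -> 0 <= r < 1 -> cmean (fun t => f (pt r t)) = f 0.
Proof.
move=> hf /andP[]; rewrite le_eqVlt => /predU1P[<- _|r0 r1].
  by rewrite -[RHS]cmean_cst; apply: eq_cmean => t; rewrite /pt -[0%:C]/(0 : C) mul0r.
have z0 : cnorm (0 : C) < r by rewrite normc_0.
rewrite -(cauchy_formula hf r0 r1 z0); apply: eq_cmean => t.
by rewrite mul0r /kern mul0r subr0 invr1 mulr1.
Qed.

Lemma holo_mean_cis f r n : holo f -> 0 < r < 1 -> (0 < n)%N ->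
  cmean (fun t => f (pt r t) * cis t ^+ n) = 0.
Proof.
move=> hf /andP[r0 r1] n0; have r01 : 0 <= r < 1 by rewrite r1 ltW.
have rc : r%:C ^+ n != 0 :> C.
  by rewrite expf_neq0//; apply: normc_neq0; rewrite normc_real gtr0_norm.
have cf := cont_holo hf r01.
apply: (mulfI rc); rewrite mulr0 -cmeanZ; last by contt.
have := holo_mean (holoM hf (holoX n (holo_id R))) r01.
rewrite expr0n eqn0Ngt n0 mulr0 => <-; apply: eq_cmean => t.
by rewrite /pt exprMn; ring.
Qed.

Definition pois z t : R := 2 * cre (kern z t) - 1.

Lemma cont_pois z : cnorm z < 1 -> cont (pois z).
Proof. by move=> z1; have ck := cont_kern z1; rewrite /pois; contt. Qed.

Lemma poisE z t : cnorm z < 1 ->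
  pois z t = (1 - cnorm z ^+ 2) / cnorm (1 - z * (cis t)^*) ^+ 2.
Proof.
move=> z1; rewrite /pois /kern; have k0 := kern_neq0 t z1.
rewrite -(normc_zcis z t); move: (z * _) k0 => w k0.
have n0 : cnorm (1 - w) ^+ 2 != 0 by rewrite expf_neq0// gt_eqF// normc_gt0.
have -> : cre ((1 - w)^-1) = (1 - cre w) / cnorm (1 - w) ^+ 2.
  have -> : (1 - w)^-1 = (1 - w)^* * ((cnorm (1 - w) ^+ 2)^-1)%:C.
    apply: (mulfI k0); rewrite mulfV// mulrA mulc_conj -real_complexM mulfV//.
  by rewrite !cpartE mulr0 subr0.
apply: (mulIf n0); rewrite mulrBl [in RHS]mulrVK ?unitfE//.
rewrite -mulrA mulfVK// mul1r !sqr_normcE !cpartE; ring.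
Qed.

Lemma pois_ge0 z t : cnorm z < 1 -> 0 <= pois z t.
Proof.
move=> z1; rewrite poisE// divr_ge0 ?exprn_ge0 ?normc_ge0//.
by rewrite subr_ge0 expr_le1 ?normc_ge0 ?ltW.
Qed.

Lemma pois_le z t : cnorm z < 1 -> pois z t <= (1 + cnorm z) / (1 - cnorm z).
Proof.
move=> z1; rewrite poisE//; have H := normc_kern_ge z t.
have d0 : 0 < 1 - cnorm z by rewrite subr_gt0.
have z0 := normc_ge0 z.
rewrite ler_pdivrMr ?exprn_gt0 ?(lt_le_trans d0 H)//.
rewrite mulrAC ler_pdivlMr//.
have : (1 - cnorm z) ^+ 2 <= cnorm (1 - z * (cis t)^*) ^+ 2.
  by rewrite lerXn2r ?nnegrE ?(ltW d0)// (le_trans (ltW d0)).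
move: (cnorm (1 - _) ^+ 2) => X HX.
have -> : (1 - cnorm z ^+ 2) * (1 - cnorm z) = (1 + cnorm z) * (1 - cnorm z) ^+ 2 by ring.
by rewrite ler_wpM2l// addr_ge0.
Qed.

Lemma mean_pois z : cnorm z < 1 -> mean (pois z) = 1.
Proof.
move=> z1; have ck := cont_kern z1.
rewrite /pois meanB; [|contt..].
rewrite meanZ; last by contt.
by rewrite mean_cst -Re_cmean cmean_kern// cre1; lra.
Qed.

(** The Poisson kernel is kern + conj kern - 1. The first term gives f (r z) by Cauchy's formula.
    The other two cancel: [f] has no negative frequencies, so against conj kern only the constant
    term f 0 survives, which is the mean of [f]. *)
Lemma poisson_formula f r z : holo f -> 0 < r < 1 -> cnorm z < 1 ->
  cmean (fun t => f (pt r t) * (pois z t)%:C) = f (r%:C * z).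
Proof.
move=> hf r01 z1; have /andP[r0 r1] := r01; have ck := cont_kern z1.
have r01' : 0 <= r < 1 by rewrite r1 ltW.
have cf := cont_holo hf r01'.
have E t : f (pt r t) * (pois z t)%:C =
   f (pt r t) * kern z t + (((f (pt r t))^* * kern z t)^* - f (pt r t)).
  rewrite conjcM conjcK.
  have -> : (pois z t)%:C = kern z t + (kern z t)^* - 1.
    by apply: complex_eqP; rewrite /pois !cpartE; ring.
  ring.
rewrite (eq_cmean E) cmeanD; [|contt..]; rewrite cmeanB; [|contt..].
rewrite holo_mean// cmean_conj; last by contt.
have -> : cmean (fun t => (f (pt r t))^* * kern z t) = (f 0)^*.
  have [M M0 fM] := holo_circle_bound hf r01'.
  apply: (@small_eq _ _ (M / (1 - cnorm z)) (cnorm z) 1%N); first by rewrite normc_ge0.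
  move=> [//|N] _.
  have fM' t : cnorm ((f (pt r t))^*) <= M by rewrite normc_conj.
  have := @cmean_kern_expand R _ M z N.+1 (ccont_conj cf) fM' z1.
  rewrite [_ / (1 - _)]mulrAC big_ord_recl expr0 mul1r big1 ?addr0.
    have -> : cmean (fun t => (f (pt r t))^* * (cis t)^* ^+ 0) = (f 0)^*; last by [].
    rewrite -(holo_mean hf r01') -cmean_conj//; apply: eq_cmean => t.
    by rewrite expr0 mulr1.
  move=> i _.
  have -> : cmean (fun t => (f (pt r t))^* * (cis t)^* ^+ lift ord0 i) =
     (cmean (fun t => f (pt r t) * cis t ^+ lift ord0 i))^*.
    rewrite -cmean_conj; last by contt.
    by apply: eq_cmean => t; rewrite conjcM conjcX.
  by rewrite holo_mean_cis// conjc0 mulr0.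
rewrite conjcK subrr addr0.
have zr : cnorm (r%:C * z) < r.
  by rewrite normcMr normc_real gtr0_norm// gtr_pMr.
rewrite -(cauchy_formula hf r0 r1 zr); apply: eq_cmean => t.
congr (_ * kern _ t); rewrite mulrAC -real_complexM mulfV ?gt_eqF//.
by rewrite -[1%:C]/(1 : C) mul1r.
Qed.

End Taylor.

Lemma sum_cut (V : nmodType) (F : nat -> V) n m : (n <= m)%N ->
  \sum_(i < m) F i = \sum_(i < n) F i + \sum_(n <= i < m) F i.
Proof.
move=> nm; rewrite -(big_mkord xpredT F) -[X in _ = X + _](big_mkord xpredT F).
exact: big_cat_nat.
Qed.

Lemma geometric_tail (R : realType) (x : R) n m : 0 <= x -> x < 1 ->
  \sum_(n <= i < m) x ^+ i <= x ^+ n / (1 - x).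
Proof.
move=> x0 x1; rewrite ler_pdivlMr ?subr_gt0//.
have [mn|/ltnW nm] := leqP m n; first by rewrite big_geq// mul0r exprn_ge0.
suff -> : (\sum_(n <= i < m) x ^+ i) * (1 - x) = x ^+ n - x ^+ m.
  by rewrite lerBlDr lerDl exprn_ge0.
rewrite -(subnKC nm); elim: (m - n)%N => [|k IH].
  by rewrite addn0 big_geq// mul0r subrr.
by rewrite addnS big_nat_recr ?leq_addr//= mulrDl IH exprS; ring.
Qed.

Lemma bernoulli_le (R : realType) n (x : R) : 0 <= x <= 1 -> 1 - n%:R * x <= (1 - x) ^+ n.
Proof.
move=> /andP[x0 x1]; elim: n => [|n IH]; first by rewrite mul0r subr0.
rewrite exprS; apply: le_trans (_ : (1 - x) * (1 - n%:R * x) <= _).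
  have nx : 0 <= n%:R * x * x by rewrite !mulr_ge0.
  by rewrite -natr1; lra.
by rewrite ler_wpM2l// subr_ge0.
Qed.

(** * Quadratic means *)

Section SquareMeans.
Variable R : realType.
Local Notation C := (R[i]^o).
Implicit Types (u v : R -> C) (n m N : nat) (r s t : R) (f g : C -> C).

Definition mean2 u : R := mean (fun t => cnorm (u t) ^+ 2).

Definition psum (c : nat -> C) N (t : R) : C := \sum_(n < N) c n * cis t ^+ n.

Lemma cont_psum c N : cont (psum c N).
Proof. by rewrite /psum; apply: ccont_sum => i; contt. Qed.

Lemma cmean_mul_conj_psum u c N : cont u ->
  cmean (fun t => u t * (psum c N t)^*) = \sum_(n < N) (c n)^* * fcoef u n.
Proof.
move=> cu; transitivity (cmean (fun t => \sum_(n < N) (c n)^* * (u t * (cis t)^* ^+ n))).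
  apply: eq_cmean => t; rewrite /psum conjc_sum mulr_sumr; apply: eq_bigr => i _.
  by rewrite conjcM conjcX; ring.
rewrite cmean_sum; last by move=> i; contt.
by apply: eq_bigr => i _; rewrite cmeanZ//; contt.
Qed.

Lemma mean2E u : (mean2 u)%:C = cmean (fun t => u t * (u t)^*).
Proof. by rewrite /mean2 -cmean_real; apply: eq_cmean => t; rewrite mulc_conj. Qed.

Lemma creal_sum I (q : seq I) (P : pred I) (F : I -> R) :
  (\sum_(i <- q | P i) F i)%:C = \sum_(i <- q | P i) (F i)%:C :> C.
Proof. by apply: (big_morph (@creal R) (@real_complexD R)). Qed.

Lemma creal_inj : injective (@creal R).
Proof. by move=> x y []. Qed.

Lemma bessel u N : cont u ->
  mean2 (fun t => u t - psum (fcoef u) N t) =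
  mean2 u - \sum_(n < N) cnorm (fcoef u n) ^+ 2.
Proof.
move=> cu; have cp := cont_psum (fcoef u) N.
set B := \sum_(n < N) _.
have E1 : cmean (fun t => u t * (psum (fcoef u) N t)^*) = B%:C.
  rewrite cmean_mul_conj_psum// creal_sum; apply: eq_bigr => i _.
  by rewrite mulrC mulc_conj.
have E2 : cmean (fun t => psum (fcoef u) N t * (psum (fcoef u) N t)^*) = B%:C.
  rewrite cmean_mul_conj_psum// creal_sum; apply: eq_bigr => i _.
  by rewrite /psum fcoef_poly ltn_ord mulrC mulc_conj.
have E3 : cmean (fun t => psum (fcoef u) N t * (u t)^*) = B%:C.
  rewrite -[RHS]conjc_creal -E1 -cmean_conj; last by contt.
  by apply: eq_cmean => t; rewrite conjcM conjcK mulrC.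
apply: creal_inj; rewrite mean2E real_complexD real_complexN mean2E.
transitivity (cmean (fun t => (u t * (u t)^* - u t * (psum (fcoef u) N t)^*) -
   (psum (fcoef u) N t * (u t)^* - psum (fcoef u) N t * (psum (fcoef u) N t)^*))).
  by apply: eq_cmean => t; rewrite conjcB; ring.
by rewrite cmeanB; [|contt..]; rewrite !cmeanB; [|contt..]; rewrite E1 E2 E3 subrr subr0.
Qed.

Lemma mean2_ge0 u : 0 <= mean2 u.
Proof. by apply: mean_ge0 => t; rewrite exprn_ge0// normc_ge0. Qed.

Lemma bessel_le u N : cont u -> \sum_(n < N) cnorm (fcoef u n) ^+ 2 <= mean2 u.
Proof. by move=> cu; rewrite -subr_ge0 -bessel// mean2_ge0. Qed.

Lemma mean2_le_bound u (d : R) : cont u -> (forall t, cnorm (u t) <= d) -> mean2 u <= d ^+ 2.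
Proof.
move=> cu ud; apply: mean_bound; first by contt.
by move=> t; rewrite lerXn2r ?nnegrE ?normc_ge0// (le_trans (normc_ge0 _) (ud t)).
Qed.

Lemma parseval_le u N (d : R) : cont u ->
  (forall t, cnorm (u t - psum (fcoef u) N t) <= d) ->
  mean2 u <= \sum_(n < N) cnorm (fcoef u n) ^+ 2 + d ^+ 2.
Proof.
move=> cu ud; rewrite addrC -lerBlDr -bessel//; apply: mean2_le_bound => //.
by have := cont_psum (fcoef u) N; contt.
Qed.

(** Pointwise arithmetic-geometric inequality with a parameter. If mean2 u <= d^2 the bound is [d],
    which replaces Cauchy-Schwarz. *)
Lemma mean_norm_le u (d : R) : cont u -> 0 < d ->
  mean (fun t => cnorm (u t)) <= (d + mean2 u / d) / 2.
Proof.
move=> cu d0.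
have -> : (d + mean2 u / d) / 2 = mean (fun t => d / 2 + (2 * d)^-1 * cnorm (u t) ^+ 2).
  rewrite meanD; [|contt..]; rewrite mean_cst meanZ; last by contt.
  by rewrite -/(mean2 u); field; rewrite gt_eqF.
apply: mean_le; [by contt..|move=> t].
rewrite -subr_ge0.
have -> : d / 2 + (2 * d)^-1 * cnorm (u t) ^+ 2 - cnorm (u t) = (2 * d)^-1 * (d - cnorm (u t)) ^+ 2.
  by field; rewrite gt_eqF.
by rewrite mulr_ge0 ?sqr_ge0// invr_ge0 mulr_ge0// ltW.
Qed.

Section Hardy2.
Variables (f : C -> C) (A : R).
Hypotheses (hf : holo f) (fA : forall r, 0 < r < 1 -> mean2 (fun t => f (pt r t)) <= A).
Let a n := cnorm (tc f n) ^+ 2.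

Let a_ge0 n : 0 <= a n. Proof. by rewrite exprn_ge0// normc_ge0. Qed.

(** Bessel's inequality on the circle of radius 1 - d, then d to 0: by Bernoulli (1 - d)^(2n) >= 1 -
    2 N d for n < N, so the loss is at most 2 N d S, and [d] is chosen to make this at most [e]. *)
Lemma h2_coef N : \sum_(n < N) cnorm (tc f n) ^+ 2 <= A.
Proof.
have H r : 0 < r < 1 -> \sum_(n < N) a n * (r ^+ 2) ^+ n <= A.
  move=> r01; apply: le_trans (fA r01).
  have r01' : 0 <= r < 1 by case/andP: r01 => r0 ->; rewrite ltW.
  apply: le_trans (bessel_le N (cont_holo hf r01')).
  apply: ler_sum => i _; rewrite tcE// normcMr normcXn normc_real ger0_norm.
    by rewrite [leRHS]exprMn -/(a i) [r ^+ 2 ^+ i]exprAC.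
  by case/andP: r01' .
set S := \sum_(n < N) _; have S0 : 0 <= S by apply: sumr_ge0 => i _; exact: a_ge0.
apply/ler_addgt0Pr => e e0.
pose d := Num.min 2^-1 (e / (2 * N%:R * (S + 1) + 1)).
have D0 : 0 < 2 * N%:R * (S + 1) + 1 by rewrite ltr_wpDl// !mulr_ge0// addr_ge0.
have d0 : 0 < d by rewrite lt_min invr_gt0 ltr0n/= divr_gt0.
have d1 : d < 1 by rewrite gt_min invf_lt1// ltr1n.
have d2 : d * (2 * N%:R * (S + 1) + 1) <= e.
  by rewrite -ler_pdivlMr// ge_min lexx orbT.
have r01 : 0 < 1 - d < 1 by rewrite subr_gt0 d1 ltrBlDr ltrDl.
apply: le_trans (_ : S <= \sum_(n < N) a n * ((1 - d) ^+ 2) ^+ n + e) _; last by rewrite lerD2r H.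
rewrite -lerBlDl /S -sumrB.
apply: (@le_trans _ _ (\sum_(n < N) a n * (2 * N%:R * d))).
  apply: ler_sum => i _; rewrite -/(a i) -{1}[a i]mulr1 -mulrBr ler_wpM2l//.
  rewrite -exprM lerBlDl -lerBlDr; apply: le_trans (bernoulli_le _ (x := d) _); last by rewrite !ltW.
  rewrite lerD2l lerN2 ler_wpM2r ?(ltW d0)// natrM ler_wpM2l// ler_nat ltnW//.
rewrite -mulr_suml -/S; apply: le_trans d2.
have : 0 <= d * (N%:R * 1) by rewrite !mulr_ge0// ltW.
by lra.
Qed.

Lemma h2_tail (e : R) : 0 < e -> exists N, forall M, \sum_(N <= n < M) cnorm (tc f n) ^+ 2 <= e.
Proof.
move=> e0; pose S N := \sum_(n < N) a n.
have SA N : S N <= A := h2_coef N.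
have hs : has_sup (range S) by split; [exists (S 0%N), 0%N|exists A => _ [N _ <-]].
have [_ [N _ <-] HN] := sup_adherent e0 hs.
exists N => M; have [MN|/ltnW NM] := leqP M N.
  by rewrite big_geq// ltW.
have SM : S M <= sup (range S) by apply: sup_upper_bound => //; exists M.
have E : S M = S N + \sum_(N <= n < M) a n.
  exact: (sum_cut a NM).
by move: SM; rewrite E; rewrite -/(S N) in HN; rewrite /a; lra.
Qed.

(** The n-th coefficient of the difference is tc f n (r^n - s^n). Beyond [N] it is controlled by the
    tail of the square sum, and below [N] by |r^n - s^n| <= N d. Parseval is used for finite sums,
    up to a uniform Taylor error. *)
Lemma h2_cauchy (e : R) : 0 < e -> exists2 r0, 0 < r0 < 1 &
  forall r s, r0 <= r < 1 -> r0 <= s < 1 ->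
  mean2 (fun t => f (pt r t) - f (pt s t)) <= e.
Proof.
move=> e0; have e40 : 0 < e / 4 by rewrite divr_gt0.
have A0 : 0 <= A by have := h2_coef 0; rewrite big_ord0.
have [N HN] := h2_tail e40.
pose d := Num.min 2^-1 (e / (4 * ((N%:R + 1) ^+ 2 * (A + 1)))).
have D0 : 0 < 4 * ((N%:R + 1) ^+ 2 * (A + 1)).
  by rewrite !mulr_gt0 ?exprn_gt0 ?ltr_wpDl.
have d0 : 0 < d by rewrite lt_min invr_gt0 ltr0n/= divr_gt0.
have d1 : d < 1 by rewrite gt_min invf_lt1// ltr1n.
have d2 : d * (4 * ((N%:R + 1) ^+ 2 * (A + 1))) <= e.
  by rewrite -ler_pdivlMr// ge_min lexx orbT.
exists (1 - d); first by rewrite subr_gt0 d1 ltrBlDr ltrDl.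
move=> r s /andP[rd r1] /andP[sd s1].
have r0 : 0 < r by apply: lt_le_trans rd; rewrite subr_gt0.
have s0 : 0 < s by apply: lt_le_trans sd; rewrite subr_gt0.
have r01 : 0 <= r < 1 by rewrite r1 ltW.
have s01 : 0 <= s < 1 by rewrite s1 ltW.
have cr := cont_holo hf r01; have cs := cont_holo hf s01.
set u := fun t => f (pt r t) - f (pt s t).
have cu : cont u by rewrite /u; contt.
have uc n : fcoef u n = tc f n * (r ^+ n - s ^+ n)%:C.
  rewrite real_complexD real_complexN mulrBr !real_complexX -!tcE ?r0 ?s0//.
  rewrite /fcoef -cmeanB; [|contt..].
  by apply: eq_cmean => t; rewrite mulrBl.
have e1 : 0 < Num.min 1 (e / 8) by rewrite lt_min ltr01 divr_gt0.
have [N1 H1] := taylor_approx hf r01 e1.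
have [N2 H2] := taylor_approx hf s01 e1.
pose M := maxn N (maxn N1 N2).
have uM t : cnorm (u t - psum (fcoef u) M t) <= 2 * Num.min 1 (e / 8).
  have -> : u t - psum (fcoef u) M t =
     (f (pt r t) - \sum_(n < M) tc f n * pt r t ^+ n) - (f (pt s t) - \sum_(n < M) tc f n * pt s t ^+ n).
    have -> : psum (fcoef u) M t = \sum_(n < M) tc f n * pt r t ^+ n - \sum_(n < M) tc f n * pt s t ^+ n.
      rewrite -sumrB; apply: eq_bigr => i _.
      by rewrite uc /pt !exprMn real_complexD real_complexN !real_complexX; ring.
    have rr (x y p q : C) : x - y - (p - q) = x - p - (y - q) by ring.
    exact: rr.
  apply: le_trans (normcBle _ _) _; rewrite mulr_natl mulr2n; apply: lerD.
    by apply: H1; rewrite ?normc_pt ?(ltW r0)// /M !leq_max leqnn !orbT.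
  by apply: H2; rewrite ?normc_pt ?(ltW s0)// /M !leq_max leqnn !orbT.
apply: le_trans (parseval_le cu uM) _.
have -> : (2 * Num.min 1 (e / 8)) ^+ 2 = 4 * Num.min 1 (e / 8) ^+ 2 by ring.
have Q : Num.min 1 (e / 8) ^+ 2 <= e / 8.
  have m1 : Num.min 1 (e / 8) <= 1 by rewrite ge_min lexx.
  have m2 : Num.min 1 (e / 8) <= e / 8 by rewrite ge_min lexx orbT.
  nra.
have NM : (N <= M)%N by rewrite leq_max leqnn.
rewrite (sum_cut (fun n => cnorm (fcoef u n) ^+ 2) NM).
have rs1 n : `|r ^+ n - s ^+ n| <= 1.
  have /andP[? ?] : 0 <= r ^+ n <= 1 by rewrite exprn_ge0 ?(ltW r0)//= exprn_ile1 ?(ltW r0) ?(ltW r1).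
  have /andP[? ?] : 0 <= s ^+ n <= 1 by rewrite exprn_ge0 ?(ltW s0)//= exprn_ile1 ?(ltW s0) ?(ltW s1).
  rewrite ler_norml; lra.
have rs2 n : (n < N)%N -> `|r ^+ n - s ^+ n| <= N%:R * d.
  move=> nN; have B x : 1 - d <= x < 1 -> 1 - N%:R * d <= x ^+ n <= 1.
    move=> /andP[dx x1]; have x0 : 0 <= x by apply: le_trans dx; rewrite subr_ge0 ltW.
    apply/andP; split; last by rewrite exprn_ile1// ltW.
    have := @bernoulli_le R n d; rewrite (ltW d0) (ltW d1) => /(_ isT) Hb.
    apply: le_trans (_ : 1 - n%:R * d <= _).
      by rewrite lerD2l lerN2 ler_wpM2r ?(ltW d0)// ler_nat ltnW.
    by apply: (le_trans Hb); rewrite lerXn2r ?nnegrE// subr_ge0 ltW.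
  rewrite ler_norml; move: (B r); rewrite rd r1 => /(_ isT) /andP[? ?].
  move: (B s); rewrite sd s1 => /(_ isT) /andP[? ?]; lra.
have P1 : \sum_(n < N) cnorm (fcoef u n) ^+ 2 <= A * (N%:R * d) ^+ 2.
  apply: le_trans (_ : \sum_(n < N) a n * (N%:R * d) ^+ 2 <= _); last first.
    by rewrite -mulr_suml ler_wpM2r ?sqr_ge0// h2_coef.
  apply: ler_sum => i _.
  rewrite uc normcMr normc_real exprMn ler_wpM2l ?exprn_ge0 ?normc_ge0//.
  rewrite lerXn2r ?nnegrE ?mulr_ge0 ?(ltW d0)//.
  exact: rs2.
have P2 : \sum_(N <= n < M) cnorm (fcoef u n) ^+ 2 <= e / 4.
  apply: le_trans (HN M); apply: ler_sum => i _.
  rewrite uc normcMr normc_real exprMn ler_piMr ?exprn_ge0 ?normc_ge0//.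
  by rewrite exprn_ile1.
have P3 : A * (N%:R * d) ^+ 2 <= e / 4.
  rewrite ler_pdivlMr//; apply: le_trans d2.
  have dd : d ^+ 2 <= d by rewrite expr2 ger_pMr// ltW.
  have -> : A * (N%:R * d) ^+ 2 * 4 = 4 * (N%:R ^+ 2 * A) * d ^+ 2 by ring.
  have -> : d * (4 * ((N%:R + 1) ^+ 2 * (A + 1))) = 4 * ((N%:R + 1) ^+ 2 * (A + 1)) * d by ring.
  apply: ler_pM; rewrite ?mulr_ge0 ?sqr_ge0 ?(ltW d0)//.
  rewrite ler_pM2l//; apply: ler_pM; rewrite ?sqr_ge0//; last by rewrite lerDl.
  by rewrite lerXn2r ?nnegrE ?lerDl ?addr_ge0.
lra.
Qed.

End Hardy2.

End SquareMeans.

(** * Locally uniform limits and power series *)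

Section Limits.
Variable R : realType.
Local Notation C := (R[i]^o).
Implicit Types (n m N : nat) (r s t : R) (f g : C -> C).

Lemma cauchy_transform_holo (u : R -> C) (M : R) : cont u -> (forall t, cnorm (u t) <= M) ->
  holo (fun z => cmean (fun t => u t * kern z t)).
Proof.
move=> cu uM; split => z z1; apply/derivableCP.
have ck := cont_kern z1.
exists (cmean (fun t => u t * ((cis t)^* * kern z t ^+ 2))) => e e0.
have M0 : 0 <= M := le_trans (normc_ge0 _) (uM 0).
pose d := (1 - cnorm z) / 2; have d0 : 0 < d by rewrite divr_gt0// subr_gt0.
pose B := (M + 1) * (d^-1) ^+ 3; have B0 : 0 < B by rewrite mulr_gt0 ?exprn_gt0 ?invr_gt0 ?ltr_wpDl.
apply/nbhs_normcP; exists (Num.min d (e / B)); first by rewrite lt_min d0 divr_gt0.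
move=> w; rewrite lt_min => /andP[wd we].
have wz : cnorm w <= 1 - d.
  have := normc_sub_ge w z; rewrite /d in wd *; lra.
have w1 : cnorm w < 1 by apply: le_lt_trans wz _; rewrite ltrBlDr ltrDl.
have ckw := cont_kern w1.
rewrite -cmeanB; [|contt..]; rewrite mulrC -cmeanZ; last by contt.
rewrite -cmeanB; [|contt..].
apply: le_trans (normc_cmean_le _) _; first by contt.
apply: mean_bound; first by contt.
move=> t.
have -> : u t * kern w t - u t * kern z t - (w - z) * (u t * ((cis t)^* * kern z t ^+ 2)) =
  u t * ((w - z) ^+ 2 * (cis t)^* ^+ 2) * (kern z t ^+ 2 * kern w t).
  rewrite /kern; have := kern_neq0 t z1; have := kern_neq0 t w1; move=> k1 k2.
  by field; rewrite k1 k2.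
rewrite !(normcMr, normcXn) normc_conj normc_cis expr1n mulr1.
have kz : cnorm (kern z t) <= d^-1.
  apply: le_trans (normc_kern_le t z1) _; rewrite lef_pV2 ?posrE ?subr_gt0// /d; lra.
have kw : cnorm (kern w t) <= d^-1.
  by apply: le_trans (normc_kern_le t w1) _; rewrite lef_pV2 ?posrE ?subr_gt0//; lra.
have K3 : cnorm (kern z t) ^+ 2 * cnorm (kern w t) <= d^-1 ^+ 3.
  rewrite [_ ^+ 3]exprSr; apply: ler_pM; rewrite ?exprn_ge0 ?normc_ge0//.
  by rewrite lerXn2r ?nnegrE ?normc_ge0 ?invr_ge0 ?(ltW d0).
have wz0 := normc_ge0 (w - z).
apply: (@le_trans _ _ ((M + 1) * cnorm (w - z) ^+ 2 * d^-1 ^+ 3)).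
  apply: ler_pM; rewrite ?mulr_ge0 ?exprn_ge0 ?normc_ge0//.
  rewrite ler_wpM2r ?exprn_ge0//; apply: le_trans (uM t) _; by rewrite lerDl.
have -> : (M + 1) * cnorm (w - z) ^+ 2 * d^-1 ^+ 3 = B * cnorm (w - z) * cnorm (w - z).
  by rewrite /B; ring.
by rewrite ler_wpM2r// mulrC -ler_pdivlMr// ltW.
Qed.

Lemma derivable_eq_near f g z : (\forall w \near z, f w = g w) ->
  derivable f z 1 -> derivable g z 1.
Proof.
move=> fg /derivableCP[d H]; have fz := nbhs_singleton fg.
apply/derivableCP; exists d => e e0; have {}H := H e e0.
by apply: filterS2 fg H => w <-; rewrite fz.
Qed.

(** Cauchy's formula passes to the uniform limit on a circle, so near [z] the limit is a Cauchy
    transform of continuous data. *)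
Lemma weierstrass (F_ : nat -> C -> C) (F : C -> C) : (forall n, holo (F_ n)) ->
  (forall r e, 0 < r < 1 -> 0 < e -> exists n, forall z, cnorm z <= r -> cnorm (F_ n z - F z) <= e) ->
  holo F.
Proof.
move=> hF cF; split => z z1.
pose r := (1 + cnorm z) / 2; have z0 := normc_ge0 z.
have r1 : r < 1 by rewrite /r; lra.
have r0 : 0 < r by rewrite /r; lra.
have zr : cnorm z < r by rewrite /r; lra.
have r01 : 0 < r < 1 by rewrite r0.
have r01' : 0 <= r < 1 by rewrite r1 ltW.
have cFr : cont (fun t => F (pt r t)).
  split => t; apply: (proj2 (@cvgCP R R (nbhs t) _ _ _)) => e e0.
  have e30 : 0 < e / 3 by rewrite divr_gt0.
  have [n Hn] := cF r _ r01 e30.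
  have /cvgCP/(_ _ e30) : F_ n (pt r s) @[s --> t] --> F_ n (pt r t).
    exact: (contP (cont_holo (hF n) r01')).
  apply: filterS => s Hs.
  have -> : F (pt r t) - F (pt r s) = - (F_ n (pt r t) - F (pt r t)) +
     (F_ n (pt r t) - F_ n (pt r s)) + (F_ n (pt r s) - F (pt r s)) by ring.
  apply: le_lt_trans (normcDle _ _) _.
  apply: le_lt_trans (lerD (normcDle _ _) (lexx _)) _.
  rewrite normcNE.
  have A1 := Hn (pt r t); have A2 := Hn (pt r s).
  rewrite normc_pt ?(ltW r0)// in A1; rewrite normc_pt ?(ltW r0)// in A2.
  have {}A1 := A1 (lexx _); have {}A2 := A2 (lexx _); lra.
have [n0 Hn0] := cF r 1 r01 ltr01.
have [M M0 HM] := holo_circle_bound (hF n0) r01'.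
have FM t : cnorm (F (pt r t)) <= M + 1.
  have -> : F (pt r t) = F_ n0 (pt r t) - (F_ n0 (pt r t) - F (pt r t)) by ring.
  by apply: le_trans (normcBle _ _) _; rewrite lerD// Hn0// normc_pt// ltW.
pose G z := cmean (fun t => F (pt r t) * kern z t).
have hG : holo G by exact: cauchy_transform_holo FM.
have nr x : cnorm (x * (r^-1)%:C) = cnorm x / r.
  by rewrite normcMr normc_real gtr0_norm ?invr_gt0.
have FG w : cnorm w < r -> F w = G (w * (r^-1)%:C).
  move=> wr; have w1 : cnorm (w * (r^-1)%:C) < 1 by rewrite nr ltr_pdivrMr ?mul1r.
  have ckw := cont_kern w1.
  have K0 : 0 < (1 - cnorm w / r)^-1 by rewrite invr_gt0 subr_gt0 -nr.
  apply/eqP; rewrite -subr_eq0; apply/eqP/normc_eq0P/eqP.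
  rewrite eq_le normc_ge0 andbT; apply/ler_addgt0Pr => e e0; rewrite add0r.
  have e1 : 0 < e / (1 + (1 - cnorm w / r)^-1) by rewrite divr_gt0 ?addr_gt0.
  have [n Hn] := cF r _ r01 e1.
  have cn := cont_holo (hF n) r01'.
  have -> : F w - G (w * (r^-1)%:C) = - (F_ n w - F w) +
    cmean (fun t => (F_ n (pt r t) - F (pt r t)) * kern (w * (r^-1)%:C) t).
    have -> : (fun t => (F_ n (pt r t) - F (pt r t)) * kern (w * (r^-1)%:C) t) =
       (fun t => F_ n (pt r t) * kern (w * (r^-1)%:C) t - F (pt r t) * kern (w * (r^-1)%:C) t).
      by apply/funext => t; rewrite mulrBl.
    rewrite cmeanB; [|contt..]; rewrite (cauchy_formula (hF n) r0 r1 wr) /G; ring.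
  apply: le_trans (normcDle _ _) _; rewrite normcNE.
  apply: (@le_trans _ _ (e / (1 + (1 - cnorm w / r)^-1) + e / (1 + (1 - cnorm w / r)^-1) * (1 - cnorm w / r)^-1)).
    apply: lerD; first by apply: Hn; exact: ltW.
    apply: le_trans (normc_cmean_le _) _; first by contt.
    apply: mean_bound; first by contt.
    move=> t; rewrite normcMr; apply: ler_pM; rewrite ?normc_ge0//.
      by apply: Hn; rewrite normc_pt// ltW.
    by rewrite -nr; exact: normc_kern_le.
  by rewrite -{1}[e / _]mulr1 -mulrDr divfK// gt_eqF// addr_gt0.
apply: (@derivable_eq_near (fun w => G (w * (r^-1)%:C)) F z).
  apply/nbhs_normcP; exists (r - cnorm z); first by rewrite subr_gt0.
  move=> w wz; rewrite FG//.
  by have := normc_sub_ge w z; lra.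
apply: (@derivable_comp R (fun w => w * (r^-1)%:C) G z).
  by apply: derivableM; [exact: derivable_id|exact: derivable_cst].
by apply: (holoP hG); rewrite nr ltr_pdivrMr ?mul1r.
Qed.

(** The intervals of centre v n and radius b n meet pairwise, so the supremum of their left ends
    lies in all of them. This provides a limit together with its error bound. *)
Lemma nested_limit (v b : nat -> R) : (forall n m, (n <= m)%N -> `|v m - v n| <= b n) ->
  exists l, forall n, `|v n - l| <= b n.
Proof.
move=> H; have cross n m : v n - b n <= v m + b m.
  have := H n _ (leq_maxl n m); have := H m _ (leq_maxr n m).
  rewrite !ler_norml => /andP[? ?] /andP[? ?]; lra.
exists (sup (range (fun n => v n - b n))) => n; rewrite ler_norml.
have ub : has_ubound (range (fun n => v n - b n)) by exists (v 0%N + b 0%N) => _ [m _ <-].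
have l1 : v n - b n <= sup (range (fun n => v n - b n)) by apply: ub_le_sup => //; exists n.
have l2 : sup (range (fun n => v n - b n)) <= v n + b n.
  by apply: ge_sup; [exists (v 0%N - b 0%N), 0%N|move=> _ [m _ <-]].
by apply/andP; split; lra.
Qed.

Lemma nested_climit (v : nat -> C) (b : nat -> R) :
  (forall n m, (n <= m)%N -> cnorm (v m - v n) <= b n) ->
  exists l, forall n, cnorm (v n - l) <= 2 * b n.
Proof.
move=> H.
have [l1 H1] : exists l, forall n, `|cre (v n) - l| <= b n.
  apply: (@nested_limit (fun n => cre (v n))) => n m nm.
  by rewrite -creN -creD (le_trans (normr_Re_le _))// H.
have [l2 H2] : exists l, forall n, `|cim (v n) - l| <= b n.
  apply: (@nested_limit (fun n => cim (v n))) => n m nm.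
  by rewrite -cimN -cimD (le_trans (normr_Im_le _))// H.
exists (Complex l1 l2) => n; apply: le_trans (normc_leReIm _) _.
rewrite creD creN cimD cimN mulr_natl mulr2n; apply: lerD; [exact: H1|exact: H2].
Qed.

Lemma power_series (c : nat -> C) (K : R) : (forall n, cnorm (c n) <= K) ->
  exists2 f, holo f & forall z, cnorm z < 1 -> forall N,
    cnorm (\sum_(n < N) c n * z ^+ n - f z) <= 2 * (K * cnorm z ^+ N / (1 - cnorm z)).
Proof.
move=> cK; have K0 : 0 <= K := le_trans (normc_ge0 _) (cK 0%N).
have E z : cnorm z < 1 -> exists l, forall N,
    cnorm (\sum_(n < N) c n * z ^+ n - l) <= 2 * (K * cnorm z ^+ N / (1 - cnorm z)).
  move=> z1; apply: (@nested_climit (fun N => \sum_(n < N) c n * z ^+ n)) => n m nm.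
  rewrite (sum_cut (fun n => c n * z ^+ n) nm) addrAC subrr add0r.
  apply: le_trans (normc_sum _ _ _) _.
  apply: (@le_trans _ _ (\sum_(n <= i < m) K * cnorm z ^+ i)).
    by apply: ler_sum => i _; rewrite normcMr normcXn ler_wpM2r ?exprn_ge0 ?normc_ge0.
  by rewrite -mulr_sumr -mulrA ler_wpM2l// geometric_tail// normc_ge0.
pose f z := if pselect (cnorm z < 1) is left z1 then sval (cid (E z z1)) else 0.
have fE z : cnorm z < 1 -> forall N,
    cnorm (\sum_(n < N) c n * z ^+ n - f z) <= 2 * (K * cnorm z ^+ N / (1 - cnorm z)).
  by move=> z1; rewrite /f; case: pselect => // z1'; exact: (svalP (cid (E z z1'))).
exists f => //; apply: (@weierstrass (fun N z => \sum_(n < N) c n * z ^+ n)).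
  move=> N; apply: holo_sum => i; apply: holoM; first exact: holo_cst.
  by apply: holoX; exact: holo_id.
move=> r e /andP[r0 r1] e0.
have D0 : 0 < 2 * (K + 1) by rewrite mulr_gt0// ltr_wpDl.
have d0 : 0 < e * (1 - r) / (2 * (K + 1)) by rewrite divr_gt0// mulr_gt0// subr_gt0.
have [|N HN] := @geometric_small R r _ _ d0; first by rewrite r1 ltW.
exists N => z zr; apply: le_trans (fE _ (le_lt_trans zr r1) N) _.
have z0 := normc_ge0 z.
have H1 : cnorm z ^+ N <= e * (1 - r) / (2 * (K + 1)).
  by apply: le_trans (ltW HN); rewrite lerXn2r ?nnegrE// ltW.
have H2 : (2 * K) * cnorm z ^+ N <= e * (1 - r).
  apply: le_trans (_ : (2 * (K + 1)) * (e * (1 - r) / (2 * (K + 1))) <= _).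
    apply: ler_pM; rewrite ?mulr_ge0 ?exprn_ge0//; by rewrite ler_pM2l// lerDl.
  by rewrite mulrC divfK// gt_eqF.
rewrite mulrA mulrA ler_pdivrMr ?subr_gt0 ?(le_lt_trans zr)//.
apply: le_trans H2 _; rewrite ler_wpM2l ?(ltW e0)//; lra.
Qed.

Lemma tc_unique f (c : nat -> C) (B : R) : holo f ->
  (forall z, cnorm z < 1 -> forall N,
    cnorm (\sum_(n < N) c n * z ^+ n - f z) <= B * cnorm z ^+ N / (1 - cnorm z)) ->
  forall n, tc f n = c n.
Proof.
move=> hf H n; have h0 : 0 < 2^-1 :> R by rewrite invr_gt0.
have h1 : 2^-1 < 1 :> R by rewrite invf_lt1// ltr1n.
have h01 : 0 < (2^-1 : R) < 1 by rewrite h0.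
have rc : (2^-1 : R)%:C ^+ n != 0 :> C.
  by rewrite expf_neq0//; apply: normc_neq0; rewrite normc_real gtr0_norm.
apply: (mulIf rc); rewrite -tcE//.
have cf : cont (fun t => f (pt 2^-1 t)) by apply: cont_holo => //; rewrite h1 ltW.
have q1 : 0 <= (2^-1 : R) < 1 by rewrite h1 ltW.
apply: (@small_eq R _ _ (B / (1 - 2^-1)) 2^-1 n.+1 q1) => N nN.
have -> : c n * (2^-1)%:C ^+ n = fcoef (psum (fun k => c k * (2^-1)%:C ^+ k) N) n.
  by rewrite fcoef_poly nN.
have cp := cont_psum (fun k => c k * (2^-1)%:C ^+ k) N.
rewrite /fcoef -cmeanB; [|contt..].
apply: le_trans (normc_cmean_le _) _; first by contt.
apply: mean_bound; first by contt.
move=> t; rewrite -mulrBl normcMr normcXn normc_conj normc_cis expr1n mulr1 normc_distC.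
have := H (pt 2^-1 t); rewrite normc_pt ?(ltW h0)// => /(_ h1 N).
rewrite [_ / (1 - _)]mulrAC; apply: le_trans.
suff -> : psum (fun k => c k * (2^-1)%:C ^+ k) N t = \sum_(n < N) c n * pt 2^-1 t ^+ n by [].
by apply: eq_bigr => i _; rewrite /pt exprMn mulrA.
Qed.

End Limits.

(** * Zeros and the maximum principle *)

Section Zeros.
Variable R : realType.
Local Notation C := (R[i]^o).
Implicit Types (n m N : nat) (r s t : R) (f g : C -> C) (z w a : C).

Lemma mid_radius z : cnorm z < 1 -> exists2 r, 0 < r < 1 & cnorm z < r.
Proof.
move=> z1; have z0 := normc_ge0 z; exists ((1 + cnorm z) / 2); last by lra.
by apply/andP; split; lra.
Qed.

Lemma holo_coef0 f : holo f -> (forall n, tc f n = 0) -> forall z, cnorm z < 1 -> f z = 0.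
Proof.
move=> hf f0 z z1; apply/normc_eq0P/eqP; rewrite eq_le normc_ge0 andbT.
apply/ler_addgt0Pr => e e0; rewrite add0r.
have [N HN] := taylor_approx hf (introT andP (conj (normc_ge0 z) z1)) e0.
have := HN N z (leqnn _) (lexx _); rewrite big1 ?subr0// => i _.
by rewrite f0 mul0r.
Qed.

Lemma tc0 f : holo f -> tc f 0 = f 0.
Proof.
move=> hf; have h01 : 0 < (2^-1 : R) < 1 by rewrite invr_gt0 ltr0n invf_lt1// ltr1n.
have h01' : 0 <= (2^-1 : R) < 1 by rewrite invr_ge0 ler0n invf_lt1// ltr1n.
rewrite -(holo_mean hf h01') -[LHS]mulr1 -(expr0 ((2^-1 : R)%:C)) -tcE//.
by apply: eq_cmean => t; rewrite expr0 mulr1.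
Qed.

(** The quotient is the locally uniform limit of the shifted Taylor polynomials: the Taylor
    remainder of [f] after N + 1 + m terms contains a factor |z|^m, which survives the division. *)
Lemma holo_divX f m : holo f -> (forall n, (n < m)%N -> tc f n = 0) ->
  exists g, [/\ holo g, g 0 = tc f m & forall z, cnorm z < 1 -> f z = z ^+ m * g z].
Proof.
move=> hf f0; pose g z := if z == 0 then tc f m else f z / z ^+ m.
exists g; split; last 2 first.
- by rewrite /g eqxx.
- move=> z z1; rewrite /g; case: eqVneq => [->|z0]; last first.
    by rewrite mulrC divfK// expf_neq0.
  case: m f0 {g} => [|m] f0; first by rewrite expr0 mul1r tc0.
  by rewrite expr0n mul0r -tc0// f0.
(* With [N.+1] terms the sum is never empty, so at 0 it already equals tc f m. *)
apply: (@weierstrass _ (fun N z => \sum_(n < N.+1) tc f (n + m)%N * z ^+ n)).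
  move=> N; apply: holo_sum => i; apply: holoM; first exact: holo_cst.
  by apply: holoX; exact: holo_id.
move=> r e /andP[r0 r1] e0.
pose s := (1 + r) / 2.
have rs : r < s by rewrite /s; lra.
have s1 : s < 1 by rewrite /s; lra.
have s0 : 0 < s by rewrite (lt_trans r0).
have [M M0 fM] : exists2 M, 0 <= M & forall t, cnorm (f (pt s t)) <= M.
  by apply: holo_circle_bound => //; rewrite s1 ltW.
have q1 : 0 <= r / s < 1 by rewrite divr_ge0 ?(ltW s0) ?(ltW r0)//= ltr_pdivrMr ?mul1r.
have /andP[q0 q2] := q1.
have sm0 : 0 < s ^+ m by rewrite exprn_gt0.
have d0 : 0 < e * (1 - r / s) / ((M + 1) / s ^+ m).
  by rewrite !divr_gt0 ?mulr_gt0 ?subr_gt0 ?ltr_wpDl.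
have [N HN] := geometric_small q1 d0.
exists N => z zr; have zs := le_lt_trans zr rs.
rewrite /g; case: eqVneq => [->|z0].
  rewrite big_ord_recl expr0 mulr1 add0n big1 ?addr0 ?subrr ?normc_0 ?(ltW e0)// => i _.
  by rewrite expr0n mulr0.
have := taylor_bound (N.+1 + m) hf (introT andP (conj s0 s1)) zs fM.
have -> : \sum_(n < N.+1 + m) tc f n * z ^+ n = z ^+ m * \sum_(n < N.+1) tc f (n + m)%N * z ^+ n.
  rewrite addnC big_split_ord /= big1 ?add0r; last by move=> i _; rewrite f0 ?mul0r.
  by rewrite mulr_sumr; apply: eq_bigr => i _; rewrite exprD addnC; ring.
have zm : z ^+ m != 0 by rewrite expf_neq0.
have nz : 0 < cnorm z by exact: normc_gt0.
have nzm : 0 < cnorm z ^+ m by rewrite exprn_gt0.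
set S := \sum_(n < N.+1) _ => H.
have -> : S - f z / z ^+ m = - ((f z - z ^+ m * S) / z ^+ m) by field.
rewrite normcNE normcMr normc_inv normcXn ler_pdivrMr//.
apply: le_trans H _.
have zq : cnorm z / s <= r / s by rewrite ler_pM2r ?invr_gt0.
have zq0 : 0 <= cnorm z / s by rewrite divr_ge0 ?(ltW nz) ?(ltW s0).
have D1 : 0 < 1 - cnorm z / s by rewrite subr_gt0 (le_lt_trans zq).
rewrite ler_pdivrMr// exprD.
have B1 : (cnorm z / s) ^+ N.+1 <= e * (1 - r / s) / ((M + 1) / s ^+ m).
  apply: le_trans (ltW HN); apply: (@le_trans _ _ ((r / s) ^+ N.+1)).
    by rewrite lerXn2r ?nnegrE.
  by rewrite ler_wiXn2l// ltW.
apply: (@le_trans _ _ ((M + 1) * (e * (1 - r / s) / ((M + 1) / s ^+ m) * (cnorm z / s) ^+ m))).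
  apply: ler_pM => //; first by rewrite mulr_ge0 ?exprn_ge0.
    by rewrite lerDl.
  by rewrite ler_wpM2r ?exprn_ge0.
have -> : (M + 1) * (e * (1 - r / s) / ((M + 1) / s ^+ m) * (cnorm z / s) ^+ m) = e * cnorm z ^+ m * (1 - r / s).
  have M1 : M + 1 != 0 by rewrite gt_eqF// ltr_wpDl.
  have gen (p q e' x : R) : p != 0 -> q != 0 -> p * (e' / (p / q) * (x / q)) = e' * x.
    by move=> pn qn; field; rewrite pn qn.
  rewrite [(cnorm z / s) ^+ m]expr_div_n; transitivity (e * (1 - r / s) * cnorm z ^+ m); last by rewrite mulrAC.
  by apply: gen => //; rewrite gt_eqF.
by rewrite ler_wpM2l ?mulr_ge0 ?(ltW e0) ?(ltW nzm)//; lra.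
Qed.

Lemma holo_factor f : holo f -> (forall z, cnorm z < 1 -> f z = 0) \/
  exists m g, [/\ holo g, g 0 != 0 & forall z, cnorm z < 1 -> f z = z ^+ m * g z].
Proof.
move=> hf; have [f0|/existsNP[n /eqP n0]] := pselect (forall n, tc f n = 0).
  by left; exact: holo_coef0.
right; have ex : exists n, tc f n != 0 by exists n.
have m0 := ex_minnP ex; case: m0 => m m0 mmin.
have [|g [hg g0 fg]] := @holo_divX f m hf.
  by move=> k km; apply/eqP; apply: contraTT km => /mmin; rewrite -leqNgt.
by exists m, g; split => //; rewrite g0.
Qed.

(** The disc automorphism taking 0 to [a], with inverse [mob (- a)]. It carries statements about
    Taylor expansions at 0 to any point, and it is the Blaschke factor used later as a test
    function. *)
Definition mob a z : C := (z + a) / (1 + a^* * z).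

Lemma mob_den a z : cnorm a < 1 -> cnorm z < 1 -> 1 + a^* * z != 0.
Proof.
move=> a1 z1; apply: normc_neq0.
have H : cnorm (a^* * z) < 1.
  rewrite normcMr normc_conj; have := normc_ge0 a; have := normc_ge0 z; nra.
have := normc_sub_ge 1 (- (a^* * z)); rewrite opprK normc_1 normcNE; lra.
Qed.

Lemma holo_mob a : cnorm a < 1 -> holo (mob a).
Proof.
move=> a1; apply: holoM; first by apply: holoD; [exact: holo_id|exact: holo_cst].
apply: holoV; last by move=> z; exact: mob_den.
apply: holoD; first exact: holo_cst.
by apply: holoM; [exact: holo_cst|exact: holo_id].
Qed.

Lemma mob_lt1 a z : cnorm a < 1 -> cnorm z < 1 -> cnorm (mob a z) < 1.
Proof.
move=> a1 z1; have d0 := normc_gt0 (mob_den a1 z1).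
rewrite /mob normcMr normc_inv ltr_pdivrMr// mul1r.
rewrite -ltr_sqr ?nnegrE ?normc_ge0// -subr_gt0.
have -> : cnorm (1 + a^* * z) ^+ 2 - cnorm (z + a) ^+ 2 =
    (1 - cnorm a ^+ 2) * (1 - cnorm z ^+ 2).
  by rewrite !sqr_normcE !cpartE; ring.
by rewrite mulr_gt0// subr_gt0 expr_lt1// normc_ge0.
Qed.

Lemma mob0 a : mob a 0 = a.
Proof. by rewrite /mob add0r mulr0 addr0 invr1 mulr1. Qed.

Lemma mobK a z : cnorm a < 1 -> cnorm z < 1 -> mob (- a) (mob a z) = z.
Proof.
move=> a1 z1; have d0 := mob_den a1 z1.
have aa : 1 - a * a^* != 0.
  apply: normc_neq0; rewrite mulc_conj -[1]/(1%:C) -real_complexN -real_complexD normc_real.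
  by rewrite normr_gt0 gt_eqF// subr_gt0 expr_lt1 ?normc_ge0.
rewrite /mob conjcN.
have -> : (z + a) / (1 + a^* * z) + - a = z * (1 - a * a^*) / (1 + a^* * z) by field.
have -> : 1 + - a^* * ((z + a) / (1 + a^* * z)) = (1 - a * a^*) / (1 + a^* * z) by field.
by field; rewrite d0 aa.
Qed.

Lemma mobNK a z : cnorm a < 1 -> cnorm z < 1 -> mob a (mob (- a) z) = z.
Proof. by move=> a1 z1; rewrite -{1}[a]opprK mobK// normcNE. Qed.

Lemma nonzero_near g z : holo g -> cnorm z < 1 -> g z != 0 ->
  exists2 r, 0 < r & forall w, cnorm (w - z) < r -> g w != 0.
Proof.
move=> hg z1 g0.
have /cvgCP/(_ _ (normc_gt0 g0)) : g w @[w --> z] --> g z.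
  exact: (derivable_continuous (holoP hg z1)).
move=> /nbhs_normcP[r r0 Hr]; exists r => // w /Hr H.
by apply: contraTneq H => ->; rewrite subr0 ltxx.
Qed.

Lemma small_point (e : R) : 0 < e -> exists z : C, [/\ z != 0, cnorm z < 1 & cnorm z < e].
Proof.
move=> e0; pose x := Num.min 2^-1 (e / 2).
have x0 : 0 < x by rewrite lt_min invr_gt0 ltr0n divr_gt0.
have x1 : x <= 2^-1 by rewrite ge_min lexx.
have x2 : x <= e / 2 by rewrite ge_min lexx orbT.
exists x%:C; rewrite normc_real gtr0_norm//; split.
- by apply: normc_neq0; rewrite normc_real gtr0_norm.
- by apply: le_lt_trans x1 _; rewrite invf_lt1// ltr1n.
- by apply: le_lt_trans x2 _; rewrite gtr_pMr// invf_lt1// ltr1n.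
Qed.

Lemma holo_mob_comp f a : holo f -> cnorm a < 1 -> holo (fun z => f (mob a z)).
Proof.
by move=> hf a1; apply: holo_comp (holo_mob a1) hf _ => z; exact: mob_lt1.
Qed.

Lemma holo_isolated f a : holo f -> cnorm a < 1 ->
  (forall z, cnorm z < 1 -> f z = 0) \/
  exists2 r, 0 < r & forall z, cnorm z < 1 -> z != a -> cnorm (z - a) < r -> f z != 0.
Proof.
move=> hf a1; have [F0|[m [g [hg g0 Fg]]]] := holo_factor (holo_mob_comp hf a1).
  left=> z z1; rewrite -(mobNK a1 z1); apply: F0; apply: mob_lt1 => //.
  by rewrite normcNE.
right; have z0 : cnorm (0 : C) < 1 by rewrite normc_0.
have [r r0 Hr] := nonzero_near hg z0 g0.
have a1' : cnorm (- a) < 1 by rewrite normcNE.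
have /cvgCP/(_ _ r0) : mob (- a) w @[w --> a] --> mob (- a) a.
  exact: (derivable_continuous (holoP (holo_mob a1') a1)).
move=> /nbhs_normcP[s s0 Hs]; exists s => // z zd za zs.
have E0 : mob (- a) a = 0 by rewrite -{2}(mob0 a) mobK.
have {}Hs := Hs z zs; rewrite E0 normc_distC subr0 in Hs.
rewrite -(mobNK a1 zd) Fg; last exact: mob_lt1.
rewrite mulf_neq0//; last by apply: Hr; rewrite subr0.
rewrite expf_neq0//; apply: contra_neq za => E.
by rewrite -(mobNK a1 zd) E mob0.
Qed.

Lemma ball_point a r : cnorm a < 1 -> 0 < r ->
  exists z, [/\ z != a, cnorm z < 1 & cnorm (z - a) < r].
Proof.
move=> a1 r0; pose e := Num.min r (1 - cnorm a).
have e0 : 0 < e by rewrite lt_min r0 subr_gt0.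
have [z [z0 z1 ze]] := small_point e0.
have er : e <= r by rewrite ge_min lexx.
have ea : e <= 1 - cnorm a by rewrite ge_min lexx orbT.
exists (a + z); split.
- by apply: contra_neq z0 => E; apply: (addrI a); rewrite E addr0.
- have := normcDle a z; lra.
- by rewrite addrC addKr; exact: lt_le_trans ze er.
Qed.

Lemma holo_zero_near f a r : holo f -> cnorm a < 1 -> 0 < r ->
  (forall z, cnorm z < 1 -> cnorm (z - a) < r -> f z = 0) ->
  forall z, cnorm z < 1 -> f z = 0.
Proof.
move=> hf a1 r0 H; have [//|[s s0 Hs]] := holo_isolated hf a1.
have rs0 : 0 < Num.min r s by rewrite lt_min r0.
have [z [za z1]] := ball_point a1 rs0; rewrite lt_min => /andP[zr zs].
by have := Hs z z1 za zs; rewrite H// eqxx.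
Qed.

Lemma holo_integral f g : holo f -> holo g ->
  (forall z, cnorm z < 1 -> f z * g z = 0) ->
  (forall z, cnorm z < 1 -> f z = 0) \/ (forall z, cnorm z < 1 -> g z = 0).
Proof.
move=> hf hg fg; have z0 : cnorm (0 : C) < 1 by rewrite normc_0.
have [|[r r0 Hr]] := holo_isolated hf z0; first by left.
have [|[s s0 Hs]] := holo_isolated hg z0; first by right.
have rs0 : 0 < Num.min r s by rewrite lt_min r0.
have [z [za z1]] := ball_point z0 rs0; rewrite lt_min => /andP[zr zs].
by have /eqP := fg z z1; rewrite mulf_eq0 (negbTE (Hr z z1 za zr)) (negbTE (Hs z z1 za zs)).
Qed.

(* A non-constant holomorphic map is open enough for its image to carry the
   identity theorem. *)
Lemma holo_comp_zero f phi : holo f -> holo phi -> (forall z, cnorm z < 1 -> cnorm (phi z) < 1) ->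
  (forall z, cnorm z < 1 -> f (phi z) = 0) ->
  (forall z, cnorm z < 1 -> f z = 0) \/ (forall z, cnorm z < 1 -> phi z = phi 0).
Proof.
move=> hf hp p1 fp; have z0 : cnorm (0 : C) < 1 by rewrite normc_0.
have [|[r r0 Hr]] := holo_isolated hf (p1 _ z0); first by left.
right=> z z1; apply/eqP; rewrite -subr_eq0; apply/eqP.
have /cvgCP/(_ _ r0) : phi w @[w --> (0 : C)] --> phi 0.
  exact: (derivable_continuous (holoP hp z0)).
move=> /(@nbhs_normcP _ 0 _)[s s0 Hs].
apply: (@holo_zero_near (fun z => phi z - phi 0) 0 s) => //.
  by apply: holoB => //; exact: holo_cst.
move=> w w1 /Hs; rewrite normc_distC => ws; apply/eqP; rewrite subr_eq0.
by apply: contraTT ws => /(Hr _ (p1 _ w1)) H; rewrite -leNgt leNgt; apply/negP => /H;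
  rewrite fp// eqxx.
Qed.

(** After moving [a] to 0, the square sum of the Taylor coefficients is at most 1 and the constant
    term already uses all of it. *)
Lemma max_principle f a : holo f -> (forall z, cnorm z < 1 -> cnorm (f z) <= 1) ->
  cnorm a < 1 -> cnorm (f a) = 1 -> forall z, cnorm z < 1 -> f z = f a.
Proof.
move=> hf f1 a1 fa.
have hF := holo_mob_comp hf a1; set F := fun z => f (mob a z) in hF.
have F1 r : 0 < r < 1 -> mean2 (fun t => F (pt r t)) <= 1.
  move=> /andP[r0 r1]; rewrite -(expr1n _ 2); apply: mean2_le_bound.
    by apply: cont_holo; rewrite ?(ltW r0).
  by move=> t; apply: f1; apply: mob_lt1; rewrite ?normc_pt ?(ltW r0).
have E0 : tc F 0 = f a.
  have [g [_ g0 /(_ 0)]] := @holo_divX F 0 hF (fun n => ltac:(by [])).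
  by rewrite normc_0 ltr01 expr0 mul1r g0 /F mob0 => ->.
have Fn n : tc F n.+1 = 0.
  have := h2_coef hF F1 n.+2; rewrite big_ord_recl E0 fa expr1n.
  rewrite -lerBrDl subrr big_ord_recr /= => H.
  apply/normc_eq0P/eqP; rewrite -sqrf_eq0 eq_le sqr_ge0 andbT.
  apply: le_trans H; rewrite /bump /= add1n lerDr.
  by apply: sumr_ge0 => i _; rewrite sqr_ge0.
have FE z : cnorm z < 1 -> F z = f a.
  move=> z1; apply/eqP; rewrite -subr_eq0; apply/eqP.
  apply: (@holo_coef0 (fun z => F z - f a)) => //.
    by apply: holoB => //; exact: holo_cst.
  have [g [hg _ Hg]] := @holo_divX F 0 hF (fun n => ltac:(by [])).
  move=> n; apply: (@tc_unique R _ (fun=> 0) 0).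
    by apply: holoB => //; exact: holo_cst.
  move=> w w1 N; rewrite big1 ?sub0r; last by move=> i _; rewrite mul0r.
  rewrite !mul0r normcNE; suff -> : F w - f a = 0 by rewrite normc_0.
  apply/eqP; rewrite subr_eq0; apply/eqP.
  apply: (@small_eq R _ _ 0 0 0%N); first by rewrite lexx ltr01.
  move=> k _; rewrite mul0r; apply/ler_addgt0Pr => e e0; rewrite add0r.
  have [N0 HN] := taylor_approx hF (introT andP (conj (normc_ge0 w) w1)) e0.
  have := HN N0.+1 w (leqnSn _) (lexx _).
  by rewrite big_ord_recl E0 expr0 mulr1 big1 ?addr0// => i _; rewrite Fn mul0r.
move=> z z1; rewrite -(mobNK a1 z1); apply: FE.
by apply: mob_lt1 => //; rewrite normcNE.
Qed.

Lemma max_principle_lt f : holo f -> (forall z, cnorm z < 1 -> cnorm (f z) <= 1) ->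
  (exists2 c, cnorm c = 1 & forall z, cnorm z < 1 -> f z = c) \/
  (forall z, cnorm z < 1 -> cnorm (f z) < 1).
Proof.
move=> hf f1; have [[a a1 fa]|H] := pselect (exists2 a, cnorm a < 1 & cnorm (f a) = 1).
  by left; exists (f a) => //; exact: max_principle.
right=> z z1; rewrite lt_neqAle f1// andbT; apply/eqP => E; apply: H.
by exists z.
Qed.

(** Moved to 0, the functions are z^k u and z^l v with u and v nonzero at 0. If l < k, the
    domination would give |v| <= |z| |u| near 0 and force v 0 = 0. So k <= l and z^(l - k) v / u is
    the ratio. *)
Lemma holo_local_ratio g0 g1 a : holo g0 -> holo g1 ->
  ~ (forall z, cnorm z < 1 -> g0 z = 0) ->
  (forall z, cnorm z < 1 -> cnorm (g1 z) <= cnorm (g0 z)) -> cnorm a < 1 ->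
  exists Q : C -> C, derivable Q a 1 /\ exists2 r, 0 < r &
    forall z, cnorm (z - a) < r -> cnorm z < 1 /\ g1 z = Q z * g0 z.
Proof.
move=> h0 h1 nz le a1.
have near1 : exists2 r, 0 < r & forall z, cnorm (z - a) < r -> cnorm z < 1.
  exists (1 - cnorm a); first by rewrite subr_gt0.
  by move=> z; have := normc_sub_ge z a; lra.
have [r1 r10 Hr1] := near1.
have [G0|[k [u [hu u0 Gu]]]] := holo_factor (holo_mob_comp h0 a1).
  case: nz => z z1; rewrite -(mobNK a1 z1); apply: G0; apply: mob_lt1 => //.
  by rewrite normcNE.
have [G1|[l [v [hv v0 Gv]]]] := holo_factor (holo_mob_comp h1 a1).
  exists (fun=> 0); split; first exact: derivable_cst.
  exists r1 => // z /Hr1 z1; split => //; rewrite mul0r -(mobNK a1 z1); apply: G1.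
  by apply: mob_lt1 => //; rewrite normcNE.
have z0 : cnorm (0 : C) < 1 by rewrite normc_0.
have kl : (k <= l)%N.
  rewrite leqNgt; apply/negP => lk.
  have [M' M'0 /(@nbhs_normcP _ 0 _)[d d0 Hd]] := derivable_bound (holoP hu z0).
  have /cvgCP/(_ (cnorm (v 0) / 2)) : v w @[w --> (0 : C)] --> v 0.
    exact: (derivable_continuous (holoP hv z0)).
  have v00 : 0 < cnorm (v 0) by exact: normc_gt0.
  rewrite divr_gt0// => /(_ isT) /(@nbhs_normcP _ 0 _)[d2 d20 Hd2].
  (* A point this close to 0 has |v z| >= |v 0| / 2 but |z| |u z| < |v 0| / 2. *)
  pose e := Num.min 1 (Num.min d (Num.min d2 (cnorm (v 0) / 2 / (M' + cnorm (u 0) + 1)))).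
  have D0 : 0 < M' + cnorm (u 0) + 1 by have := normc_ge0 (u 0); lra.
  have e0 : 0 < e by rewrite !lt_min ltr01 d0 d20 !divr_gt0.
  have [z [zn z1]] := small_point e0.
  rewrite /e !lt_min => /and4P[_ zd zd2 ze].
  have Hz := le (mob a z) (mob_lt1 a1 z1); rewrite Gu// Gv// in Hz.
  have zp := normc_gt0 zn.
  have Hz' : cnorm (v z) <= cnorm z * cnorm (u z).
    rewrite -(@ler_pM2l _ (cnorm z ^+ l)) ?exprn_gt0//.
    rewrite !normcMr !normcXn in Hz; apply: le_trans Hz _.
    rewrite -(subnKC lk) exprD exprSr -!mulrA ler_wpM2l ?exprn_ge0 ?normc_ge0//.
    rewrite ler_wpM2l ?normc_ge0// ler_piMl ?normc_ge0// exprn_ile1 ?normc_ge0// ltW//.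
  have uz : cnorm (u z) <= M' + cnorm (u 0).
    have := Hd z; rewrite !subr0 => /(_ zd) Hu.
    have := normc_sub_ge (u z) (u 0).
    have : M' * cnorm z <= M' by rewrite ler_piMr ?ltW.
    lra.
  have vz : cnorm (v 0) / 2 <= cnorm (v z).
    have := Hd2 z; rewrite subr0 => /(_ zd2) Hvz.
    have := normc_sub_ge (v 0) (v z); lra.
  have : cnorm z * (M' + cnorm (u 0) + 1) < cnorm (v 0) / 2 by rewrite -ltr_pdivlMr.
  have : cnorm z * cnorm (u z) <= cnorm z * (M' + cnorm (u 0)) by rewrite ler_wpM2l ?normc_ge0.
  lra.
have a1' : cnorm (- a) < 1 by rewrite normcNE.
have E0 : mob (- a) a = 0 by rewrite -{2}(mob0 a) mobK.
pose q z := z ^+ (l - k) * v z / u z.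
have dq : derivable q 0 1.
  apply: derivableM; last by apply: derivableV => //; exact: (holoP hu z0).
  by apply: (holoP (holoM (holoX (l - k) (holo_id R)) hv) z0).
exists (fun z => q (mob (- a) z)); split.
  by apply: derivable_comp; [exact: (holoP (holo_mob a1') a1)|rewrite E0].
have [ru ru0 Hu] := nonzero_near hu z0 u0.
have /cvgCP/(_ _ ru0) : mob (- a) w @[w --> a] --> mob (- a) a.
  exact: (derivable_continuous (holoP (holo_mob a1') a1)).
move=> /nbhs_normcP[s s0 Hs].
exists (Num.min r1 s); first by rewrite lt_min r10.
move=> z; rewrite lt_min => /andP[/Hr1 z1 /Hs]; rewrite E0 normc_distC subr0 => zs.
split=> //; rewrite -{1 3}(mobNK a1 z1).
have m1 := mob_lt1 a1' z1; rewrite Gu// Gv//.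
have uz : u (mob (- a) z) != 0 by apply: Hu; rewrite subr0.
rewrite /q -{1}(subnK kl) exprD.
by move: (mob _ _ ^+ (l - k)) (mob _ _ ^+ k) (v _) (u _) uz => x y p e e0; field.
Qed.

(** The value at each point is taken from a local ratio. Ratios agree away from the zeros of [g0],
    which are isolated, so near each point the chosen values coincide with one holomorphic function.
    The bound by 1 reaches the zeros by continuity. *)
Lemma holo_division g0 g1 : holo g0 -> holo g1 ->
  ~ (forall z, cnorm z < 1 -> g0 z = 0) ->
  (forall z, cnorm z < 1 -> cnorm (g1 z) <= cnorm (g0 z)) ->
  exists phi, [/\ holo phi, forall z, cnorm z < 1 -> g1 z = phi z * g0 z &
    forall z, cnorm z < 1 -> cnorm (phi z) <= 1].
Proof.
move=> h0 h1 nz le.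
have ex a : cnorm a < 1 -> exists c : C, exists Q : C -> C, [/\ derivable Q a 1, Q a = c & exists2 r, 0 < r &
    forall z, cnorm (z - a) < r -> cnorm z < 1 /\ g1 z = Q z * g0 z].
  move=> a1; have [Q [dQ HQ]] := holo_local_ratio h0 h1 nz le a1.
  by exists (Q a), Q; split.
pose phi a := if pselect (cnorm a < 1) is left a1 then sval (cid (ex a a1)) else 0.
have phiP a : cnorm a < 1 -> exists Q : C -> C, [/\ derivable Q a 1, Q a = phi a & exists2 r, 0 < r &
    forall z, cnorm (z - a) < r -> cnorm z < 1 /\ g1 z = Q z * g0 z].
  by move=> a1; rewrite /phi; case: pselect => // a1'; exact: (svalP (cid (ex a a1'))).
have E z : cnorm z < 1 -> g1 z = phi z * g0 z.
  move=> z1; have [Q [_ <- [r r0 Hr]]] := phiP z z1.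
  by have [] := Hr z; rewrite ?subrr ?normc_0.
have nbh a : cnorm a < 1 -> exists Q : C -> C, [/\ derivable Q a 1 , Q a = phi a & exists2 r, 0 < r &
    forall z, cnorm (z - a) < r -> cnorm z < 1 /\ Q z = phi z].
  move=> a1; have [Q [dQ Qa [r r0 Hr]]] := phiP a a1.
  have [//|[s s0 Hs]] := holo_isolated h0 a1.
  exists Q; split => //; exists (Num.min r s); first by rewrite lt_min r0.
  move=> z; rewrite lt_min => /andP[zr zs]; have [z1 gz] := Hr z zr; split => //.
  have [->//|za] := eqVneq z a.
  by apply: (mulIf (Hs z z1 za zs)); rewrite -gz E.
have hphi : holo phi.
  split=> a a1; have [Q [dQ Qa [r r0 Hr]]] := nbh a a1.
  apply: (derivable_eq_near _ dQ); apply/nbhs_normcP; exists r => // z /Hr[].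
  by [].
exists phi; split => // a a1.
have le1 z : cnorm z < 1 -> g0 z != 0 -> cnorm (phi z) <= 1.
  move=> z1 gz; have := le z z1; rewrite E// normcMr ger_pMl//; exact: normc_gt0.
have [//|[s s0 Hs]] := holo_isolated h0 a1.
apply/ler_addgt0Pr => e e0.
have /cvgCP/(_ _ e0) : phi w @[w --> a] --> phi a.
  exact: (derivable_continuous (holoP hphi a1)).
move=> /nbhs_normcP[d d0 Hd].
have ds0 : 0 < Num.min d s by rewrite lt_min d0.
have [z [za z1]] := ball_point a1 ds0; rewrite lt_min => /andP[zd zs].
have := le1 z z1 (Hs z z1 za zs); have := Hd z zd.
by have := normc_sub_ge (phi a) (phi z); lra.
Qed.

End Zeros.

(** * Subharmonicity and subordination *)

Section Subharmonic.
Variable R : realType.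
Local Notation C := (R[i]^o).
Implicit Types (n m N : nat) (r s t : R) (f g : C -> C) (u : R -> R) (z w a : C).

Lemma sqrtc_Re_gt0 z : 0 < cre z -> 0 < cre (sqrtc z : C).
Proof.
case: z => x y; rewrite /cre /= => x0.
by rewrite sqrtr_gt0 divr_gt0// ltr_wpDl// sqrtr_ge0.
Qed.

Lemma normc_sqrtc z : cnorm (sqrtc z : C) ^+ 2 = cnorm z.
Proof. by rewrite -normcXn sqr_sqrtc. Qed.

(** For w and z in the right half-plane |sqrt w + sqrt z| is at least Re (sqrt z), so rationalising
    sqrt w - sqrt z controls the remainder. *)
Lemma derivable_sqrtc z : 0 < cre z -> derivable (fun w => sqrtc w : C) z 1.
Proof.
move=> z0; set s : C -> C := fun w => sqrtc w.
have sz := sqrtc_Re_gt0 z0; set m := cre (s z) in sz.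
have [rz rz0 Hr] : exists2 r, 0 < r & forall w, cnorm (w - z) < r -> 0 < cre w.
  exists (cre z) => // w; rewrite normc_distC => H.
  by have := le_lt_trans (Re_le_normc _) H; rewrite creD creN; lra.
apply/derivableCP; exists (2 * s z)^-1 => e e0.
apply/nbhs_normcP; exists (Num.min rz (e * (2 * m ^+ 3))).
  by rewrite lt_min rz0 mulr_gt0// mulr_gt0// exprn_gt0.
move=> w; rewrite lt_min => /andP[/Hr w0 wz].
have sw := sqrtc_Re_gt0 w0.
have mz : m <= cnorm (s z) by exact: Re_le_normc.
have mD : m <= cnorm (s w + s z).
  apply: le_trans (Re_le_normc _); rewrite creD /m; move: sw; rewrite -/(s w).
  by move: (cre (s w)) (cre (s z)) => x y; lra.
have z1 : s z != 0 by apply: normc_neq0; apply: lt_le_trans mz.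
have z2 : s w + s z != 0 by apply: normc_neq0; apply: lt_le_trans mD.
have Ew : w = s w ^+ 2 by rewrite sqr_sqrtc.
have Ez : z = s z ^+ 2 by rewrite sqr_sqrtc.
have dif : s w - s z = (w - z) / (s w + s z).
  by rewrite {2}Ew {2}Ez; field.
have -> : s w - s z - (2 * s z)^-1 * (w - z) =
   - ((w - z) * ((w - z) / (s w + s z)) / ((2 * s z) * (s w + s z))).
  have wzE : w - z = (s w - s z) * (s w + s z) by rewrite {1}Ew {1}Ez; ring.
  rewrite -dif wzE; field.
  by rewrite z1 z2.
rewrite normcNE !normcMr !normc_inv !normcMr mulrC -!mulrA.
have n2 : cnorm (2 : C) = 2 by rewrite -(creal_nat R 2) normc_real ger0_norm.
rewrite n2; have := normc_ge0 (w - z); move: wz mz mD.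
move: (cnorm (s z)) (cnorm (s w + s z)) (cnorm (w - z)) => A B x xm mA mB x0.
have A0 : 0 < A by apply: lt_le_trans mA.
have B0 : 0 < B by apply: lt_le_trans mB.
have -> : (2 * (A * B))^-1 * (x * (x / B)) = x / (2 * (A * (B * B))) * x.
  by field; rewrite !gt_eqF.
rewrite ler_wpM2r// ler_pdivrMr ?mulr_gt0//; apply: (le_trans (ltW xm)).
have m0 := ltW sz; rewrite ler_pM2l// ler_pM2l// exprS expr2.
by apply: ler_pM => //; [exact: mulr_ge0|exact: ler_pM].
Qed.

Lemma sqrtrD_le (x y : R) : 0 <= x -> 0 <= y -> Num.sqrt (x + y) <= Num.sqrt x + Num.sqrt y.
Proof.
move=> x0 y0; rewrite -(@ler_pXn2r _ 2) ?nnegrE ?addr_ge0 ?sqrtr_ge0//.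
rewrite sqr_sqrtr ?addr_ge0// sqrrD !sqr_sqrtr// addrAC lerDl.
by rewrite mulrn_wge0// mulr_ge0// sqrtr_ge0.
Qed.

(* [S] extends holomorphically to the discs of radius r^-1. *)
Definition holo_beyond (S : C -> C) := exists2 rho : R, 0 < rho < 1 &
  forall r, rho <= r < 1 -> holo (fun z => S (z * (r^-1)%:C)).

Lemma holo_beyondM S1 S2 : holo_beyond S1 -> holo_beyond S2 ->
  holo_beyond (fun z => S1 z * S2 z).
Proof.
move=> [r1 /andP[r10 r11] H1] [r2 /andP[r20 r21] H2].
exists (Num.max r1 r2); first by rewrite lt_max r10 gt_max r11 r21.
move=> r; rewrite ge_max => /andP[/andP[l1 l2] r3].
by apply: holoM; [apply: H1|apply: H2]; apply/andP.
Qed.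

Lemma sqrt_affine (k b : C) : cnorm b < 1 ->
  holo_beyond (fun w => sqrtc k * sqrtc (1 - b * w)).
Proof.
move=> b1; have b0 := normc_ge0 b; exists ((1 + cnorm b) / 2); first by apply/andP; split; lra.
move=> r /andP[r0 r1]; have r2 : cnorm b < r by lra.
have r3 : 0 < r by lra.
apply: holoM; first exact: holo_cst.
split => z z1; apply: (@derivable_comp _ (fun z => 1 - b * (z * (r^-1)%:C)) (fun w => sqrtc w)).
  apply: (holoP _ z1); apply: holoB; first exact: holo_cst.
  apply: holoM; first exact: holo_cst.
  by apply: holoM; [exact: holo_id|exact: holo_cst].
apply: derivable_sqrtc; rewrite creD creN cre1 subr_gt0.
apply: le_lt_trans (Re_le_normc _) _; rewrite !normcMr normc_real ger0_norm ?invr_ge0 ?(ltW r3)//.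
rewrite mulrA ltr_pdivrMr// mul1r; apply: le_lt_trans r2.
by rewrite ler_piMr// ltW.
Qed.

(** |S|^2 is the modulus of a zero-free substitute for w - a. A root inside is reflected: 1 -
    conj(a) w has the same modulus on the circle and a larger one inside. A root on or outside the
    circle is pushed outwards by [e]. *)
Lemma sqrt_root a e : 0 < e -> exists S, [/\ holo_beyond S,
  forall w, cnorm w <= 1 -> cnorm (w - a) <= cnorm (S w) ^+ 2 &
  forall t, cnorm (S (cis t)) ^+ 2 <= cnorm (cis t - a) + e].
Proof.
move=> e0; have [a1|a1] := ltP (cnorm a) 1.
  exists (fun w => sqrtc 1 * sqrtc (1 - a^* * w)).
  have nS w : cnorm (sqrtc 1 * sqrtc (1 - a^* * w) : C) ^+ 2 = cnorm (1 - a^* * w).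
    by rewrite normcMr exprMn !normc_sqrtc normc_1 mul1r.
  split => [|w w1|t]; first by apply: sqrt_affine; rewrite normc_conj.
    rewrite nS -(@ler_pXn2r _ 2) ?nnegrE ?normc_ge0//.
    have : cnorm a ^+ 2 <= 1 by rewrite exprn_ile1 ?normc_ge0// ltW.
    have : cnorm w ^+ 2 <= 1 by rewrite exprn_ile1 ?normc_ge0.
    by rewrite !sqr_normcE !cpartE; nra.
  rewrite nS; have -> : 1 - a^* * cis t = cis t * (cis t - a)^*.
    by rewrite conjcB mulrBr mulcis_conj mulrC.
  by rewrite normcMr normc_cis mul1r normc_conj lerDl ltW.
have a0 : 0 < cnorm a by apply: lt_le_trans a1.
set a' := a * (1 + e / cnorm a)%:C.
have ea : 0 < e / cnorm a by rewrite divr_gt0.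
have na' : cnorm a' = cnorm a + e.
  rewrite normcMr normc_real ger0_norm ?addr_ge0 ?(ltW ea)//.
  by rewrite mulrDr mulr1 mulrC divfK// gt_eqF.
have a'1 : 1 < cnorm a' by rewrite na'; lra.
have a'0 : a' != 0 by apply: normc_neq0; lra.
have nS w : cnorm (sqrtc a' * sqrtc (1 - a'^-1 * w) : C) ^+ 2 = cnorm (a' - w).
  rewrite normcMr exprMn !normc_sqrtc -normcMr.
  by rewrite mulrBr mulr1 mulrA mulfV// mul1r.
exists (fun w => sqrtc a' * sqrtc (1 - a'^-1 * w)); split => [|w w1|t].
- have a'p : 0 < cnorm a' by lra.
  by apply: sqrt_affine; rewrite normc_inv invf_lt1.
- rewrite nS -(@ler_pXn2r _ 2) ?nnegrE ?normc_ge0// normc_distC.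
  have h0 : 0 < e / cnorm a by [].
  have H : cre (a * w^*) <= cnorm a ^+ 2.
    apply: le_trans (Re_le_normc _) _; rewrite normcMr normc_conj expr2.
    by rewrite ler_wpM2l ?normc_ge0// (le_trans w1).
  rewrite /a'; move: (e / cnorm a) h0 => x x0; move: H.
  rewrite !sqr_normcE !cpartE => H; nra.
rewrite nS; have -> : a' - cis t = (a - cis t) + a * (e / cnorm a)%:C.
  by rewrite /a' real_complexD mulrDr mulr1 addrAC.
apply: le_trans (normcDle _ _) _; rewrite normc_distC lerD2l normcMr normc_real ger0_norm ?(ltW ea)//.
by rewrite mulrC divfK// gt_eqF.
Qed.

Lemma sqrt_poly (c : C) (rs : seq C) e : 0 < e -> exists S, [/\ holo_beyond S,
  forall w, cnorm w <= 1 -> cnorm (c * \prod_(a <- rs) (w - a)) <= cnorm (S w) ^+ 2 &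
  forall t, cnorm (S (cis t)) ^+ 2 <= cnorm (c * \prod_(a <- rs) (cis t - a)) + e].
Proof.
elim: rs e => [|a rs IH] e e0.
  exists (fun=> sqrtc c); split => [|w w1|t].
  - exists 2^-1; first by apply/andP; split; lra.
    by move=> r _; exact: holo_cst.
  - by rewrite big_nil mulr1 normc_sqrtc.
  - by rewrite big_nil mulr1 normc_sqrtc lerDl ltW.
have [M M0 HM] : exists2 M, 0 <= M & forall t, cnorm (c * \prod_(a <- rs) (cis t - a)) <= M.
  elim: rs {IH} => [|b rs [M M0 HM]].
    by exists (cnorm c); [exact: normc_ge0|move=> t; rewrite big_nil mulr1].
  exists ((1 + cnorm b) * M); first by rewrite mulr_ge0// addr_ge0 ?normc_ge0.
  move=> t; rewrite big_cons mulrCA normcMr ler_pM ?normc_ge0//.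
  by rewrite (le_trans (normcBle _ _))// normc_cis.
have L0 := normc_ge0 a; set L := 1 + cnorm a.
have D0 : 0 < M + L + 1 by rewrite /L; lra.
(* In the product of the two bounds the error terms are at most d (M + L + d), hence at most [e]. *)
set d := Num.min 1 (e / (M + L + 1)).
have d0 : 0 < d by rewrite lt_min ltr01 divr_gt0.
have d1 : d <= 1 by rewrite ge_min lexx.
have de : d * (M + L + 1) <= e by rewrite -ler_pdivlMr// ge_min lexx orbT.
have [S1 [h1 H1 H1']] := IH _ d0; have [S2 [h2 H2 H2']] := sqrt_root a d0.
exists (fun z => S2 z * S1 z); split => [|w w1|t]; first exact: holo_beyondM.
  by rewrite big_cons mulrCA (normcMr (w - a)) (normcMr (S2 w)) exprMn ler_pM ?normc_ge0 ?H1 ?H2.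
rewrite big_cons mulrCA (normcMr (cis t - a)) (normcMr (S2 _)) exprMn.
apply: (le_trans (ler_pM (sqr_ge0 _) (sqr_ge0 _) (H2' t) (H1' t))).
have := HM t; have : cnorm (cis t - a) <= L by rewrite (le_trans (normcBle _ _))// normc_cis.
have := normc_ge0 (cis t - a).
move: (cnorm _) (cnorm (_ * _)) => x y x0 xL yM.
rewrite mulrDl !mulrDr -addrA lerD2l; apply: le_trans de.
have -> : x * d + (d * y + d * d) = d * (y + x + d) by ring.
by rewrite ler_wpM2l ?(ltW d0)//; lra.
Qed.

Lemma cont_sqrt u : cont u -> cont (fun t => Num.sqrt (u t) : R).
Proof. by move=> cu; apply: (cont_comp (h := @Num.sqrt R) cu); exact: sqrt_continuous. Qed.

(** [S] majorises the square root of the polynomial in the disc, satisfies the Poisson formula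
    exactly, and nearly equals that square root in modulus on the circle. *)
Lemma sqrt_poly_le (c : C) (rs : seq C) z : cnorm z < 1 ->
  Num.sqrt (cnorm (c * \prod_(a <- rs) (z - a))) <=
  mean (fun t => pois z t * Num.sqrt (cnorm (c * \prod_(a <- rs) (cis t - a)))).
Proof.
move=> z1; set q := fun w => c * \prod_(a <- rs) (w - a).
have cq : cont (fun t => q (cis t)).
  apply: ccontM; first exact: cont_cst.
  elim: rs {q} => [|a rs IH].
    by under eq_fun do rewrite big_nil; exact: cont_cst.
  under eq_fun do rewrite big_cons; apply: ccontM => //.
  by apply: ccontB; [exact: cont_cis|exact: cont_cst].
have cp := cont_pois z1.
apply/ler_addgt0Pr => e e0.
(* The tolerance is e^2, so that after the square root it becomes at most [e]. *)
have [S [[rho /andP[rho0 rho1] hS] H1 H2]] := sqrt_poly c rs (exprn_gt0 2 e0).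
have r1 : 0 < rho < 1 by rewrite rho0.
have /hS hSr : rho <= rho < 1 by rewrite lexx.
have rn0 : rho%:C != 0 by apply: normc_neq0; rewrite normc_real gtr0_norm.
have Ept t : S (pt rho t * (rho^-1)%:C) = S (cis t).
  by rewrite /pt real_complexV mulrAC mulfV// mul1r.
have cS : cont (fun t => S (cis t)).
  have := cont_holo hSr (introT andP (conj (ltW rho0) rho1)).
  by under [X in cont X -> _]eq_fun do rewrite Ept.
have P := poisson_formula hSr r1 z1.
have Sz : S z = cmean (fun t => S (cis t) * (pois z t)%:C).
  transitivity (S (rho%:C * z * (rho^-1)%:C)).
    by rewrite real_complexV mulrAC mulfV// mul1r.
  by rewrite -P; apply: eq_cmean => t; rewrite Ept.
have -> : e = mean (fun t => e * pois z t) by rewrite meanZ// mean_pois// mulr1.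
have cs := cont_sqrt (cont_normc cq).
rewrite -meanD; [|by apply: contM|by apply: contM => //; exact: cont_cst].
apply: (@le_trans _ _ (cnorm (S z))).
  rewrite -(@ler_pXn2r _ 2) ?nnegrE ?sqrtr_ge0 ?normc_ge0//.
  by rewrite sqr_sqrtr ?normc_ge0// H1// ltW.
rewrite Sz; apply: le_trans (normc_cmean_le _) _; first by apply: ccontM => //; exact: ccont_real.
apply: mean_le => [||t].
- by apply: cont_normc; apply: ccontM => //; exact: ccont_real.
- apply: contD; first exact: contM.
  by apply: contM => //; exact: cont_cst.
rewrite normcMr normc_real ger0_norm ?pois_ge0// -[X in X + _]mulrC -mulrDl.
rewrite ler_wpM2r ?pois_ge0//.
have -> : cnorm (S (cis t)) = Num.sqrt (cnorm (S (cis t)) ^+ 2).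
  by rewrite sqrtr_sqr ger0_norm// normc_ge0.
apply: le_trans (_ : _ <= Num.sqrt (cnorm (q (cis t)) + e ^+ 2)) _.
  by rewrite ler_wsqrtr.
apply: le_trans (sqrtrD_le (normc_ge0 _) (sqr_ge0 _)) _.
by rewrite lerD2l sqrtr_sqr ger0_norm// ltW.
Qed.

(** A Taylor polynomial is split into linear factors over the algebraically closed field [R[i]]. Its
    uniform error (e / 2)^2 costs e / 2 after the square root, once on each side. *)
Lemma subharmonic_half f r z : holo f -> 0 < r < 1 -> cnorm z < 1 ->
  Num.sqrt (cnorm (f (r%:C * z))) <=
  mean (fun t => pois z t * Num.sqrt (cnorm (f (pt r t)))).
Proof.
move=> hf /andP[r0 r1] z1; apply/ler_addgt0Pr => e e0.
have e2 : 0 < e / 2 by rewrite divr_gt0.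
have [N HN] := taylor_approx hf (introT andP (conj (ltW r0) r1)) (exprn_gt0 2 e2).
set T := fun w => \sum_(n < N) tc f n * w ^+ n.
have {}HN w : cnorm w <= r -> cnorm (f w - T w) <= (e / 2) ^+ 2 by apply: HN.
have [c [rs Hq]] : exists c rs, forall w, T (r%:C * w) = c * \prod_(a <- rs) (w - a).
  pose P : {poly R[i]} := \poly_(n < N) (tc f n * r%:C ^+ n).
  have [rs EP] := closed_field_poly_normal P.
  exists (lead_coef P), rs => w; transitivity P.[w].
    rewrite horner_poly; apply: eq_bigr => n _.
    by rewrite exprMn mulrA.
  rewrite {1}EP hornerZ horner_prod; congr (_ * _).
  by apply: eq_bigr => a _; rewrite hornerXsubC.
have sq x y : cnorm (x - y) <= (e / 2) ^+ 2 ->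
    Num.sqrt (cnorm x) <= Num.sqrt (cnorm y) + e / 2.
  move=> xy; rewrite -[e / 2]ger0_norm ?(ltW e2)// -[`|e / 2|]sqrtr_sqr.
  apply: le_trans (sqrtrD_le (normc_ge0 _) (sqr_ge0 _)); apply: ler_wsqrtr.
  have := normc_sub_ge x y; have := xy; lra.
have cp := cont_pois z1.
have cf : cont (fun t => Num.sqrt (cnorm (f (pt r t)))).
  by apply/cont_sqrt/cont_normc/cont_holo; rewrite ?r1 ?ltW.
have rz : cnorm (r%:C * z) <= r.
  by rewrite normcMr normc_real gtr0_norm// ler_piMr// ltW.
apply: (le_trans (sq _ _ (HN _ rz))); rewrite Hq.
have {2}-> : e = e / 2 + e / 2 by lra.
rewrite addrA lerD2r; apply: (le_trans (sqrt_poly_le _ _ z1)).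
have -> : e / 2 = mean (fun t => e / 2 * pois z t) by rewrite meanZ// mean_pois// mulr1.
have cT : cont (fun t => Num.sqrt (cnorm (c * \prod_(a <- rs) (cis t - a)))).
  apply/cont_sqrt/cont_normc; under eq_fun do rewrite -Hq.
  apply: ccont_sum => n; apply: ccontM; first exact: cont_cst.
  by apply: ccontX; exact: cont_pt.
rewrite -meanD; [|by apply: contM|by apply: contM => //; exact: cont_cst].
apply: mean_le => [||t]; first exact: contM.
  by apply: contD; apply: contM => //; exact: cont_cst.
rewrite [_ / 2 * _]mulrC -mulrDr ler_wpM2l ?pois_ge0//.
by apply: sq; rewrite normc_distC -Hq; apply: HN; rewrite normc_pt// ltW.
Qed.

End Subharmonic.

(** * Means of powers, Jensen's inequality and Littlewood subordination *)

Section PowerMeans.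
Variable R : realType.
Local Notation C := (R[i]^o).
Implicit Types (n m N : nat) (r s t q : R) (f g : C -> C) (u v : R -> R) (z w a : C).

Lemma continuous_powR_norm q : 0 < q -> continuous (fun x : R => `|x| `^ q).
Proof.
move=> q0 x; have [->|x0] := eqVneq x 0.
  apply/cvgrPdist_lt => e e0; rewrite normr0 powR0 ?gt_eqF//.
  have d0 : 0 < e `^ q^-1 by exact: powR_gt0.
  exists (e `^ q^-1) => // y /=; rewrite sub0r normrN => yd; rewrite sub0r normrN ger0_norm ?powR_ge0//.
  have -> : e = (e `^ q^-1) `^ q by rewrite -powRrM mulVf ?gt_eqF// powRr1// ltW.
  by apply: gt0_ltr_powR; rewrite ?nnegrE ?normr_ge0 ?powR_ge0.
have nx : 0 < `|x| by rewrite normr_gt0.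
apply: (continuous_comp (g := fun y => y `^ q)); first exact: norm_continuous.
apply: differentiable_continuous; apply/derivable1_diffP.
by apply: derivable_powR; rewrite in_itv/= andbT.
Qed.

Lemma cont_powR q u : 0 < q -> cont u -> (forall t, 0 <= u t) -> cont (fun t => u t `^ q).
Proof.
move=> q0 cu u0; have -> : (fun t => u t `^ q) = (fun t => `|u t| `^ q).
  by apply: funext => t; rewrite ger0_norm.
exact: (cont_comp cu (continuous_powR_norm q0)).
Qed.

Lemma cont_powR_normc q (f : R -> C) : 0 < q -> cont f -> cont (fun t => cnorm (f t) `^ q).
Proof. by move=> q0 cf; apply: cont_powR => // [|t]; [exact: cont_normc|exact: normc_ge0]. Qed.

Lemma mean_cvg (u_ : nat -> R -> R) u (M : R) : (forall n, cont (u_ n)) -> cont u ->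
  (forall n t, `|u_ n t| <= M) -> (forall t, u_ n t @[n --> \oo] --> u t) ->
  mean (u_ n) @[n --> \oo] --> mean u.
Proof.
move=> cn cu uM ucv.
have uM' t : `|u t| <= M.
  apply: (ler_cvg_to (cvg_norm (ucv t)) (cvg_cst M)).
  by apply: nearW => n; exact: uM.
have H : mean (fun t => u_ n t - u t) @[n --> \oo] --> 0.
  apply: (@mean_cvg0 _ _ (M + M)) => [n|n t|].
  - exact: contB.
  - by apply: le_trans (ler_normB _ _) _; rewrite lerD.
  - apply: aeW => t _; rewrite -(subrr (u t)); apply: cvgB => //; exact: cvg_cst.
rewrite -[mean u]add0r; have -> : (fun n => mean (u_ n)) = (fun n => mean (fun t => u_ n t - u t) + mean u).
  by apply: funext => n; rewrite meanB// subrK.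
by apply: cvgD => //; exact: cvg_cst.
Qed.

(* Young's inequality says that x^a lies above its tangent at y. *)
Lemma powR_tangent (a x y : R) : 1 <= a -> 0 <= x -> 0 <= y ->
  a * y `^ (a - 1) * x <= x `^ a + (a - 1) * y `^ a.
Proof.
move=> a1 x0 y0; have [->|a_neq1] := eqVneq a 1.
  by rewrite subrr powRr0 mul0r addr0 !mul1r powRr1.
have a11 : 1 < a by rewrite lt_neqAle eq_sym a_neq1.
have a0 : 0 < a by lra.
have an0 : a != 0 by rewrite gt_eqF.
have an1 : a - 1 != 0 by rewrite subr_eq0.
have b0 : 0 < a / (a - 1) by rewrite divr_gt0// subr_gt0.
have ab : a^-1 + (a / (a - 1))^-1 = 1.
  by field; rewrite an0 an1.
have := conjugate_powR x0 (powR_ge0 y (a - 1)) a0 b0 ab.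
rewrite -powRrM mulrCA mulfV ?gt_eqF ?subr_gt0// mulr1.
rewrite -(@ler_pM2l _ a)// mulrDr.
have -> : a * (x `^ a / a) = x `^ a by field; rewrite gt_eqF.
have -> : a * (y `^ a / (a / (a - 1))) = (a - 1) * y `^ a.
  by field; rewrite an0 an1.
by rewrite mulrCA mulrC mulrAC.
Qed.

(** Jensen's inequality for the probability density [pois z]: the tangent inequality of x^a at the
    mean value [y] is averaged. *)
Lemma pois_jensen (a : R) u z : 1 <= a -> cont u -> (forall t, 0 <= u t) -> cnorm z < 1 ->
  (mean (fun t => pois z t * u t)) `^ a <= mean (fun t => pois z t * u t `^ a).
Proof.
move=> a1 cu u0 z1; have cp := cont_pois z1; set y := mean _.
have a0 : 0 < a by lra.
have cua : cont (fun t => u t `^ a) by exact: cont_powR.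
have y0 : 0 <= y by apply: mean_ge0 => t; rewrite mulr_ge0// pois_ge0.
have : a * y `^ (a - 1) * y <= mean (fun t => pois z t * u t `^ a) + (a - 1) * y `^ a.
  have -> : (a - 1) * y `^ a = mean (fun t => (a - 1) * y `^ a * pois z t).
    by rewrite meanZ// mean_pois// mulr1.
  rewrite {2}/y -meanZ; last exact: contM.
  rewrite -meanD; [|exact: contM|by apply: contM => //; exact: cont_cst].
  apply: mean_le => [||t]; first by apply: contM; [exact: cont_cst|exact: contM].
    by apply: contD; apply: contM => //; exact: cont_cst.
  rewrite mulrCA [X in _ <= _ + X]mulrC -mulrDr.
  by apply: ler_wpM2l; [exact: pois_ge0|exact: powR_tangent].
have [y00|yp] := eqVneq y 0; last first.
  rewrite -mulrA [_ * y]mulrC mulr_powRB1// mulrBl mul1r; lra.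
by move=> _; rewrite y00 powR0 ?gt_eqF//; apply: mean_ge0 => t; rewrite mulr_ge0 ?pois_ge0 ?powR_ge0.
Qed.

(** The exponent 1/2 implies all larger ones, by Jensen's inequality with the convex power 2 q. *)
Lemma subharmonic f q r z : holo f -> 2^-1 <= q -> 0 < r < 1 -> cnorm z < 1 ->
  cnorm (f (r%:C * z)) `^ q <= mean (fun t => pois z t * cnorm (f (pt r t)) `^ q).
Proof.
move=> hf q2 r1 z1; have q20 : 0 <= 2 * q by lra.
have qE x : 0 <= x -> x `^ q = (Num.sqrt x) `^ (2 * q).
  by move=> x0; rewrite -powR12_sqrt// -powRrM mulrA mulVf ?mul1r.
rewrite qE ?normc_ge0//; under eq_mean do rewrite qE ?normc_ge0//.
have /andP[r0 r11] := r1.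
have cs : cont (fun t => Num.sqrt (cnorm (f (pt r t)))).
  by apply/cont_sqrt/cont_normc/cont_holo; rewrite ?r11 ?ltW.
have s0 t : 0 <= Num.sqrt (cnorm (f (pt r t))) by exact: sqrtr_ge0.
have q21 : 1 <= 2 * q by lra.
apply: le_trans (pois_jensen q21 cs s0 z1).
apply: ge0_ler_powR; rewrite ?nnegrE ?sqrtr_ge0//.
  by apply: mean_ge0 => t; rewrite mulr_ge0 ?sqrtr_ge0 ?pois_ge0.
exact: subharmonic_half.
Qed.

Lemma scale_sub (s : R) z : z - s%:C * z = (1 - s)%:C * z.
Proof. by rewrite real_complexD real_complexN mulrBl mul1r. Qed.

Lemma scale_lt1 (s : R) z : 0 < s < 1 -> cnorm z < 1 -> cnorm (s%:C * z) < 1.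
Proof.
move=> /andP[s0 s1] z1; rewrite normcMr normc_real gtr0_norm//.
by apply: mulr_ilt1 => //; [exact: ltW|exact: normc_ge0].
Qed.

Section Herglotz.
Variables (v : R -> R) (M : R).
Hypotheses (cv : cont v) (v0 : forall t, 0 <= v t) (vM : forall t, v t <= M).

(** The Herglotz transform of [v]: a holomorphic function whose real part is the Poisson integral of
    [v]. *)
Definition herg z : C := 2 * cmean (fun t => (v t)%:C * kern z t) - (mean v)%:C.

Let cvC : cont (fun t => (v t)%:C : C).
Proof. exact: ccont_real. Qed.

Let vM' t : cnorm ((v t)%:C) <= M.
Proof. by rewrite normc_real ger0_norm. Qed.

Lemma holo_herg : holo herg.
Proof.
apply: holoB; last exact: holo_cst.
by apply: holoM; [exact: holo_cst|exact: (cauchy_transform_holo cvC vM')].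
Qed.

Lemma Re_herg z : cnorm z < 1 -> cre (herg z) = mean (fun t => pois z t * v t).
Proof.
move=> z1; have ck := cont_kern z1.
rewrite /herg creD creN cre_real -(creal_nat R 2) creM cre_real cim_real mul0r subr0.
rewrite Re_cmean; under eq_mean do rewrite creM cre_real cim_real mul0r subr0.
rewrite -meanZ; last by apply: contM => //; exact: cont_Re.
rewrite -meanB//; last by apply: contM; [exact: cont_cst|apply: contM => //; exact: cont_Re].
by apply: eq_mean => t; rewrite /pois; ring.
Qed.

Lemma herg_le z : cnorm z < 1 -> cre (herg z) <= (1 + cnorm z) / (1 - cnorm z) * mean v.
Proof.
move=> z1; have cp := cont_pois z1; rewrite Re_herg// -meanZ//; apply: mean_le => [||t].
- exact: contM.
- by apply: contM => //; exact: cont_cst.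
by rewrite ler_wpM2r// pois_le.
Qed.

Lemma tc_herg n : tc herg n = 2 * fcoef (fun t => (v t)%:C) n - ((n == 0)%:R * mean v)%:C.
Proof.
have M0 : 0 <= M by apply: le_trans (v0 0) (vM 0).
have mM : `|mean v| <= M by rewrite ger0_norm ?mean_ge0//; exact: mean_bound.
apply: (@tc_unique _ _ (fun n => 2 * fcoef (fun t => (v t)%:C) n - ((n == 0)%:R * mean v)%:C)
  (3 * M) holo_herg) => z z1 N.
have D0 : 0 < 1 - cnorm z by lra.
have -> : \sum_(n < N) (2 * fcoef (fun t => (v t)%:C) n - (((n : nat) == 0)%:R * mean v)%:C) * z ^+ n =
    2 * (\sum_(n < N) z ^+ n * fcoef (fun t => (v t)%:C) n) - ((N != 0)%:R * mean v)%:C.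
  under eq_bigr do rewrite mulrBl -mulrA [fcoef _ _ * _]mulrC.
  rewrite sumrB -mulr_sumr; congr (_ - _); case: N => [|N].
    by rewrite big_ord0 mul0r.
  rewrite big_ord_recl big1 => [|i _]; last by rewrite mul0r mul0r.
  by rewrite /= expr0 mulr1 addr0.
have H := cmean_kern_expand N cvC vM' z1.
set S := \sum_(n < N) _ in H *; set K := cmean _ in H.
have -> : 2 * S - ((N != 0)%:R * mean v)%:C - herg z = - (2 * (K - S)) + ((N == 0)%:R * mean v)%:C.
  have c0 : 0%:C = 0 :> C by [].
    by rewrite /herg -/K; case: eqP => _ /=; rewrite mul0r mul1r c0; ring.
apply: le_trans (normcDle _ _) _; rewrite normcNE normcMr -(creal_nat R 2) normc_real ger0_norm//.
have -> : 3 * M * cnorm z ^+ N / (1 - cnorm z) =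
  2 * (M * cnorm z ^+ N / (1 - cnorm z)) + M * cnorm z ^+ N / (1 - cnorm z) by ring.
apply: lerD; first by rewrite ler_wpM2l.
rewrite normc_real; case: N {S H} => [|N].
  rewrite mul1r expr0 mulr1 ler_pdivlMr// (le_trans _ mM)// ler_piMr//.
  by have := normc_ge0 z; lra.
by rewrite mul0r normr0 divr_ge0 ?(ltW D0)// mulr_ge0// exprn_ge0 ?normc_ge0.
Qed.

Lemma herg_coef_sum N : \sum_(n < N) cnorm (tc herg n) ^+ 2 <= 4 * mean (fun t => v t ^+ 2).
Proof.
have -> : mean (fun t => v t ^+ 2) = mean2 (fun t => (v t)%:C : C).
  by apply: eq_mean => t; rewrite normc_real ger0_norm.
apply: le_trans (ler_wpM2l _ (bessel_le N cvC)) => //.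
rewrite mulr_sumr; apply: ler_sum => n _; rewrite tc_herg.
have f0 : fcoef (fun t => (v t)%:C) 0 = (mean v)%:C.
  by rewrite -cmean_real; apply: eq_cmean => t; rewrite expr0 mulr1.
have -> : (4 : R) = 2 ^+ 2 by ring.
rewrite -exprMn lerXn2r ?nnegrE ?mulr_ge0 ?normc_ge0//.
case: (n : nat) => [|m]; last first.
  by rewrite mul0r subr0 normcMr -(creal_nat R 2) normc_real ger0_norm.
rewrite f0 mul1r -(creal_nat R 2) -real_complexM -real_complexN -real_complexD !normc_real.
have m0 : 0 <= mean v by exact: mean_ge0.
rewrite (ger0_norm m0) ger0_norm; lra.
Qed.

End Herglotz.

(** Subharmonicity bounds |f (s w)|^q by the harmonic function Re (herg w). Composed with [phi] it
    stays harmonic, so its mean is its value at phi 0, which the maximum of the Poisson kernel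
    bounds. *)
Lemma littlewood_scaled f phi q r s : holo f -> holo phi ->
  (forall z, cnorm z < 1 -> cnorm (phi z) < 1) -> 2^-1 <= q -> 0 < s < 1 -> 0 <= r < 1 ->
  mean (fun t => cnorm (f (s%:C * phi (pt r t))) `^ q) <=
  (1 + cnorm (phi 0)) / (1 - cnorm (phi 0)) * mean (fun t => cnorm (f (pt s t)) `^ q).
Proof.
move=> hf hp p1 q2 s01 r01; have /andP[s0 s1] := s01; have /andP[r0 r1] := r01.
have q0 : 0 < q by lra.
set v := fun t => cnorm (f (pt s t)) `^ q.
have cv : cont v by apply: cont_powR_normc => //; apply: cont_holo => //; rewrite s1 ltW.
have v0 t : 0 <= v t by exact: powR_ge0.
have [M M0 HM] := holo_circle_bound hf (introT andP (conj (ltW s0) s1)).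
have vM t : v t <= M `^ q by apply: ge0_ler_powR; rewrite ?nnegrE ?normc_ge0// ltW.
have hh := holo_herg cv v0 vM.
have p0 : cnorm (phi 0) < 1 by apply: p1; rewrite normc_0.
have hhp := holo_comp hp hh p1.
apply: le_trans (herg_le cv v0 p0).
rewrite -(holo_mean hhp r01) Re_cmean; apply: mean_le => [||t].
- apply: cont_powR_normc => //; have hs : holo (fun z => f (s%:C * phi z)).
    apply: (holo_comp _ hf); first by apply: holoM => //; exact: holo_cst.
    by move=> z z1; apply: scale_lt1 => //; exact: p1.
  exact: (cont_holo hs r01).
- exact: cont_Re (cont_holo hhp r01).
rewrite Re_herg// ?p1 ?normc_pt//; apply: subharmonic => //.
by rewrite p1 ?normc_pt.
Qed.

Lemma selfmap_circle phi r : holo phi -> (forall z, cnorm z < 1 -> cnorm (phi z) < 1) ->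
  0 <= r < 1 -> exists2 rho, 0 < rho < 1 & forall t, cnorm (phi (pt r t)) < rho.
Proof.
move=> hp p1 r01; have /andP[r0 r1] := r01.
have cu : cont (fun t => cnorm (phi (pt r t))) by apply: cont_normc; exact: cont_holo.
have [c _ Hc] := EVT_max (ltW (pi2_gt0 R)) (con_within (conT 0 (2 * pi) cu)).
have pc : cnorm (phi (pt r c)) < 1 by rewrite p1 ?normc_pt.
have n0 := normc_ge0 (phi (pt r c)).
exists ((1 + cnorm (phi (pt r c))) / 2); first by apply/andP; split; lra.
move=> t; have [t' t'I Et] := cis_representative t.
rewrite /pt -Et; apply: le_lt_trans (Hc t' _) _; first by rewrite in_itv.
lra.
Qed.

(** Here s tends to 1. On the circle of radius [r] the values of [phi] stay in a disc of radius
    [rho] < 1, where [f] is bounded, so dominated convergence applies. *)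
Lemma littlewood f phi q r (A : R) : holo f -> holo phi ->
  (forall z, cnorm z < 1 -> cnorm (phi z) < 1) -> 2^-1 <= q -> 0 <= r < 1 ->
  (forall s, 0 < s < 1 -> mean (fun t => cnorm (f (pt s t)) `^ q) <= A) ->
  mean (fun t => cnorm (f (phi (pt r t))) `^ q) <=
  (1 + cnorm (phi 0)) / (1 - cnorm (phi 0)) * A.
Proof.
move=> hf hp p1 q2 r01 fA; have /andP[r0 r1] := r01; have q0 : 0 < q by lra.
have p0 : cnorm (phi 0) < 1 by apply: p1; rewrite normc_0.
have K0 : 0 <= (1 + cnorm (phi 0)) / (1 - cnorm (phi 0)).
  by rewrite divr_ge0//; have := normc_ge0 (phi 0); lra.
have [rho /andP[rho0 rho1] Hrho] := selfmap_circle hp p1 r01.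
pose s_ n : R := 1 - (n.+2%:R)^-1.
have s01 n : 0 < s_ n < 1.
  have : 0 < (n.+2%:R : R)^-1 by rewrite invr_gt0.
  have : (n.+2%:R : R)^-1 < 1 by rewrite invf_lt1// ltr1n.
  by move=> h1 h2; rewrite /s_ subr_gt0 h1 gtrBl.
have scv : s_ n @[n --> \oo] --> (1 : R).
  rewrite /s_ -[X in _ --> X]subr0; apply: cvgB; first exact: cvg_cst.
  have := @cvg_harmonic R; rewrite -(cvg_shiftS _); exact.
have s2 : rho < (1 + rho) / 2 < 1 by apply/andP; split; lra.
have [s21 s22] := andP s2.
have [M M0 HM] := holo_circle_bound hf (introT andP (conj (ltW (lt_trans rho0 s21)) s22)).
have nps n t : cnorm ((s_ n)%:C * phi (pt r t)) < rho.
  have /andP[sn0 sn1] := s01 n.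
  rewrite normcMr normc_real gtr0_norm//; apply: le_lt_trans (Hrho t).
  by rewrite ler_piMl ?normc_ge0// ltW.
have bd w : cnorm w < rho -> cnorm (f w) <= M / (1 - rho / ((1 + rho) / 2)).
  move=> wr; have wr2 : cnorm w < (1 + rho) / 2 by lra.
  have s20 : 0 < (1 + rho) / 2 by lra.
  have s2' : 0 < (1 + rho) / 2 < 1 by rewrite s20.
  apply: le_trans (cauchy_bound hf s2' wr2 HM) _.
  have d1 : rho / ((1 + rho) / 2) < 1 by rewrite ltr_pdivrMr// mul1r.
  have d2 : cnorm w / ((1 + rho) / 2) <= rho / ((1 + rho) / 2) by rewrite ler_pM2r ?invr_gt0// ltW.
  by rewrite ler_wpM2l// lef_pV2 ?posrE; lra.
set B := M / _ in bd.
have H : mean (fun t => cnorm (f ((s_ n)%:C * phi (pt r t))) `^ q) @[n --> \oo] -->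
         mean (fun t => cnorm (f (phi (pt r t))) `^ q).
  have hsn n : holo (fun z => f ((s_ n)%:C * phi z)).
    have /andP[sn0 sn1] := s01 n.
    apply: (holo_comp _ hf); first by apply: holoM => //; exact: holo_cst.
    by move=> z z1; apply: scale_lt1 => //; exact: p1.
  apply: (@mean_cvg _ _ (B `^ q)) => [n||n t|t].
  - by apply: cont_powR_normc => //; exact: (cont_holo (hsn n)).
  - by apply: cont_powR_normc => //; exact: (cont_holo (holo_comp hp hf p1)).
  - rewrite ger0_norm ?powR_ge0//; apply: ge0_ler_powR; rewrite ?nnegrE ?normc_ge0 ?(ltW q0)//.
      exact: le_trans (normc_ge0 _) (bd _ (nps n t)).
    exact: bd.
  have z1 : cnorm (phi (pt r t)) < 1 by rewrite p1 ?normc_pt.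
  set z := phi (pt r t) in z1 *.
  have -> : cnorm (f z) `^ q = `|cnorm (f z)| `^ q by rewrite ger0_norm ?normc_ge0.
  have -> : (fun n => cnorm (f ((s_ n)%:C * z)) `^ q) = (fun n => `|cnorm (f ((s_ n)%:C * z))| `^ q).
    by apply: funext => n; rewrite ger0_norm ?normc_ge0.
  apply: (cvg_comp (fun n => cnorm (f ((s_ n)%:C * z))) (fun x : R => `|x| `^ q)); last exact: continuous_powR_norm.
  apply: (cvg_comp (fun n => f ((s_ n)%:C * z)) (fun x => cnorm x)); last exact: continuous_normc.
  have cf : f w @[w --> z] --> f z by exact: (derivable_continuous (holoP hf z1)).
  apply: (cvg_comp _ _ _ cf); apply/cvgCP => e e0.
  have := scv => /cvgrPdist_lt/(_ e e0); apply: filterS => n.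
  have -> : z - (s_ n)%:C * z = (1 - s_ n)%:C * z by exact: scale_sub.
  rewrite normcMr normc_real; apply: le_lt_trans; rewrite ler_piMr// ltW//.
rewrite -(cvg_lim _ H)//; apply: limr_le; first by apply/cvg_ex; eexists; exact: H.
near=> n; apply: le_trans (littlewood_scaled hf hp p1 q2 (s01 n) r01) _.
by rewrite ler_wpM2l// fA.
Unshelve. all: by end_near. Qed.

(** Continuity of point evaluation: [z] is written as r w with |w| < 1, and the Poisson kernel at
    [w] is bounded. *)
Lemma point_bound q z : 2^-1 <= q -> cnorm z < 1 -> exists2 K, 0 < K & forall f A, holo f ->
  (forall s, 0 < s < 1 -> mean (fun t => cnorm (f (pt s t)) `^ q) <= A) ->
  cnorm (f z) `^ q <= K * A.
Proof.
move=> q2 z1; have [r r01 zr] := mid_radius z1; have /andP[r0 r1] := r01.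
have w1 : cnorm (z * (r^-1)%:C) < 1.
  by rewrite normcMr normc_real gtr0_norm ?invr_gt0// ltr_pdivrMr// mul1r.
have cp := cont_pois w1; have q0 : 0 < q by lra.
exists ((1 + cnorm (z * (r^-1)%:C)) / (1 - cnorm (z * (r^-1)%:C))).
  by rewrite divr_gt0 ?subr_gt0// ltr_wpDr// normc_ge0.
move=> f A hf fA; have := subharmonic hf q2 r01 w1.
have rn0 : r%:C != 0 by apply: normc_neq0; rewrite normc_real gtr0_norm.
have -> : r%:C * (z * (r^-1)%:C) = z by rewrite real_complexV mulrC divfK.
move=> /le_trans; apply; have cf : cont (fun t => cnorm (f (pt r t)) `^ q).
  by apply: cont_powR_normc => //; apply: cont_holo; rewrite ?r1 ?ltW.
apply: (@le_trans _ _ ((1 + cnorm (z * (r^-1)%:C)) / (1 - cnorm (z * (r^-1)%:C)) *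
    mean (fun t => cnorm (f (pt r t)) `^ q))); last first.
  by rewrite ler_wpM2l ?fA// divr_ge0 ?subr_ge0 ?(ltW w1)// addr_ge0// normc_ge0.
rewrite -(meanZ _ cf); apply: mean_le => [||t]; first exact: contM.
  by apply: contM => //; exact: cont_cst.
by rewrite ler_wpM2r ?powR_ge0// pois_le.
Qed.

End PowerMeans.

(** * Density of polynomials *)

Section Majorant.
Variable R : realType.
Local Notation C := (R[i]^o).
Implicit Types (n m N : nat) (r s t q : R) (f g : C -> C) (u v : R -> R) (z w a : C).

(** A limit along an ultrafilter treats all Taylor coefficients at once, in place of a diagonal
    extraction. *)
Lemma ultra_limit (U : set_system nat) (a : nat -> R) (K : R) : UltraFilter U ->
  (forall n, `|a n| <= K) -> exists l : R, a n @[n --> U] --> l.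
Proof.
move=> UU aK; have UaU : UltraFilter (a @ U).
  split=> [|G PG aUG]; first exact: fmap_proper_filter.
  apply/seteqP; split => // A GA.
  have [//|UnA] := @in_ultra_setVsetC _ _ (a @^-1` A) UU.
  have /aUG GnA : (a @ U) (~` A) by [].
  have : G (A `&` ~` A) by exact: filterI.
  by rewrite setICr => G0; case: (filter_not_empty G G0).
have := @segment_compact R (- K) K; rewrite compact_ultra => /(_ _ UaU) [].
  by apply: (@filterS _ U _ setT); [move=> n _; rewrite /= in_itv/= -ler_norml|exact: filterT].
by move=> l [_ lim_l]; exists l.
Qed.

Lemma ultra_climit (U : set_system nat) (a : nat -> C) (K : R) : UltraFilter U ->
  (forall n, cnorm (a n) <= K) ->
  exists l, forall e, 0 < e -> \forall n \near U, cnorm (l - a n) < e.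
Proof.
move=> UU aK.
have [x Hx] : exists l : R, cre (a n) @[n --> U] --> l.
  by apply: (@ultra_limit _ _ K) => n; apply: le_trans (normr_Re_le _) (aK n).
have [y Hy] : exists l : R, cim (a n) @[n --> U] --> l.
  by apply: (@ultra_limit _ _ K) => n; apply: le_trans (normr_Im_le _) (aK n).
exists (Complex x y) => e e0; have e2 : 0 < e / 2 by rewrite divr_gt0.
move/cvgrPdist_lt : Hx => /(_ _ e2) Hx; move/cvgrPdist_lt : Hy => /(_ _ e2) Hy.
apply: filterS2 Hx Hy => n Hx Hy; apply: le_lt_trans (normc_leReIm _) _.
rewrite creD creN cimD cimN; rewrite /cre /cim /= in Hx Hy *; lra.
Qed.

Definition exhaust n : R := 1 - (n.+2%:R)^-1.

Lemma exhaust01 n : 0 < exhaust n < 1.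
Proof.
have : 0 < (n.+2%:R : R)^-1 by rewrite invr_gt0.
have : (n.+2%:R : R)^-1 < 1 by rewrite invf_lt1// ltr1n.
by move=> h1 h2; rewrite /exhaust subr_gt0 h1 gtrBl.
Qed.

Lemma exhaust_cvg : exhaust n @[n --> \oo] --> (1 : R).
Proof.
rewrite /exhaust -[X in _ --> X]subr0; apply: cvgB; first exact: cvg_cst.
by have := @cvg_harmonic R; rewrite -(cvg_shiftS _); exact.
Qed.

Lemma exhaust_near f z e : holo f -> cnorm z < 1 -> 0 < e ->
  \forall n \near \oo, cnorm (f z - f ((exhaust n)%:C * z)) < e.
Proof.
move=> hf z1 e0.
have cf : f w @[w --> z] --> f z by exact: (derivable_continuous (holoP hf z1)).
suff : f ((exhaust n)%:C * z) @[n --> \oo] --> f z by move/cvgCP; exact.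
apply: (cvg_comp _ _ _ cf); apply/cvgCP => {}e {}e0.
have := exhaust_cvg => /cvgrPdist_lt/(_ e e0); apply: filterS => n.
rewrite scale_sub normcMr normc_real; apply: le_lt_trans.
by rewrite ler_piMr// ltW.
Qed.

Lemma tc_tail f (K : R) z N : holo f -> (forall n, cnorm (tc f n) <= K) -> cnorm z < 1 ->
  cnorm (f z - \sum_(n < N) tc f n * z ^+ n) <= K * cnorm z ^+ N / (1 - cnorm z).
Proof.
move=> hf fK z1; have z0 := normc_ge0 z; apply/ler_addgt0Pr => e e0.
have K0 : 0 <= K by apply: le_trans (normc_ge0 _) (fK 0%N).
have [N0 HN0] := taylor_approx hf (introT andP (conj z0 z1)) e0.
have := HN0 (maxn N N0) z (leq_maxr _ _) (lexx _).
rewrite (@sum_cut _ (fun n => tc f n * z ^+ n) N) ?leq_maxl// => H.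
set S := \sum_(n < N) _ in H *; set T := \sum_(_ <= _ < _) _ in H.
have -> : f z - S = f z - (S + T) + T by ring.
apply: le_trans (normcDle _ _) _; rewrite addrC; apply: lerD => //.
apply: (le_trans (normc_sum _ _ _)).
apply: (@le_trans _ _ (\sum_(N <= n < maxn N N0) K * cnorm z ^+ n)).
  by apply: ler_sum => n _; rewrite normcMr normcXn ler_wpM2r ?exprn_ge0.
by rewrite -mulr_sumr -mulrA ler_wpM2l// geometric_tail.
Qed.

(* The majorant is harmonic and square integrable: this is why exponents down to 1 / 2 matter. *)
Lemma harmonic_majorant f p (A : R) : holo f -> 1 <= p ->
  (forall s, 0 < s < 1 -> mean (fun t => cnorm (f (pt s t)) `^ p) <= A) ->
  exists h, [/\ holo h, forall z, cnorm z < 1 -> cnorm (f z) `^ (p / 2) <= cre (h z) &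
    forall r, 0 < r < 1 -> mean2 (fun t => h (pt r t)) <= 4 * A].
Proof.
move=> hf p1 fA; set q := p / 2; have q2 : 2^-1 <= q by rewrite /q; lra.
have q0 : 0 < q by lra.
pose v n t := cnorm (f (pt (exhaust n) t)) `^ q.
have v0 n t : 0 <= v n t by exact: powR_ge0.
have cv n : cont (v n).
  apply: cont_powR_normc => //; apply: cont_holo => //.
  by have /andP[/ltW -> ->] := exhaust01 n.
have vM n : exists M, forall t, v n t <= M.
  have /andP[r0 r1] := exhaust01 n.
  have [M M0 HM] := holo_circle_bound hf (introT andP (conj (ltW r0) r1)).
  by exists (M `^ q) => t; apply: ge0_ler_powR; rewrite ?nnegrE ?normc_ge0// ltW.
have v2 n : mean (fun t => v n t ^+ 2) <= A.
  apply: le_trans (fA _ (exhaust01 n)); rewrite le_eqVlt; apply/orP; left; apply/eqP.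
  apply: eq_mean => t; rewrite /v -powR_mulrn ?powR_ge0// -powRrM; congr (_ `^ _).
  by rewrite /q mulrAC -mulrA divff// mulr1.
have A0 : 0 <= A by apply: le_trans (v2 0%N); apply: mean_ge0 => t; exact: sqr_ge0.
pose h n := herg (v n).
have hh n : holo (h n) by have [M HM] := vM n; exact: (holo_herg (cv n) (v0 n) HM).
have hsum n N : \sum_(k < N) cnorm (tc (h n) k) ^+ 2 <= 4 * A.
  have [M HM] := vM n; apply: (le_trans (herg_coef_sum (cv n) (v0 n) HM N)).
  by rewrite ler_wpM2l.
set K := 4 * A + 1.
have hK n k : cnorm (tc (h n) k) <= K.
  have := hsum n k.+1; rewrite big_ord_recr /=.
  have : 0 <= \sum_(i < k) cnorm (tc (h n) i) ^+ 2 by apply: sumr_ge0 => i _; exact: sqr_ge0.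
  have := normc_ge0 (tc (h n) k); rewrite /K; nra.
have K0 : 0 <= K by rewrite /K; lra.
(* The Herglotz transforms of |f|^q on growing circles have bounded coefficients; their limits along
   [U] are the coefficients of the majorant. [U] refines the filter at infinity, so the dilates of
   [f] still converge to [f] along it. *)
have [U [UU sU]] := ultraFilterLemma (@eventually_filter).
have [c Hc] := choice (fun k => ultra_climit UU (fun n => hK n k)).
have cK k : cnorm (c k) <= K.
  apply/ler_addgt0Pr => e e0; have [n Hn] := filter_ex (Hc k e e0).
  have := normc_sub_ge (c k) (tc (h n) k); have := hK n k; lra.
have [g hg Hg] := power_series cK.
have tcg k : tc g k = c k.
  apply: (tc_unique (c := c) (B := 2 * K) hg) => z z1 N; apply: le_trans (Hg z z1 N) _.
  by rewrite !mulrA.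
have csum N : \sum_(k < N) cnorm (c k) ^+ 2 <= 4 * A.
  apply/ler_addgt0Pr => e e0.
  set d := e / ((N%:R + 1) * (2 * K + 1)).
  have D0 : 0 < (N%:R + 1) * (2 * K + 1) :> R by rewrite mulr_gt0 ?ltr_wpDl// mulr_ge0.
  have d0 : 0 < d by rewrite divr_gt0.
  have [n Hn] : exists n, forall k, (k < N)%N -> cnorm (c k - tc (h n) k) < d.
    have : \forall n \near U, forall k : 'I_N, cnorm (c k - tc (h n) k) < d.
      by apply: filter_forall => k; exact: Hc.
    by move=> /filter_ex[n Hn]; exists n => k kN; exact: (Hn (Ordinal kN)).
  apply: (@le_trans _ _ (\sum_(k < N) (cnorm (tc (h n) k) ^+ 2 + d * (2 * K + 1)))).
    apply: ler_sum => k _; have := Hn k (ltn_ord k).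
    have := normc_sub_ge (c k) (tc (h n) k); have := hK n k; have := cK k.
    have := normc_ge0 (c k); have := normc_ge0 (tc (h n) k).
    move: (cnorm (c k)) (cnorm (tc _ _)) (cnorm (_ - _)) => x y w y0 x0 xK yK xy wd.
    have -> : x ^+ 2 = y ^+ 2 + (x - y) * (x + y) by ring.
    rewrite lerD2l; have [xy0|xy0] := leP (x - y) 0.
      by apply: (@le_trans _ _ 0); [rewrite mulr_le0_ge0// addr_ge0|rewrite mulr_ge0 ?(ltW d0)//; lra].
    by apply: ler_pM; [exact: ltW|exact: addr_ge0|lra|lra].
  rewrite big_split /= sumr_const card_ord lerD ?hsum// -[_ *+ N]mulr_natl /d.
  have D1 : (2 * K + 1) != 0 by rewrite gt_eqF// ltr_wpDl// mulr_ge0.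
  have D2 : 0 < N%:R + 1 :> R by rewrite ltr_wpDl.
  have -> : N%:R * (e / ((N%:R + 1) * (2 * K + 1)) * (2 * K + 1)) = e * (N%:R / (N%:R + 1)).
    by field; rewrite D1 gt_eqF.
  by rewrite ler_piMr ?(ltW e0)// ler_pdivrMr// mul1r lerDl.
exists g; split => // [z z1|r r01].
- apply/ler_addgt0Pr => e e0; have e5 : 0 < e / 5 by rewrite divr_gt0.
  have D0 : 0 < 1 - cnorm z by lra.
  have [N HN] : exists N, K * cnorm z ^+ N / (1 - cnorm z) <= e / 5 / 2.
    have d0 : 0 < e / 5 / 2 * (1 - cnorm z) / (K + 1).
      by rewrite divr_gt0 ?mulr_gt0 ?divr_gt0// ltr_wpDl.
    have [N HN] := geometric_small (introT andP (conj (normc_ge0 z) z1)) d0.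
    exists N.
    rewrite ler_pdivrMr//; apply: le_trans (_ : _ <= (K + 1) * cnorm z ^+ N) _.
      by rewrite ler_wpM2r ?exprn_ge0 ?normc_ge0// lerDl.
    by rewrite mulrC -ler_pdivlMr ?(ltW HN)// ltr_wpDl.
  have D1 : 0 < N%:R + 1 :> R by rewrite ltr_wpDl.
  have d0 : 0 < e / 5 / (N%:R + 1) by rewrite divr_gt0.
  have E1 : \forall n \near U, forall k : 'I_N, cnorm (c k - tc (h n) k) < e / 5 / (N%:R + 1).
    by apply: filter_forall => k; exact: Hc.
  have E2 := sU _ (exhaust_near hf z1 e5).
  have E3 : \forall n \near U, cnorm (f z) `^ q - cnorm (f ((exhaust n)%:C * z)) `^ q < e / 5.
    have H := @continuous_powR_norm R q q0 (cnorm (f z)).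
    have /cvgrPdist_lt/(_ _ e5)/= := H; rewrite (ger0_norm (normc_ge0 _)).
    move=> /nbhs_normP[d /= d1 Hd]; apply: filterS (sU _ (exhaust_near hf z1 d1)) => n Hn.
    have := Hd (cnorm (f ((exhaust n)%:C * z))); rewrite /= (ger0_norm (normc_ge0 _)).
    move=> /(_ (le_lt_trans (ler_normc_sub _ _) Hn)); apply: le_lt_trans; exact: ler_norm.
  have [n [N1 N3]] := @filter_ex _ U _ _ (filterI E1 E3).
  have [M HM] := vM n.
  have SH : cnorm (f ((exhaust n)%:C * z)) `^ q <= cre (h n z).
    by rewrite Re_herg//; apply: subharmonic => //; exact: exhaust01.
  have T1 : cnorm (h n z - \sum_(k < N) tc (h n) k * z ^+ k) <= e / 5 / 2.
    exact: le_trans (tc_tail _ (hh n) (hK n) z1) HN.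
  have T2 : cnorm (g z - \sum_(k < N) c k * z ^+ k) <= e / 5.
    rewrite normc_distC; apply: le_trans (Hg z z1 N) _; lra.
  have T3 : cnorm (\sum_(k < N) tc (h n) k * z ^+ k - \sum_(k < N) c k * z ^+ k) <= e / 5.
    rewrite -sumrB; apply: le_trans (normc_sum _ _ _) _.
    apply: (@le_trans _ _ (\sum_(k < N) e / 5 / (N%:R + 1))).
      apply: ler_sum => k _; rewrite -mulrBl normcMr normc_distC normcXn.
      by rewrite -[leRHS]mulr1 ler_pM ?normc_ge0 ?exprn_ge0 ?normc_ge0 ?(ltW (N1 k))// exprn_ile1 ?normc_ge0 ?ltW.
    rewrite sumr_const card_ord -[_ *+ N]mulr_natl mulrCA ler_piMr ?(ltW e5)//.
    by rewrite ler_pdivrMr// mul1r lerDl.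
  have T : cnorm (h n z - g z) <= e / 5 * 4.
    set x := h n z in T1 *; set S1 := \sum_(_ < _) _ in T1 T3; set S2 := \sum_(_ < _) _ in T2 T3.
    have -> : x - g z = (x - S1) + (S1 - S2) - (g z - S2) by ring.
    apply: le_trans (normcBle _ _) _; have := normcDle (x - S1) (S1 - S2); lra.
  have := le_trans (Re_le_normc _) T; rewrite creD creN; move: N3 SH; rewrite /=; lra.
have /andP[r0 r1] := r01.
apply/ler_addgt0Pr => e e0.
have cg : cont (fun t => g (pt r t)) by apply: cont_holo; rewrite ?r1 ?ltW.
set d := Num.min 1 e; have d0 : 0 < d by rewrite lt_min ltr01.
have d2 : d ^+ 2 <= e.
  have d1 : d <= 1 by rewrite ge_min lexx.
  by apply: (@le_trans _ _ d); [rewrite expr2 ler_piMr// ltW|rewrite ge_min lexx orbT].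
have [N HN] := taylor_approx hg (introT andP (conj (ltW r0) r1)) d0.
have fc n : fcoef (fun t => g (pt r t)) n = c n * r%:C ^+ n by rewrite tcE// tcg.
apply: le_trans (parseval_le cg (N := N) (d := d) _) _ => [t|].
  have := HN N (pt r t) (leqnn _); rewrite normc_pt ?(ltW r0)// => /(_ (lexx _)).
  suff -> : psum (fcoef (fun t => g (pt r t))) N t = \sum_(n < N) tc g n * pt r t ^+ n by [].
  by apply: eq_bigr => n _; rewrite fc tcg /pt exprMn mulrA.
apply: lerD => //; apply: le_trans (csum N); apply: ler_sum => n _; rewrite fc.
rewrite normcMr normcXn normc_real gtr0_norm// exprMn ler_piMr ?sqr_ge0//.
by rewrite exprn_ile1 ?exprn_ge0 ?(ltW r0)// exprn_ile1 ?(ltW r0)// ltW.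
Qed.

End Majorant.

(** * From quadratic means to H^p: dilates and polynomials *)

Section Density.
Variable R : realType.
Local Notation C := (R[i]^o).
Implicit Types (n m N : nat) (r s t q p : R) (f g k : C -> C) (u v : R -> R) (z w a : C).

(** Subordination to the identity, whose constant is 1, after dividing the radii by [s]. *)
Lemma mean_powR_mono g q r s : holo g -> 2^-1 <= q -> 0 <= r <= s -> s < 1 ->
  mean (fun t => cnorm (g (pt r t)) `^ q) <= mean (fun t => cnorm (g (pt s t)) `^ q).
Proof.
move=> hg q2 /andP[r0 rs] s1; have [<-//|rs'] := eqVneq r s.
have {rs'}rs : r < s by rewrite lt_neqAle rs'.
have s0 : 0 < s by apply: le_lt_trans rs.
have rs1 : 0 <= r / s < 1 by rewrite divr_ge0 ?(ltW s0)// ltr_pdivrMr// mul1r.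
have := @littlewood_scaled R g (fun z => z) q (r / s) s hg (@holo_id R) (fun _ h => h) q2.
rewrite normc_0 addr0 subr0 divr1 mul1r => /(_ (introT andP (conj s0 s1)) rs1).
have E t : s%:C * pt (r / s) t = pt r t.
  by rewrite /pt mulrA -real_complexM mulrCA mulfV ?gt_eqF// mulr1.
by under eq_mean do rewrite E.
Qed.

Lemma powR_add_le p (x y : R) : 0 <= p -> 0 <= x -> 0 <= y ->
  (x + y) `^ p <= 2 `^ p * (x `^ p + y `^ p).
Proof.
move=> p0 x0 y0; wlog xy : x y x0 y0 / x <= y.
  by move=> H; have [/H->//|/ltW/H] := leP x y; rewrite addrC [y `^ p + _]addrC; exact.
apply: (@le_trans _ _ ((2 * y) `^ p)).
  by apply: ge0_ler_powR => //; rewrite ?nnegrE ?addr_ge0 ?mulr_ge0//; lra.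
by rewrite powRM// ler_wpM2l ?powR_ge0// lerDr powR_ge0.
Qed.

Lemma powR_le_mul p (x M : R) : 1 <= p -> 0 <= x <= M -> x `^ p <= M `^ (p - 1) * x.
Proof.
move=> p1 /andP[x0 xM]; rewrite -mulr_powRB1//; last by lra.
rewrite mulrC ler_wpM2r//; apply: ge0_ler_powR; rewrite ?nnegrE//; first by lra.
exact: le_trans xM.
Qed.

(* Where |k1| or |k2| exceeds 2 K0, the larger of them is far from k0. *)
Lemma split_bound p (K0 M : R) (f1 f2 b1 b2 k0 k1 k2 : C) : 1 <= p -> 0 <= K0 -> M = 2 * K0 ->
  f1 = b1 * k1 ^+ 2 -> f2 = b2 * k2 ^+ 2 -> cnorm b1 <= 1 -> cnorm b2 <= 1 ->
  cnorm f1 `^ p <= cnorm k1 ^+ 2 -> cnorm f2 `^ p <= cnorm k2 ^+ 2 -> cnorm k0 <= K0 ->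
  cnorm (f1 - f2) `^ p <=
  (2 * M ^+ 2) `^ (p - 1) * (M ^+ 2 + 2 * M) * (cnorm (b1 - b2) + cnorm (k1 - k2)) +
  2 `^ p * 8 * (cnorm (k1 - k0) ^+ 2 + cnorm (k2 - k0) ^+ 2).
Proof.
move=> p1 K00 ME E1 E2 b1l b2l f1l f2l k0l.
have M0 : 0 <= M by rewrite ME mulr_ge0.
have p0 : 0 <= p by lra.
have [n1 n2 n3 n4] : [/\ 0 <= cnorm (b1 - b2), 0 <= cnorm (k1 - k2), 0 <= cnorm k1 & 0 <= cnorm k2].
  by split; exact: normc_ge0.
have A0 : 0 <= (2 * M ^+ 2) `^ (p - 1) * (M ^+ 2 + 2 * M) * (cnorm (b1 - b2) + cnorm (k1 - k2)).
  rewrite !mulr_ge0 ?powR_ge0 ?addr_ge0 ?sqr_ge0//; exact: mulr_ge0.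
have B0 : 0 <= 2 `^ p * 8 * (cnorm (k1 - k0) ^+ 2 + cnorm (k2 - k0) ^+ 2).
  by rewrite !mulr_ge0 ?powR_ge0 ?addr_ge0 ?sqr_ge0.
have [/andP[k1M k2M]|] := boolP ((cnorm k1 <= M) && (cnorm k2 <= M)).
  apply: (@le_trans _ _ ((2 * M ^+ 2) `^ (p - 1) * (M ^+ 2 + 2 * M) * (cnorm (b1 - b2) + cnorm (k1 - k2)))); last by rewrite lerDl.
  have kM x : cnorm x <= M -> cnorm (x ^+ 2) <= M ^+ 2.
    by move=> xM; rewrite normcXn lerXn2r ?nnegrE ?normc_ge0.
  have fM b x : cnorm b <= 1 -> cnorm x <= M -> cnorm (b * x ^+ 2) <= M ^+ 2.
    move=> bl /kM xM; rewrite normcMr -[leRHS]mul1r; apply: ler_pM => //; exact: normc_ge0.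
  apply: le_trans (powR_le_mul (M := 2 * M ^+ 2) p1 _) _.
    rewrite normc_ge0 /= E1 E2; apply: le_trans (normcBle _ _) _.
    by have := fM b1 k1 b1l k1M; have := fM b2 k2 b2l k2M; lra.
  rewrite -mulrA ler_wpM2l ?powR_ge0//.
  have -> : f1 - f2 = (b1 - b2) * k1 ^+ 2 + b2 * ((k1 - k2) * (k1 + k2)) by rewrite E1 E2; ring.
  apply: le_trans (normcDle _ _) _.
  have T1 : cnorm ((b1 - b2) * k1 ^+ 2) <= cnorm (b1 - b2) * M ^+ 2.
    by rewrite normcMr ler_wpM2l// kM.
  have T2 : cnorm (b2 * ((k1 - k2) * (k1 + k2))) <= cnorm (k1 - k2) * (2 * M).
    rewrite normcMr -[leRHS]mul1r; apply: ler_pM; rewrite ?normc_ge0//.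
    rewrite normcMr ler_wpM2l//; apply: le_trans (normcDle _ _) _; lra.
  apply: (le_trans (lerD T1 T2)); rewrite mulrDl !mulrDr.
  have := mulr_ge0 n1 M0; have := mulr_ge0 n2 (sqr_ge0 M).
  move: (cnorm (b1 - b2)) (cnorm (k1 - k2)) => x y; lra.
have far x : M < cnorm x -> cnorm x ^+ 2 <= 4 * cnorm (x - k0) ^+ 2.
  move=> Mx; have := normc_sub_ge x k0; have := normc_ge0 x; have := normc_ge0 (x - k0).
  move: (cnorm (x - k0)) (cnorm x) k0l Mx; rewrite ME => y xx k0l Mx y0 x0 xy; nra.
have bigmax : M < Num.max (cnorm k1) (cnorm k2) ->
    Num.max (cnorm k1) (cnorm k2) ^+ 2 <= 4 * (cnorm (k1 - k0) ^+ 2 + cnorm (k2 - k0) ^+ 2).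
  have := sqr_ge0 (cnorm (k1 - k0)); have := sqr_ge0 (cnorm (k2 - k0)).
  have := far k1; have := far k2.
  by case: (leP (cnorm k1) (cnorm k2)) => _ h1 h2 h3 h4 ?; [have := h1 _|have := h2 _]; lra.
rewrite negb_and -!ltNge -lt_max => /bigmax bm.
apply: (@le_trans _ _ (2 `^ p * 8 * (cnorm (k1 - k0) ^+ 2 + cnorm (k2 - k0) ^+ 2))); last by rewrite lerDr.
apply: (@le_trans _ _ ((cnorm f1 + cnorm f2) `^ p)).
  by apply: ge0_ler_powR; rewrite ?nnegrE ?addr_ge0 ?normc_ge0// normcBle.
apply: (le_trans (powR_add_le p0 (normc_ge0 _) (normc_ge0 _))).
rewrite -mulrA ler_wpM2l ?powR_ge0//.
have le1 : cnorm k1 ^+ 2 <= Num.max (cnorm k1) (cnorm k2) ^+ 2.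
  by rewrite lerXn2r ?nnegrE ?le_max ?n3 ?lexx.
have le2 : cnorm k2 ^+ 2 <= Num.max (cnorm k1) (cnorm k2) ^+ 2.
  by rewrite lerXn2r ?nnegrE ?le_max ?n3 ?lexx ?orbT.
move: bm le1 le2; lra.
Qed.

(** Factor f = B k^2. Both [B], bounded by 1, and [k] have bounded quadratic means, so their dilates
    are Cauchy in quadratic mean, and [split_bound] transfers this to p-th powers of [f]. *)
Lemma hardy_cauchy f p (A e : R) : holo f -> 1 <= p ->
  (forall s, 0 < s < 1 -> mean (fun t => cnorm (f (pt s t)) `^ p) <= A) -> 0 < e ->
  exists2 r0, 0 < r0 < 1 & forall r s, r0 <= r < 1 -> r0 <= s < 1 ->
  mean (fun t => cnorm (f (pt r t) - f (pt s t)) `^ p) <= e.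
Proof.
move=> hf p1 fA e0; have p0 : 0 < p by lra.
have [h [hh fh h2]] := harmonic_majorant hf p1 fA.
(* The summand 1 gives |k| >= 1, as Re h >= 0. So [k] can be inverted, and |f| <= |k|^2 holds also
   where |f| <= 1. *)
pose k z := 1 + h z.
have hk : holo k by apply: holoD => //; exact: holo_cst.
have h0 z : cnorm z < 1 -> 0 <= cre (h z) by move=> z1; apply: le_trans (fh z z1); exact: powR_ge0.
have kh z : 1 + cre (h z) <= cnorm (k z).
  by apply: le_trans (Re_le_normc _); rewrite creD cre1.
have k1 z : cnorm z < 1 -> 1 <= cnorm (k z).
  by move=> z1; apply: le_trans (kh z); rewrite lerDl h0.
have k0 z : cnorm z < 1 -> k z != 0.
  by move=> z1; apply: normc_neq0; apply: lt_le_trans (k1 z z1).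
have fk z : cnorm z < 1 -> cnorm (f z) `^ (p / 2) <= cnorm (k z).
  by move=> z1; apply: le_trans (fh z z1) _; apply: le_trans (kh z); rewrite lerDr.
have fk2 z : cnorm z < 1 -> cnorm (f z) `^ p <= cnorm (k z) ^+ 2.
  move=> z1; have -> : p = p / 2 * 2%:R by lra.
  rewrite powRrM powR_mulrn ?powR_ge0// lerXn2r ?nnegrE ?powR_ge0 ?normc_ge0//.
  exact: fk.
pose B z := f z * (k z ^+ 2)^-1.
have hB : holo B.
  apply: holoM => //; apply: holoV; first exact: holoX.
  by move=> z z1; rewrite expf_neq0// k0.
have fB z : cnorm z < 1 -> f z = B z * k z ^+ 2.
  by move=> z1; rewrite /B divfK// expf_neq0// k0.
have B1 z : cnorm z < 1 -> cnorm (B z) <= 1.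
  move=> z1; rewrite /B normcMr normc_inv normcXn ler_pdivrMr ?mul1r; last first.
    by rewrite exprn_gt0// (lt_le_trans _ (k1 z z1)).
  have [f1|f1] := leP (cnorm (f z)) 1.
    by apply: (le_trans f1); rewrite exprn_ege1// k1.
  apply: le_trans (fk2 z z1); rewrite -[leLHS]powRr1 ?normc_ge0//.
  by apply: ler_powR => //; exact: ltW.
have kA r : 0 < r < 1 -> mean2 (fun t => k (pt r t)) <= 2 * (1 + 4 * A).
  move=> r01; have /andP[r0 r1] := r01.
  have ch : cont (fun t => h (pt r t)) by apply: cont_holo; rewrite ?r1 ?ltW.
  apply: (@le_trans _ _ (mean (fun t => 2 * (1 + cnorm (h (pt r t)) ^+ 2)))); last first.
    rewrite meanZ ?meanD ?mean_cst; [|contt..].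
    by have := h2 r r01; rewrite /mean2; lra.
  rewrite /mean2; apply: mean_le => [||t]; [|contt|].
    by rewrite /k; contt.
  have := normcDle 1 (h (pt r t)); rewrite normc_1 -/(k _).
  have := normc_ge0 (k (pt r t)); have := normc_ge0 (h (pt r t)).
  move: (cnorm (h _)) (cnorm (k _)) => x y x0 y0 yx.
  have : y ^+ 2 <= (1 + x) ^+ 2 by rewrite lerXn2r// nnegrE addr_ge0.
  have := sqr_ge0 (1 - x); rewrite !expr2; lra.
have BA r : 0 < r < 1 -> mean2 (fun t => B (pt r t)) <= 1 ^+ 2.
  move=> /andP[r0 r1]; apply: mean2_le_bound => [|t]; first by apply: cont_holo; rewrite ?r1 ?ltW.
  by apply: B1; rewrite normc_pt// ltW.
have P0 : 0 < 2 `^ p * 8 :> R by rewrite mulr_gt0// powR_gt0.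
have e1 : 0 < e / (2 `^ p * 8) / 4 by rewrite !divr_gt0.
(* On the circle of radius [rk], [k] serves as the bounded reference function of [split_bound]. Its
   bound fixes the truncation level [M] before the accuracy [d] is chosen. *)
have [rk rk01 Hk] := h2_cauchy hk kA e1; have /andP[rk0 rk1] := rk01.
have [K0 K00 HK0] := holo_circle_bound hk (introT andP (conj (ltW rk0) rk1)).
set M := 2 * K0; set AM := (2 * M ^+ 2) `^ (p - 1) * (M ^+ 2 + 2 * M).
have AM0 : 0 <= AM.
  by rewrite mulr_ge0 ?powR_ge0// addr_ge0 ?sqr_ge0// !mulr_ge0.
have D0 : 0 < AM + 1 by lra.
set d := e / 4 / (AM + 1); have d0 : 0 < d by rewrite !divr_gt0.
have d2 : 0 < d ^+ 2 by rewrite exprn_gt0.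
have [r1 r101 H1] := h2_cauchy hk kA d2.
have [r2 r201 H2] := h2_cauchy hB BA d2.
have small (u : R -> C) : cont u -> mean2 u <= d ^+ 2 -> mean (fun t => cnorm (u t)) <= d.
  move=> cu u2; apply: le_trans (mean_norm_le cu d0) _.
  have : mean2 u / d <= d by rewrite ler_pdivrMr// -expr2.
  lra.
exists (Num.max rk (Num.max r1 r2)).
  move: rk01 r101 r201 => /andP[? ?] /andP[? ?] /andP[? ?].
  by rewrite lt_max !gt_max; apply/andP; split; [apply/orP; left|apply/and3P; split].
move=> r s; rewrite !ge_max => /andP[/and3P[rkr r1r r2r] rl] /andP[/and3P[rks r1s r2s] sl].
have rr : 0 <= r < 1 by rewrite rl andbT (le_trans (ltW rk0)).
have ss : 0 <= s < 1 by rewrite sl andbT (le_trans (ltW rk0)).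
have kk : 0 <= rk < 1 by rewrite rk1 ltW.
have [cf cf'] : cont (fun t => f (pt r t)) /\ cont (fun t => f (pt s t)) by split; exact: cont_holo.
have [cB cB'] : cont (fun t => B (pt r t)) /\ cont (fun t => B (pt s t)) by split; exact: cont_holo.
have [ck ck'] : cont (fun t => k (pt r t)) /\ cont (fun t => k (pt s t)) by split; exact: cont_holo.
have ck0 : cont (fun t => k (pt rk t)) by exact: cont_holo.
pose X t : R := AM * (cnorm (B (pt r t) - B (pt s t)) + cnorm (k (pt r t) - k (pt s t))) +
  2 `^ p * 8 * (cnorm (k (pt r t) - k (pt rk t)) ^+ 2 + cnorm (k (pt s t) - k (pt rk t)) ^+ 2).
apply: (@le_trans _ _ (mean X)).
  apply: mean_le => [||t]; [|by rewrite /X; contt|].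
    by apply: cont_powR_normc => //; contt.
  have pr : cnorm (pt r t) < 1 by rewrite normc_pt//; case/andP: rr.
  have ps : cnorm (pt s t) < 1 by rewrite normc_pt//; case/andP: ss.
  by apply: (@split_bound p K0 M) => //; [exact: fB|exact: fB|exact: B1|exact: B1|exact: fk2|exact: fk2].
rewrite /X meanD ?meanZ ?meanD; [|contt..].
have := Hk r rk; have := Hk s rk; rewrite rkr rks rl sl rk1 lexx => /(_ isT isT) T1 /(_ isT isT) T2.
have T3 := small _ (ccontB cB cB') (H2 r s (introT andP (conj r2r rl)) (introT andP (conj r2s sl))).
have T4 := small _ (ccontB ck ck') (H1 r s (introT andP (conj r1r rl)) (introT andP (conj r1s sl))).
rewrite /mean2 in T1 T2.
have T5 : AM * (d + d) <= e / 2.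
  have : AM * d <= e / 4 by rewrite /d mulrCA ler_piMr ?divr_ge0 ?(ltW e0)// ler_pdivrMr// mul1r lerDl.
  lra.
have T6 : 2 `^ p * 8 * (e / (2 `^ p * 8) / 4 + e / (2 `^ p * 8) / 4) = e / 2.
  by move: (2 `^ p * 8) P0 => P P0; field; rewrite gt_eqF.
have -> : e = e / 2 + e / 2 by lra.
apply: lerD.
  by apply: le_trans T5; rewrite ler_wpM2l// lerD.
by rewrite -[X in _ <= X]T6 ler_wpM2l ?(ltW P0)// lerD.
Qed.

(** A dilate of [f] is close to [f] in the mean, and on the disc it is a uniform limit of its Taylor
    polynomials. *)
Lemma poly_dense f p (A e : R) : holo f -> 1 <= p ->
  (forall s, 0 < s < 1 -> mean (fun t => cnorm (f (pt s t)) `^ p) <= A) -> 0 < e ->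
  exists N (c : nat -> C), forall r, 0 <= r < 1 ->
  mean (fun t => cnorm (f (pt r t) - \sum_(n < N) c n * pt r t ^+ n) `^ p) <= e.
Proof.
move=> hf p1 fA e0; have p0 : 0 < p by lra.
have P0 : 0 < 2 `^ p :> R by exact: powR_gt0.
have e1 : 0 < e / 2 / 2 `^ p by rewrite !divr_gt0.
have [r0 /andP[r00 r01] H] := hardy_cauchy hf p1 fA e1.
set rho := (1 + r0) / 2; have rho1 : 0 < rho < 1 by rewrite /rho; apply/andP; split; lra.
have /andP[q0 q1] := rho1.
have hfr : holo (fun z => f (rho%:C * z)).
  apply: (holo_comp _ hf); first by apply: holoM; [exact: holo_cst|exact: holo_id].
  by move=> z; exact: scale_lt1.
set d := (e / 2 / 2 `^ p) `^ p^-1; have d0 : 0 < d by exact: powR_gt0.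
have dp : d `^ p = e / 2 / 2 `^ p by rewrite -powRrM mulVf ?gt_eqF// powRr1// ltW.
have [N HN] := taylor_approx hf (introT andP (conj (ltW q0) q1)) d0.
exists N, (fun n => tc f n * rho%:C ^+ n).
set P := fun z => \sum_(n < N) tc f n * rho%:C ^+ n * z ^+ n.
have hP : holo P.
  by apply: holo_sum => n; apply: holoM; [exact: holo_cst|exact/holoX/holo_id].
have hD := holoB hf hfr; have hD2 := holoB hfr hP; have hD3 := holoB hf hP.
have B1 r : 0 <= r < 1 -> mean (fun t => cnorm (f (pt r t) - f (rho%:C * pt r t)) `^ p) <= e / 2 / 2 `^ p.
  move=> /andP[rr0 rr1].
  (* Means grow with the radius, so the estimate may be made at a larger radius [s]; taking s >= r0
     / rho puts both [s] and rho s above [r0]. *)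
  set s := Num.max r (Num.max r0 (r0 / rho)).
  have s1 : s < 1 by rewrite !gt_max rr1 r01 ltr_pdivrMr// mul1r /rho; lra.
  have rs : 0 <= r <= s by rewrite rr0 le_max lexx.
  have q2 : 2^-1 <= p by lra.
  apply: le_trans (mean_powR_mono hD q2 rs s1) _.
  under eq_mean do rewrite /pt mulrA -real_complexM.
  apply: H; first by rewrite s1 andbT !le_max lexx orbT.
  have r0s : r0 / rho <= s by rewrite !le_max lexx !orbT.
  apply/andP; split; first by rewrite mulrC -ler_pdivrMr.
  by apply: le_lt_trans s1; rewrite ler_piMl ?(ltW q1)//; case/andP: rs => /le_trans; apply.
move=> r rr; have /andP[rr0 rr1] := rr.
have cD := cont_holo hD rr; have cD2 := cont_holo hD2 rr; have cD3 := cont_holo hD3 rr.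
apply: (@le_trans _ _ (mean (fun t => 2 `^ p * (cnorm (f (pt r t) - f (rho%:C * pt r t)) `^ p +
    cnorm (f (rho%:C * pt r t) - P (pt r t)) `^ p)))).
  apply: mean_le => [||t].
  - by apply: cont_powR_normc => //; exact: cD3.
  - apply: contM; first exact: cont_cst.
    by apply: contD; exact: cont_powR_normc.
  apply: le_trans (powR_add_le (ltW p0) (normc_ge0 _) (normc_ge0 _)).
  apply: ge0_ler_powR; rewrite ?nnegrE ?addr_ge0 ?normc_ge0 ?(ltW p0)//.
  have -> : f (pt r t) - P (pt r t) = (f (pt r t) - f (rho%:C * pt r t)) + (f (rho%:C * pt r t) - P (pt r t)) by ring.
  exact: normcDle.
have c1 := cont_powR_normc p0 cD; have c2 := cont_powR_normc p0 cD2.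
rewrite meanZ ?meanD//; last exact: contD.
have B2 : mean (fun t => cnorm (f (rho%:C * pt r t) - P (pt r t)) `^ p) <= e / 2 / 2 `^ p.
  apply: mean_bound => // t; rewrite -dp; apply: ge0_ler_powR; rewrite ?nnegrE ?normc_ge0 ?(ltW p0) ?(ltW d0)//.
  have -> : P (pt r t) = \sum_(n < N) tc f n * (rho%:C * pt r t) ^+ n.
    by move: (pt r t) => x; apply: eq_bigr => n _; rewrite exprMn mulrA.
  apply: HN => //; rewrite normcMr normc_real gtr0_norm// normc_pt//.
  by rewrite ler_piMr ?ltW.
have -> : e = 2 `^ p * (e / 2 / 2 `^ p + e / 2 / 2 `^ p).
  by move: (2 `^ p) P0 => x x0; field; rewrite gt_eqF.
rewrite ler_wpM2l ?(ltW P0)//.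
exact: lerD (B1 r rr) B2.
Qed.

End Density.

(** * Radial limits *)

Section Primitives.
Variable R : realType.
Local Notation C := (R[i]^o).
Local Notation mu := (@lebesgue_measure R).
Implicit Types (n m N : nat) (r s t : R) (u v : R -> R).
Local Notation D := (`[0, 2 * pi]%classic : set R).

Lemma integral_mean u : cont u ->
  (\int[mu]_(t in D) (u t)%:E)%E = (2 * pi * mean u)%:E.
Proof.
move=> cu; rewrite /mean mulrA mulfV ?gt_eqF ?pi2_gt0// mul1r.
rewrite /rint /Rintegral fineK//; apply: integrable_fin_num => //.
exact: con_integrable (conT 0 (2 * pi) cu).
Qed.

Lemma nneseries_le (a : nat -> R) (B : R) : (forall n, 0 <= a n) ->
  (forall N, \sum_(n < N) a n <= B) -> (\sum_(n <oo) (a n)%:E <= B%:E)%E.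
Proof.
move=> a0 aB; apply: lime_le; first by apply: is_cvg_nneseries => n _ _; rewrite lee_fin.
by apply: nearW => N; rewrite big_mkord sumEFin lee_fin.
Qed.

(** The sum of the increments in absolute value has integral at most 4 pi, so it is finite almost
    everywhere. *)
Lemma ae_cvg (u_ : nat -> R -> R) : (forall n, cont (u_ n)) ->
  (forall n, mean (fun t => `|u_ n.+1 t - u_ n t|) <= 2^-1 ^+ n) ->
  {ae mu, forall t, D t -> cvgn (fun n => u_ n t)}.
Proof.
move=> cu um; have mD : measurable D by [].
pose w n t : R := `|u_ n.+1 t - u_ n t|.
have cw n : cont (w n) by apply: cont_normr; exact: contB.
have mw n := measurable_int _ (con_integrable (conT 0 (2 * pi) (cw n))).
have w0 n t : (0 <= (w n t)%:E)%E by rewrite lee_fin normr_ge0.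
pose g : R -> \bar R := fun t => (\sum_(n <oo) (w n t)%:E)%E.
have g0 t : (0 <= g t)%E by apply: nneseries_ge0.
have ig : mu.-integrable D g.
  apply/integrableP; split.
    by apply: (@ge0_emeasurable_sum _ _ _ D (fun n t => (w n t)%:E) xpredT) => // n _; exact: mw.
  under eq_integral => t _ do rewrite gee0_abs//.
  rewrite /g integral_nneseries//.
  apply: (@le_lt_trans _ _ (2 * pi * 2)%:E); last exact: ltry.
  have -> : (\sum_(n <oo) \int[mu]_(t in D) (w n t)%:E = \sum_(n <oo) (2 * pi * mean (w n))%:E)%E.
    by apply: eq_eseriesr => n _; exact: integral_mean.
  have P0 := ltW (pi2_gt0 R).
  apply: nneseries_le => [n|N].
    by rewrite mulr_ge0// mean_ge0// => t; rewrite normr_ge0.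
  rewrite -mulr_sumr ler_wpM2l//.
  apply: (@le_trans _ _ (\sum_(n < N) 2^-1 ^+ n)); first by apply: ler_sum => n _; exact: um.
  have := @geometric_tail R 2^-1 0 N; rewrite big_mkord expr0 => H.
  have E2 : 1 - 2^-1 = 2^-1 :> R by lra.
  move: H; rewrite E2 invrK mul1r; apply; first by lra.
  by rewrite invf_lt1// ltr1n.
have gae : {ae mu, forall x, D x -> g x \is a fin_num} := @integrable_ae _ _ R mu D mD g ig.
move: gae; apply: filterS; first exact: (ae_filter_ringOfSetsType mu).
move=> t H /H gfin.
have cs : cvgn (series (fun n => u_ n.+1 t - u_ n t)).
  apply: normed_cvg; apply: nondecreasing_is_cvgn.
    by apply: nondecreasing_series => n _ _; exact: normr_ge0.
  exists (fine (g t)) => _ [N _ <-] /=; rewrite -lee_fin fineK// /series /= -sumEFin.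
  by apply: nneseries_lim_ge => n _ _.
have -> : (fun n => u_ n t) = (fun n => u_ 0 t + series (fun n => u_ n.+1 t - u_ n t) n).
  apply: funext => n; rewrite /series /= telescope_sumr//; ring.
by apply: is_cvgD => //; exact: is_cvg_cst.
Qed.

Lemma rint_primitive u : cont u ->
  exists I, forall t, 0 <= t <= 2 * pi -> is_derive t 1 I (u t) /\ I t - I 0 = rint 0 t u.
Proof.
move=> cu; have i1 x : mu.-integrable `[-1, x]%classic (EFin \o u) := con_integrable (conT (-1) x cu).
(* Starting at -1 makes 0 an interior point, so the derivative there is two-sided. *)
exists (fun x => rint (-1) x u) => t /andP[t0 t2].
have [] := @continuous_FTC1_closed _ u (-1) t (t + 1) _ (i1 _) _ (contP cu (x := t)).
- by rewrite ltrDl.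
- by apply: lt_le_trans t0; rewrite ltrN10.
move=> d1 d2; split; first by apply: DeriveDef; [exact: d1|rewrite -derive1E; exact: d2].
by rewrite (rint_split (b := 0) _ t0 (conT _ _ cu)) ?lerN10//; ring.
Qed.

(* The functions rint 0 t (u_ n) are uniformly close to the primitive of the
   pointwise limit of u_, which is differentiable at its Lebesgue points. *)
Lemma limit_primitive (u_ : nat -> R -> R) (M : R) : (forall n, cont (u_ n)) ->
  (forall n t, `|u_ n t| <= M) ->
  (forall n, mean (fun t => `|u_ n.+1 t - u_ n t|) <= 2^-1 ^+ n) ->
  exists I : R -> R,
    (forall e, 0 < e -> \forall n \near \oo, forall t, 0 <= t <= 2 * pi -> `|rint 0 t (u_ n) - I t| <= e) /\
    {ae mu, forall t, 0 < t < 2 * pi -> derivable I t 1}.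
Proof.
move=> cu uM um; have mD : measurable D by [].
(* The upper limit is measurable without exception and equals the pointwise limit wherever that
   exists. *)
pose f : R -> R := (fun t => limn_sup (u_ ^~ t)) \_ D.
have M0 : 0 <= M by apply: le_trans (normr_ge0 _) (uM 0%N 0).
have mu_ n := measurable_int mu (con_integrable (conT 0 (2 * pi) (cu n))).
have mf : measurable_fun [set: R] f.
  apply/(measurable_restrictT _ _).1 => //; apply: measurable_fun_limn_sup.
  - by move=> t _; exists M => _ [n _ <-]; apply: le_trans (ler_norm _) (uM n t).
  - by move=> t _; exists (- M) => _ [n _ <-]; have := uM n t; rewrite ler_norml => /andP[].
  - by move=> n; apply/measurable_EFinP; exact: mu_.
have mf' : measurable_fun D (EFin \o f).
  by apply/measurable_EFinP; apply: measurable_funS mf.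
have uf : {ae mu, forall t, D t -> (EFin \o u_ n) t @[n --> \oo] --> (EFin \o f) t}.
  have := ae_cvg cu um; apply: filterS; first exact: (ae_filter_ringOfSetsType mu).
  move=> t H Dt; have Hf : u_ n t @[n --> \oo] --> f t.
    have -> : f t = limn_sup (u_ ^~ t) by rewrite /f patchE mem_set.
    by rewrite cvg_limn_supE; exact: H.
  by apply: (cvg_comp (fun n => u_ n t) (fun x => x%:E) Hf); exact: cvg_refl.
have iM : mu.-integrable D (EFin \o cst M).
  by apply: con_integrable; exact: con_cst.
have uM' : {ae mu, forall t n, D t -> (`|(EFin \o u_ n) t| <= (EFin \o cst M) t)%E}.
  by apply: aeW => t n _ /=; rewrite lee_fin.
have [iF F0 _] := @dominated_convergence _ _ R mu _ mD _ _ _ mu_ mf' uf iM uM'.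
have ifT : mu.-integrable [set: R] (EFin \o f).
  have := (@integrable_mkcond _ _ R mu D (EFin \o f) mD).1 iF.
  suff -> : (EFin \o f) \_ D = EFin \o f by [].
  by apply: funext => t; rewrite patchE; case: ifP => tD //=; rewrite /f patchE tD.
exists (fun t => (\int[mu]_(x in `[0, t]) f x)%R); split.
- move=> e e0; have := F0 => /fine_cvgP[Ffin /cvgrPdist_le/(_ e e0)].
  move: Ffin; apply: filterS2 => n Ffin /=; rewrite sub0r normrN => Fe t /andP[t0 t2].
  have sub : `[0, t]%classic `<=` D.
    by move=> x; rewrite /= !in_itv/= => /andP[-> xt]; exact: le_trans xt t2.
  have i1 : mu.-integrable `[0, t]%classic (EFin \o u_ n) := con_integrable (conT 0 t (cu n)).
  have i2 : mu.-integrable `[0, t]%classic (EFin \o f) by apply: integrableS iF.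
  have i3 : mu.-integrable `[0, t]%classic (EFin \o (fun x => u_ n x - f x)).
    have mt : measurable (`[0, t]%classic : set R) by [].
    exact: (@integrableB _ _ R mu _ mt _ _ i1 i2).
  rewrite /rint -RintegralB//; apply: (le_trans (le_normr_Rintegral _ i3)) => //.
  apply: le_trans Fe; apply: le_trans (ler_norm _).
  rewrite /Rintegral; apply: fine_le => //.
    apply: integrable_fin_num => //.
    exact: (integrable_norm i3).
  apply: ge0_subset_integral => //.
  have i4 : mu.-integrable D (EFin \o (fun x => u_ n x - f x)).
    exact: (@integrableB _ _ R mu _ mD _ _ (con_integrable (conT 0 (2 * pi) (cu n))) iF).
  exact: (measurable_int _ (integrable_norm i4)).
have L := open_integrable_locally openT ifT.
have i0 y : mu.-integrable [set` Interval (BLeft 0) (BRight y)] (EFin \o f).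
  by apply: integrableS ifT.
have := FTC1 i0 L; apply: filterS; first exact: (ae_filter_ringOfSetsType mu).
move=> t H /andP[t0 _]; have [] := H _ => //.
Qed.

End Primitives.

(** * Fatou's theorem for bounded holomorphic functions *)

Section Fatou.
Variable R : realType.
Local Notation C := (R[i]^o).
Local Notation mu := (@lebesgue_measure R).
Implicit Types (n m N : nat) (r s t x e : R) (u v : R -> R) (z w : C).

Lemma one_sub_cos (y : R) : 1 - cos y = 2 * sin (y / 2) ^+ 2.
Proof.
have {1}-> : y = (y / 2) *+ 2 by rewrite -mulr_natr divfK.
by rewrite cos_mulr2n cos2sin2; ring.
Qed.

(** Where the cosine exceeds 1/2, the mean value theorem gives sin (y / 2) >= y / 4 for y >= 0. *)
Lemma one_sub_cos_near : exists2 d : R, 0 < d &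
  forall y, `|y| < d -> y ^+ 2 <= 8 * (1 - cos y).
Proof.
have /cvgrPdist_lt/(_ 2^-1) : cos y @[y --> (0:R)] --> cos 0 by exact: continuous_cos.
rewrite invr_gt0 ltr0n => /(_ isT)/nbhs_normP[d /= d0 Hd]; exists d => // y yd.
rewrite -(cos_norm y) -(real_normK (num_real y)) one_sub_cos.
move: (normr_ge0 y) yd; move: `|y| => {}y; rewrite le_eqVlt => /predU1P[<- _|y0 yd].
  by rewrite mul0r sin0 expr0n/= !mulr0.
have y2 : 0 < y / 2 by rewrite divr_gt0.
have [c /andP[c0 cy] Ec] := MVT y2 (fun x _ => is_derive_sin x)
  (continuous_subspaceT (@continuous_sin R)).
rewrite !bnd_simp in c0 cy.
have cd : `|0 - c| < d by rewrite sub0r normrN gtr0_norm//; lra.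
have := Hd c cd; rewrite cos0 => /(le_lt_trans (ler_norm _)) cc.
rewrite sin0 !subr0 in Ec; rewrite Ec.
have : 2^-1 * (y / 2) <= cos c * (y / 2) by rewrite ler_wpM2r ?(ltW y2)//; lra.
have : 0 <= 2^-1 * (y / 2) by rewrite mulr_ge0 ?invr_ge0// ltW.
move: (cos c * (y / 2)) => X; nra.
Qed.

Lemma one_sub_cos_gt0 (y : R) : y != 0 -> `|y| < 2 * pi -> 0 < 1 - cos y.
Proof.
move=> y0 y2; rewrite -cos_norm one_sub_cos mulr_gt0// exprn_gt0// sin_gt0_pi//.
by rewrite divr_gt0 ?normr_gt0//= ltr_pdivrMr// mulrC.
Qed.

Lemma one_sub_cos_far x d : 0 < x < 2 * pi -> 0 < d -> exists2 m : R, 0 < m &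
  forall t, 0 <= t <= 2 * pi -> d <= `|t - x| -> m <= 1 - cos (t - x).
Proof.
move=> /andP[x0 x2] d0.
(* The added term is twice the positive part of d - |t - x|. So [g] equals 1 - cos away from [x] and
   is positive everywhere on the interval; compactness makes its minimum positive. *)
pose g t : R := (1 - cos (t - x)) + ((d - `|t - x|) + `|d - `|t - x| |).
have cg : continuous g.
  move=> t; apply: cvgD.
    apply: cvgB; first exact: cvg_cst.
    apply: (cvg_comp (fun t => t - x) (@cos R)); last exact: continuous_cos.
    by apply: cvgB; [exact: cvg_id|exact: cvg_cst].
  have H : d - `|y - x| @[y --> t] --> d - `|t - x|.
    apply: cvgB; first exact: cvg_cst.
    by apply: cvg_norm; apply: cvgB; [exact: cvg_id|exact: cvg_cst].
  by apply: cvgD => //; exact: cvg_norm.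
have [c cI Hc] := EVT_min (ltW (pi2_gt0 R)) (continuous_subspaceT cg).
move: cI; rewrite in_itv/= => /andP[c0 c2].
exists (g c) => [|t tI dt].
  have [cd|cd] := ltP `|c - x| d.
    apply: ltr_wpDl; first by have := cos_le1 (c - x); lra.
    have A0 : 0 < d - `|c - x| by lra.
    by rewrite (gtr0_norm A0) addr_gt0.
  have c3 := ler_norm (- (d - `|c - x|)); rewrite normrN in c3.
  apply: ltr_pwDl; last by lra.
  apply: one_sub_cos_gt0.
    by rewrite -normr_gt0 (lt_le_trans d0).
  by rewrite ltr_norml; apply/andP; split; lra.
have := Hc t; rewrite in_itv/= => /(_ tI) /le_trans; apply.
have A0 : d - `|t - x| <= 0 by lra.
by rewrite /g (ler0_norm A0) subrr addr0.
Qed.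

(** [pden] is |1 - r cis y|^2, [pker] the Poisson kernel in terms of the angle, and [dpker] its
    derivative in the angle. *)
Definition pden r y : R := 1 - 2 * r * cos y + r ^+ 2.
Definition pker r y : R := (1 - r ^+ 2) / pden r y.
Definition dpker r y : R := - ((1 - r ^+ 2) * (2 * r * sin y)) / pden r y ^+ 2.

Lemma pdenE r y : pden r y = (1 - r) ^+ 2 + 2 * r * (1 - cos y).
Proof. by rewrite /pden; ring. Qed.

Lemma pden_ge r y : 0 <= r -> (1 - r) ^+ 2 <= pden r y.
Proof.
by move=> r0; rewrite pdenE lerDl mulr_ge0 ?mulr_ge0//; have := cos_le1 y; lra.
Qed.

Lemma pden_gt0 r y : 0 <= r < 1 -> 0 < pden r y.
Proof.
move=> /andP[r0 r1]; apply: lt_le_trans (pden_ge y r0).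
by rewrite exprn_gt0// subr_gt0.
Qed.

Lemma pois_pker r x t : 0 <= r < 1 -> pois (pt r x) t = pker r (t - x).
Proof.
move=> /andP[r0 r1]; rewrite poisE ?normc_pt// /pker; congr (_ / _).
rewrite /pt -mulrA cis_conj -cisD sqr_normcE !cpartE cre_cis cim_cis.
have -> : pden r (t - x) = 1 - 2 * r * cos (x - t) + r ^+ 2.
  by rewrite /pden -cosN opprB.
have := cos2Dsin2 (x - t); move: (cos (x - t)) (sin (x - t)) => c s cs.
transitivity (1 - 2 * r * c + r ^+ 2 * (c ^+ 2 + s ^+ 2)); first by ring.
by rewrite cs mulr1.
Qed.

Lemma is_derive_pker r x t : 0 <= r < 1 ->
  is_derive t 1 (fun t => pker r (t - x)) (dpker r (t - x)).
Proof.
move=> r01; have D0 : pden r (t - x) != 0 by rewrite gt_eqF// pden_gt0.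
have dd : is_derive t 1 (fun t => pden r (t - x)) (2 * r * sin (t - x)).
  rewrite /pden; apply: is_derive_eq; rewrite /GRing.scale /=; ring.
have dV := is_deriveV (f := fun t => pden r (t - x)) D0 dd.
have := is_deriveM (is_derive_cst (1 - r ^+ 2) t 1) dV.
rewrite /pker /dpker => H; apply: (is_derive_eq H); rewrite /GRing.scale /=.
by field.
Qed.

Lemma con_derive a b u v : (forall t, a <= t <= b -> is_derive t 1 u (v t)) -> con a b u.
Proof.
move=> du; split => x xab; apply: differentiable_continuous; apply/derivable1_diffP.
by have [] := du x xab.
Qed.

Lemma rint_parts (a b : R) (J j P q : R -> R) : a <= b -> con a b j -> con a b q ->
  (forall t, a <= t <= b -> is_derive t 1 J (j t)) ->
  (forall t, a <= t <= b -> is_derive t 1 P (q t)) ->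
  rint a b (fun t => j t * P t) = J b * P b - J a * P a - rint a b (fun t => J t * q t).
Proof.
move=> ab cj cq dJ dP; have cJ := con_derive dJ; have cP := con_derive dP.
have [c1 c2] : con a b (fun t => j t * P t) /\ con a b (fun t => J t * q t).
  by split; exact: conM.
have F : rint a b (fun t => j t * P t + J t * q t) = J b * P b - J a * P a.
  apply: (rint_FTC (U := fun t => J t * P t)) => // [|t tab]; first exact: conD.
  have := is_deriveM (dJ t tab) (dP t tab).
  by move=> H; apply: (is_derive_eq H); rewrite /GRing.scale /=; ring.
by rewrite -F rintD// addrK.
Qed.

Lemma cont_dpker r x : 0 <= r < 1 -> cont (fun t => dpker r (t - x)).
Proof.
move=> r01; have cs (f : R -> R) : continuous f -> cont (fun t => f (t - x)).
  move=> cf; split => t; apply: (continuous_comp (f := fun t => t - x) (g := f)); last exact: cf.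
  by apply: cvgB; [exact: cvg_id|exact: cvg_cst].
have c1 := cs _ (@continuous_cos R); have c2 := cs _ (@continuous_sin R).
have c3 : cont (fun t => pden r (t - x)).
  rewrite /pden; apply: contD; last exact: cont_cst.
  by apply: contB; [exact: cont_cst|apply: contM => //; exact: cont_cst].
rewrite /dpker; apply: contM.
  apply: contN; apply: contM; first exact: cont_cst.
  by apply: contM => //; exact: cont_cst.
split => t; apply: cvgV; first by rewrite expf_neq0// gt_eqF// pden_gt0.
exact: (contP (contX 2 c3)).
Qed.

Lemma cont_pker r x : 0 <= r < 1 -> cont (fun t => pker r (t - x)).
Proof.
move=> r01; split => t; apply: differentiable_continuous; apply/derivable1_diffP.
by have [] := is_derive_pker x t r01.
Qed.

Lemma pker_ge0 r y : 0 <= r < 1 -> 0 <= pker r y.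
Proof.
move=> r01; rewrite divr_ge0 ?(ltW (pden_gt0 _ r01))// subr_ge0 exprn_ile1//; lra.
Qed.

(** The angular derivative weighted by the distance is dominated by the kernel itself. Hence an
    error o(|t - x|) in the primitive gives o(1) after integration by parts. *)
Lemma dpker_near r y : 0 <= r < 1 -> y ^+ 2 <= 8 * (1 - cos y) ->
  `|y * dpker r y| <= 4 * pker r y.
Proof.
move=> r01 yc; have /andP[r0 r1] := r01; have D0 := pden_gt0 y r01.
have r2 : 0 <= 1 - r ^+ 2 by rewrite subr_ge0 exprn_ile1// ltW.
have ys : `|y * sin y| <= 4 * (1 - cos y).
  have c0 : 0 <= 1 - cos y by rewrite subr_ge0 cos_le1.
  have c1 := cos_geN1 y; rewrite -(@ler_pXn2r _ 2) ?nnegrE ?mulr_ge0//.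
  rewrite real_normK ?num_real// exprMn sin2cos2.
  have -> : (4 * (1 - cos y)) ^+ 2 = 8 * (1 - cos y) * (2 * (1 - cos y)) by ring.
  have -> : 1 - cos y ^+ 2 = (1 - cos y) * (1 + cos y) by ring.
  apply: ler_pM => //; first exact: sqr_ge0.
  by rewrite mulrC ler_wpM2r//; lra.
have -> : y * dpker r y = - (pker r y * (2 * r * (y * sin y)) / pden r y).
  by rewrite /dpker /pker; field; rewrite gt_eqF.
have P0 := pker_ge0 y r01.
rewrite normrN; move: (pker r y) P0 => P P0.
rewrite normrM normrM normrM (ger0_norm P0) normrM (ger0_norm r0) (ger0_norm (ler0n _ 2)).
rewrite normfV (gtr0_norm D0) ler_pdivrMr// [4 * _]mulrC -[_ * 4 * _]mulrA ler_wpM2l//.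
apply: (@le_trans _ _ (2 * r * (4 * (1 - cos y)))).
  by rewrite ler_wpM2l// mulr_ge0.
by rewrite pdenE; have := sqr_ge0 (1 - r); have := mulr_ge0 r0 (normr_ge0 (y * sin y)); nra.
Qed.

Lemma dpker_far r y (m : R) : 2^-1 <= r < 1 -> 0 < m <= 1 - cos y ->
  `|dpker r y| <= (1 - r ^+ 2) / m ^+ 2.
Proof.
move=> /andP[r2 r1] /andP[m0 my]; have r0 : 0 < r by move: r2; clear; lra.
have q0 : 0 <= 1 - r ^+ 2 by rewrite subr_ge0 exprn_ile1// ltW.
have Dm : 2 * r * m <= pden r y.
  rewrite pdenE; apply: (@le_trans _ _ (2 * r * (1 - cos y))); last by rewrite lerDr sqr_ge0.
  by rewrite ler_wpM2l// mulr_ge0// ltW.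
have rm : 0 < 2 * r * m by rewrite !mulr_gt0.
have D0 : 0 < pden r y by exact: lt_le_trans Dm.
rewrite /dpker mulNr normrN !normrM (ger0_norm q0) (gtr0_norm r0) ger0_norm// normfV.
rewrite (ger0_norm (sqr_ge0 _)) -!mulrA ler_wpM2l//.
rewrite mulrA mulrA ler_pdivrMr ?exprn_gt0// ler_pdivlMl ?exprn_gt0//.
apply: (@le_trans _ _ (m ^+ 2 * (2 * r))).
  by rewrite ler_wpM2l ?sqr_ge0// ler_piMr ?mulr_ge0 ?(ltW r0)// ler_norml sin_geN1 sin_le1.
apply: (@le_trans _ _ ((2 * r * m) ^+ 2)); last by rewrite lerXn2r ?nnegrE ?(ltW rm) ?(ltW D0).
rewrite exprMn mulrC ler_wpM2r ?sqr_ge0//.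
rewrite expr2 ler_peMr ?mulr_ge0 ?(ltW r0)//; lra.
Qed.

Lemma pker_far r y (m : R) : 2^-1 <= r < 1 -> 0 < m <= 1 - cos y ->
  pker r y <= (1 - r ^+ 2) / m.
Proof.
move=> /andP[r2 r1] /andP[m0 my]; have r0 : 0 < r by move: r2; clear; lra.
have q0 : 0 <= 1 - r ^+ 2 by rewrite subr_ge0 exprn_ile1// ltW.
have Dm : m <= pden r y.
  rewrite pdenE; apply: (@le_trans _ _ (2 * r * (1 - cos y))); last by rewrite lerDr sqr_ge0.
  by nra.
by rewrite /pker ler_wpM2l// lef_pV2 ?posrE// (lt_le_trans m0).
Qed.

Lemma dpker_bound r y : 0 <= r < 1 -> `|dpker r y| <= 2 / (1 - r) ^+ 4.
Proof.
move=> r01; have /andP[r0 r1] := r01; have D := pden_ge y r0; have D0 := pden_gt0 y r01.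
have h : 0 < 1 - r by lra.
have q0 : 0 <= 1 - r ^+ 2 by rewrite subr_ge0 exprn_ile1// ltW.
rewrite /dpker mulNr normrN normrM normfV (ger0_norm (sqr_ge0 _)).
apply: ler_pM; rewrite ?invr_ge0 ?sqr_ge0//; last first.
  rewrite lef_pV2 ?posrE ?exprn_gt0//.
  have -> : (1 - r) ^+ 4 = ((1 - r) ^+ 2) ^+ 2 by rewrite -exprM.
  by rewrite lerXn2r ?nnegrE ?sqr_ge0 ?(ltW D0).
rewrite !normrM (ger0_norm q0) (ger0_norm r0) ger0_norm// -[leRHS]mul1r.
apply: ler_pM => //; first by rewrite !mulr_ge0.
  by rewrite lerBlDr lerDl sqr_ge0.
rewrite -mulrA -[leRHS]mulr1 ler_wpM2l//; apply: mulr_ile1 => //; first exact: ltW.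
by rewrite ler_norml sin_geN1 sin_le1.
Qed.

Lemma pker_period r x : pker r (2 * pi - x) = pker r (0 - x).
Proof.
rewrite /pker /pden; have -> : cos (2 * pi - x) = cos (0 - x) => //.
by rewrite sub0r addrC mulr_natl cosD2pi.
Qed.

Lemma rint_pker r x : 0 <= r < 1 -> rint 0 (2 * pi) (fun t => pker r (t - x)) = 2 * pi.
Proof.
move=> r01; have Pn : 2 * pi != 0 :> R by rewrite gt_eqF ?pi2_gt0.
have zr : cnorm (pt r x) < 1 by case/andP: r01 => r0 r1; rewrite normc_pt.
have <- : rint 0 (2 * pi) (pois (pt r x)) = rint 0 (2 * pi) (fun t => pker r (t - x)).
  by apply: eq_rint => t _; rewrite pois_pker.
have := mean_pois zr; rewrite /mean => Mp.
by apply: (mulfI (invr_neq0 Pn)); rewrite Mp mulVf.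
Qed.

(* Integrating the Poisson formula by parts against E(t) = int_0^t u - J0 - l(t - x). *)
Lemma poisson_parts f r s x (l J0 : R) : holo f -> 0 < s < 1 -> 0 <= r < 1 ->
  let u t := cre (f (pt s t)) in
  2 * pi * (cre (f (s%:C * pt r x)) - l) =
  (rint 0 (2 * pi) u - 2 * pi * l) * pker r (0 - x) -
  rint 0 (2 * pi) (fun t => (rint 0 t u - J0 - l * (t - x)) * dpker r (t - x)).
Proof.
move=> hf s01 r01 u; have /andP[s0 s1] := s01; have /andP[r0 r1] := r01.
have cf : cont (fun t => f (pt s t)) by apply: cont_holo; rewrite ?s1 ?ltW.
have cu : cont u by exact: cont_Re.
have zr : cnorm (pt r x) < 1 by rewrite normc_pt.
have P0 := ltW (pi2_gt0 R).
have Pn : 2 * pi != 0 :> R by rewrite gt_eqF ?pi2_gt0.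
have cp := cont_pker x r01.
have E1 : 2 * pi * cre (f (s%:C * pt r x)) = rint 0 (2 * pi) (fun t => u t * pker r (t - x)).
  rewrite -(poisson_formula hf s01 zr) Re_cmean /mean mulrA mulfV// mul1r.
  by apply: eq_rint => t _; rewrite creM cre_real cim_real mulr0 subr0 pois_pker.
have E2 := rint_pker x r01.
have [I HI] := rint_primitive cu.
have cd := cont_dpker x r01.
pose J t := rint 0 t u - J0 - l * (t - x).
have H := @rint_parts 0 (2 * pi) (fun t => I t - I 0 - J0 - l * (t - x)) (fun t => u t - l)
  (fun t => pker r (t - x)) (fun t => dpker r (t - x)) P0.
have {}H := H (conT _ _ (contB cu (cont_cst R l))) (conT _ _ cd).
have EJ : rint 0 (2 * pi) (fun t => (I t - I 0 - J0 - l * (t - x)) * dpker r (t - x)) =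
    rint 0 (2 * pi) (fun t => J t * dpker r (t - x)).
  by apply: eq_rint => t tI; have [_ ->] := HI t tI.
have [_ I2] := HI (2 * pi) (introT andP (conj P0 (lexx _))).
transitivity (rint 0 (2 * pi) (fun t => (u t - l) * pker r (t - x))).
  have El : 2 * pi * l = l * rint 0 (2 * pi) (fun t => pker r (t - x)) by rewrite E2 mulrC.
  rewrite mulrBr E1 El -rintZ; last exact: conT.
  rewrite -rintB; [|by apply: conT; exact: contM|by apply: conT; apply: contM => //; exact: cont_cst].
  by apply: eq_rint => t _; rewrite mulrBl.
have dE t : 0 <= t <= 2 * pi -> is_derive t 1 (fun t => I t - I 0 - J0 - l * (t - x)) (u t - l).
  move=> tI; have [dI _] := HI t tI.
  have : is_derive t 1 (fun t => I t - I 0 - J0 - l * (t - x)) (u t - 0 - 0 - l).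
    have d2 : is_derive t 1 (fun t => l * (t - x)) l.
      by apply: is_derive_eq; rewrite /GRing.scale /=; ring.
    by apply: is_deriveB; apply: is_deriveB; apply: is_deriveB.
  by rewrite !subr0.
rewrite (H dE (fun t _ => is_derive_pker x t r01)) EJ pker_period -I2.
by ring.
Qed.

(** Dilates of a bounded function are Cauchy in quadratic mean, so some radii give increments
    summable in mean, as [limit_primitive] requires. *)
Lemma fast_radii f (M : R) : holo f -> (forall z, cnorm z < 1 -> cnorm (f z) <= M) ->
  exists rho : nat -> R, [/\ forall n, 0 < rho n < 1, forall n, exhaust R n <= rho n &
    forall n, mean (fun t => `|cre (f (pt (rho n.+1) t)) - cre (f (pt (rho n) t))|) <= 2^-1 ^+ n].
Proof.
move=> hf fM.
have fA r : 0 < r < 1 -> mean2 (fun t => f (pt r t)) <= M ^+ 2.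
  move=> /andP[r0 r1]; apply: mean2_le_bound => [|t]; first by apply: cont_holo; rewrite ?r1 ?ltW.
  by apply: fM; rewrite normc_pt// ltW.
have d0 n : 0 < 2^-1 ^+ n :> R by rewrite exprn_gt0// invr_gt0.
have H n : exists r0, 0 < r0 < 1 /\ forall r s, r0 <= r < 1 -> r0 <= s < 1 ->
    mean2 (fun t => f (pt r t) - f (pt s t)) <= (2^-1 ^+ n) ^+ 2.
  have [r0 r01 Hr] := h2_cauchy hf fA (exprn_gt0 2 (d0 n)).
  by exists r0.
have [r0 Hr] := choice H.
(* The maximum runs over all thresholds up to [n], so rho n and rho n.+1 both exceed r0 n. *)
pose rho n := Num.max (exhaust R n) (\big[Num.max/0]_(j < n.+1) r0 j).
have rho01 n : 0 < rho n < 1.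
  have /andP[e0 e1] := exhaust01 R n; rewrite lt_max e0 /= gt_max e1 /=.
  elim/big_ind: _ => // [x y x1 y1|j _]; first by rewrite gt_max x1.
  by have [/andP[]] := Hr j.
have rho_ge n j : (j <= n)%N -> r0 j <= rho n.
  by move=> jn; rewrite le_max; apply/orP; right; exact: (le_bigmax _ (fun j : 'I_n.+1 => r0 j) (Ordinal (jn : (j < n.+1)%N))).
exists rho; split => // [n|n]; first by rewrite le_max lexx.
have /andP[p0 p1] := rho01 n; have /andP[q0 q1] := rho01 n.+1.
have [_ /(_ (rho n.+1) (rho n))] := Hr n.
rewrite p1 q1 !rho_ge// => /(_ isT isT) H2.
have c1 : cont (fun t => f (pt (rho n.+1) t)) by apply: cont_holo; rewrite ?q1 ?ltW.
have c2 : cont (fun t => f (pt (rho n) t)) by apply: cont_holo; rewrite ?p1 ?ltW.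
have cc := ccontB c1 c2.
apply: (@le_trans _ _ (mean (fun t => cnorm (f (pt (rho n.+1) t) - f (pt (rho n) t))))).
  apply: mean_le => [||t]; [by contt|by contt|].
  by apply: le_trans (normr_Re_le _); rewrite creD creN.
apply: le_trans (mean_norm_le cc (d0 n)) _.
have : mean2 (fun t => f (pt (rho n.+1) t) - f (pt (rho n) t)) / 2^-1 ^+ n <= 2^-1 ^+ n.
  by rewrite ler_pdivrMr// -expr2.
have half (a b : R) : b <= a -> (a + b) / 2 <= a by lra.
exact: half.
Qed.

Lemma radial_near f x (r e : R) (rho : nat -> R) : holo f -> 0 <= r < 1 -> 0 < e ->
  (forall n, 0 < rho n < 1) -> (forall n, exhaust R n <= rho n) ->
  \forall n \near \oo, cnorm (f (pt r x) - f ((rho n)%:C * pt r x)) < e.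
Proof.
move=> hf /andP[r0 r1] e0 rho01 rho_ge.
have z1 : cnorm (pt r x) < 1 by rewrite normc_pt.
have cf : f w @[w --> pt r x] --> f (pt r x) by exact: (derivable_continuous (holoP hf z1)).
move/cvgCP : cf => /(_ _ e0)/nbhs_normcP[d d0 Hd].
have := @exhaust_cvg R => /cvgrPdist_lt/(_ _ d0); apply: filterS => n Hn.
apply: Hd; rewrite normc_distC scale_sub normcMr normc_real.
have /andP[p0 p1] := rho01 n; have /andP[q0 q1] := exhaust01 R n.
rewrite gtr0_norm ?subr_gt0// in Hn; rewrite gtr0_norm ?subr_gt0//.
apply: le_lt_trans (_ : _ <= 1 - rho n) _; last by have := rho_ge n; lra.
by rewrite ler_piMr ?subr_ge0 ?ltW.
Qed.

(** At a point [x] where the limit primitive [I] has derivative [l], the function E t = I t - I x -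
    l (t - x) is o(|t - x|). The Poisson integral is integrated by parts against its approximations
    from finite radii, so no boundary integral of [f] is needed. *)
Lemma fatou_Re f (M : R) : holo f -> (forall z, cnorm z < 1 -> cnorm (f z) <= M) ->
  {ae mu, forall x, 0 < x < 2 * pi -> exists l, cre (f (pt r x)) @[r --> 1^'-] --> (l : R)}.
Proof.
move=> hf fM; have M0 : 0 <= M.
  by apply: le_trans (normc_ge0 (f 0)) (fM _ _); rewrite normc_0.
have [rho [rho01 rho_ge rhoC]] := fast_radii hf fM.
pose u n t := cre (f (pt (rho n) t)).
have cu n : cont (u n).
  by apply/cont_Re/cont_holo => //; have /andP[/ltW -> ->] := rho01 n.
have uM n t : `|u n t| <= M.
  apply: le_trans (normr_Re_le _) (fM _ _).
  by have /andP[p0 p1] := rho01 n; rewrite normc_pt ?ltW.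
have [I [Iu Id]] := limit_primitive cu uM rhoC.
move: Id; apply: filterS; first exact: (ae_filter_ringOfSetsType mu).
move=> x Hx x02; have /andP[x0 x2] := x02.
have dI := Hx x02; set l : R := 'D_1 I x.
have dI' : is_derive x 1 I l by exact: DeriveDef.
exists l; apply/cvgrPdist_le => e e0.
have P0 : 0 < 2 * pi :> R := pi2_gt0 R.
have [m' m'0 Hm'] := one_sub_cos_far x02 x0.
pose ep := e / 10; have ep0 : 0 < ep by rewrite divr_gt0.
have [d1 d10 Hd1] := one_sub_cos_near.
have [d2 d20 Hd2] : exists2 d : R, 0 < d & forall t, `|t - x| < d -> `|I t - I x - l * (t - x)| <= ep * `|t - x|.
  have /cvgrPdist_lt/(_ _ ep0) : h^-1 *: ((I \o shift x) (h *: 1) - I x) @[h --> 0^'] --> l := dI.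
  move=> /nbhs_normP[d /= d0 Hd]; exists d => // t tx.
  have [->|tx0] := eqVneq t x; first by rewrite !subrr mulr0 subr0 normr0 mulr0.
  have h0 : t - x != 0 by rewrite subr_eq0.
  have := Hd (t - x); rewrite /= sub0r normrN => /(_ tx h0) /ltW.
  rewrite /GRing.scale /= mulr1 subrK => Ht.
  have -> : I t - I x - l * (t - x) = - ((l - (t - x)^-1 * (I t - I x)) * (t - x)) by field.
  by rewrite normrN normrM ler_wpM2r.
set d := Num.min d1 d2; have d0 : 0 < d by rewrite lt_min d10.
have [m m0 Hm] := one_sub_cos_far x02 d0.
set K := 2 * pi * M; have K0 : 0 <= K by rewrite mulr_ge0// ltW.
have uK n t : 0 <= t <= 2 * pi -> `|rint 0 t (u n)| <= K.
  move=> /andP[t0 t2]; apply: (le_trans (normr_rint_le (conT 0 t (cu n)))).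
  apply: (@le_trans _ _ (rint 0 t (fun=> M))).
    by apply: rint_le => [||y _]; [apply: conT; exact: cont_normr|exact: con_cst|exact: uM].
  by rewrite rint_cst// subr0 mulrC ler_wpM2r.
set C0 := 2 * (K + 1) + `|l| * (2 * pi).
have IK t : 0 <= t <= 2 * pi -> `|I t| <= K + 1.
  move=> tI; have [n Hn] := filter_ex (Iu 1 ltr01).
  have -> : I t = rint 0 t (u n) - (rint 0 t (u n) - I t) by ring.
  by apply: (le_trans (ler_normB _ _)); rewrite lerD ?uK ?Hn.
have xI : 0 <= x <= 2 * pi by rewrite !ltW.
have tx t : 0 <= t <= 2 * pi -> `|t - x| <= 2 * pi.
  by move=> /andP[t0 t2]; rewrite ler_norml; apply/andP; split; lra.
have EC t : 0 <= t <= 2 * pi -> `|I t - I x - l * (t - x)| <= C0.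
  move=> tI; apply: (le_trans (ler_normB _ _)); rewrite normrM; apply: lerD.
    by apply: (le_trans (ler_normB _ _)); have := IK _ tI; have := IK _ xI; lra.
  by rewrite ler_wpM2l// tx.
have C00 : 0 <= C0 := le_trans (normr_ge0 _) (EC x xI).
(* Contributions away from [x] carry a factor 1 - r^2, which is made small by r to 1: [m'] serves
   the boundary term at angle 0, and [m] the part of the integral at distance at least [d]. *)
set Q := (K + 2 * pi * `|l|) / m' + 2 * pi * C0 / m ^+ 2.
have Q0 : 0 <= Q.
  have l0 := mulr_ge0 (ltW P0) (normr_ge0 l); have c0 := mulr_ge0 (ltW P0) C00.
  apply: addr_ge0; apply: divr_ge0 => //; last exact: sqr_ge0; last exact: ltW.
  exact: addr_ge0.
have del0 : 0 < ep / (Q + 1) by rewrite divr_gt0// ltr_wpDl.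
near=> r.
have r1 : r < 1 by near: r; exact: nbhs_left_lt.
have r2 : 2^-1 <= r by apply: ltW; near: r; apply: nbhs_left_gt; rewrite invf_lt1// ltr1n.
have r3 : 1 - r <= ep / (Q + 1).
  suff : 1 - ep / (Q + 1) < r by clear; lra.
  by near: r; apply: nbhs_left_gt; rewrite gtrBl.
have r0 : 0 < r by move: r2; clear; lra.
have r01 : 0 <= r < 1 by rewrite r1 ltW.
have rr : 2^-1 <= r < 1 by rewrite r2.
have q0 : 0 <= 1 - r ^+ 2 by rewrite subr_ge0 exprn_ile1// ltW.
(* This crude bound of the derivative blows up as r tends to 1, but [n] is chosen after [r], close
   enough to the primitive to compensate. *)
set Kr := 2 / (1 - r) ^+ 4.
have Kr0 : 0 < Kr by rewrite divr_gt0// exprn_gt0// subr_gt0.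
have eta0 : 0 < ep / (2 * Kr) by rewrite divr_gt0// mulr_gt0.
have [n [Hn1 Hn2]] := filter_ex (filterI (radial_near x hf r01 ep0 rho01 rho_ge) (Iu _ eta0)).
rewrite distrC; have PP := poisson_parts x l (rint 0 x (u n)) hf (rho01 n) r01.
have cd := cont_dpker x r01; have cp := cont_pker x r01.
set En := fun t => rint 0 t (u n) - rint 0 x (u n) - l * (t - x).
have bound t : 0 <= t <= 2 * pi ->
    `|En t * dpker r (t - x)| <= 4 * ep * pker r (t - x) + (C0 * ((1 - r ^+ 2) / m ^+ 2) + ep).
  move=> tI; set E := I t - I x - l * (t - x).
  have -> : En t = E + ((rint 0 t (u n) - I t) - (rint 0 x (u n) - I x)) by rewrite /En /E; ring.
  rewrite mulrDl; apply: (le_trans (ler_normD _ _)); rewrite addrA; apply: lerD; last first.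
    rewrite normrM; apply: (@le_trans _ _ ((ep / (2 * Kr) + ep / (2 * Kr)) * Kr)).
      apply: ler_pM => //; last exact: dpker_bound.
      by apply: (le_trans (ler_normB _ _)); apply: lerD; apply: Hn2.
    by rewrite le_eqVlt; apply/orP; left; apply/eqP; field; rewrite gt_eqF.
  have pk0 : 0 <= 4 * ep * pker r (t - x).
    by apply: mulr_ge0 (pker_ge0 _ r01); rewrite mulr_ge0// ltW.
  have far0 : 0 <= C0 * ((1 - r ^+ 2) / m ^+ 2).
    by rewrite mulr_ge0// divr_ge0// sqr_ge0.
  have [td|td] := ltP `|t - x| d; last first.
    apply: ler_wpDl => //; rewrite normrM; apply: ler_pM => //; first exact: EC.
    by apply: dpker_far => //; rewrite m0 Hm.
  apply: ler_wpDr => //; move: td; rewrite lt_min => /andP[td1 td2].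
  rewrite normrM; apply: (@le_trans _ _ (ep * `|t - x| * `|dpker r (t - x)|)).
    by rewrite ler_wpM2r// Hd2.
  have Hn := dpker_near r01 (Hd1 _ td1); rewrite normrM in Hn.
  rewrite -[ep * _ * _]mulrA; apply: le_trans (ler_wpM2l (ltW ep0) Hn) _.
  by rewrite [4 * ep]mulrC mulrA.
have [G HG] := rint_primitive (cu n).
have cG : con 0 (2 * pi) G by apply: (con_derive (v := u n)) => t /HG[].
have cE : con 0 (2 * pi) (fun t => G t - G 0 - rint 0 x (u n) - l * (t - x)).
  split => t tI; apply: cvgB.
    by apply: cvgB; [apply: cvgB; [exact: (conP cG)|exact: cvg_cst]|exact: cvg_cst].
  by apply: cvgM; [exact: cvg_cst|apply: cvgB; [exact: cvg_id|exact: cvg_cst]].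
have Epk := rint_pker x r01.
have R1 : `|rint 0 (2 * pi) (fun t => En t * dpker r (t - x))| <=
    2 * pi * (4 * ep + (C0 * ((1 - r ^+ 2) / m ^+ 2) + ep)).
  have -> : rint 0 (2 * pi) (fun t => En t * dpker r (t - x)) =
      rint 0 (2 * pi) (fun t => (G t - G 0 - rint 0 x (u n) - l * (t - x)) * dpker r (t - x)).
    by apply: eq_rint => t /HG[_ ->].
  have cEd := conM cE (conT 0 (2 * pi) cd).
  apply: (le_trans (normr_rint_le cEd)).
  apply: (@le_trans _ _ (rint 0 (2 * pi) (fun t => 4 * ep * pker r (t - x) + (C0 * ((1 - r ^+ 2) / m ^+ 2) + ep)))).
    apply: rint_le => [||t tI]; last by have [_ ->] := HG t tI; exact: bound.
      by apply: (con_comp (h := fun y : R => `|y|) cEd); exact: norm_continuous.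
    by apply: conT; apply: contD; [apply: contM => //; exact: cont_cst|exact: cont_cst].
  rewrite rintD; [|by apply: conT; apply: contM => //; exact: cont_cst|exact: con_cst].
  rewrite rintZ ?Epk ?rint_cst ?(ltW P0)//; last exact: conT.
  by rewrite subr0 -mulrDl mulrC.
have R2 : `|(rint 0 (2 * pi) (u n) - 2 * pi * l) * pker r (0 - x)| <=
    (K + 2 * pi * `|l|) * ((1 - r ^+ 2) / m').
  rewrite normrM; apply: ler_pM => //.
    apply: (le_trans (ler_normB _ _)); rewrite normrM (gtr0_norm P0); apply: lerD => //.
    by apply: uK; rewrite lexx ltW.
  rewrite ger0_norm ?pker_ge0//; apply: pker_far => //; rewrite m'0 Hm' ?lexx ?(ltW P0)//.
  by rewrite sub0r normrN gtr0_norm.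
have R3 : (1 - r ^+ 2) * Q <= 2 * ep.
  have : (1 - r) * Q <= ep.
    apply: (@le_trans _ _ (ep / (Q + 1) * Q)); first by rewrite ler_wpM2r.
    by rewrite mulrAC -mulrA ler_piMr ?(ltW ep0)// ler_pdivrMr ?mul1r ?lerDl// ltr_wpDl.
  have -> : 1 - r ^+ 2 = (1 - r) * (1 + r) by ring.
  have : 0 <= (1 - r) * Q by rewrite mulr_ge0// subr_ge0 ltW.
  by move=> y0 y1; rewrite mulrAC [2 * ep]mulrC; apply: ler_pM => //; move: r0 r1; clear; lra.
have R4 : 2 * pi * `|cre (f ((rho n)%:C * pt r x)) - l| <= 2 * pi * (5 * ep) + 2 * ep.
  rewrite -{1}(gtr0_norm P0) -normrM PP; apply: (le_trans (ler_normB _ _)).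
  apply: le_trans (lerD R2 R1) _; rewrite addrC.
  apply: le_trans (_ : _ <= 2 * pi * (5 * ep) + (1 - r ^+ 2) * Q) _; last by rewrite lerD2l.
  by rewrite /Q le_eqVlt; apply/orP; left; apply/eqP; ring.
have R5 : 2 <= 2 * pi :> R by have := @pi_ge2 R; clear; lra.
have R6 : `|cre (f ((rho n)%:C * pt r x)) - l| <= 6 * ep.
  rewrite -(ler_pM2l P0); apply: le_trans R4 _.
  by have := ler_wpM2r (ltW ep0) R5; clear; lra.
have -> : cre (f (pt r x)) - l = cre (f (pt r x) - f ((rho n)%:C * pt r x)) + (cre (f ((rho n)%:C * pt r x)) - l).
  by rewrite creD creN; ring.
apply: (le_trans (ler_normD _ _)); have := le_lt_trans (normr_Re_le _) Hn1.
have -> : e = 10 * ep by rewrite /ep; field.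
by move: R6 ep0; clear; lra.
Unshelve. all: by end_near. Qed.

Lemma ae_imp (P Q : R -> Prop) : {ae mu, forall t, P t} -> (forall t, P t -> Q t) ->
  {ae mu, forall t, Q t}.
Proof. by move=> HP PQ; move: HP; apply: filterS => //; exact: (ae_filter_ringOfSetsType mu). Qed.

Lemma ae_and (P Q : R -> Prop) : {ae mu, forall t, P t} -> {ae mu, forall t, Q t} ->
  {ae mu, forall t, P t /\ Q t}.
Proof.
move=> HP HQ; move: HP HQ; apply: filterS2; first exact: (ae_filter_ringOfSetsType mu).
by move=> t.
Qed.

Lemma ae_not_eq (a : R) : {ae mu, forall x, x != a}.
Proof.
exists [set a]; split => //; first exact: lebesgue_measure_set1.
by move=> x /= /negP; rewrite negbK => /eqP ->.
Qed.

Lemma fatou f (M : R) : holo f -> (forall z, cnorm z < 1 -> cnorm (f z) <= M) ->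
  {ae mu, forall t, t \in `[0, 2 * pi] -> exists l : C, f (pt r t) @[r --> 1^'-] --> l}.
Proof.
move=> hf fM; pose g z : C := - ci * f z.
have hg : holo g by apply: holoM => //; exact: holo_cst.
have ni : cnorm (ci : C) = 1.
  by apply/eqP; rewrite -(@eqrXn2 _ 2) ?normc_ge0// sqr_normcE cre_i cim_i; apply/eqP; ring.
have gM z : cnorm z < 1 -> cnorm (g z) <= M.
  by move=> z1; rewrite normcMr normcNE ni mul1r fM.
have gE z : cre (g z) = cim (f z) by rewrite !cpartE; ring.
have H := ae_and (ae_and (fatou_Re hf fM) (fatou_Re hg gM))
  (ae_and (ae_not_eq 0) (ae_not_eq (2 * pi))).
apply: (ae_imp H) => t [[H1 H2] [t0 t2]]; rewrite in_itv/= => /andP[le0 le2].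
have tI : 0 < t < 2 * pi by rewrite !lt_neqAle eq_sym t0 le0 t2.
have [x Hx] := H1 tI; have [y Hy] := H2 tI.
exists (Complex x y); apply/cvgCP => e e0; have e2 : 0 < e / 2 by rewrite divr_gt0.
move/cvgrPdist_lt : Hx => /(_ _ e2) Hx; move/cvgrPdist_lt : Hy => /(_ _ e2) Hy.
apply: filterS2 Hx Hy => r; rewrite gE => Hx Hy; apply: le_lt_trans (normc_leReIm _) _.
rewrite creD creN cimD cimN; rewrite /cre /cim /= in Hx Hy *; lra.
Qed.

End Fatou.

(** * Inner functions *)

Section Inner.
Variable R : realType.
Local Notation C := (R[i]^o).
Local Notation mu := (@lebesgue_measure R).
Implicit Types (n m k N : nat) (r s t e : R) (f g h phi : C -> C) (u v : R -> R) (z w b : C).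

Definition radial f t (l : C) := f (pt r t) @[r --> 1^'-] --> l.

(** Counterpart of [inner] for functions on the whole plane, of which only the values in the disc
    matter ([hinner_eq]). *)
Record hinner h : Prop := Hinner { hinner_holo : holo h;
  hinner_bounded : exists M : R, forall z, cnorm z < 1 -> cnorm (h z) <= M;
  hinner_radial : {ae mu, forall t, t \in `[0, 2 * pi] -> exists l, radial h t l /\ cnorm l = 1} }.

Lemma cont_exhaust f n : holo f -> cont (fun t => f (pt (exhaust R n) t)).
Proof. by move=> hf; apply: cont_holo => //; have /andP[/ltW -> ->] := exhaust01 R n. Qed.

Lemma pt_exhaust n t : cnorm (pt (exhaust R n) t) < 1.
Proof. by have /andP[e0 e1] := exhaust01 R n; rewrite normc_pt ?ltW. Qed.

Lemma radial_exhaust f t l : radial f t l ->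
  f (pt (exhaust R n) t) @[n --> \oo] --> l.
Proof.
move=> fl; apply: (cvg_comp (fun n => exhaust R n) (fun r => f (pt r t)) _ fl).
move=> A; rewrite /at_left /within /= => HA.
apply: (@filterS _ \oo _ _ _ _ (@exhaust_cvg R _ HA)) => n /=; apply.
by have /andP[_] := exhaust01 R n.
Qed.

Lemma mean_ae0 (u_ : nat -> R -> R) (M : R) : (forall n, cont (u_ n)) ->
  (forall n t, `|u_ n t| <= M) ->
  {ae mu, forall t, t \in `[0, 2 * pi] -> u_ n t @[n --> \oo] --> (0 : R)} ->
  forall e, 0 < e -> \forall n \near \oo, `|mean (u_ n)| < e.
Proof.
move=> cu uM u0 e e0; have := mean_cvg0 cu uM u0 => /cvgrPdist_lt/(_ _ e0).
by apply: filterS => n; rewrite sub0r normrN.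
Qed.

(** By dominated convergence the means of |f| over growing circles tend to 0, and Cauchy's formula
    bounds |f z| by such means. *)
Lemma bounded_radial0 f (M : R) : holo f -> (forall z, cnorm z < 1 -> cnorm (f z) <= M) ->
  {ae mu, forall t, t \in `[0, 2 * pi] -> radial f t 0} -> forall z, cnorm z < 1 -> f z = 0.
Proof.
move=> hf fM f0 z z1; have [r r01 zr] := mid_radius z1; have /andP[r0 r1] := r01.
have rz : 0 < 1 - cnorm z / r by rewrite subr_gt0 ltr_pdivrMr// mul1r.
apply/normc_eq0P/eqP; rewrite eq_le normc_ge0 andbT; apply/ler_addgt0Pr => e e0.
have e1 : 0 < e * (1 - cnorm z / r) by rewrite mulr_gt0.
have cn n : cont (fun t => cnorm (f (pt (exhaust R n) t))) by apply/cont_normc/cont_exhaust.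
have bn n t : `|cnorm (f (pt (exhaust R n) t))| <= M.
  by rewrite ger0_norm ?normc_ge0//; apply: fM; exact: pt_exhaust.
have zn : {ae mu, forall t, t \in `[0, 2 * pi] -> cnorm (f (pt (exhaust R n) t)) @[n --> \oo] --> (0 : R)}.
  apply: (ae_imp f0) => t H tI; rewrite -(normc_0 R).
  apply: (cvg_comp (fun n => f (pt (exhaust R n) t)) (fun x => cnorm x)); last exact: continuous_normc.
  exact: radial_exhaust (H tI).
have H := mean_ae0 cn bn zn e1.
have r1' : 1 - r > 0 by lra.
have := @exhaust_cvg R => /cvgrPdist_lt/(_ _ r1') H2.
have [n [Hn Hr]] := filter_ex (filterI H H2).
have /andP[p0 p1] := exhaust01 R n.
have rn : r < exhaust R n by have := le_lt_trans (ler_norm _) Hr; lra.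
rewrite add0r; apply: le_trans (cauchy_mean_bound hf (exhaust01 R n) (lt_trans zr rn)) _.
have d1 : cnorm z / exhaust R n <= cnorm z / r.
  by rewrite ler_wpM2l ?normc_ge0// lef_pV2 ?posrE// ltW.
have d2 : 0 < 1 - cnorm z / exhaust R n by lra.
rewrite ler_pdivrMr//; apply: le_trans (ltW (le_lt_trans (ler_norm _) Hn)) _.
by apply: ler_wpM2l; [exact: ltW|lra].
Qed.

Section Facts.
Variable h : C -> C.
Hypothesis ih : hinner h.

Lemma hinner_cvg (w : C -> R) : continuous w ->
  {ae mu, forall t, t \in `[0, 2 * pi] -> exists l, cnorm l = 1 /\
    w (h (pt (exhaust R n) t)) @[n --> \oo] --> w l}.
Proof.
move=> cw; apply: (ae_imp (hinner_radial ih)) => t H tI; have [l [Hl l1]] := H tI.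
have rl := radial_exhaust Hl; exists l; split => //.
exact: (cvg_comp (fun n => h (pt (exhaust R n) t)) w rl (cw l)).
Qed.

(** In the Poisson formula on growing circles, |h| may be replaced by 1 at a cost that dominated
    convergence sends to 0. *)
Lemma hinner_le1 z : cnorm z < 1 -> cnorm (h z) <= 1.
Proof.
move=> z1; have [M hM] := hinner_bounded ih; have hh := hinner_holo ih.
have cp := cont_pois z1.
have ch n := cont_exhaust n hh.
pose u_ n t : R := pois z t * (cnorm (h (pt (exhaust R n) t)) - 1).
have cu n : cont (u_ n) by apply: contM => //; apply: contB; [exact: cont_normc|exact: cont_cst].
set K := (1 + cnorm z) / (1 - cnorm z).
have uM n t : `|u_ n t| <= K * (M + 1).
  rewrite normrM; apply: ler_pM => //; first by rewrite ger0_norm ?pois_ge0// pois_le.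
  apply: (le_trans (ler_normB _ _)); rewrite normr1 lerD2r ger0_norm ?normc_ge0//.
  by apply: hM; exact: pt_exhaust.
have u0 : {ae mu, forall t, t \in `[0, 2 * pi] -> u_ n t @[n --> \oo] --> (0 : R)}.
  apply: (ae_imp (hinner_cvg (@continuous_normc R))) => t H tI; have [l [l1 Hl]] := H tI.
  rewrite -(mulr0 (pois z t)); apply: cvgM; first exact: cvg_cst.
  by rewrite -(subrr 1) -{2}l1; apply: cvgB => //; exact: cvg_cst.
apply/ler_addgt0Pr => e e0; have e2 : 0 < e / 2 by rewrite divr_gt0.
have [n [Hn1 Hn2]] := filter_ex (filterI (mean_ae0 cu uM u0 e2) (exhaust_near hh z1 e2)).
have B : cnorm (h ((exhaust R n)%:C * z)) <= 1 + mean (u_ n).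
  rewrite -(poisson_formula hh (exhaust01 R n) z1).
  apply: (le_trans (normc_cmean_le _)); first by apply: ccontM => //; exact: ccont_real.
  rewrite -(mean_pois z1) -meanD//; apply: mean_le => [||t].
  - by apply: cont_normc; apply: ccontM => //; exact: ccont_real.
  - exact: contD.
  by rewrite /u_ normcMr normc_real ger0_norm ?pois_ge0//; rewrite le_eqVlt; apply/orP; left; apply/eqP; ring.
have := normc_sub_ge (h z) (h ((exhaust R n)%:C * z)); have := ler_norm (mean (u_ n)).
move: Hn1 Hn2 B; rewrite /=; lra.
Qed.

(** The form in which unimodular boundary values are used below: it involves circles inside the disc
    only. *)
Lemma hinner_sqr_mean e : 0 < e ->
  \forall n \near \oo, mean (fun t => 1 - cnorm (h (pt (exhaust R n) t)) ^+ 2) < e.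
Proof.
move=> e0; have hh := hinner_holo ih; have ch n := cont_exhaust n hh.
have cn n : cont (fun t => 1 - cnorm (h (pt (exhaust R n) t)) ^+ 2).
  by apply: contB; [exact: cont_cst|apply: contX; exact: cont_normc].
have bn n t : `|1 - cnorm (h (pt (exhaust R n) t)) ^+ 2| <= 1.
  have h1 := hinner_le1 (pt_exhaust n t); have h0 := normc_ge0 (h (pt (exhaust R n) t)).
  have : cnorm (h (pt (exhaust R n) t)) ^+ 2 <= 1 by rewrite exprn_ile1.
  have := sqr_ge0 (cnorm (h (pt (exhaust R n) t))).
  by move=> ? ?; rewrite ger0_norm; lra.
have zn : {ae mu, forall t, t \in `[0, 2 * pi] ->
    1 - cnorm (h (pt (exhaust R n) t)) ^+ 2 @[n --> \oo] --> (0 : R)}.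
  apply: (ae_imp (hinner_cvg (@continuous_normc R))) => t H tI; have [l [l1 Hl]] := H tI.
  have := cvgB (cvg_cst (1 : R)) (cvgM Hl Hl); rewrite l1 mulr1 subrr; exact.
by have := mean_ae0 cn bn zn e0; apply: filterS => n; apply: le_lt_trans; exact: ler_norm.
Qed.

End Facts.

Lemma hinnerM h1 h2 : hinner h1 -> hinner h2 -> hinner (fun z => h1 z * h2 z).
Proof.
move=> i1 i2; split.
- exact: holoM (hinner_holo i1) (hinner_holo i2).
- exists 1 => z z1; rewrite normcMr mulr_ile1 ?normc_ge0//; exact: hinner_le1.
apply: (ae_imp (ae_and (hinner_radial i1) (hinner_radial i2))) => t [H1 H2] tI.
have [l1 [r1 n1]] := H1 tI; have [l2 [r2 n2]] := H2 tI.
exists (l1 * l2); split; last by rewrite normcMr n1 n2 mulr1.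
move: r1 r2; rewrite /radial => r1 r2; exact: (cvgM r1 r2).
Qed.

Lemma ae_cvg0 (u_ : nat -> R -> R) : (forall n, cont (u_ n)) -> (forall n t, 0 <= u_ n t) ->
  (forall n, mean (u_ n) <= 2^-1 ^+ n) ->
  {ae mu, forall t, t \in `[0, 2 * pi] -> u_ n t @[n --> \oo] --> (0 : R)}.
Proof.
move=> cu u0 um; pose v n t : R := \sum_(k < n) u_ k t.
have cv n : cont (v n).
  elim: n => [|n IH]; first by under [v _]funext do rewrite /v big_ord0; exact: cont_cst.
  have -> : v n.+1 = (fun t => v n t + u_ n t) by apply: funext => t; rewrite /v big_ord_recr.
  exact: contD.
have dv n t : v n.+1 t - v n t = u_ n t by rewrite /v big_ord_recr /= addrAC subrr add0r.
have vm n : mean (fun t => `|v n.+1 t - v n t|) <= 2^-1 ^+ n.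
  apply: le_trans (um n); rewrite le_eqVlt; apply/orP; left; apply/eqP.
  by apply: eq_mean => t; rewrite dv ger0_norm.
apply: (ae_imp (ae_cvg cv vm)) => t H tI.
have cvg_v : cvgn (fun n => v n t) by apply: H; exact: tI.
have -> : (fun n => u_ n t) = (fun n => v n.+1 t - v n t) by apply: funext => n; rewrite dv.
rewrite -(subrr (limn (fun n => v n t))); apply: cvgB => //.
by rewrite (cvg_shiftS (fun n => v n t)).
Qed.

(** Convergence in mean gives almost everywhere convergence to 0 along a fast subsequence, which
    identifies any limit of the full sequence. *)
Lemma mean_lim0_ae (u_ : nat -> R -> R) : (forall n, cont (u_ n)) -> (forall n t, 0 <= u_ n t) ->
  (forall e, 0 < e -> \forall n \near \oo, mean (u_ n) < e) ->
  {ae mu, forall t, t \in `[0, 2 * pi] -> forall l : R, u_ n t @[n --> \oo] --> l -> l = 0}.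
Proof.
move=> cu u0 um.
have H k : exists n, (k <= n)%N /\ mean (u_ n) <= 2^-1 ^+ k.
  have d0 : 0 < 2^-1 ^+ k :> R by rewrite exprn_gt0// invr_gt0.
  have K : \forall n \near \oo, (k <= n)%N by exists k.
  have [n [n1 n2]] := filter_ex (filterI (um _ d0) K).
  by exists n; split => //; exact: ltW.
have [nk Hnk] := choice H.
apply: (ae_imp (ae_cvg0 (fun k => cu (nk k)) (fun k => u0 (nk k)) (fun k => (Hnk k).2))).
move=> t Ht tI l ul; have H0 := Ht tI.
have nkoo : nk k @[k --> \oo] --> \oo.
  move=> A [N _ NA]; exists N => // k Nk; apply: NA => /=.
  by apply: leq_trans (Hnk k).1.
have H1 : u_ (nk k) t @[k --> \oo] --> l by exact: (cvg_comp nk (fun n => u_ n t) nkoo ul).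
by rewrite -(cvg_lim _ H1)// (cvg_lim _ H0).
Qed.

End Inner.

(** * Composition of inner functions *)

Section InnerComposition.
Variable R : realType.
Local Notation C := (R[i]^o).
Implicit Types (n m k N : nat) (r s t e : R) (f g h : C -> C) (u v : R -> R) (z w : C).

Section Star.
Variable phi : C -> C.
Hypotheses (ip : hinner phi) (p1 : forall z, cnorm z < 1 -> cnorm (phi z) < 1).
Let b := phi 0.
Let P n t : C := phi (pt (exhaust R n) t).

Let hp : holo phi. Proof. exact: hinner_holo. Qed.

Let cP n : cont (P n). Proof. exact: cont_exhaust. Qed.

Let P1 n t : cnorm (P n t) <= 1. Proof. by apply/ltW/p1/pt_exhaust. Qed.

Lemma cmean_inner_pow n k : cmean (fun t => P n t ^+ k) = b ^+ k.
Proof.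
by apply: (holo_mean (holoX k hp)); have /andP[/ltW -> ->] := exhaust01 R n.
Qed.

(** The integrand is phi^k |phi|^(2m). Replacing |phi|^(2m) by 1 costs at most m (1 - |phi|^2) by
    Bernoulli, small in mean since [phi] is inner. *)
Lemma cmean_inner_powD k m : cmean (fun t => P n t ^+ (m + k) * (P n t)^* ^+ m) @[n --> \oo] --> b ^+ k.
Proof.
apply/cvgCP => e e0; have e1 : 0 < e / (m%:R + 1) by rewrite divr_gt0// ltr_wpDl.
have := hinner_sqr_mean ip e1; apply: filterS => n Hn.
rewrite -(cmean_inner_pow n k) -cmeanB; [|by contt|].
  2: by apply: ccontM; [contt|apply: ccontX; contt].
apply: le_lt_trans (normc_cmean_le _) _.
  apply: ccontB; first by contt.
  by apply: ccontM; [contt|apply: ccontX; contt].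
apply: (@le_lt_trans _ _ (mean (fun t => m%:R * (1 - cnorm (P n t) ^+ 2)))).
  apply: mean_le => [||t].
  - apply: cont_normc; apply: ccontB; first by contt.
    by apply: ccontM; [contt|apply: ccontX; contt].
  - apply: contM; first exact: cont_cst.
    by apply: contB; [exact: cont_cst|apply: contX; exact: cont_normc].
  have P0 := normc_ge0 (P n t); have x1 : cnorm (P n t) ^+ 2 <= 1 by rewrite exprn_ile1.
  have x0 := sqr_ge0 (cnorm (P n t)).
  have -> : P n t ^+ k - P n t ^+ (m + k) * (P n t)^* ^+ m =
      P n t ^+ k * ((1 - (cnorm (P n t) ^+ 2) ^+ m)%:C).
    rewrite real_complexD real_complexN real_complexX -mulc_conj mulrDr exprD exprMn.
    by rewrite -[1%:C]/(1 : C) mulr1; ring.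
  rewrite normcMr normcXn normc_real ger0_norm ?subr_ge0 ?exprn_ile1//.
  rewrite -[leRHS]mul1r; apply: ler_pM; rewrite ?exprn_ge0 ?exprn_ile1 ?subr_ge0//.
    by rewrite exprn_ile1.
  have := @bernoulli_le R m (1 - cnorm (P n t) ^+ 2); rewrite subKr => H.
  have {}H : 1 - m%:R * (1 - cnorm (P n t) ^+ 2) <= (cnorm (P n t) ^+ 2) ^+ m.
    by apply: H; apply/andP; split; lra.
  by rewrite lerBlDl -lerBlDr.
rewrite meanZ; last first.
  by apply: contB; [exact: cont_cst|apply: contX; exact: cont_normc].
have m0 : 0 < m%:R + 1 :> R by rewrite ltr_wpDl.
apply: (@le_lt_trans _ _ ((m%:R + 1) * mean (fun t => 1 - cnorm (P n t) ^+ 2))).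
  rewrite ler_wpM2r ?lerDl//; apply: mean_ge0 => t.
  by rewrite subr_ge0 exprn_ile1 ?normc_ge0.
by rewrite mulrC -ltr_pdivlMr.
Qed.

(** The mixed moments of the Poisson measure at [b], which is the image of normalised arc length
    under the boundary values of [phi]. *)
Definition cpow (b : C) n m : C := if (m <= n)%N then b ^+ (n - m) else b^* ^+ (m - n).

Lemma cmean_inner_mixed n m : cmean (fun t => P k t ^+ n * (P k t)^* ^+ m) @[k --> \oo] --> cpow b n m.
Proof.
rewrite /cpow; case: leqP => nm.
  by have := @cmean_inner_powD (n - m) m; rewrite subnKC.
have H := @cmean_inner_powD (m - n) n; rewrite (subnKC (ltnW nm)) in H.
rewrite -conjcX; have -> : (fun k => cmean (fun t => P k t ^+ n * (P k t)^* ^+ m)) =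
    (fun k => (cmean (fun t => P k t ^+ m * (P k t)^* ^+ n))^*).
  apply: funext => k; rewrite -cmean_conj; last by apply: ccontM; [contt|apply: ccontX; contt].
  by apply: eq_cmean => t; rewrite conjcM !conjcX conjcK mulrC.
apply/cvgCP => e e0; move/cvgCP : H => /(_ e e0); apply: filterS => k.
by rewrite -conjcB normc_conj.
Qed.

(* Equal to |z - b|^2 on the unit circle. The image of normalised arc length under an inner
   function phi with phi 0 = b has density (1 - |b|^2) / |z - b|^2, so against this weight the
   powers of phi are orthogonal. *)
Definition bweight (b z : C) : C := (1 + cnorm b ^+ 2)%:C - b^* * z - b * z^*.

Lemma cont_bweight n : cont (fun t => bweight b (P n t)).
Proof. by apply: ccontB; [apply: ccontB|]; contt. Qed.

(** Off the diagonal the weight annihilates the geometric moments; on it, 1 + |b|^2 - 2 |b|^2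
    remains. *)
Lemma cpow_star n m : (1 + cnorm b ^+ 2)%:C * cpow b n m - b^* * cpow b n.+1 m - b * cpow b n m.+1 =
  (n == m)%:R * (1 - cnorm b ^+ 2)%:C.
Proof.
rewrite real_complexD [(1 - _)%:C]real_complexD real_complexN -mulc_conj -[1%:C]/(1 : C) /cpow.
have [nm|nm|->] := ltngtP n m.
- have [k Ek] : exists k, m = (n.+1 + k)%N by exists (m - n.+1)%N; rewrite subnKC.
  have -> : (if (m <= n.+1)%N then b ^+ (n.+1 - m) else b^* ^+ (m - n.+1)) = b^* ^+ k.
    by case: leqP; rewrite Ek ?addKn// -{2}[n.+1]addn0 leq_add2l leqn0 => /eqP ->; rewrite addn0 subnn !expr0.
  have -> : (m - n = k.+1)%N by rewrite Ek addSnnS addKn.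
  have -> : (m.+1 - n = k.+2)%N by rewrite Ek addSnnS -addnS addKn.
  by rewrite !exprS mul0r; ring.
- have [k Ek] : exists k, n = (m.+1 + k)%N by exists (n - m.+1)%N; rewrite subnKC.
  have -> : (m <= n.+1)%N by rewrite ltnW// ltnW.
  have -> : (n - m = k.+1)%N by rewrite Ek addSnnS addKn.
  have -> : (n - m.+1 = k)%N by rewrite Ek addKn.
  have -> : (n.+1 - m = k.+2)%N by rewrite Ek addSnnS -addnS addKn.
  by rewrite !exprS mul0r; ring.
by rewrite leqnSn subnn !subSnn expr0 !expr1 mul1r; ring.
Qed.

Lemma star n m : cmean (fun t => P k t ^+ n * (P k t)^* ^+ m * bweight b (P k t)) @[k --> \oo] -->
  (n == m)%:R * (1 - cnorm b ^+ 2)%:C.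
Proof.
rewrite -cpow_star.
have -> : (fun k => cmean (fun t => P k t ^+ n * (P k t)^* ^+ m * bweight b (P k t))) =
  (fun k => (1 + cnorm b ^+ 2)%:C * cmean (fun t => P k t ^+ n * (P k t)^* ^+ m) -
    b^* * cmean (fun t => P k t ^+ n.+1 * (P k t)^* ^+ m) -
    b * cmean (fun t => P k t ^+ n * (P k t)^* ^+ m.+1)).
  apply: funext => k; have c i j : cont (fun t => P k t ^+ i * (P k t)^* ^+ j).
    by apply: ccontM; [contt|apply: ccontX; contt].
  rewrite -!cmeanZ// -cmeanB; [|by apply: ccontM => //; exact: cont_cst..].
  rewrite -cmeanB; [|by apply: ccontB; apply: ccontM => //; exact: cont_cst|by apply: ccontM => //; exact: cont_cst].
  by apply: eq_cmean => t; rewrite /bweight !exprS; ring.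
have cM (c : C) i j := cvgM (cvg_cst c) (@cmean_inner_mixed i j).
by apply: cvgB; [apply: cvgB|]; exact: cM.
Qed.

Lemma clim_sum N (x_ : nat -> nat -> C) (l : nat -> C) :
  (forall i, (i < N)%N -> x_ i k @[k --> \oo] --> l i) ->
  \sum_(i < N) x_ i k @[k --> \oo] --> \sum_(i < N) l i.
Proof.
elim: N => [|N IH] H.
  rewrite big_ord0; have -> : (fun k => \sum_(i < 0) x_ i k) = (fun=> 0 : C).
    by apply: funext => k; rewrite big_ord0.
  exact: cvg_cst.
rewrite big_ord_recr; have -> : (fun k => \sum_(i < N.+1) x_ i k) = (fun k => \sum_(i < N) x_ i k + x_ N k).
  by apply: funext => k; rewrite big_ord_recr.
apply: cvgD; last exact: H.
by apply: IH => i iN; apply: H; exact: ltnW.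
Qed.

Let ccmul n m k : cont (fun t => P k t ^+ n * (P k t)^* ^+ m * bweight b (P k t)).
Proof.
apply: ccontM; last exact: cont_bweight.
by apply: ccontM; [contt|apply: ccontX; contt].
Qed.

Lemma star_poly (a : nat -> C) N m :
  cmean (fun t => (\sum_(i < N) a i * P k t ^+ i) * (P k t)^* ^+ m * bweight b (P k t)) @[k --> \oo] -->
  (if (m < N)%N then a m else 0) * (1 - cnorm b ^+ 2)%:C.
Proof.
have -> : (if (m < N)%N then a m else 0) * (1 - cnorm b ^+ 2)%:C =
    \sum_(i < N) a i * ((i == m :> nat)%:R * (1 - cnorm b ^+ 2)%:C).
  under eq_bigr do rewrite mulrA; rewrite -mulr_suml; congr (_ * _).
  case: ltnP => mN; last first.
    by rewrite big1// => i _; rewrite (ltn_eqF (leq_trans (ltn_ord i) mN)) mulr0.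
  rewrite (bigD1 (Ordinal mN))//= eqxx mulr1 big1 ?addr0// => i /eqP im.
  by case: eqP => [E|]; [case: im; exact: val_inj|rewrite mulr0].
have -> : (fun k => cmean (fun t => (\sum_(i < N) a i * P k t ^+ i) * (P k t)^* ^+ m * bweight b (P k t))) =
    (fun k => \sum_(i < N) a i * cmean (fun t => P k t ^+ i * (P k t)^* ^+ m * bweight b (P k t))).
  apply: funext => k; rewrite (eq_bigr (fun i : 'I_N => cmean (fun t => a i * (P k t ^+ i * (P k t)^* ^+ m * bweight b (P k t))))); last first.
    by move=> i _; rewrite cmeanZ.
  rewrite -cmean_sum; last by move=> i; apply: ccontM; [exact: cont_cst|exact: ccmul].
  by apply: eq_cmean => t; rewrite !mulr_suml; apply: eq_bigr => i _; rewrite !mulrA.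
apply: (@clim_sum N (fun i k => a i * cmean (fun t => P k t ^+ i * (P k t)^* ^+ m * bweight b (P k t)))
  (fun i => a i * ((i == m)%:R * (1 - cnorm b ^+ 2)%:C))) => i _.
exact: (cvgM (cvg_cst (a i)) (@star i m)).
Qed.

Lemma star_sq (a : nat -> C) N :
  mean (fun t => cnorm (\sum_(i < N) a i * P k t ^+ i) ^+ 2 * cre (bweight b (P k t))) @[k --> \oo] -->
  (\sum_(i < N) cnorm (a i) ^+ 2) * (1 - cnorm b ^+ 2).
Proof.
set q := fun k t => \sum_(i < N) a i * P k t ^+ i.
have cq k : cont (q k) by apply: ccont_sum => i; contt.
have -> : (\sum_(i < N) cnorm (a i) ^+ 2) * (1 - cnorm b ^+ 2) =
    cre (\sum_(m < N) (a m)^* * ((if (m < N)%N then a m else 0) * (1 - cnorm b ^+ 2)%:C)).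
  under [in RHS]eq_bigr => m _ do rewrite ltn_ord mulrA [_ * a m]mulrC mulc_conj.
  by rewrite -mulr_suml -creal_sum -real_complexM cre_real.
have -> : (fun k => mean (fun t => cnorm (q k t) ^+ 2 * cre (bweight b (P k t)))) =
    (fun k => cre (\sum_(m < N) (a m)^* * cmean (fun t => q k t * (P k t)^* ^+ m * bweight b (P k t)))).
  apply: funext => k.
  have c1 m : cont (fun t => q k t * (P k t)^* ^+ m * bweight b (P k t)).
    by apply: ccontM; [apply: ccontM => //; apply: ccontX; contt|exact: cont_bweight].
  rewrite (eq_bigr (fun m : 'I_N => cmean (fun t => (a m)^* * (q k t * (P k t)^* ^+ m * bweight b (P k t))))); last first.
    by move=> m _; rewrite cmeanZ.
  rewrite -cmean_sum; last by move=> m; apply: ccontM; [exact: cont_cst|exact: c1].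
  rewrite Re_cmean; apply: eq_mean => t.
  have -> : \sum_(m < N) (a m)^* * (q k t * (P k t)^* ^+ m * bweight b (P k t)) =
     (cnorm (q k t) ^+ 2)%:C * bweight b (P k t).
    rewrite -mulc_conj {2}/q conjc_sum mulr_sumr mulr_suml; apply: eq_bigr => m _.
    by rewrite conjcM conjcX -/(q k t); move: (q k t) => x; ring.
  by rewrite creM cre_real cim_real mul0r subr0.
apply: (cvg_comp _ (fun x : C => cre x)); last exact: continuous_Re.
apply: (@clim_sum N (fun m k => (a m)^* * cmean (fun t => q k t * (P k t)^* ^+ m * bweight b (P k t)))
  (fun m => (a m)^* * ((if (m < N)%N then a m else 0) * (1 - cnorm b ^+ 2)%:C))) => m _.
exact: (cvgM (cvg_cst (a m)^*) (@star_poly a N m)).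
Qed.

Lemma bweightE z : cre (bweight b z) = cnorm (z - b) ^+ 2 + (1 - cnorm z ^+ 2).
Proof. by rewrite /bweight !sqr_normcE !cpartE; ring. Qed.

Lemma bweight_ge0 z : cnorm z <= 1 -> 0 <= cre (bweight b z).
Proof.
by move=> z1; rewrite bweightE addr_ge0 ?sqr_ge0// subr_ge0 exprn_ile1 ?normc_ge0.
Qed.

Lemma normc_bweight_le z : cnorm z <= 1 -> cnorm (bweight b z) <= 4.
Proof.
move=> z1; have z0 := normc_ge0 z; have b0 := normc_ge0 b.
have b1 : cnorm b < 1 by apply: p1; rewrite normc_0.
have h : cnorm b * cnorm z <= 1 by rewrite mulr_ile1// ltW.
have h2 : cnorm b ^+ 2 <= 1 by rewrite exprn_ile1// ltW.
rewrite /bweight; apply: le_trans (normcBle _ _) _; rewrite normcMr normc_conj.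
have := normcBle ((1 + cnorm b ^+ 2)%:C) (b^* * z).
rewrite normcMr normc_conj normc_real ger0_norm ?addr_ge0 ?sqr_ge0//; lra.
Qed.

Lemma mean_bweight n : mean (fun t => cre (bweight b (P n t))) = 1 - cnorm b ^+ 2.
Proof.
rewrite -Re_cmean cmeanB; [|by apply: ccontB; contt|by contt].
rewrite cmeanB; [|by contt|by contt].
rewrite cmean_cst !cmeanZ; [|by contt|by contt].
have := cmean_inner_pow n 1; under eq_cmean do rewrite expr1.
rewrite expr1 => E; rewrite cmean_conj; last by contt.
by rewrite E mulc_conj [_ * b]mulrC mulc_conj !creD !creN !cre_real; ring.
Qed.

(** For a polynomial, tc f m (1 - |b|^2) is the limit of the weighted mean of (f \o phi)
    conj(phi)^m, and the weight is at most 4. Density and subordination extend this to [f]. The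
    bound is free of [A], which makes it uniform over the powers of an inverse of [phi]. *)
Lemma coef_comp_le f (A : R) m : holo f ->
  (forall s, 0 < s < 1 -> mean (fun t => cnorm (f (pt s t))) <= A) ->
  forall B : R, (forall s, 0 < s < 1 -> mean (fun t => cnorm (f (phi (pt s t)))) <= B) ->
  cnorm (tc f m) * (1 - cnorm b ^+ 2) <= 4 * B.
Proof.
move=> hf fA B fB.
have M1 (g : R -> C) : mean (fun t => cnorm (g t) `^ 1) = mean (fun t => cnorm (g t)).
  by apply: eq_mean => t; rewrite powRr1 ?normc_ge0.
have b1 : cnorm b < 1 by apply: p1; rewrite normc_0.
set K := (1 + cnorm b) / (1 - cnorm b).
have K0 : 0 < K.
  by rewrite divr_gt0 ?subr_gt0// ltr_wpDr// normc_ge0.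
have b2 : 0 <= 1 - cnorm b ^+ 2 by rewrite subr_ge0 exprn_ile1 ?normc_ge0 ?ltW.
have b21 : 1 - cnorm b ^+ 2 <= 1 by rewrite lerBlDr lerDl sqr_ge0.
apply/ler_addgt0Pr => e e0.
(* The term 2^m is the cost of reading the m-th coefficient on the circle of radius 1/2, and 4 K
   that of subordination under the weight. *)
set d := e / (4 * K + 2 ^+ m + 1).
have m0 : 0 < 2 ^+ m :> R by rewrite exprn_gt0.
have D0 : 0 < 4 * K + 2 ^+ m + 1 by rewrite !addr_gt0// mulr_gt0.
have d0 : 0 < d by rewrite divr_gt0.
have fA1 s : 0 < s < 1 -> mean (fun t => cnorm (f (pt s t)) `^ 1) <= A.
  by move=> s01; rewrite (M1 (fun t => f (pt s t))); exact: fA.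
have [N [a Ha]] := poly_dense hf (lexx 1) fA1 d0.
set q := fun z => \sum_(n < N) a n * z ^+ n.
have hq : holo q.
  by apply: holo_sum => n; apply: holoM; [exact: holo_cst|exact/holoX/holo_id].
have hD := holoB hf hq.
have {}Ha r : 0 <= r < 1 -> mean (fun t => cnorm (f (pt r t) - q (pt r t))) <= d.
  by move=> /Ha; rewrite (M1 (fun t => f (pt r t) - q (pt r t))).
set am := if (m < N)%N then a m else 0.
have Em : cnorm (tc f m - am) <= 2 ^+ m * d.
  have r2 : 0 <= (2^-1 : R) < 1 by rewrite invr_ge0 ler0n invf_lt1// ltr1n.
  have cf := cont_holo hf r2; have cq := cont_holo hq r2; have cD := cont_holo hD r2.
  have Eq : fcoef (fun t => q (pt 2^-1 t)) m * 2 ^+ m = am.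
    have -> : (fun t => q (pt 2^-1 t)) = (fun t => \sum_(n < N) (a n * (2^-1)%:C ^+ n) * cis t ^+ n).
      by apply: funext => t; apply: eq_bigr => n _; rewrite /pt exprMn mulrA.
    rewrite (fcoef_poly (fun n => a n * (2^-1)%:C ^+ n)) /am; case: ifP => _; last by rewrite mul0r.
    rewrite -mulrA -exprMn -(creal_nat R 2) -real_complexM mulVf ?pnatr_eq0//.
    by rewrite -[1%:C]/(1 : C) expr1n mulr1.
  rewrite -Eq /tc -mulrBl -cmeanB; [|by apply: ccontM => //; apply: ccontX; contt..].
  rewrite normcMr normcXn -(creal_nat R 2) normc_real ger0_norm// mulrC ler_wpM2l ?(ltW m0)//.
  apply: le_trans (Ha _ r2).
  have -> : cmean (fun t => f (pt 2^-1 t) * (cis t)^* ^+ m - q (pt 2^-1 t) * (cis t)^* ^+ m) =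
      fcoef (fun t => f (pt 2^-1 t) - q (pt 2^-1 t)) m.
    by apply: eq_cmean => t; rewrite mulrBl.
  exact: fcoef_le.
have qB k : mean (fun t => cnorm (q (P k t))) <= B + K * d.
  have ck := cont_exhaust k (holo_comp hp hf p1); have cq := cont_exhaust k (holo_comp hp hq p1).
  have cD := cont_exhaust k (holo_comp hp hD p1).
  have /andP[e1 e2] := exhaust01 R k.
  have L : mean (fun t => cnorm (f (P k t) - q (P k t))) <= K * d.
    have h1 : 2^-1 <= 1 :> R by rewrite invf_le1// ler1n.
    have e12 : 0 <= exhaust R k < 1 by rewrite e2 ltW.
    rewrite -(M1 (fun t => f (P k t) - q (P k t))).
    apply: (littlewood hD hp p1 h1 e12) => s /andP[s0 s1].
    by rewrite (M1 (fun t => f (pt s t) - q (pt s t))); apply: Ha; rewrite s1 ltW.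
  apply: (@le_trans _ _ (mean (fun t => cnorm (f (P k t)) + cnorm (f (P k t) - q (P k t))))).
    apply: mean_le => [||t]; [exact: cont_normc|by apply: contD; exact: cont_normc|].
    have -> : q (P k t) = f (P k t) - (f (P k t) - q (P k t)) by ring.
    by apply: le_trans (normcBle _ _) _; rewrite subKr.
  rewrite meanD; [|exact: cont_normc..].
  by apply: lerD => //; apply: fB; rewrite e1.
have aB : cnorm am * (1 - cnorm b ^+ 2) <= 4 * (B + K * d).
  apply/ler_addgt0Pr => e' e'0.
  have := @star_poly a N m => /cvgCP/(_ _ e'0) H; have [k Hk] := filter_ex H.
  have := normc_sub_ge (am * (1 - cnorm b ^+ 2)%:C) (cmean (fun t => q (P k t) * (P k t)^* ^+ m * bweight b (P k t))).
  rewrite normcMr normc_real ger0_norm//.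
  have ck : cont (fun t => q (P k t)) := cont_exhaust k (holo_comp hp hq p1).
  have cW : cont (fun t => q (P k t) * (P k t)^* ^+ m * bweight b (P k t)).
    by apply: ccontM; [apply: ccontM => //; apply: ccontX; contt|exact: cont_bweight].
  have : cnorm (cmean (fun t => q (P k t) * (P k t)^* ^+ m * bweight b (P k t))) <= 4 * (B + K * d).
    apply: (le_trans (normc_cmean_le cW)).
    apply: (@le_trans _ _ (mean (fun t => 4 * cnorm (q (P k t))))).
      apply: mean_le => [||t]; [exact: cont_normc|by apply: contM; [exact: cont_cst|exact: cont_normc]|].
      rewrite normcMr normcMr normcXn normc_conj mulrC; apply: ler_pM; rewrite ?mulr_ge0 ?normc_ge0 ?exprn_ge0 ?normc_ge0//.
        exact: normc_bweight_le.
      by rewrite ler_piMr ?normc_ge0// exprn_ile1 ?normc_ge0.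
    by rewrite meanZ ?ler_wpM2l//; exact: cont_normc.
  by move: Hk; rewrite /= -/am; lra.
have T : cnorm (tc f m) * (1 - cnorm b ^+ 2) <= cnorm am * (1 - cnorm b ^+ 2) + 2 ^+ m * d.
  have := normc_sub_ge (tc f m) am => H.
  apply: (@le_trans _ _ ((cnorm am + 2 ^+ m * d) * (1 - cnorm b ^+ 2))).
    by rewrite ler_wpM2r//; lra.
  by rewrite mulrDl lerD2l ler_piMr// mulr_ge0 ?ltW.
have Ed : (4 * K + 2 ^+ m) * d <= e.
  rewrite /d mulrCA ler_piMr ?(ltW e0)// ler_pdivrMr// mul1r lerDl//.
by move: T aB Ed; rewrite mulrDl; lra.
Qed.

(** The quadratic means of an inner function tend to 1, so by Parseval a finite Taylor section
    carries all of the square sum but [d], and Bessel's identity bounds the rest on every circle. *)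
Lemma inner_split f (d : R) : hinner f -> 0 < d -> exists N,
  1 - d <= \sum_(n < N) cnorm (tc f n) ^+ 2 /\
  forall s, 0 < s < 1 -> mean2 (fun t => f (pt s t) - \sum_(n < N) tc f n * pt s t ^+ n) <= d.
Proof.
move=> fi d0; have hf := hinner_holo fi.
have f1 := hinner_le1 fi.
have fA r : 0 < r < 1 -> mean2 (fun t => f (pt r t)) <= 1.
  move=> /andP[r0 r1]; rewrite -(expr1n R 2); apply: mean2_le_bound => [|t].
    by apply: cont_holo; rewrite ?r1 ?ltW.
  by apply: f1; rewrite normc_pt// ltW.
have d3 : 0 < d / 3 by rewrite divr_gt0.
have [N HN] := h2_tail hf fA d3.
have psumE s M t : 0 < s < 1 -> psum (fcoef (fun t => f (pt s t))) M t = \sum_(n < M) tc f n * pt s t ^+ n.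
  move=> s01; rewrite /psum; apply: eq_bigr => n _; rewrite (tcE n hf s01) /pt.
  by move: (s%:C) (cis t) (tc f n) => x y w; rewrite exprMn mulrA.
pose eta := Num.min 1 (d / 3); have eta0 : 0 < eta by rewrite lt_min ltr01.
have eta2 : eta ^+ 2 <= d / 3.
  apply: (@le_trans _ _ eta); last by rewrite ge_min lexx orbT.
  by rewrite expr2 ler_piMr ?(ltW eta0)// ge_min lexx.
have fcle s n : 0 < s < 1 -> cnorm (fcoef (fun t => f (pt s t)) n) ^+ 2 <= cnorm (tc f n) ^+ 2.
  move=> s01; have -> := tcE n hf s01; have /andP[s0 s1] := s01.
  move: (tc f n) => x; rewrite normcMr normcXn normc_real (gtr0_norm s0).
  apply: lerXn2r; rewrite ?nnegrE ?normc_ge0//; first by rewrite mulr_ge0 ?normc_ge0// exprn_ge0// ltW.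
  by apply: ler_piMr; [exact: normc_ge0|apply: exprn_ile1 => //; exact: ltW].
have big s : 0 < s < 1 -> exists2 M, (N <= M)%N &
    mean2 (fun t => f (pt s t)) <= \sum_(n < M) cnorm (fcoef (fun t => f (pt s t)) n) ^+ 2 + d / 3.
  move=> s01; have /andP[s0 s1] := s01.
  have [M0 HM] := taylor_approx hf (introT andP (conj (ltW s0) s1)) eta0.
  exists (maxn N M0); first exact: leq_maxl.
  have cf : cont (fun t => f (pt s t)) by apply: cont_holo; rewrite ?s1 ?ltW.
  apply: le_trans (parseval_le cf (N := maxn N M0) (d := eta) _) _ => [t|]; last by rewrite lerD2l.
  by rewrite psumE//; apply: HM; [exact: leq_maxr|rewrite normc_pt// ltW].
exists N; split.
  have [n Hn] := filter_ex (hinner_sqr_mean fi d3).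
  have s01 := exhaust01 R n; have /andP[s0 s1] := s01.
  have [M NM HM] := big _ s01.
  have cf : cont (fun t => f (pt (exhaust R n) t)) by exact: cont_exhaust.
  rewrite meanB in Hn; [|exact: cont_cst|by apply: contX; exact: cont_normc].
  rewrite mean_cst -/(mean2 (fun t => f (pt (exhaust R n) t))) in Hn.
  have S1 : \sum_(n0 < M) cnorm (fcoef (fun t => f (pt (exhaust R n) t)) n0) ^+ 2 <= \sum_(n0 < M) cnorm (tc f n0) ^+ 2.
    by apply: ler_sum => i _; exact: fcle.
  rewrite (@sum_cut _ (fun n => cnorm (tc f n) ^+ 2) N M)// in S1.
  have := HN M; move: S1 HM Hn; lra.
move=> s s01; have /andP[s0 s1] := s01.
have cf : cont (fun t => f (pt s t)) by apply: cont_holo; rewrite ?s1 ?ltW.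
have -> : (fun t => f (pt s t) - \sum_(n < N) tc f n * pt s t ^+ n) =
    (fun t => f (pt s t) - psum (fcoef (fun t => f (pt s t))) N t).
  by apply: funext => t; rewrite psumE.
rewrite bessel//; have [M NM HM] := big _ s01.
rewrite (@sum_cut _ (fun n => cnorm (fcoef (fun t => f (pt s t)) n) ^+ 2) N M)// in HM.
have : \sum_(N <= n < M) cnorm (fcoef (fun t => f (pt s t)) n) ^+ 2 <= d / 3.
  by apply: le_trans (HN M); apply: ler_sum => i _; exact: fcle.
move: HM; lra.
Qed.

Let W k t := cre (bweight b (P k t)).

(** [f] is replaced by a Taylor section [q]. The weighted mean of |q \o phi|^2 tends to the square
    sum of its coefficients times 1 - |b|^2, nearly the weighted mean of 1. Subordination with
    exponent 2 controls f - q after composition. *)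
Lemma inner_comp_mean f e : hinner f -> 0 < e -> \forall k \near \oo,
  mean (fun t => (1 - cnorm (f (P k t)) ^+ 2) * W k t) < e.
Proof.
move=> fi e0; have hf := hinner_holo fi.
have b1 : cnorm b < 1 by apply: p1; rewrite normc_0.
set K := (1 + cnorm b) / (1 - cnorm b).
have K0 : 0 < K by rewrite divr_gt0 ?subr_gt0// ltr_wpDr// normc_ge0.
have b2 : 0 <= 1 - cnorm b ^+ 2 by rewrite subr_ge0 exprn_ile1 ?normc_ge0 ?ltW.
have b21 : 1 - cnorm b ^+ 2 <= 1 by rewrite lerBlDr lerDl sqr_ge0.
(* Parameter of the inequality 2 D <= dl + D^2 / dl, which linearises |q|^2 - |f|^2; with weight at
   most 4 it contributes e / 4. *)
pose dl := e / 16; have dl0 : 0 < dl by rewrite divr_gt0.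
set L := 4 * (1 + dl^-1) * K.
have D1 : 0 < 1 + dl^-1 by rewrite addr_gt0// invr_gt0.
have L0 : 0 < L by apply: mulr_gt0 => //; exact: mulr_gt0.
pose d := e / 4 / (L + 1); have d0 : 0 < d by rewrite !divr_gt0// addr_gt0.
have dL : d * L <= e / 4.
  rewrite /d mulrAC -mulrA ler_piMr ?divr_ge0 ?(ltW e0)// ler_pdivrMr ?addr_gt0// mul1r lerDl//.
have de : d <= e / 4.
  by rewrite /d ler_piMr ?divr_ge0 ?(ltW e0)// invf_le1 ?addr_gt0// lerDr ltW.
have [N [HN1 HN2]] := inner_split fi d0.
set q := fun z => \sum_(n < N) tc f n * z ^+ n.
have hq : holo q.
  by apply: holo_sum => n; apply: holoM; [exact: holo_cst|exact/holoX/holo_id].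
have hD := holoB hf hq.
have e8 : 0 < e / 8 by rewrite divr_gt0.
have := @star_sq (tc f) N => /cvgrPdist_lt/(_ _ e8); apply: filterS => k Hk.
have cw : cont (W k) by apply: cont_Re; exact: cont_bweight.
have cF : cont (fun t => f (P k t)) := cont_exhaust k (holo_comp hp hf p1).
have cq : cont (fun t => q (P k t)) := cont_exhaust k (holo_comp hp hq p1).
have cD : cont (fun t => f (P k t) - q (P k t)) by exact: ccontB.
have W0 t : 0 <= W k t by apply: bweight_ge0; exact: P1.
have W4 t : W k t <= 4.
  by apply: le_trans (Re_le_normc _) _; apply: normc_bweight_le; exact: P1.
have cq2 : cont (fun t => cnorm (q (P k t)) ^+ 2) by apply: contX; exact: cont_normc.
have cD2 : cont (fun t => cnorm (f (P k t) - q (P k t)) ^+ 2) by apply: contX; exact: cont_normc.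
have mD : mean (fun t => cnorm (f (P k t) - q (P k t)) ^+ 2) <= K * d.
  have pw (g : R -> C) : mean (fun t => cnorm (g t) `^ 2%:R) = mean (fun t => cnorm (g t) ^+ 2).
    by apply: eq_mean => t; rewrite powR_mulrn ?normc_ge0.
  rewrite -(pw (fun t => f (P k t) - q (P k t))).
  have h1 : 2^-1 <= 2%:R :> R by rewrite (@le_trans _ _ 1) ?invf_le1 ?ler1n.
  have /andP[e1 e2] := exhaust01 R k; have e12 : 0 <= exhaust R k < 1 by rewrite e2 ltW.
  apply: (littlewood hD hp p1 h1 e12) => s s01.
  by rewrite (pw (fun t => f (pt s t) - q (pt s t))); exact: HN2.
have ct : cont (fun t => (1 - cnorm (q (P k t)) ^+ 2) * W k t).
  by apply: contM => //; apply: contB => //; exact: cont_cst.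
have ct2 : cont (fun t => 4 * dl + 4 * (1 + dl^-1) * cnorm (f (P k t) - q (P k t)) ^+ 2).
  by apply: contD; [exact: cont_cst|apply: contM => //; exact: cont_cst].
apply: (@le_lt_trans _ _ (mean (fun t => (1 - cnorm (q (P k t)) ^+ 2) * W k t +
   (4 * dl + 4 * (1 + dl^-1) * cnorm (f (P k t) - q (P k t)) ^+ 2)))).
  apply: mean_le => [||t]; last first.
  - have F0 := normc_ge0 (f (P k t)); have F1 := hinner_le1 fi (p1 (pt_exhaust k t)).
    have qF : cnorm (q (P k t)) <= cnorm (f (P k t)) + cnorm (f (P k t) - q (P k t)).
      have {1}-> : q (P k t) = f (P k t) - (f (P k t) - q (P k t)) by ring.
      exact: normcBle.
    have q0 := normc_ge0 (q (P k t)); have D0 := normc_ge0 (f (P k t) - q (P k t)).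
    move: (W0 t) (W4 t) F0 F1 qF q0 D0; rewrite -/(P k t).
    move: (cnorm (f _)) (cnorm (q _)) (cnorm (_ - _)) (W k t) => F Q D w w0 w4 F0 F1 QF Q0 D0.
    have yg : 2 * D <= dl + dl^-1 * D ^+ 2.
      have := mulr_ge0 (ltW (_ : 0 < dl^-1)) (sqr_ge0 (D - dl)).
      rewrite invr_gt0 => /(_ dl0).
      have -> : dl^-1 * (D - dl) ^+ 2 = dl^-1 * D ^+ 2 - 2 * D + dl.
        by field; rewrite gt_eqF.
      by lra.
    have Q2 : Q ^+ 2 <= F ^+ 2 + (dl + (1 + dl^-1) * D ^+ 2).
      apply: (@le_trans _ _ ((F + D) ^+ 2)); first by rewrite lerXn2r// nnegrE addr_ge0.
      have FD : F * D <= D by rewrite ler_piMl.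
      rewrite sqrrD -mulr_natl mulrDl mul1r; lra.
    have S0 : 0 <= dl + (1 + dl^-1) * D ^+ 2.
      by rewrite addr_ge0 ?(ltW dl0)// mulr_ge0 ?sqr_ge0// addr_ge0// invr_ge0 ltW.
    have := ler_wpM2l S0 w4; have := ler_wpM2r w0 Q2.
    have -> : 4 * dl + 4 * (1 + dl^-1) * D ^+ 2 = (dl + (1 + dl^-1) * D ^+ 2) * 4 by ring.
    move: (dl + _) (F ^+ 2) (Q ^+ 2) => S A B; lra.
  - exact: contD.
  - by apply: contM => //; apply: contB; [exact: cont_cst|apply: contX; exact: cont_normc].
have c4 : cont (fun _ : R => 4 * dl) by exact: cont_cst.
have c5 : cont (fun t => 4 * (1 + dl^-1) * cnorm (f (P k t) - q (P k t)) ^+ 2).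
  by apply: contM => //; exact: cont_cst.
rewrite (meanD ct ct2) (meanD c4 c5) (meanZ _ cD2) mean_cst.
have -> : mean (fun t => (1 - cnorm (q (P k t)) ^+ 2) * W k t) =
    mean (W k) - mean (fun t => cnorm (q (P k t)) ^+ 2 * W k t).
  rewrite -meanB//; last exact: contM.
  by apply: eq_mean => t; rewrite mulrBl mul1r.
rewrite mean_bweight.
have S1 : (1 - cnorm b ^+ 2) - d <= (\sum_(n < N) cnorm (tc f n) ^+ 2) * (1 - cnorm b ^+ 2).
  apply: (@le_trans _ _ ((1 - d) * (1 - cnorm b ^+ 2))); last by rewrite ler_wpM2r.
  by rewrite mulrBl mul1r lerD2l lerN2 ler_piMr// ltW.
have T1 : 4 * (1 + dl^-1) * mean (fun t => cnorm (f (P k t) - q (P k t)) ^+ 2) <= e / 4.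
  apply: le_trans dL; have -> : d * L = 4 * (1 + dl^-1) * (K * d) by rewrite /L; ring.
  by apply: ler_wpM2l => //; apply: mulr_ge0 => //; exact: ltW.
have := le_lt_trans (ler_norm _) Hk; rewrite -/q.
have -> : 4 * dl = e / 4 by rewrite /dl; field.
by move: S1 T1 de e0; rewrite /W; lra.
Qed.

(** Radial limits [l] of f \o phi and [w] of [phi] exist almost everywhere, and the vanishing
    weighted mean forces (1 - |l|^2) |w - b|^2 = 0. As |w| = 1 > |b|, this gives |l| = 1. *)
Lemma hinner_comp f : hinner f -> hinner (fun z => f (phi z)).
Proof.
move=> fi; have hf := hinner_holo fi; have hF := holo_comp hp hf p1.
have F1 z : cnorm z < 1 -> cnorm (f (phi z)) <= 1 by move=> z1; apply: hinner_le1 => //; exact: p1.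
split => //; first by exists 1.
have b1 : cnorm b < 1 by apply: p1; rewrite normc_0.
pose u k t := (1 - cnorm (f (P k t)) ^+ 2) * W k t.
have cF k : cont (fun t => f (P k t)) := cont_exhaust k hF.
have cu k : cont (u k).
  apply: contM; last by apply: cont_Re; exact: cont_bweight.
  by apply: contB; [exact: cont_cst|apply: contX; exact: cont_normc].
have u0 k t : 0 <= u k t.
  rewrite mulr_ge0 ?bweight_ge0 ?P1// subr_ge0 exprn_ile1 ?normc_ge0//.
  by apply: F1; exact: pt_exhaust.
have U := mean_lim0_ae cu u0 (fun (x : R) (H : 0 < x) => inner_comp_mean fi H).
apply: (ae_imp (ae_and U (ae_and (fatou hF F1) (hinner_radial ip)))) => t [Hu [HF Hp]] tI.
have [l Hl] := HF tI; have [w [Hw w1]] := Hp tI; exists l; split; first exact: Hl.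
have rl : f (P k t) @[k --> \oo] --> l := @radial_exhaust R (fun z => f (phi z)) t l Hl.
have rw : P k t @[k --> \oo] --> w := @radial_exhaust R phi t w Hw.
have nl : cnorm (f (P k t)) @[k --> \oo] --> cnorm l.
  exact: (cvg_comp (fun k => f (P k t)) (fun x => cnorm x) rl (@continuous_normc R l)).
have nW : W k t @[k --> \oo] --> cre (bweight b w).
  have H : bweight b (P k t) @[k --> \oo] --> bweight b w.
    apply: cvgB; first by apply: cvgB; [exact: cvg_cst|apply: cvgM; [exact: cvg_cst|exact: rw]].
    apply: cvgM; first exact: cvg_cst.
    exact: (cvg_comp (fun k => P k t) (fun x : C => x^* : C) rw (@continuous_conjc R w)).
  exact: (cvg_comp (fun k => bweight b (P k t)) (fun x => cre x) H (@continuous_Re R _)).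
have nu : u k t @[k --> \oo] --> (1 - cnorm l ^+ 2) * cre (bweight b w).
  exact: (cvgM (cvgB (cvg_cst (1 : R)) (cvgM nl nl)) nW).
have := Hu tI _ nu; rewrite bweightE w1 expr1n subrr addr0 => /eqP; rewrite mulf_eq0 => /orP[|].
  rewrite subr_eq0 eq_sym sqrf_eq1 => /orP[/eqP//|/eqP nl1].
  by have := normc_ge0 l; rewrite nl1 => ?; lra.
rewrite sqrf_eq0 => /eqP E; have := normc_sub_ge w b; rewrite E w1 => ?; lra.
Qed.

End Star.

End InnerComposition.

(** * Weighted composition operators *)

Section Bridge.
Variable R : realType.
Local Notation C := (R[i]^o).
Implicit Types (n m k N : nat) (r s t e : R) (f g h : disc R -> C) (F G : C -> C) (z w : C) (x : disc R).

Lemma disc_lt1 x : cnorm (val x) < 1.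
Proof. by rewrite -normc_lt1; exact: (valP x). Qed.

Lemma ext_val f x : ext f (val x) = f x.
Proof. by rewrite /ext valK. Qed.

Lemma discP z : cnorm z < 1 -> exists x : disc R, val x = z.
Proof. by rewrite -normc_lt1 => z1; exists (exist (fun z : R[i] => is_true (`|z| < 1)) z z1). Qed.

Definition res F : disc R -> C := fun x => F (val x).

Lemma ext_res F z : cnorm z < 1 -> ext (res F) z = F z.
Proof. by move=> /discP[x <-]; rewrite ext_val. Qed.

Lemma res_ext f : res (ext f) = f.
Proof. by apply: funext => x; rewrite /res ext_val. Qed.

Lemma near_normc_lt1 z : cnorm z < 1 -> \forall w \near z, cnorm w < 1.
Proof.
move=> z1; have d0 : 0 < 1 - cnorm z by rewrite subr_gt0.
apply: filterS (near_normc_lt z d0) => w wz.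
have -> : w = (w - z) + z by rewrite subrK.
by apply: le_lt_trans (normcDle _ _) _; rewrite -ltrBrDr normc_distC.
Qed.

Lemma holo_eq F G : holo F -> (forall z, cnorm z < 1 -> F z = G z) -> holo G.
Proof.
move=> hF FG; split => z z1; have dF := holoP hF z1.
apply: (@near_eq_derivable _ _ _ F G z 1) => //.
by apply: filterS (near_normc_lt1 z1) => w; exact: FG.
Qed.

Lemma HolP f : Hol f <-> holo (ext f).
Proof.
split=> [hf|hf x]; last exact: (holoP hf (disc_lt1 x)).
by split => z /discP[x <-]; exact: hf.
Qed.

Lemma Hol_res F : Hol (res F) <-> holo F.
Proof.
rewrite HolP; split => hF; apply: (holo_eq hF) => z z1; first exact: ext_res.
by rewrite ext_res.
Qed.

Lemma polarE_pt r t : polar r t = pt r t.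
Proof. exact: polarE. Qed.

Definition pmean (p : R) F r := mean (fun t => cnorm (F (pt r t)) `^ p).

Lemma eq_pmean p F G r : 0 <= r < 1 -> (forall z, cnorm z < 1 -> F z = G z) -> pmean p F r = pmean p G r.
Proof.
by move=> /andP[r0 r1] FG; apply: eq_mean => t; rewrite FG// normc_pt.
Qed.

Section Exponent.
Variables (p : R) (p1 : 1 <= p).

Let p0 : 0 < p. Proof. exact: lt_le_trans p1. Qed.

Lemma powR_le (x y : R) : 0 <= x -> x <= y -> x `^ p <= y `^ p.
Proof.
move=> x0 xy; apply: ge0_ler_powR; rewrite ?nnegrE//; first exact: ltW.
exact: le_trans xy.
Qed.

Lemma pmean_ge0 F r : 0 <= pmean p F r.
Proof. by apply: mean_ge0 => t; exact: powR_ge0. Qed.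

Lemma hardy_meanE f r : Hol f -> 0 <= r < 1 ->
  hardy_mean p f r = (pmean p (ext f) r `^ p^-1)%:E.
Proof.
move=> /HolP hf r01; have cf := cont_powR_normc p0 (cont_holo hf r01).
rewrite /hardy_mean -poweR_EFin; congr (_ `^ _)%E.
have -> : (fun t => (ComplexField.Normc.normc (ext f (polar r t)) `^ p)%:E) =
   (fun t => (cnorm (ext f (pt r t)) `^ p)%:E) by apply: funext => t; rewrite polarE_pt.
rewrite (integral_mean cf) -EFinM mulrA mulVf ?mul1r//.
by rewrite gt_eqF// pi2_gt0.
Qed.

Lemma hardy_norm_le f e : Hol f -> 0 <= e ->
  (hardy_norm p f <= e%:E)%E <-> forall r, 0 <= r < 1 -> pmean p (ext f) r <= e `^ p.
Proof.
move=> hf e0; have pV : 0 <= p^-1 by rewrite invr_ge0 ltW.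
have powK (x : R) : 0 <= x -> (x `^ p^-1) `^ p = x.
  by move=> x0; rewrite -powRrM mulVf ?gt_eqF// powRr1.
have powK' (x : R) : 0 <= x -> (x `^ p) `^ p^-1 = x.
  by move=> x0; rewrite -powRrM mulfV ?gt_eqF// powRr1.
split => [H r r01|H].
  have : (hardy_mean p f r <= e%:E)%E.
    by apply: le_trans H; apply: ereal_sup_ubound; exists r => //=; rewrite in_itv.
  rewrite hardy_meanE// lee_fin => H'.
  by rewrite -(powK _ (pmean_ge0 _ _)); apply: powR_le => //; exact: powR_ge0.
apply: ge_ereal_sup => _ [r /= r01 <-]; move: r01; rewrite in_itv /= => r01.
rewrite hardy_meanE// lee_fin -(powK' _ e0); apply: ge0_ler_powR => //; rewrite ?nnegrE ?powR_ge0 ?pmean_ge0//.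
exact: H.
Qed.

Lemma hardyP f : hardy p f <-> holo (ext f) /\ exists A : R, forall r, 0 <= r < 1 -> pmean p (ext f) r <= A.
Proof.
split=> [[hf fp]|[hf [A HA]]].
  split; first exact/HolP.
  have n0 : (0 <= hardy_norm p f)%E.
    apply: (@le_trans _ _ (hardy_mean p f 0)); first exact: poweR_ge0.
    by apply: ereal_sup_ubound; exists 0 => //=; rewrite in_itv /= lexx ltr01.
  have fn : hardy_norm p f \is a fin_num by rewrite ge0_fin_numE.
  have := @hardy_norm_le f (fine (hardy_norm p f)) hf (fine_ge0 n0).
  by rewrite fineK// => -[/(_ (lexx _)) H _]; exists (fine (hardy_norm p f) `^ p).
have Hf : Hol f by exact/HolP.
split => //; have A0 : 0 <= A by apply: le_trans (HA 0 _); rewrite ?pmean_ge0// lexx ltr01.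
apply: (@le_lt_trans _ _ (A `^ p^-1)%:E); last exact: ltry.
apply/(hardy_norm_le Hf); first exact: powR_ge0.
by move=> r r01; rewrite -powRrM mulVf ?gt_eqF// powRr1// HA.
Qed.

Lemma hardy_res F A : holo F -> (forall r, 0 <= r < 1 -> pmean p F r <= A) -> hardy p (res F).
Proof.
move=> hF HA; apply/hardyP; split; first by apply: (holo_eq hF) => z z1; rewrite ext_res.
by exists A => r r01; rewrite (eq_pmean _ r01 (G := F))//; [exact: HA|exact: ext_res].
Qed.

Lemma hardy_bounded F (M : R) : holo F -> (forall z, cnorm z < 1 -> cnorm (F z) <= M) -> hardy p (res F).
Proof.
move=> hF FM; apply: (@hardy_res _ (M `^ p)) => // r r01; have /andP[r0 r1] := r01.
apply: mean_bound => [|t]; first exact: cont_powR_normc p0 (cont_holo hF r01).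
have F1 : cnorm (F (pt r t)) <= M by apply: FM; rewrite normc_pt.
by apply: powR_le => //; exact: normc_ge0.
Qed.

Lemma pmeanD F G r : holo F -> holo G -> 0 <= r < 1 ->
  pmean p (fun z => F z + G z) r <= 2 `^ p * (pmean p F r + pmean p G r).
Proof.
move=> hF hG r01; have cF := cont_holo hF r01; have cG := cont_holo hG r01.
have cFp := cont_powR_normc p0 cF; have cGp := cont_powR_normc p0 cG.
rewrite /pmean -meanD// -meanZ; last exact: contD.
apply: mean_le => [||t].
- exact: (cont_powR_normc p0 (ccontD cF cG)).
- by apply: contM; [exact: cont_cst|exact: contD].
have H := powR_add_le (ltW p0) (normc_ge0 (F (pt r t))) (normc_ge0 (G (pt r t))).
by apply: le_trans H; apply: powR_le; [exact: normc_ge0|exact: normcDle].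
Qed.

Lemma pmeanM F G r (K : R) : holo F -> holo G -> 0 <= r < 1 -> 0 <= K ->
  (forall z, cnorm z < 1 -> cnorm (F z) <= K) ->
  pmean p (fun z => F z * G z) r <= K `^ p * pmean p G r.
Proof.
move=> hF hG r01 K0 FK; have cF := cont_holo hF r01; have cG := cont_holo hG r01.
have /andP[r0 r1] := r01; have cGp := cont_powR_normc p0 cG.
rewrite /pmean -meanZ//; apply: mean_le => [||t].
- exact: (cont_powR_normc p0 (ccontM cF cG)).
- by apply: contM; [exact: cont_cst|].
have F1 : cnorm (F (pt r t)) <= K by apply: FK; rewrite normc_pt.
rewrite normcMr powRM ?normc_ge0//; apply: ler_wpM2r; first exact: powR_ge0.
by apply: powR_le => //; exact: normc_ge0.
Qed.

Lemma hardy_lin (c : C) f g : hardy p f -> hardy p g -> hardy p (c *: f + g).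
Proof.
move=> /hardyP[hf [A HA]] /hardyP[hg [B HB]].
rewrite -[c *: f + g]res_ext.
pose H z := c * ext f z + ext g z.
have hcf : holo (fun z => c * ext f z) by apply: holoM => //; exact: holo_cst.
have E : res (ext (c *: f + g)) = res H.
  by apply: funext => x; rewrite res_ext /res /H !ext_val.
rewrite E; apply: (@hardy_res _ (2 `^ p * (cnorm c `^ p * A + B))) => [|r r01].
  exact: holoD.
apply: le_trans (pmeanD hcf hg r01) _; apply: ler_wpM2l; first exact: powR_ge0.
apply: lerD; last exact: HB.
apply: (@le_trans _ _ (cnorm c `^ p * pmean p (ext f) r)).
  exact: (pmeanM (holo_cst c) hf r01 (normc_ge0 c)).
by apply: ler_wpM2l; [exact: powR_ge0|exact: HA].
Qed.

End Exponent.

Lemma innerP f : inner f <-> hinner (ext f).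
Proof.
have E F t : (fun r => F (polar r t)) = (fun r => F (pt r t)) :> (R -> C).
  by apply: funext => r; rewrite polarE_pt.
split => [[/HolP hf [M HM] Hr]|[hf [M HM] Hr]]; split => //; try exact/HolP.
- by exists M => _ /discP[x <-]; rewrite ext_val; exact: HM.
- apply: (ae_imp Hr) => t H tI; have [l [Hl l1]] := H tI; exists l; split; last exact/normc_eq1.
  by move: Hl; rewrite /radial E.
- by exists M => x; rewrite -(ext_val f); apply: HM; exact: disc_lt1.
- apply: (ae_imp Hr) => t H tI; have [l [Hl l1]] := H tI; exists l; split; last exact/normc_eq1.
  by rewrite E; exact: Hl.
Qed.

Lemma radial_eq F G t l : (forall z, cnorm z < 1 -> F z = G z) -> radial F t l -> radial G t l.
Proof.
move=> FG; apply: cvg_trans; apply: near_eq_cvg; rewrite /at_left /within /=.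
have d1 : 0 < 1 :> R by [].
have : \forall r \near (1 : R), `|1 - r| < 1 by exact: (@cvgr_dist_lt _ _ _ _ _ _ _ (@cvg_id _ (nbhs (1 : R))) _ d1).
apply: filterS => r H r1; rewrite FG// normc_pt//.
by move: H; rewrite ltr_norml => /andP[_]; lra.
Qed.

Lemma hinner_eq F G : (forall z, cnorm z < 1 -> F z = G z) -> hinner F -> hinner G.
Proof.
move=> FG [hF [M HM] Hr]; split; first exact: holo_eq FG.
  by exists M => z z1; rewrite -FG//; exact: HM.
apply: (ae_imp Hr) => t H tI; have [l [Hl l1]] := H tI; exists l; split => //.
exact: radial_eq Hl.
Qed.

Lemma inner_res F : inner (res F) <-> hinner F.
Proof.
rewrite innerP; split; apply: hinner_eq => z z1; first exact: ext_res.
by rewrite ext_res.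
Qed.

Lemma inner_hardy (p : R) f : 1 <= p -> inner f -> hardy p f.
Proof.
move=> p1 /innerP fi; rewrite -(res_ext f).
exact: (hardy_bounded p1 (hinner_holo fi) (hinner_le1 fi)).
Qed.

End Bridge.

(** * Weighted compositions are continuous and preserve inner functions *)

Section Composition.
Variable R : realType.
Local Notation C := (R[i]^o).
Implicit Types (n m k N : nat) (r s t e : R) (f g h : disc R -> C) (F G : C -> C) (z w : C) (x : disc R).
Variables (p : R) (p1 : 1 <= p).

Lemma hardyB f g : hardy p f -> hardy p g -> hardy p (f - g).
Proof. by move=> hf hg; have := hardy_lin p1 (-1) hg hf; rewrite scaleN1r addrC. Qed.

Lemma pmean_comp F G r (A : R) : holo F -> holo G -> (forall z, cnorm z < 1 -> cnorm (G z) < 1) ->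
  0 <= r < 1 -> (forall s, 0 <= s < 1 -> pmean p F s <= A) ->
  pmean p (fun z => F (G z)) r <= (1 + cnorm (G 0)) / (1 - cnorm (G 0)) * A.
Proof.
move=> hF hG G1 r01 HA; have h2 : 2^-1 <= p by apply: le_trans p1; rewrite invf_le1 ?ler1n.
by apply: (littlewood hF hG G1 h2 r01) => s /andP[s0 s1]; apply: HA; rewrite s1 ltW.
Qed.

Section Operator.
Variables (T : (disc R -> C) -> (disc R -> C)) (psi : disc R -> C) (phi : disc R -> disc R).
Hypotheses (hpsi : Hol psi) (psi1 : forall x, cnorm (psi x) <= 1) (hphi : Hol (val \o phi)).
Hypothesis TE : forall f, hardy p f -> T f = psi \* (f \o phi).

Let Phi := ext (val \o phi).

Lemma ext_phi x : Phi (val x) = val (phi x).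
Proof. by rewrite /Phi ext_val. Qed.

Lemma ext_phi_lt1 z : cnorm z < 1 -> cnorm (Phi z) < 1.
Proof. by move=> /discP[x <-]; rewrite ext_phi; exact: disc_lt1. Qed.

Let hPhi : holo Phi. Proof. exact/HolP. Qed.

Let K := (1 + cnorm (Phi 0)) / (1 - cnorm (Phi 0)).

Let K0 : 0 < K.
Proof.
have b1 : cnorm (Phi 0) < 1 by apply: ext_phi_lt1; rewrite normc_0.
by rewrite divr_gt0 ?subr_gt0// ltr_wpDr// normc_ge0.
Qed.

Lemma ext_weighted f z : cnorm z < 1 ->
  ext (psi \* (f \o phi)) z = ext psi z * ext f (Phi z).
Proof. by move=> /discP[x <-]; rewrite ext_phi !ext_val. Qed.

Lemma holo_weighted f : hardy p f -> holo (fun z => ext psi z * ext f (Phi z)).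
Proof.
move=> /(hardyP p1)[hf _]; apply: holoM; first exact/HolP.
by apply: (holo_comp hPhi hf) => z; exact: ext_phi_lt1.
Qed.

Lemma pmean_weighted f r A : hardy p f -> 0 <= r < 1 ->
  (forall s, 0 <= s < 1 -> pmean p (ext f) s <= A) ->
  pmean p (ext (psi \* (f \o phi))) r <= K * A.
Proof.
move=> hf r01 HA; rewrite (eq_pmean _ r01 (ext_weighted f)).
have hF := proj1 (proj1 (hardyP p1 f) hf).
have hc : holo (fun z => ext f (Phi z)).
  by apply: (holo_comp hPhi hF) => z; exact: ext_phi_lt1.
have psi1' z : cnorm z < 1 -> cnorm (ext psi z) <= 1.
  by move=> /discP[x <-]; rewrite ext_val.
have := pmeanM p1 (proj1 (HolP psi) hpsi) hc r01 ler01 psi1'.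
rewrite powR1 mul1r => H; apply: le_trans H _.
by apply: (pmean_comp hF hPhi) => // z; exact: ext_phi_lt1.
Qed.

Lemma hardy_weighted f : hardy p f -> hardy p (psi \* (f \o phi)).
Proof.
move=> hf; apply/(hardyP p1); split.
  by apply: (holo_eq (holo_weighted hf)) => z z1; rewrite ext_weighted.
have [_ [A HA]] := proj1 (hardyP p1 f) hf.
by exists (K * A) => r r01; exact: pmean_weighted.
Qed.

(** Only |psi| <= 1 and a holomorphic self-map [phi] are assumed, so the result also covers the
    inverse operator built from an automorphism. *)
Lemma weighted_operator : hardy_operator p T.
Proof.
split.
- by move=> f hf; rewrite (TE hf); exact: hardy_weighted.
- move=> c f g hf hg; rewrite (TE hf) (TE hg) (TE (hardy_lin p1 c hf hg)).
  apply: funext => x /=.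
  have -> : (c *: f + g) (phi x) = c * f (phi x) + g (phi x) by [].
  have -> : (c *: (psi \* (f \o phi)) + psi \* (g \o phi)) x =
    c * (psi x * f (phi x)) + psi x * g (phi x) by [].
  by rewrite mulrDr mulrCA.
(* No p-th root of [K] is needed: as p >= 1, (K + 1)^-1 to the power [p] is at most (K + 1)^-1.
   Halving [e] turns a weak inequality into a strict one. *)
move=> f hf e e0; pose d := e / 2 / (K + 1).
have K1 : 0 < K + 1 by rewrite addr_gt0.
have e2 : 0 < e / 2 by rewrite divr_gt0.
have d0 : 0 < d by rewrite divr_gt0.
exists d => // g hg gf; have hgf := hardyB hg hf.
have -> : T g - T f = psi \* ((g - f) \o phi).
  rewrite (TE hf) (TE hg); apply: funext => x /=.
  have -> : (psi \* (g \o phi) - psi \* (f \o phi)) x = psi x * g (phi x) - psi x * f (phi x) by [].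
  by rewrite -mulrBr.
have [Hgf _] := hgf; have [Hw _] := hardy_weighted hgf.
apply: (@le_lt_trans _ _ (e / 2)%:E); last by rewrite lte_fin ltr_pdivrMr// ltr_pMr// ltr1n.
apply/(hardy_norm_le p1 Hw (ltW e2)) => r r01.
have /(hardy_norm_le p1 Hgf (ltW d0)) Hd := ltW gf.
apply: le_trans (pmean_weighted hgf r01 Hd) _.
have K1V : 0 <= (K + 1)^-1 <= 1.
  by rewrite invr_ge0 (ltW K1) invf_le1// lerDr ltW.
have q : (K + 1)^-1 `^ p <= (K + 1)^-1.
  by have := powR_le_mul p1 K1V; rewrite powR1 mul1r.
have /andP[V0 _] := K1V.
rewrite /d powRM ?(ltW e2)//.
have P0 : 0 <= (e / 2) `^ p by exact: powR_ge0.
move: (_ `^ p) P0 => E E0 in q *.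
rewrite mulrCA; apply: ler_piMr => //.
apply: (@le_trans _ _ (K * (K + 1)^-1)); first by apply: ler_wpM2l => //; exact: ltW.
by rewrite ler_pdivrMr// mul1r lerDl.
Qed.

End Operator.

Lemma weighted_composition_operator T psi phi : weighted_composition p T psi phi ->
  hardy_operator p T /\ (forall h, inner h -> inner (T h)).
Proof.
move=> [/innerP ipsi /innerP iphi _ TE].
have hpsi : Hol psi by apply/HolP; exact: hinner_holo.
have psi1 x : cnorm (psi x) <= 1.
  by rewrite -(ext_val psi); apply: hinner_le1 => //; exact: disc_lt1.
have hphi : Hol (val \o phi) by apply/HolP; exact: hinner_holo.
split; first exact: (weighted_operator hpsi psi1 hphi TE).
move=> h ih; rewrite TE; last exact: inner_hardy.
apply/innerP.
apply: (hinner_eq (F := fun z => ext psi z * ext h (ext (val \o phi) z))).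
  by move=> z z1; rewrite ext_weighted.
apply: hinnerM => //; apply: hinner_comp => //; last exact/innerP.
by move=> z; exact: ext_phi_lt1.
Qed.

End Composition.

(** * Operators preserving inner functions *)

Section InnerSequences.
Variable R : realType.
Local Notation C := (R[i]^o).
Implicit Types (n m k N : nat) (r s t e : R) (f h F G : C -> C) (z w a : C).

Lemma hinner_cst h c : hinner h -> (forall z, cnorm z < 1 -> h z = c) -> cnorm c = 1.
Proof.
move=> ih hc; have c1 : cnorm c <= 1.
  by rewrite -(hc 0) ?normc_0//; apply: hinner_le1 => //; rewrite normc_0.
apply/le_anti; rewrite c1 /= leNgt; apply/negP => c1'.
have e0 : 0 < 1 - cnorm c ^+ 2 by rewrite subr_gt0 exprn_ilt1// normc_ge0.
have [n] := filter_ex (hinner_sqr_mean ih e0).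
rewrite (eq_mean (v := fun=> 1 - cnorm c ^+ 2)) ?mean_cst ?ltxx// => t.
by rewrite hc//; exact: pt_exhaust.
Qed.

Lemma hinner_neq0 h : hinner h -> ~ (forall z, cnorm z < 1 -> h z = 0).
Proof. by move=> ih /(hinner_cst ih)/eqP; rewrite normc_0 eq_sym oner_eq0. Qed.

Lemma hinner_cancel h F G : hinner h -> holo F -> holo G ->
  (forall z, cnorm z < 1 -> h z * F z = h z * G z) -> forall z, cnorm z < 1 -> F z = G z.
Proof.
move=> ih hF hG FG.
have D0 z : cnorm z < 1 -> h z * (F z - G z) = 0 by move=> z1; rewrite mulrBr FG// subrr.
have [/(hinner_neq0 ih)//|H] := holo_integral (hinner_holo ih) (holoB hF hG) D0.
by move=> z z1; apply/eqP; rewrite -subr_eq0 H.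
Qed.

Lemma hinner_at F (l : R -> C) : holo F -> (forall z, cnorm z < 1 -> cnorm (F z) <= 1) ->
  (forall t, radial F t (l t)) -> (forall t, cnorm (l t) = 1) -> hinner F.
Proof.
move=> hF F1 Fl l1; split => //; first by exists 1.
by apply: aeW => t _; exists (l t).
Qed.

Lemma radial_id t : radial (fun z => z) t (cis t).
Proof.
rewrite /radial /pt -[X in _ --> X]mul1r.
apply: cvgM; last exact: cvg_cst.
by apply: cvg_at_left_filter; exact: (@continuous_real_complex R 1).
Qed.

Lemma hinner_id : hinner (fun z : C => z).
Proof.
apply: (@hinner_at (fun z => z) (@cis R)); [exact: holo_id|by move=> z /ltW|exact: radial_id|exact: normc_cis].
Qed.

Lemma hinner_unimodular (c : C) : cnorm c = 1 -> hinner (fun=> c).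
Proof.
move=> c1; apply: (@hinner_at (fun=> c) (fun=> c)) => [|z _|t|//].
- exact: holo_cst.
- by rewrite c1.
- exact: cvg_cst.
Qed.

Lemma hinnerX h n : hinner h -> hinner (fun z => h z ^+ n).
Proof.
move=> ih; elim: n => [|n IH].
  by apply: (hinner_eq (F := fun=> 1)) => //; apply: hinner_unimodular; rewrite normc_1.
by apply: hinner_eq (hinnerM ih IH) => z _; rewrite exprS.
Qed.

Lemma normc_mob_cis a t : cnorm a < 1 -> cnorm (mob a (cis t)) = 1.
Proof.
move=> a1; rewrite /mob normcMr normc_inv.
have E : cnorm (1 + a^* * cis t) = cnorm (cis t + a).
  have -> : 1 + a^* * cis t = cis t * (cis t + a)^*.
    by rewrite conjcD mulrDr mulcis_conj mulrC.
  by rewrite normcMr normc_cis mul1r normc_conj.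
rewrite E mulfV// gt_eqF//.
have := normc_sub_ge (cis t) (- a); rewrite opprK normcNE normc_cis.
by apply: lt_le_trans; rewrite subr_gt0.
Qed.

Lemma hinner_mob a : cnorm a < 1 -> hinner (mob a).
Proof.
move=> a1; apply: (@hinner_at (mob a) (fun t => mob a (cis t))).
- exact: holo_mob.
- by move=> z z1; apply: ltW; exact: mob_lt1.
- move=> t; have := @radial_id t; rewrite /radial => H.
  have D0 : 1 + a^* * cis t != 0.
    apply/negP => /eqP E; have := normc_sub_ge 1 (- (a^* * cis t)).
    rewrite opprK E normcNE normc_0 normc_1 normcMr normc_cis mulr1 normc_conj.
    by move: a1; lra.
  have N : pt r t + a @[r --> 1^'-] --> cis t + a.
    exact: (cvgD H (cvg_cst a)).
  have D : 1 + a^* * pt r t @[r --> 1^'-] --> 1 + a^* * cis t.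
    exact: (cvgD (cvg_cst (1 : C)) (cvgM (cvg_cst (a^* : C)) H)).
  have V : (1 + a^* * pt r t)^-1 @[r --> 1^'-] --> (1 + a^* * cis t)^-1 by exact: (cvgV D0 D).
  exact: (cvgM N V).
- by move=> t; exact: normc_mob_cis.
Qed.

(* First-order term in [s] of [|w + s v|^2 = 1 + O(s^2)]. *)
Lemma tangent_bound w v l s : cnorm w = 1 -> cnorm l = 1 -> cnorm v <= 2 -> 0 < s <= 2^-1 ->
  cnorm (l - (w + s%:C * v)) <= 4 * s ^+ 2 -> `|cre (w^* * v)| <= 8 * s.
Proof.
move=> w1 l1 v2 /andP[s0 s2] H.
set u := w + s%:C * v in H.
have U : cnorm u ^+ 2 = 1 + 2 * s * cre (w^* * v) + s ^+ 2 * cnorm v ^+ 2.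
  have -> : 1 + 2 * s * cre (w^* * v) = cnorm w ^+ 2 + 2 * s * cre (w^* * v) by rewrite w1 expr1n.
  rewrite !sqr_normcE /u !cpartE; ring.
have d := ler_normc_sub u l; rewrite l1 normc_distC in d.
have {d}H : `|cnorm u - 1| <= 4 * s ^+ 2 by apply: le_trans d H.
have s21 : 4 * s ^+ 2 <= 1.
  have : s ^+ 2 <= 2^-1 ^+ 2 by rewrite lerXn2r// nnegrE ?invr_ge0 ltW.
  by lra.
have v4 : cnorm v ^+ 2 <= 4.
  have -> : 4 = 2 ^+ 2 :> R by rewrite -natrX.
  by rewrite lerXn2r ?nnegrE ?normc_ge0.
have sv : s ^+ 2 * cnorm v ^+ 2 <= s ^+ 2 * 4 by rewrite ler_wpM2l// sqr_ge0.
have sv0 : 0 <= s ^+ 2 * cnorm v ^+ 2 by rewrite mulr_ge0// sqr_ge0.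
have u0 := normc_ge0 u.
move: (cre _) U sv sv0 H u0 => x; move: (cnorm u) (s ^+ 2 * _) => y q U sv sv0.
rewrite ler_norml => /andP[H1 H2] u0.
have Y : `|y ^+ 2 - 1| <= 12 * s ^+ 2.
  have -> : y ^+ 2 - 1 = (y - 1) * (y + 1) by ring.
  rewrite normrM [X in _ * X]ger0_norm; last by lra.
  have -> : 12 * s ^+ 2 = 4 * s ^+ 2 * 3 by ring.
  by apply: ler_pM; [exact: normr_ge0|lra|rewrite ler_norml H1|lra].
have X : `|2 * s * x| <= 16 * s ^+ 2.
  move: Y; rewrite !ler_norml => /andP[Y1 Y2]; apply/andP; split; lra.
rewrite normrM ger0_norm in X; last by lra.
have -> : 8 * s = (2 * s)^-1 * (16 * s ^+ 2) by field; rewrite gt_eqF.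
by rewrite ler_pdivlMl//; lra.
Qed.

Lemma small_eq0 (x : R) : (forall n, `|x| <= 8 * (n.+2%:R)^-1) -> x = 0.
Proof.
move=> H; apply/eqP; rewrite -normr_eq0; apply/negP => /negP x0.
have {}x0 : 0 < `|x| by rewrite lt_neqAle eq_sym x0 normr_ge0.
have [n] := ltr_add_invr (x := `|x| / 8) (y := 0) (divr_gt0 x0 (ltr0n _ 8)).
rewrite add0r => Hn; have := H n; rewrite leNgt => /negP; apply.
rewrite -ltr_pdivlMl// mulrC; apply: le_lt_trans Hn.
by rewrite lef_pV2 ?posrE ?ltr0n// ler_nat.
Qed.

(** The real direction makes conj(w1) (w0 - w2) imaginary and the imaginary one makes conj(w1) (w0 +
    w2) real. So conj(w1) w0 and conj(w1) w2 are conjugate, which on the circle is the claim. *)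
Lemma circle_relation w0 w1 w2 : cnorm w0 = 1 -> cnorm w1 = 1 -> cnorm w2 = 1 ->
  (forall n, let s := n.+2%:R^-1 in
    exists2 l, cnorm l = 1 & cnorm (l - (w1 + s%:C * (w0 - w2))) <= 4 * s ^+ 2) ->
  (forall n, let s := n.+2%:R^-1 in
    exists2 l, cnorm l = 1 & cnorm (l - (w1 + s%:C * (ci * (w0 + w2)))) <= 4 * s ^+ 2) ->
  w1 ^+ 2 = w0 * w2.
Proof.
move=> n0 n1 n2 H1 H2.
have s01 n : 0 < (n.+2%:R^-1 : R) <= 2^-1.
  by rewrite invr_gt0 ltr0n/= lef_pV2 ?posrE ?ltr0n// ler_nat.
have E1 : cre (w1^* * (w0 - w2)) = 0.
  apply: small_eq0 => n; have [l l1 Hl] := H1 n.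
  apply: (tangent_bound n1 l1 _ (s01 n) Hl).
  by apply: le_trans (normcBle _ _) _; rewrite n0 n2.
have E2 : cre (w1^* * (ci * (w0 + w2))) = 0.
  apply: small_eq0 => n; have [l l1 Hl] := H2 n.
  apply: (tangent_bound n1 l1 _ (s01 n) Hl).
  rewrite normcMr; have -> : cnorm (ci : C) = 1 by apply/eqP; rewrite -sqrp_eq1 ?normc_ge0// sqr_normcE cre_i cim_i expr1n expr0n add0r.
  by rewrite mul1r; apply: le_trans (normcDle _ _) _; rewrite n0 n2.
have W : w1 * w1^* = 1 by rewrite mulc_conj n1 expr1n.
have V : w2 * w2^* = 1 by rewrite mulc_conj n2 expr1n.
have E : w1^* * w0 = (w1^* * w2)^*.
  apply: complex_eqP; move: E1 E2; rewrite !cpartE; lra.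
have -> : w0 = w1 * (w1^* * w0) by rewrite mulrA W mul1r.
rewrite E conjcM conjcK; transitivity (w1 ^+ 2 * (w2 * w2^*)); first by rewrite V mulr1.
by ring.
Qed.

End InnerSequences.

(** * Inner functions in geometric progression *)

Section GeometricInner.
Variable R : realType.
Local Notation C := (R[i]^o).
Local Notation mu := (@lebesgue_measure R).
Implicit Types (n m k N : nat) (r s t e : R) (f h F G : C -> C) (z w a : C).

Lemma radial_normc_le F t l (M : R) : (forall z, cnorm z < 1 -> cnorm (F z) <= M) ->
  radial F t l -> cnorm l <= M.
Proof.
move=> FM /radial_exhaust H.
have nl := cvg_comp (fun n => F (pt (exhaust R n) t)) (fun x => cnorm x) H (@continuous_normc R l).
apply: (ler_cvg_to nl (cvg_cst M)); apply: nearW => n /=.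
by apply: FM; exact: pt_exhaust.
Qed.

Lemma radialB F G t l l' : radial F t l -> radial G t l' -> radial (fun z => F z - G z) t (l - l').
Proof. by rewrite /radial => H1 H2; exact: (cvgB H1 H2). Qed.

Lemma radialD F G t l l' : radial F t l -> radial G t l' -> radial (fun z => F z + G z) t (l + l').
Proof. by rewrite /radial => H1 H2; exact: (cvgD H1 H2). Qed.

Lemma radialM F G t l l' : radial F t l -> radial G t l' -> radial (fun z => F z * G z) t (l * l').
Proof. by rewrite /radial => H1 H2; exact: (cvgM H1 H2). Qed.

Lemma radial_cst (c : C) t : radial (fun=> c) t c.
Proof. by rewrite /radial; exact: cvg_cst. Qed.

Lemma radial_unique F t l l' : radial F t l -> radial F t l' -> l = l'.
Proof.
by rewrite /radial => H1 H2; apply: (@cvg_unique _ (@norm_hausdorff _ C) _ _ _ _ H1 H2).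
Qed.

Variable g : nat -> C -> C.
Hypothesis ig : forall n, hinner (g n).
Hypothesis gB : forall k a, cnorm a <= 2^-1 -> exists2 F, hinner F &
  forall z, cnorm z < 1 -> cnorm (F z - (g k.+1 z + a * g k z - a^* * g k.+2 z)) <= 4 * cnorm a ^+ 2.

Let hg n : holo (g n) := hinner_holo (ig n).

(** The parameter runs over a = u / (n + 2) only: a countable family, so the exceptional null sets
    can be united, and |a| <= 1/2 as [gB] requires. *)
Lemma boundary_family k (u : C) : cnorm u = 1 ->
  {ae mu, forall t, t \in `[0, 2 * pi] -> forall w0 w1 w2,
    radial (g k) t w0 -> radial (g k.+1) t w1 -> radial (g k.+2) t w2 ->
    forall n, let s := n.+2%:R^-1 in exists2 l, cnorm l = 1 &
      cnorm (l - (w1 + s%:C * (u * w0 - u^* * w2))) <= 4 * s ^+ 2}.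
Proof.
move=> u1; pose a n : C := (n.+2%:R^-1)%:C * u.
have na n : cnorm (a n) = n.+2%:R^-1 by rewrite normcMr u1 mulr1 normc_real ger0_norm.
have a2 n : cnorm (a n) <= 2^-1 by rewrite na lef_pV2 ?posrE ?ltr0n// ler_nat.
have /choice[F HF] : forall n, exists F, hinner F /\ forall z, cnorm z < 1 ->
    cnorm (F z - (g k.+1 z + a n * g k z - (a n)^* * g k.+2 z)) <= 4 * cnorm (a n) ^+ 2.
  by move=> n; have [F iF HF] := gB k (a2 n); exists F.
have := ae_foralln (fun n => hinner_radial (proj1 (HF n))).
move=> H; apply: (ae_imp H) => t {}H tI w0 w1 w2 r0 r1 r2 n.
set s := n.+2%:R^-1.
have [l [rl l1]] := H n tI; exists l => //.
have -> : s%:C * (u * w0 - u^* * w2) = a n * w0 - (a n)^* * w2.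
  by rewrite /a conjcM conjc_creal -/s mulrBr !mulrA.
rewrite addrA -(na n : _ = s); apply: (radial_normc_le (t := t) (proj2 (HF n))).
move: (a n) => c.
have R0 : radial (fun z => c * g k z) t (c * w0) := radialM (@radial_cst c t) r0.
have R2 : radial (fun z => c^* * g k.+2 z) t (c^* * w2) := radialM (@radial_cst (c^*) t) r2.
have R1 : radial (fun z => g k.+1 z + c * g k z) t (w1 + c * w0) := radialD r1 R0.
have R3 : radial (fun z => g k.+1 z + c * g k z - c^* * g k.+2 z) t (w1 + c * w0 - c^* * w2) := radialB R1 R2.
exact: (radialB rl R3).
Qed.

(* Comparing moduli on the circle to first order in [a], for [a] real and for [a] imaginary. *)
Lemma consecutive_relation k z : cnorm z < 1 -> g k.+1 z ^+ 2 = g k z * g k.+2 z.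
Proof.
move=> z1; apply/eqP; rewrite -subr_eq0; apply/eqP.
pose D w := g k.+1 w ^+ 2 - g k w * g k.+2 w.
have g1 n w : cnorm w < 1 -> cnorm (g n w) <= 1 := hinner_le1 (ig n) (z := w).
have hD : holo D by apply: holoB; [exact: holoX|exact: holoM].
apply: (@bounded_radial0 R D 2 hD _ _ z z1).
  move=> w w1; apply: le_trans (normcBle _ _) _; rewrite normcXn normcMr.
  have -> : 2 = 1 + 1 :> R by [].
  apply: lerD; first by apply: exprn_ile1; [exact: normc_ge0|exact: g1].
  by apply: mulr_ile1; [exact: normc_ge0|exact: normc_ge0|exact: g1|exact: g1].
have i1 : cnorm (ci : C) = 1.
  by apply/eqP; rewrite -sqrp_eq1 ?normc_ge0// sqr_normcE cre_i cim_i expr1n expr0n add0r.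
have B1 := boundary_family k (normc_1 R); have B2 := boundary_family k i1.
have G0 := hinner_radial (ig k); have G1 := hinner_radial (ig k.+1); have G2 := hinner_radial (ig k.+2).
apply: (ae_imp (ae_and (ae_and B1 B2) (ae_and G0 (ae_and G1 G2)))) => t [[H1 H2] [A0 [A1 A2]]] tI.
have [w0 [r0 n0]] := A0 tI; have [w1 [r1 n1]] := A1 tI; have [w2 [r2 n2]] := A2 tI.
have E : w1 ^+ 2 = w0 * w2.
  apply: circle_relation => // n s; have := H1 tI _ _ _ r0 r1 r2 n; have := H2 tI _ _ _ r0 r1 r2 n.
    by move=> _ [l l1 Hl]; exists l => //; move: Hl; rewrite conjc1 !mul1r.
  move=> [l l1 Hl] _; exists l => //; move: Hl.
  have -> : (ci : C)^* = - ci by apply: complex_eqP; rewrite !cpartE ?oppr0.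
  by have -> : ci * w0 - - ci * w2 = ci * (w0 + w2) by rewrite mulNr opprK mulrDr.
have -> : 0 = w1 * w1 - w0 * w2 by rewrite -E expr2 subrr.
exact: (radialB (radialM r1 r1) (radialM r0 r2)).
Qed.

Lemma first_relation k z : cnorm z < 1 -> g k.+1 z * g 0%N z = g k z * g 1%N z.
Proof.
elim: k z => [|k IH] z; first by rewrite mulrC.
apply: (@hinner_cancel R (g k) (fun z => g k.+2 z * g 0%N z) (fun z => g k.+1 z * g 1%N z)) => //.
- exact: holoM.
- exact: holoM.
move=> w w1; rewrite mulrA -consecutive_relation// mulrA -mulrA.
rewrite -[RHS](_ : g k.+1 w * (g k w * g 1%N w) = _); last by ring.
by rewrite -IH//; ring.
Qed.

Lemma power_relation n z : cnorm z < 1 -> g n z * g 0%N z ^+ n = g 1%N z ^+ n * g 0%N z.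
Proof.
move=> z1; elim: n => [|n IH]; first by rewrite !expr0 mulr1 mul1r.
rewrite [g 0%N z ^+ _]exprS mulrA first_relation// mulrAC IH exprS; ring.
Qed.

(** If |g 1| > |g 0| > 0 at a point, [power_relation] and |g n| <= 1 give |g 0| <= (|g 0| / |g 1|)^n
    for all [n], which is absurd. *)
Lemma first_le z : cnorm z < 1 -> cnorm (g 1%N z) <= cnorm (g 0%N z).
Proof.
move=> z1; have g1 n : cnorm (g n z) <= 1 := hinner_le1 (ig n) z1.
have [g00|g00] := eqVneq (g 0%N z) 0.
  have := consecutive_relation 0 z1; rewrite g00 mul0r => /eqP; rewrite sqrf_eq0 => /eqP ->.
  by rewrite normc_0.
rewrite leNgt; apply/negP => lt; have y0 := normc_gt0 g00; have x0 := lt_trans y0 lt.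
have q01 : 0 <= cnorm (g 0%N z) / cnorm (g 1%N z) < 1.
  by rewrite divr_ge0 ?normc_ge0//= ltr_pdivrMr// mul1r.
have [n Hn] := geometric_small q01 y0.
have := congr1 (@cnorm R) (power_relation n z1); rewrite !normcMr !normcXn => E.
have : cnorm (g 0%N z) <= (cnorm (g 0%N z) / cnorm (g 1%N z)) ^+ n.
  rewrite expr_div_n ler_pdivlMr ?exprn_gt0// mulrC -E; apply: ler_piMl => //.
  by rewrite exprn_ge0// ltW.
by move/le_lt_trans/(_ Hn); rewrite ltxx.
Qed.

(** The quotient g 1 / g 0 extends over the zeros of g 0 and is bounded by 1, so Fatou's theorem
    gives it radial limits; they are quotients of unimodular numbers. *)
Lemma geometric_inner : exists phi, hinner phi /\
  forall n z, cnorm z < 1 -> g n z = phi z ^+ n * g 0%N z.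
Proof.
have [phi [hphi E phi1]] := holo_division (hg 0) (hg 1) (hinner_neq0 (ig 0%N)) first_le.
exists phi; split.
  split => //; first by exists 1.
  apply: (ae_imp (ae_and (fatou hphi phi1) (ae_and (hinner_radial (ig 0%N)) (hinner_radial (ig 1%N))))).
  move=> t [H [H0 H1]] tI; have [l Hl] := H tI; have [l0 [r0 n0]] := H0 tI; have [l1 [r1 n1]] := H1 tI.
  exists l; split; first exact: Hl.
  have r : radial (g 1%N) t (l * l0).
    have E' z : cnorm z < 1 -> phi z * g 0%N z = g 1%N z by move=> z1; rewrite E.
    exact: (radial_eq E' (radialM Hl r0)).
  have := congr1 (@cnorm R) (radial_unique r r1); rewrite normcMr n0 n1 mulr1.
  by [].
elim=> [|n IH] z z1; first by rewrite expr0 mul1r.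
apply: (@hinner_cancel R (g 0%N) (g n.+1) (fun z => phi z ^+ n.+1 * g 0%N z)) => //.
- by apply: holoM => //; exact: holoX.
move=> w w1; rewrite mulrC first_relation// IH// E// exprS; ring.
Qed.

End GeometricInner.

(** * Images of monomials and of Blaschke products *)

Section InnerPreserving.
Variable R : realType.
Local Notation C := (R[i]^o).
Implicit Types (n m k N : nat) (r s t e : R) (f h : disc R -> C) (F G : C -> C) (z w a : C).
Variables (p : R) (p1 : 1 <= p) (T : (disc R -> C) -> (disc R -> C)).
Hypothesis opT : hardy_operator p T.

Let p0 : 0 < p. Proof. exact: lt_le_trans p1. Qed.
Let p2 : 2^-1 <= p. Proof. by apply: le_trans p1; rewrite invf_le1 ?ler1n. Qed.

Local Notation H F := (hardy p (res F)).
Local Notation tf F := (ext (T (res F))).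

Lemma hardy_resD (c : C) F G : H F -> H G -> H (fun z => c * F z + G z).
Proof. by move=> hF hG; exact: (hardy_lin p1 c hF hG). Qed.

Lemma hardy_cst (c : C) : H (fun=> c).
Proof. by apply: (hardy_bounded p1 (holo_cst c) (M := cnorm c)). Qed.

Lemma operatorD (c : C) F G z : H F -> H G -> cnorm z < 1 ->
  tf (fun z => c * F z + G z) z = c * tf F z + tf G z.
Proof.
move=> hF hG /discP[x <-]; rewrite !ext_val; have [_ lT _] := opT.
have -> : res (fun z => c * F z + G z) = c *: res F + res G by [].
by rewrite lT.
Qed.

Lemma operator0 z : cnorm z < 1 -> tf (fun=> 0) z = 0.
Proof.
move=> z1; have h0 := hardy_cst 0; have := operatorD 1 h0 h0 z1.
have -> : (fun z : C => 1 * 0 + 0) = (fun=> 0 : C) by apply: funext => w; rewrite mulr0 addr0.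
by rewrite mul1r => E; apply: (addrI (tf (fun=> 0) z)); rewrite -E addr0.
Qed.

Lemma hardy_sum (c : nat -> C) (F_ : nat -> C -> C) N : (forall n, H (F_ n)) ->
  H (fun z => \sum_(n < N) c n * F_ n z).
Proof.
move=> hF; elim: N => [|N IH].
  by have -> : (fun z => \sum_(n < 0) c n * F_ n z) = (fun=> 0) :> (C -> C);
    [apply: funext => z; rewrite big_ord0|exact: hardy_cst].
have -> : (fun z => \sum_(n < N.+1) c n * F_ n z) = (fun z => c N * F_ N z + \sum_(n < N) c n * F_ n z).
  by apply: funext => z; rewrite big_ord_recr addrC.
exact: (@hardy_resD (c N) (F_ N) (fun z => \sum_(n < N) c n * F_ n z) (hF N) IH).
Qed.

Lemma operator_sum (c : nat -> C) (F_ : nat -> C -> C) N z : (forall n, H (F_ n)) -> cnorm z < 1 ->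
  tf (fun z => \sum_(n < N) c n * F_ n z) z = \sum_(n < N) c n * tf (F_ n) z.
Proof.
move=> hF z1; elim: N => [|N IH].
  rewrite big_ord0 -[RHS](operator0 z1); congr (ext (T (res _)) z).
  by apply: funext => w; rewrite big_ord0.
rewrite big_ord_recr /= addrC -IH -operatorD//; last exact: hardy_sum.
by congr (ext (T (res _)) z); apply: funext => w; rewrite big_ord_recr addrC.
Qed.

(** Continuity of [T] followed by continuity of evaluation at [z]. *)
Lemma operator_cont F z e : H F -> cnorm z < 1 -> 0 < e -> exists2 d, 0 < d &
  forall G, H G -> (forall r, 0 <= r < 1 -> pmean p (fun z => G z - F z) r <= d) ->
  cnorm (tf G z - tf F z) <= e.
Proof.
move=> hF z1 e0; have [K K0 HK] := point_bound p2 z1.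
have [hT _ cT] := opT.
have K1 : 0 < K + 1 by rewrite addr_gt0.
have e1 : 0 < e / (K + 1) by rewrite divr_gt0.
have [d d0 Hd] := cT _ hF _ e1.
have d2 : 0 < d / 2 by rewrite divr_gt0.
exists ((d / 2) `^ p) => [|G hG GF]; first exact: powR_gt0.
have hGF := hardyB p1 hG hF; have hTGF := hardyB p1 (hT _ hG) (hT _ hF).
have Hn : (hardy_norm p (res G - res F)%R < d%:E)%E.
  apply: (@le_lt_trans _ _ (d / 2)%:E); last by rewrite lte_fin ltr_pdivrMr// ltr_pMr// ltr1n.
  apply/(hardy_norm_le p1 (proj1 hGF) (ltW d2)) => r r01.
  rewrite (eq_pmean p r01 (G := fun z => G z - F z)); first exact: GF.
  by move=> w /discP[x <-]; rewrite ext_val.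
have /ltW/(hardy_norm_le p1 (proj1 hTGF) (ltW e1)) He := Hd _ hG Hn.
have E : ext (T (res G) - T (res F)) z = tf G z - tf F z.
  by have [x <-] := discP z1; rewrite !ext_val.
have B : cnorm (ext (T (res G) - T (res F)) z) `^ p <= K * (e / (K + 1)) `^ p.
  apply: HK; first exact: (proj1 (proj1 (hardyP p1 _) hTGF)).
  by move=> s /andP[s0 s1]; apply: He; rewrite s1 ltW.
rewrite -E leNgt; apply/negP => lt.
have : e `^ p < cnorm (ext (T (res G) - T (res F)) z) `^ p.
  by apply: gt0_ltr_powR; rewrite ?nnegrE ?normc_ge0// ltW.
move=> /lt_le_trans/(_ B); rewrite ltNge => /negP; apply.
have V01 : 0 <= (K + 1)^-1 <= 1 by rewrite invr_ge0 (ltW K1) invf_le1// lerDr ltW.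
have q : (K + 1)^-1 `^ p <= (K + 1)^-1 by have := powR_le_mul p1 V01; rewrite powR1 mul1r.
have /andP[V0 _] := V01; rewrite powRM ?(ltW e0)// mulrCA; apply: ler_piMr; first exact: powR_ge0.
apply: (@le_trans _ _ (K * (K + 1)^-1)); first by apply: ler_wpM2l => //; exact: ltW.
by rewrite ler_pdivrMr// mul1r lerDl.
Qed.

Lemma pmean_le_unif F r (d : R) : holo F -> 0 <= r < 1 -> 0 <= d <= 1 ->
  (forall z, cnorm z < 1 -> cnorm (F z) <= d) -> pmean p F r <= d.
Proof.
move=> hF r01 d01 Fd; have /andP[r0 r1] := r01.
apply: mean_bound => [|t]; first exact: cont_powR_normc p0 (cont_holo hF r01).
have F1 : cnorm (F (pt r t)) <= d by apply: Fd; rewrite normc_pt.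
have /andP[d0 d1] := d01; apply: le_trans (_ : d `^ p <= _); first exact: (powR_le p1 (normc_ge0 _) F1).
by have := powR_le_mul p1 d01; rewrite powR1 mul1r.
Qed.

Lemma operator_cont_unif F z e : H F -> cnorm z < 1 -> 0 < e -> exists2 d, 0 < d &
  forall G, H G -> (forall z, cnorm z < 1 -> cnorm (G z - F z) <= d) ->
  cnorm (tf G z - tf F z) <= e.
Proof.
move=> hF z1 e0; have [d d0 Hd] := operator_cont hF z1 e0.
have hHF := proj1 (Hol_res F) (proj1 hF).
exists (Num.min 1 d) => [|G hG GF]; first by rewrite lt_min ltr01.
have hHG := proj1 (Hol_res G) (proj1 hG).
apply: Hd => // r r01; apply: (@le_trans _ _ (Num.min 1 d)); last by rewrite ge_min lexx orbT.
apply: pmean_le_unif => //; first exact: holoB.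
by rewrite le_min ler01 ltW//= ge_min lexx.
Qed.

Hypothesis iT : forall h, inner h -> inner (T h).

Definition mono n z : C := z ^+ n.

Let hmono n : H (mono n).
Proof. by apply: inner_hardy => //; apply/inner_res; exact/hinnerX/hinner_id. Qed.

Let g n := tf (mono n).

Lemma inner_image n : hinner (g n).
Proof. by apply/innerP/iT/inner_res; exact/hinnerX/hinner_id. Qed.

Lemma normc_half_geom (x : C) : cnorm x <= 2^-1 -> 2^-1 <= cnorm (1 - x).
Proof. by move=> x2; have := normc_sub_ge 1 x; rewrite normc_1; lra. Qed.

(** Geometric expansion of 1 / (1 + conj(a) z), of ratio at most 1/2. The constant 4 combines |z +
    a| <= 2 with the denominator, at least 1/2. *)
Lemma mob_truncation k a z N : cnorm a <= 2^-1 -> cnorm z < 1 ->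
  cnorm (\sum_(n < N) (- a^*) ^+ n * (a * mono (k + n) z + mono (k + n).+1 z) - z ^+ k * mob a z)
    <= 4 * 2^-1 ^+ N.
Proof.
move=> a2 z1; pose x := - a^* * z.
have x2 : cnorm x <= 2^-1.
  rewrite normcMr normcNE normc_conj; apply: le_trans a2; apply: ler_piMr; [exact: normc_ge0|exact: ltW].
have X2 := normc_half_geom x2.
have X0 : 1 - x != 0 by apply: normc_neq0; apply: lt_le_trans X2; rewrite invr_gt0.
have -> : \sum_(n < N) (- a^*) ^+ n * (a * mono (k + n) z + mono (k + n).+1 z) =
    z ^+ k * (z + a) * \sum_(n < N) x ^+ n.
  rewrite mulr_sumr; apply: eq_bigr => n _; rewrite /mono /x exprMn exprS exprD; ring.
have -> : mob a z = (z + a) / (1 - x) by rewrite /mob /x mulNr opprK.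
have S : \sum_(n < N) x ^+ n = (1 - x ^+ N) / (1 - x).
  by apply: (canRL (mulfK X0)); rewrite mulrC -[1 - x]opprB mulNr -subrX1 opprB.
rewrite S.
have -> : z ^+ k * (z + a) * ((1 - x ^+ N) / (1 - x)) - z ^+ k * ((z + a) / (1 - x)) =
   - (z ^+ k * (z + a) * x ^+ N / (1 - x)) by field.
rewrite normcNE !normcMr normc_inv !normcXn ler_pdivrMr; last by apply: lt_le_trans X2; rewrite invr_gt0.
have zk : cnorm z ^+ k <= 1 by apply: exprn_ile1; [exact: normc_ge0|exact: ltW].
have za : cnorm (z + a) <= 2 by apply: le_trans (normcDle _ _) _; lra.
have xN : cnorm x ^+ N <= 2^-1 ^+ N by rewrite lerXn2r ?nnegrE ?normc_ge0 ?invr_ge0.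
have h0 : 0 <= 2^-1 ^+ N :> R by rewrite exprn_ge0 ?invr_ge0.
apply: (@le_trans _ _ (2 * 2^-1 ^+ N)); last first.
  have -> : 4 * 2^-1 ^+ N * cnorm (1 - x) = 2 * 2^-1 ^+ N * (2 * cnorm (1 - x)) by ring.
  by apply: ler_peMr; [exact: mulr_ge0|lra].
apply: ler_pM => //; [apply: mulr_ge0| apply: exprn_ge0 |]; rewrite ?exprn_ge0 ?normc_ge0//.
by rewrite -[2]mul1r; apply: ler_pM => //; rewrite ?exprn_ge0 ?normc_ge0.
Qed.

(** The terms n = 0 and n = 1 give the main part and an excess |a|^2 |g k.+1|; the terms from n = 2
    on sum to at most 3 |a|^2. This is the origin of the constant 4. *)
Lemma first_order k a z N : cnorm a <= 2^-1 -> cnorm z < 1 ->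
  cnorm (\sum_(n < N.+2) (- a^*) ^+ n * (a * g (k + n) z + g (k + n).+1 z) -
    (g k.+1 z + a * g k z - a^* * g k.+2 z)) <= 4 * cnorm a ^+ 2.
Proof.
move=> a2 z1; have g1 n : cnorm (g n z) <= 1 := hinner_le1 (inner_image n) z1.
rewrite !big_ord_recl /= !addn0 expr0 expr1 mul1r.
have -> : (k + bump 0 0 = k.+1)%N by rewrite /bump addn1.
set S := \sum_(i < N) _.
have -> : a * g k z + g k.+1 z + (- a^* * (a * g k.+1 z + g k.+2 z) + S) -
   (g k.+1 z + a * g k z - a^* * g k.+2 z) = S - a^* * a * g k.+1 z by ring.
have x0 := normc_ge0 a.
have S3 : cnorm S <= 3 * cnorm a ^+ 2.
  apply: le_trans (normc_sum _ _ _) _.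
  apply: (@le_trans _ _ (\sum_(i < N) cnorm a ^+ 2 * (3 / 2) * 2^-1 ^+ i)).
    apply: ler_sum => i _; rewrite normcMr normcXn normcNE normc_conj.
    have -> : bump 0 (bump 0 i) = (2 + i)%N by [].
    rewrite exprD; apply: (@le_trans _ _ (cnorm a ^+ 2 * cnorm a ^+ i * (3 / 2))).
      apply: ler_wpM2l; first by apply: mulr_ge0; exact: exprn_ge0.
      apply: le_trans (normcDle _ _) _; rewrite normcMr.
      have := ler_pM x0 (normc_ge0 _) a2 (g1 (k + (2 + i))%N); have := g1 (k + (2 + i)).+1.
      lra.
    rewrite -mulrA [X in _ <= X](_ : _ = cnorm a ^+ 2 * (2^-1 ^+ i * (3 / 2))); last by ring.
    apply: ler_wpM2l; first exact: sqr_ge0.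
    apply: ler_wpM2r; first by rewrite divr_ge0.
    by rewrite lerXn2r ?nnegrE ?invr_ge0.
  rewrite -mulr_sumr -(big_mkord xpredT (fun i => 2^-1 ^+ i)).
  have h2 : 0 <= 2^-1 :> R by rewrite invr_ge0.
  have h1 : 2^-1 < 1 :> R by rewrite invf_lt1 ?ltr1n.
  have := geometric_tail 0 N h2 h1; rewrite expr0 => Hg.
  have Hg' : \sum_(0 <= i < N) (2^-1 : R) ^+ i <= 2 by apply: le_trans Hg _; rewrite ler_pdivrMr; lra.
  have := ler_wpM2l (mulr_ge0 (sqr_ge0 (cnorm a)) (_ : 0 <= 3 / 2)) Hg'.
  rewrite divr_ge0// => /(_ isT); lra.
apply: le_trans (normcBle _ _) _; rewrite !normcMr normc_conj.
have := ler_piMr (mulr_ge0 x0 x0) (g1 k.+1); rewrite -expr2; lra.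
Qed.

(** The inner function is the image of z^k [mob a]. Truncations converge uniformly to the latter, so
    their images converge pointwise, with the bound of [first_order] independent of the
    truncation. *)
Lemma blaschke_image k a : cnorm a <= 2^-1 -> exists2 F, hinner F &
  forall z, cnorm z < 1 -> cnorm (F z - (g k.+1 z + a * g k z - a^* * g k.+2 z)) <= 4 * cnorm a ^+ 2.
Proof.
move=> a2; have a1 : cnorm a < 1 by lra.
pose B z := z ^+ k * mob a z.
have iB : hinner B by apply: hinnerM; [exact/hinnerX/hinner_id|exact: hinner_mob].
have hB : H B by apply: inner_hardy => //; exact/inner_res.
exists (tf B); first by apply/innerP/iT/inner_res.
move=> z z1; apply/ler_addgt0Pr => e e0.
have [d d0 Hd] := operator_cont_unif hB z1 e0.
have h2 : 0 <= (2^-1 : R) < 1 by rewrite invr_ge0 ler0n invf_lt1 ?ltr1n.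
have d4 : 0 < d / 4 by rewrite divr_gt0.
have [N HN] := geometric_small h2 d4.
have hF n : H (fun z => a * mono (k + n) z + mono (k + n).+1 z) by exact: (hardy_resD a (hmono _) (hmono _)).
have := Hd _ (hardy_sum (fun n => (- a^*) ^+ n) N.+2 hF).
rewrite (operator_sum _ _ hF z1).
have -> : \sum_(n < N.+2) (- a^*) ^+ n * tf (fun z => a * mono (k + n) z + mono (k + n).+1 z) z =
    \sum_(n < N.+2) (- a^*) ^+ n * (a * g (k + n) z + g (k + n).+1 z).
  by apply: eq_bigr => n _; rewrite (operatorD a (hmono (k + n)) (hmono (k + n).+1) z1).
move=> {}Hd; have := first_order k N a2 z1.
set A := \sum_(n < _) _; set M := g k.+1 z + _ - _ => HA.
have -> : tf B z - M = (A - M) - (A - tf B z) by ring.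
apply: le_trans (normcBle _ _) _; apply: lerD => //.
apply: Hd => w w1; apply: le_trans (mob_truncation k N.+2 a2 w1) _.
rewrite !exprS; have : 0 <= 2^-1 ^+ N :> R by rewrite exprn_ge0 ?invr_ge0.
by move: HN; rewrite ltr_pdivlMr//; lra.
Qed.

End InnerPreserving.

(** * The symbol of an operator preserving inner functions *)

Section Symbol.
Variable R : realType.
Local Notation C := (R[i]^o).
Implicit Types (n m k N : nat) (r s t e : R) (f h : disc R -> C) (F G : C -> C) (z w a : C).

Lemma poly_mean2_le (a : nat -> C) N r : 0 <= r < 1 ->
  mean2 (fun t => \sum_(n < N) a n * pt r t ^+ n) <= \sum_(n < N) cnorm (a n) ^+ 2.
Proof.
move=> r01; have /andP[r0 r1] := r01; pose b n := a n * r%:C ^+ n.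
have -> : (fun t => \sum_(n < N) a n * pt r t ^+ n) = (fun t => \sum_(n < N) b n * cis t ^+ n).
  apply: funext => t; apply: eq_bigr => n _; rewrite /b /pt.
  by move: (r%:C) (cis t) (a n) => x y w; rewrite exprMn mulrA.
have cu : cont (fun t => \sum_(n < N) b n * cis t ^+ n) by exact: (cont_psum b N).
have E n : fcoef (fun t => \sum_(n < N) b n * cis t ^+ n) n = if (n < N)%N then b n else 0 by exact: fcoef_poly.
apply: le_trans (parseval_le (N := N) (d := 0) cu _) _.
  move=> t; rewrite (_ : _ - _ = 0) ?normc_0//; apply/eqP; rewrite subr_eq0; apply/eqP.
  by apply: eq_bigr => n _; rewrite E ltn_ord.
rewrite expr0n addr0; apply: ler_sum => n _; rewrite E ltn_ord.
rewrite lerXn2r ?nnegrE ?normc_ge0// /b normcMr; apply: ler_piMr; first exact: normc_ge0.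
by rewrite normcXn normc_real ger0_norm//; apply: exprn_ile1 => //; exact: ltW.
Qed.

Lemma poly_holo (a : nat -> C) N : holo (fun z => \sum_(n < N) a n * z ^+ n).
Proof. by apply: holo_sum => n; apply: holoM; [exact: holo_cst|apply: holoX; exact: holo_id]. Qed.

(* The averages take the value 1 at the conjugate of [c]: evaluation at a boundary point is not
   continuous on H^p. *)
Lemma averages_small p c e : 1 <= p -> cnorm c = 1 -> 0 < e -> exists k, forall r, 0 <= r < 1 ->
  pmean p (fun z => \sum_(n < k.+1) (k.+1%:R^-1)%:C * c ^+ n * z ^+ n) r <= e.
Proof.
move=> p1 c1 e0.
have [k Hk] := ltr_add_invr (x := e ^+ 2) (y := 0) (exprn_gt0 2 e0).
exists k => r r01; have /andP[r0 r1] := r01.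
pose a n : C := (k.+1%:R^-1)%:C * c ^+ n.
have na n : cnorm (a n) = k.+1%:R^-1.
  by rewrite /a normcMr normcXn c1 expr1n mulr1 normc_real ger0_norm.
have hq := poly_holo a k.+1; have cq := cont_holo hq r01.
have q1 z : cnorm z < 1 -> cnorm (\sum_(n < k.+1) a n * z ^+ n) <= 1.
  move=> z1; apply: le_trans (normc_sum _ _ _) _.
  apply: (@le_trans _ _ (\sum_(n < k.+1) k.+1%:R^-1)).
    apply: ler_sum => n _; rewrite normcMr na normcXn; apply: ler_piMr => //.
    by apply: exprn_ile1; [exact: normc_ge0|exact: ltW].
  by rewrite sumr_const card_ord -(mulr_natr (k.+1%:R^-1)) mulVf.
have M2 : mean2 (fun t => \sum_(n < k.+1) a n * pt r t ^+ n) <= e ^+ 2.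
  apply: le_trans (poly_mean2_le a k.+1 r01) _.
  under eq_bigr do rewrite na.
  by rewrite sumr_const card_ord -(mulr_natr (k.+1%:R^-1 ^+ 2)) expr2 -mulrA mulVf// mulr1 -[X in X <= _]add0r ltW.
apply: (@le_trans _ _ (mean (fun t => cnorm (\sum_(n < k.+1) a n * pt r t ^+ n)))).
  apply: mean_le => [||t].
  - by apply: cont_powR_normc cq; exact: lt_le_trans p1.
  - exact: cont_normc.
  have b01 : 0 <= cnorm (\sum_(n < k.+1) a n * pt r t ^+ n) <= 1 by rewrite normc_ge0 q1// normc_pt.
  by have := powR_le_mul p1 b01; rewrite powR1 mul1r.
apply: le_trans (mean_norm_le cq e0) _.
have : mean2 (fun t => \sum_(n < k.+1) a n * pt r t ^+ n) / e <= e.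
  by rewrite ler_pdivrMr// -expr2.
by move: (_ / e) => y; lra.
Qed.

Variables (p : R) (p1 : 1 <= p) (T : (disc R -> C) -> (disc R -> C)).
Hypothesis opT : hardy_operator p T.
Hypothesis iT : forall h, inner h -> inner (T h).

Let p2 : 2^-1 <= p. Proof. by apply: le_trans p1; rewrite invf_le1 ?ler1n. Qed.

Local Notation H F := (hardy p (res F)).
Local Notation tf F := (ext (T (res F))).

Let hmono n : H (@mono R n).
Proof. by apply: inner_hardy => //; apply/inner_res; exact/hinnerX/hinner_id. Qed.

Variable phi : C -> C.
Hypothesis iphi : hinner phi.
Hypothesis phiE : forall n z, cnorm z < 1 -> tf (@mono R n) z = phi z ^+ n * tf (@mono R 0) z.

Let hphi := hinner_holo iphi.

Lemma operator_poly (c : nat -> C) N z : cnorm z < 1 ->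
  tf (fun z => \sum_(n < N) c n * z ^+ n) z = tf (@mono R 0) z * \sum_(n < N) c n * phi z ^+ n.
Proof.
move=> z1; rewrite (operator_sum p1 opT c N hmono z1) mulr_sumr.
by apply: eq_bigr => n _; rewrite phiE// mulrA mulrC.
Qed.

(** If [phi] were constant equal to [c], every average built on conj(c) would have image T 1, while
    the averages tend to 0 in H^p. Continuity would make T 1 vanish, but it is inner. *)
Lemma symbol_nonconstant c : ~ (forall z, cnorm z < 1 -> phi z = c).
Proof.
move=> pc; have c1 := hinner_cst iphi pc.
apply: (hinner_neq0 (inner_image iT 0)) => z z1.
apply/normc_eq0P/le_anti; rewrite normc_ge0 andbT; apply/ler_addgt0Pr => e e0; rewrite add0r.
have [d d0 Hd] := operator_cont p1 opT (hardy_cst p1 0) z1 e0.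
have c1' : cnorm (c^*) = 1 by rewrite normc_conj.
have [k Hk] := averages_small p1 c1' d0.
pose a n : C := (k.+1%:R^-1)%:C * c^* ^+ n.
have := Hd _ (hardy_sum p1 a k.+1 hmono).
rewrite (operator0 p1 opT z1) subr0 (operator_poly a k.+1 z1) pc//.
have -> : \sum_(n < k.+1) a n * c ^+ n = 1.
  rewrite (eq_bigr (fun=> (k.+1%:R^-1)%:C)) => [|n _]; last first.
    by rewrite /a -mulrA -exprMn mulrC [_ * c]mulrC mulc_conj c1 !expr1n mul1r.
  by rewrite sumr_const card_ord -(mulr_natr ((k.+1%:R^-1)%:C)) -creal_nat -real_complexM mulVf.
rewrite mulr1; apply => r r01.
rewrite (eq_pmean p r01 (G := fun z => \sum_(n < k.+1) a n * z ^+ n)); first exact: Hk.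
by move=> w _; rewrite subr0.
Qed.

Lemma symbol_lt1 z : cnorm z < 1 -> cnorm (phi z) < 1.
Proof.
have [[c _ pc]|] := max_principle_lt hphi (hinner_le1 iphi); last exact.
by have := symbol_nonconstant pc.
Qed.

Lemma operator_symbol F z : H F -> cnorm z < 1 -> tf F z = tf (@mono R 0) z * F (phi z).
Proof.
move=> hF z1; have pz := symbol_lt1 z1.
apply/eqP; rewrite -subr_eq0; apply/eqP/normc_eq0P/le_anti; rewrite normc_ge0 andbT.
apply/ler_addgt0Pr => e e0; rewrite add0r; have e2 : 0 < e / 2 by rewrite divr_gt0.
have [d d0 Hd] := operator_cont p1 opT hF z1 e2.
have [K K0 HK] := point_bound p2 pz.
have hhF := proj1 (Hol_res F) (proj1 hF).
have [_ [A HA]] := proj1 (hardyP p1 _) hF.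
have HA' s : 0 < s < 1 -> mean (fun t => cnorm (F (pt s t)) `^ p) <= A.
  move=> /andP[s0 s1]; have s01 : 0 <= s < 1 by rewrite s1 ltW.
  by have := HA s s01; rewrite (eq_pmean p s01 (G := F)) => // w w1; rewrite ext_res.
have E0 : 0 < (e / 2) `^ p / K by rewrite divr_gt0// powR_gt0.
(* The polynomial must be close to [F] both for the continuity of [T] at [F] and for evaluation at
   phi z. *)
have m0 : 0 < Num.min d ((e / 2) `^ p / K) by rewrite lt_min d0.
have [N [c Hc]] := poly_dense hhF p1 HA' m0.
set q := fun z => \sum_(n < N) c n * z ^+ n.
have hq : holo q := poly_holo c N.
have Hq : H q by exact: (hardy_sum p1 c N hmono).
have dq : cnorm (tf q z - tf F z) <= e / 2.
  apply: Hd => // r r01; apply: (@le_trans _ _ (Num.min d ((e / 2) `^ p / K))); last by rewrite ge_min lexx.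
  apply: le_trans (Hc r r01); rewrite le_eqVlt; apply/orP; left; apply/eqP.
  by apply: eq_mean => t; rewrite normc_distC.
have dF : cnorm (F (phi z) - q (phi z)) <= e / 2.
  have B : cnorm (F (phi z) - q (phi z)) `^ p <= K * ((e / 2) `^ p / K).
    apply: (HK (fun z => F z - q z)); first exact: holoB.
    move=> s /andP[s0 s1]; apply: (@le_trans _ _ (Num.min d ((e / 2) `^ p / K))); last by rewrite ge_min lexx orbT.
    by apply: Hc; rewrite s1 ltW.
  rewrite mulrCA mulfV ?gt_eqF// mulr1 in B.
  rewrite leNgt; apply/negP => lt; move: B; rewrite leNgt => /negP; apply.
  by apply: gt0_ltr_powR; rewrite ?nnegrE ?normc_ge0 ?(ltW e2)//; exact: lt_le_trans p1.
rewrite -/(q _) in dq.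
have Eq : tf q z = tf (@mono R 0) z * q (phi z) := operator_poly c N z1.
have -> : tf F z - tf (@mono R 0) z * F (phi z) =
   - (tf q z - tf F z) - tf (@mono R 0) z * (F (phi z) - q (phi z)) by rewrite Eq; ring.
have g1 := hinner_le1 (inner_image iT 0) z1.
apply: le_trans (normcBle _ _) _; rewrite normcNE normcMr.
have := ler_piMl (normc_ge0 (F (phi z) - q (phi z))) g1.
by move: dq dF; lra.
Qed.

End Symbol.

Section Representation.
Variable R : realType.
Local Notation C := (R[i]^o).

Lemma inner_preserving_weighted_composition (p : R) (T : (disc R -> C) -> (disc R -> C)) :
  1 <= p -> hardy_operator p T -> (forall h, inner h -> inner (T h)) ->
  exists psi phi, weighted_composition p T psi phi.
Proof.
move=> p1 opT iT.
have [f [iphi phiE]] := geometric_inner (inner_image iT) (blaschke_image p1 opT iT).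
have f1 := symbol_lt1 p1 opT iT iphi phiE.
have /choice[phi Hphi] : forall x : disc R, exists y : disc R, val y = f (val x).
  by move=> x; apply: discP; apply: f1; exact: disc_lt1.
have E : val \o phi = res f by apply: funext => x /=; rewrite Hphi.
exists (T (res (@mono R 0))), phi; split.
- by apply: iT; apply/inner_res; exact/hinnerX/hinner_id.
- by rewrite E; exact/inner_res.
- move=> c pc; have fc z : cnorm z < 1 -> f z = val c.
    by move=> /discP[x <-]; rewrite -Hphi pc.
  by have := disc_lt1 c; rewrite (hinner_cst iphi fc) ltxx.
move=> g hg; apply: funext => x /=.
have hg' : hardy p (res (ext g)) by rewrite res_ext.
have := operator_symbol p1 opT iT iphi phiE hg' (disc_lt1 x).
by rewrite res_ext !ext_val -Hphi ext_val.
Qed.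

End Representation.

(** * Surjective operators *)

Section Surjective.
Variable R : realType.
Local Notation C := (R[i]^o).
Implicit Types (n m k N : nat) (r s t e : R) (F G : C -> C) (z w a : C).

Lemma pmean1E F r : pmean 1 F r = mean (fun t => cnorm (F (pt r t))).
Proof. by apply: eq_mean => t; rewrite powRr1 ?normc_ge0. Qed.

Lemma hardy_mean1 p (f : disc R -> C) : 1 <= p -> hardy p f ->
  exists A : R, forall r, 0 <= r < 1 -> pmean 1 (ext f) r <= A.
Proof.
move=> p1 /(hardyP p1)[hf [A HA]]; exists (1 + A) => r r01.
have cf := cont_holo hf r01; have cp := cont_powR_normc (lt_le_trans ltr01 p1) cf.
apply: (@le_trans _ _ (mean (fun t => 1 + cnorm (ext f (pt r t)) `^ p))); last first.
  by rewrite meanD//; [rewrite mean_cst lerD2l; exact: HA|exact: cont_cst].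
rewrite pmean1E; apply: mean_le => [||t].
- exact: cont_normc.
- by apply: contD => //; exact: cont_cst.
have x0 := normc_ge0 (ext f (pt r t)); move: (cnorm _) x0 => x x0.
have [x1|/ltW x1] := leP x 1; first by apply: le_trans x1 _; rewrite lerDl powR_ge0.
apply: le_trans (_ : x `^ p <= _); last by rewrite lerDr.
by rewrite -[X in X <= _]powRr1//; exact: ler_powR.
Qed.

Section Reciprocal.
Variables (psi phi g : C -> C).
Hypotheses (ipsi : hinner psi) (hphi : holo phi) (phi1 : forall z, cnorm z < 1 -> cnorm (phi z) < 1).
Variable A : R.
Hypotheses (hg : holo g) (gA : forall r, 0 <= r < 1 -> pmean 1 g r <= A).
Hypothesis recip : forall z, cnorm z < 1 -> psi z * g (phi z) = 1.

(* On the circle [psi] has modulus 1, so approximating [g] by polynomials in the mean gives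
   [|1 / psi 0| <= 1]. *)
Lemma inner_reciprocal : cnorm (psi 0) = 1.
Proof.
have z0 : cnorm (0 : C) < 1 by rewrite normc_0.
have hpsi := hinner_holo ipsi; have psi1 := hinner_le1 ipsi.
apply/le_anti; rewrite psi1//=; apply/ler_addgt0Pr => e3 e30.
pose e := e3 / 3; have e0 : 0 < e by rewrite divr_gt0.
set K := (1 + cnorm (phi 0)) / (1 - cnorm (phi 0)).
have K0 : 0 < K by rewrite divr_gt0 ?subr_gt0 ?phi1// ltr_wpDr// normc_ge0.
have gA' s : 0 < s < 1 -> mean (fun t => cnorm (g (pt s t)) `^ 1) <= A.
  by move=> /andP[s0 s1]; apply: gA; rewrite s1 ltW.
have eK : 0 < e / K by rewrite divr_gt0.
have [N [c Hc]] := poly_dense hg (lexx 1) gA' eK.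
set q := fun z => \sum_(n < N) c n * z ^+ n.
have hq : holo q := poly_holo c N.
have hqp : holo (fun z => q (phi z)) := holo_comp hphi hq phi1.
have hgp : holo (fun z => g (phi z)) := holo_comp hphi hg phi1.
have D r : 0 <= r < 1 -> mean (fun t => cnorm (g (phi (pt r t)) - q (phi (pt r t)))) <= e.
  move=> r01; have Hc' s : 0 <= s < 1 -> pmean 1 (fun z => g z - q z) s <= e / K by exact: Hc.
  have := pmean_comp (lexx 1) (holoB hg hq) hphi phi1 r01 Hc'.
  by rewrite pmean1E -/K mulrCA mulfV ?gt_eqF// mulr1.
have D0 : cnorm (g (phi 0) - q (phi 0)) <= e.
  have r00 : 0 <= (0 : R) < 1 by rewrite lexx ltr01.
  have := D 0 r00; have pt0 t : pt 0 t = 0 :> C by apply: mul0r.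
  by rewrite (eq_mean (fun t => congr1 (fun z => cnorm (g (phi z) - q (phi z))) (pt0 t))) mean_cst.
pose M := \sum_(n < N) cnorm (c n).
have M0 : 0 <= M by apply: sumr_ge0 => n _; exact: normc_ge0.
have qM z : cnorm z < 1 -> cnorm (q (phi z)) <= M.
  move=> z1; apply: le_trans (normc_sum _ _ _) _; apply: ler_sum => n _.
  rewrite normcMr normcXn; apply: ler_piMr; first exact: normc_ge0.
  by apply: exprn_ile1; [exact: normc_ge0|apply: ltW; exact: phi1].
have M1 : 0 < M + 1 by rewrite ltr_wpDl.
have eM : 0 < e / (M + 1) by rewrite divr_gt0.
have [n Hn] := filter_ex (hinner_sqr_mean ipsi eM).
have /andP[r0 r1] := exhaust01 R n; have r01 : 0 <= exhaust R n < 1 by rewrite r1 ltW.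
set r := exhaust R n in r0 r1 r01 Hn.
have cq := cont_holo hqp r01; have cg := cont_holo hgp r01; have cpsi := cont_holo hpsi r01.
have cd : cont (fun t => cnorm (g (phi (pt r t)) - q (phi (pt r t)))).
  by apply: cont_normc; exact: ccontB.
have cm : cont (fun t => 1 - cnorm (psi (pt r t)) ^+ 2).
  by apply: contB; [exact: cont_cst|apply: contX; exact: cont_normc].
have cMm : cont (fun t => M * (1 - cnorm (psi (pt r t)) ^+ 2)).
  by apply: contM => //; exact: cont_cst.
have c1 : cont (fun _ : R => 1 : R) by exact: cont_cst.
(* With x = |psi| and y = |q \o phi|, write y = x y + (1 - x) y. The first term is at most 1 + |g \o
   phi - q \o phi| by [recip]; the second is at most M (1 - x^2), small in mean because [psi] is
   inner. *)
have Q : cnorm (q (phi 0)) <= 1 + e + e.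
  rewrite -(holo_mean hqp r01); apply: le_trans (normc_cmean_le cq) _.
  apply: (@le_trans _ _ (mean (fun t => 1 + cnorm (g (phi (pt r t)) - q (phi (pt r t))) +
     M * (1 - cnorm (psi (pt r t)) ^+ 2)))).
    apply: mean_le => [||t]; first exact: cont_normc.
      by apply: contD => //; exact: contD.
    have zt : cnorm (pt r t) < 1 by rewrite normc_pt// ltW.
    have rc := congr1 (@cnorm R) (recip zt); rewrite normcMr normc_1 in rc.
    have := qM _ zt; have := psi1 _ zt; have := normcBle (g (phi (pt r t))) (g (phi (pt r t)) - q (phi (pt r t))).
    have -> : g (phi (pt r t)) - (g (phi (pt r t)) - q (phi (pt r t))) = q (phi (pt r t)) by ring.
    have := normc_ge0 (psi (pt r t)); have := normc_ge0 (g (phi (pt r t)) - q (phi (pt r t))).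
    have := normc_ge0 (q (phi (pt r t))); move: rc.
    move: (cnorm (psi _)) (cnorm (q _)) (cnorm (g _ - _)) (cnorm (g _)) => x y d u xu y0 d0 x0 yu x1 yM.
    have xx : x * y <= 1 + d.
      apply: (@le_trans _ _ (x * (u + d))); first exact: ler_wpM2l.
      by rewrite mulrDr xu lerD2l; exact: ler_piMl.
    have yy : (1 - x) * y <= M * (1 - x ^+ 2).
      apply: (@le_trans _ _ ((1 - x) * M)); first by apply: ler_wpM2l => //; rewrite subr_ge0.
      rewrite mulrC; apply: ler_wpM2l => //; rewrite lerD2l lerN2 expr2; exact: ler_piMr.
    have -> : y = x * y + (1 - x) * y by ring.
    exact: lerD.
  rewrite (meanD (contD c1 cd) cMm) (meanD c1 cd) mean_cst (meanZ _ cm).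
  apply: lerD; first by rewrite lerD2l; exact: D.
  apply: (@le_trans _ _ (M * (e / (M + 1)))); first by apply: ler_wpM2l => //; exact: ltW.
  by rewrite mulrCA; apply: ler_piMr; [exact: ltW|rewrite ler_pdivrMr// mul1r lerDl].
have := congr1 (@cnorm R) (recip z0); rewrite normcMr normc_1 => E.
have U : cnorm (g (phi 0)) <= 1 + e3.
  have -> : g (phi 0) = (g (phi 0) - q (phi 0)) + q (phi 0) by ring.
  apply: le_trans (normcDle _ _) _; move: D0 Q; rewrite /e; lra.
have := ler_wpM2l (normc_ge0 (psi 0)) U; rewrite E.
have := ler_piMl (ltW e30) (psi1 0 z0); lra.
Qed.

End Reciprocal.

Section Inverse.
Variables (phi : C -> C) (g_ : nat -> C -> C).
Hypotheses (iphi : hinner phi) (phi1 : forall z, cnorm z < 1 -> cnorm (phi z) < 1).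
Hypotheses (hg : forall n, holo (g_ n))
  (gA : forall n, exists A : R, forall r, 0 <= r < 1 -> pmean 1 (g_ n) r <= A)
  (gE : forall n z, cnorm z < 1 -> g_ n (phi z) = z ^+ n).

Let hphi := hinner_holo iphi.

(** [phi] is cancelled on the right. It is not constant, because g_ 1 recovers z from phi z and so
    separates 0 from 1/2. *)
Lemma holo_comp_eq F G : holo F -> holo G -> (forall z, cnorm z < 1 -> F (phi z) = G (phi z)) ->
  forall z, cnorm z < 1 -> F z = G z.
Proof.
move=> hF hG FG.
have FG0 z : cnorm z < 1 -> F (phi z) - G (phi z) = 0 by move=> z1; rewrite FG// subrr.
have [H z z1|pc] := holo_comp_zero (holoB hF hG) hphi phi1 FG0.
  by apply/eqP; rewrite -subr_eq0 H.
have z0 : cnorm (0 : C) < 1 by rewrite normc_0.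
have h1 : cnorm (2^-1%:C : C) < 1 by rewrite normc_real ger0_norm ?invr_ge0// invf_lt1 ?ltr1n.
have := @gE 1%N _ h1; rewrite (pc _ h1) gE// !expr1 => /(congr1 (@cnorm R)).
rewrite normc_0 normc_real ger0_norm ?invr_ge0// => /esym/eqP; rewrite invr_eq0 pnatr_eq0//.
Qed.

Lemma inverse_power n z : cnorm z < 1 -> g_ n z = g_ 1%N z ^+ n.
Proof.
apply: (@holo_comp_eq (g_ n) (fun z => g_ 1%N z ^+ n)) => // [|w w1]; first exact: holoX.
by rewrite !gE// expr1.
Qed.

(* The Taylor coefficients of [g_ 1 ^+ n] are bounded independently of [n], because
   [g_ 1 ^+ n] composed with [phi] is [z ^+ n]. *)
Lemma inverse_le1 z : cnorm z < 1 -> cnorm (g_ 1%N z) <= 1.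
Proof.
move=> z1; have b1 : cnorm (phi 0) < 1 by apply: phi1; rewrite normc_0.
have b2 : 0 < 1 - cnorm (phi 0) ^+ 2 by rewrite subr_gt0 exprn_ilt1// normc_ge0.
set K := 4 / (1 - cnorm (phi 0) ^+ 2); have K0 : 0 < K by rewrite divr_gt0.
have coef n m : cnorm (tc (g_ n) m) <= K.
  have [A HA] := gA n.
  have HA' s : 0 < s < 1 -> mean (fun t => cnorm (g_ n (pt s t))) <= A.
    by move=> /andP[s0 s1]; rewrite -pmean1E; apply: HA; rewrite s1 ltW.
  have B s : 0 < s < 1 -> mean (fun t => cnorm (g_ n (phi (pt s t)))) <= 1.
    move=> /andP[s0 s1]; have s01 : 0 <= s < 1 by rewrite s1 ltW.
    apply: mean_bound => [|t]; first exact/cont_normc/(cont_holo (holo_comp hphi (hg n) phi1) s01).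
    have zt : cnorm (pt s t) < 1 by rewrite normc_pt// ltW.
    by rewrite gE// normcXn; apply: exprn_ile1; [exact: normc_ge0|exact: ltW].
  have := coef_comp_le iphi phi1 m (hg n) HA' B; rewrite mulr1 => H.
  by rewrite ler_pdivlMr.
have q0 := normc_ge0 z; have d0 : 0 < 1 - cnorm z by rewrite subr_gt0.
have bound n : cnorm (g_ 1%N z) ^+ n <= K / (1 - cnorm z) + 1.
  rewrite -normcXn -inverse_power//.
  have [r /andP[r0 r1] zr] := mid_radius z1.
  have r01 : 0 <= r < 1 by rewrite r1 ltW.
  have [N HN] := taylor_approx (hg n) r01 (@ltr01 R).
  have := HN N z (leqnn N) (ltW zr).
  have -> : g_ n z = (g_ n z - \sum_(m < N) tc (g_ n) m * z ^+ m) + \sum_(m < N) tc (g_ n) m * z ^+ m by rewrite subrK.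
  set S := \sum_(m < N) _; rewrite addrK => H; apply: le_trans (normcDle _ _) _; rewrite addrC.
  apply: lerD => //; apply: le_trans (normc_sum _ _ _) _.
  apply: (@le_trans _ _ (K * \sum_(0 <= m < N) cnorm z ^+ m)).
    rewrite big_mkord mulr_sumr; apply: ler_sum => m _; rewrite normcMr normcXn.
    by apply: ler_wpM2r => //; exact: exprn_ge0.
  by apply: ler_wpM2l; [exact: ltW|have := geometric_tail 0 N q0 z1; rewrite expr0 div1r].
rewrite leNgt; apply/negP => lt; have x0 := lt_trans ltr01 lt.
have L0 : 0 < K / (1 - cnorm z) + 1 by rewrite ltr_wpDl// ltW// divr_gt0.
have q01 : 0 <= (cnorm (g_ 1%N z))^-1 < 1 by rewrite invr_ge0 (ltW x0) invf_lt1.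
have LV : 0 < (K / (1 - cnorm z) + 1)^-1 by rewrite invr_gt0.
have [n Hn] := geometric_small q01 LV.
move: Hn; rewrite exprVn ltf_pV2 ?posrE ?exprn_gt0// => /lt_le_trans/(_ (bound n)).
by rewrite ltxx.
Qed.

Lemma inverse_lt1 z : cnorm z < 1 -> cnorm (g_ 1%N z) < 1.
Proof.
have [[c _ gc]|] := max_principle_lt (hg 1) inverse_le1; last exact.
have z0 : cnorm (0 : C) < 1 by rewrite normc_0.
have h1 : cnorm (2^-1%:C : C) < 1 by rewrite normc_real ger0_norm ?invr_ge0// invf_lt1 ?ltr1n.
have := @gE 1%N _ h1; have := @gE 1%N _ z0; rewrite (gc _ (phi1 z0)) (gc _ (phi1 h1)) !expr1 => -> /(congr1 (@cnorm R)).
by rewrite normc_0 normc_real ger0_norm ?invr_ge0// => /esym/eqP; rewrite invr_eq0 pnatr_eq0.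
Qed.

(** phi \o g_ 1 and the identity agree after composition with [phi], which can be cancelled. *)
Lemma inverse_right z : cnorm z < 1 -> phi (g_ 1%N z) = z.
Proof.
apply: (@holo_comp_eq (fun z => phi (g_ 1%N z)) (fun z => z)).
- exact: holo_comp (hg 1) hphi inverse_lt1.
- exact: holo_id.
by move=> w w1; rewrite gE// expr1.
Qed.

End Inverse.

Lemma surjective_symbol p T psi phi : 1 <= p -> weighted_composition p T psi phi ->
  T @` hardy p = hardy p ->
  (exists2 c : R[i], `|c| = 1 & psi = cst c) /\ automorphism phi.
Proof.
move=> p1 [/innerP ipsi /innerP iphi _ TE] Tsurj.
have phi1 : forall z, cnorm z < 1 -> cnorm (ext (val \o phi) z) < 1.
  by move=> _ /discP[x <-]; rewrite ext_val; exact: disc_lt1.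
have pre F : hardy p (res F) -> exists2 g, hardy p g & forall z, cnorm z < 1 ->
    ext psi z * ext g (ext (val \o phi) z) = F z.
  move=> hF; have : (T @` hardy p) (res F) by rewrite Tsurj.
  move=> [g hg Tg]; exists g => // z z1.
  by rewrite -ext_weighted// -TE// Tg ext_res.
have hmono n : hardy p (res (@mono R n)).
  by apply: inner_hardy => //; apply/inner_res; exact/hinnerX/hinner_id.
have psi0 : cnorm (ext psi 0) = 1.
  have [g hg gE] := pre _ (hardy_cst p1 1); have [A HA] := hardy_mean1 p1 hg.
  have hg' := proj1 (proj1 (hardyP p1 g) hg).
  exact: (inner_reciprocal ipsi (hinner_holo iphi) phi1 hg' HA gE).
set c := ext psi 0 in psi0.
have psic z : cnorm z < 1 -> ext psi z = c.
  apply: (max_principle (hinner_holo ipsi) (hinner_le1 ipsi) _ psi0).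
  by rewrite normc_0.
split.
  exists c; first exact/normc_eq1.
  by apply: funext => x; rewrite -(ext_val psi) psic//; exact: disc_lt1.
have c0 : c != 0 by apply: normc_neq0; rewrite psi0.
(* Preimages of the monomials under [T]; the unimodular constant [c] is absorbed into [g_]. *)
have /choice[h Hh] : forall n, exists g : disc R -> C, hardy p g /\ forall z, cnorm z < 1 ->
    c * ext g (ext (val \o phi) z) = z ^+ n.
  move=> n; have [g hg gE] := pre _ (hmono n); exists g; split => // z z1.
  by rewrite -(psic z z1) gE.
pose g_ n z := c * ext (h n) z.
have hg n : holo (g_ n).
  by apply: holoM; [exact: holo_cst|exact: (proj1 (proj1 (hardyP p1 _) (proj1 (Hh n))))].
have gA n : exists A : R, forall r, 0 <= r < 1 -> pmean 1 (g_ n) r <= A.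
  have [A HA] := hardy_mean1 p1 (proj1 (Hh n)); exists A => r r01.
  rewrite pmean1E; apply: le_trans (HA r r01); rewrite pmean1E le_eqVlt; apply/orP; left; apply/eqP.
  by apply: eq_mean => t; rewrite normcMr psi0 mul1r.
have gE n z : cnorm z < 1 -> g_ n (ext (val \o phi) z) = z ^+ n := proj2 (Hh n) z.
have g1 := inverse_lt1 iphi phi1 hg gA gE.
have gr := inverse_right iphi phi1 hg gA gE.
have /choice[phi' Hphi] : forall x : disc R, exists y : disc R, val y = g_ 1%N (val x).
  by move=> x; apply: discP; apply: g1; exact: disc_lt1.
exists phi'; split.
- move=> x; apply: val_inj; rewrite Hphi.
  by have := gE 1%N _ (disc_lt1 x); rewrite ext_val expr1.
- move=> x; apply: val_inj.
  by have := gr _ (disc_lt1 x); rewrite -Hphi ext_val.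
- by apply/HolP; exact: hinner_holo.
- have -> : val \o phi' = res (g_ 1%N) by apply: funext => x /=; rewrite Hphi.
  exact/Hol_res.
Qed.

Lemma automorphism_invertible p T (c : C) phi : 1 <= p ->
  (forall f, hardy p f -> T f = cst c \* (f \o phi)) -> cnorm c = 1 -> automorphism phi ->
  hardy_invertible p T.
Proof.
move=> p1 TE c1 [phi' [K1 K2 hphi hphi']].
have c0 : c != 0 by apply: normc_neq0; rewrite c1.
pose S (f : disc R -> C) : disc R -> C := cst (c^-1) \* (f \o phi').
have hS : hardy_operator p S.
  apply: (@weighted_operator R p p1 S (cst c^-1) phi' _ _ hphi' (fun f _ => erefl (S f))).
  - by apply/(Hol_res (fun=> c^-1)); exact: holo_cst.
  - by move=> x; rewrite normc_inv c1 invr1.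
exists S; split => // f hf.
  rewrite TE//; apply: funext => x /=; rewrite /S /= K2 mulrA mulVf//; exact: mul1r.
rewrite TE; last by have [hh _ _] := hS; exact: hh.
by apply: funext => x; rewrite /S /= K1 mulrA mulfV//; exact: mul1r.
Qed.

End Surjective.

Theorem theorem1p4 (R : realType) (p : R) (hp : 1 <= p)
    (T : (disc R -> R[i]^o) -> (disc R -> R[i]^o))
    (hT : forall f, hardy p f -> Hol (T f)) :
  (hardy_operator p T /\ (forall h, inner h -> inner (T h)) <->
   exists psi phi, weighted_composition p T psi phi) /\
  (hardy_operator p T /\ (forall h, inner h -> inner (T h)) ->
   T @` hardy p = hardy p ->
   (forall psi phi, weighted_composition p T psi phi ->
      (exists2 c : R[i], `|c| = 1 & psi = cst c) /\ automorphism phi) /\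
   hardy_invertible p T).
Proof.
split; first split.
- by move=> [opT iT]; exact: inner_preserving_weighted_composition.
- by move=> [psi [phi]]; exact: weighted_composition_operator.
move=> [opT iT] Tsurj; split=> [psi phi W|]; first exact: surjective_symbol W Tsurj.
have [psi [phi W]] := inner_preserving_weighted_composition hp opT iT.
have [[c c1 psic] aphi] := surjective_symbol hp W Tsurj.
have [_ _ _ TE] := W; rewrite psic in TE.
exact: (automorphism_invertible hp TE (proj1 (normc_eq1 c) c1) aphi).
Qed.
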